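(* Let $a,b$ be positive integers with $b>a$. Let $(E,\nabla)$ be an algebraic connection on $\mathbb A^1(\mathbb C)$ with irregular class $\Theta_{a,b}$ at $\infty$, let $\mathbb V$ be its Stokes filtered local system, let $P^{\mathrm{rec}}:=\Phi^{\mathrm{rec}}_{a,b}(\mathbb V)\in\mathbf P_{a,b}$ be the collection of its recessive lines and $P^{\mathrm{sub}}:=\Phi^{\mathrm{sub}}_{a,b}(\mathbb V)\in\mathbf P_{a,b}$ the collection of the annihilators of its subdominant hyperplanes. Let $(\widehat E,\widehat\nabla)=\mathscr F(E,\nabla)$ be the Fourier transform of $(E,\nabla)$, which has (after rescaling the coordinate by a positive real number) irregular class $\widehat\Theta_{b-a,b}$, let $\widehat{\mathbb V}$ be its Stokes filtered local system, and set $\widehat P^{\mathrm{rec}}:=\widehat\Phi^{\mathrm{rec}}_{b-a,b}(\widehat{\mathbb V})\in\mathbf P_{b-a,b}$ and $\widehat P^{\mathrm{sub}}:=\widehat\Phi^{\mathrm{sub}}_{b-a,b}(\widehat{\mathbb V})\in\mathbf P_{b-a,b}$. Then there exist natural isomorphisms $$\widehat P^{\mathrm{rec}}\simeq\mathscr G(P^{\mathrm{sub}}),\qquad \widehat P^{\mathrm{sub}}\simeq\mathscr G(P^{\mathrm{rec}}),$$ where $\mathscr G:\mathbf P_{a,b}\to\mathbf P_{b-a,b}$ is the categorical Gale transform.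
   Context: **Irregular classes.** For $i\in\mathbb Z$ put $q_i=e^{2\pi\sqrt{-1}\,i/a}z^{b/a}$, evaluated at $z=Re^{\sqrt{-1}\theta}$ ($R>0$, $\theta\in\mathbb R$) as $q_i(Re^{\sqrt{-1}\theta})=R^{b/a}e^{\sqrt{-1}(2\pi i+b\theta)/a}$. Only $i$ mod $a$ matters. A connection on $\mathbb A^1$ has irregular class $\Theta_{a,b}$ at $\infty$ if its formal solutions at $\infty$ have exponential factors $e^{q_i}$, $i\in\mathbb Z/a\mathbb Z$, each with multiplicity one (so its rank is $a$). **Stokes filtered local systems.** Let $\partial=\mathbb R/2\pi\mathbb Z$ be the circle of directions at $\infty$ (direction $[\theta]$ = argument of $z$). Over $d=[\theta]$ let $I_d=\{[q_i,\theta]: i\in\mathbb Z/a\}$, with the identification $[q_i,\theta+2\pi]=[q_{i+b},\theta]$. Write $[q_i,\theta]<_d[q_j,\theta]$ iff $\mathrm{Re}\,q_i(e^{\sqrt{-1}\theta})<\mathrm{Re}\,q_j(e^{\sqrt{-1}\theta})$. Directions where this is not a total order are the Stokes directions. A Stokes filtered local system of type $\Theta_{a,b}$ is an $a$-dimensional complex vector space $V$ (a constant local system) with, for each non-Stokes direction $d$, subspaces $F_d(\mathtt i)\subset V$, $\mathtt i\in I_d$, increasing for $<_d$, with $\dim F_d(\mathtt i)/F_d(<\mathtt i)=1$ where $F_d(<\mathtt i)=\sum_{\mathtt j<_d\mathtt i}F_d(\mathtt j)$, locally constant in $d$, and such that near each Stokes direction $d$ there is a locally constant grading $V=\bigoplus_{\mathtt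 i\in I_{d'}}V(\mathtt i)$ with $F_{d'}(\mathtt i)=\bigoplus_{\mathtt j\le_{d'}\mathtt i}V(\mathtt j)$ for all non-Stokes $d'$ near $d$. By the (Deligne–Malgrange) irregular Riemann–Hilbert correspondence, connections on $\mathbb A^1$ with class $\Theta_{a,b}$ at $\infty$ are equivalent to Stokes filtered local systems of type $\Theta_{a,b}$ ($V$ is the space of solutions, filtered by growth rate near each direction). **Recessive/subdominant subspaces.** At a non-Stokes direction $d$ the recessive subspace is $F_d(\mathtt i)$ for $\mathtt i$ the minimum of $I_d$ (a line); the subdominant subspace is $F_d(<\mathtt i)$ for $\mathtt i$ the maximum of $I_d$ (a hyperplane). Put $\theta_{i,l}=\frac{2\pi}{b}\left(-i+l\frac a2\right)$. For $l$ odd, $V^{\mathrm{rec}}_{i,l}$ is the recessive line at directions near $[\theta_{i,l}]$; for $l$ even, $V^{\mathrm{sub}}_{i,l}$ is the subdominant hyperplane at directions near $[\theta_{i,l}]$. **The groupoid $\mathbf P_{a,b}$.** Objects: $(V,(V_1,\dots,V_b))$ with $\dim V=a$, each $V_i\subset V$ a line, such that any $a$ cyclically consecutive lines (indices mod $b$) span $V$. Morphisms: linear isomorphisms carrying $V_i$ to $V_i'$ for all $i$. Define $\Phi^{\mathrm{rec}}_{a,b}(V,F)=(V,(V^{\mathrm{rec}}_{1,1},\dots,V^{\mathrm{rec}}_{b,1}))$ and $\Phi^{\mathrm{sub}}_{a,b}(V,F)=(V^*,((V^{\mathrm{sub}}_{1,0})^0,\dots,(V^{\mathrm{sub}}_{b,0})^0))$,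 where $(\cdot)^0$ denotes the annihilator in $V^*$. **Fourier transform.** It is induced on modules over the Weyl algebra by $z\mapsto-\partial_w$, $\partial_z\mapsto w$ ($w$ the dual coordinate). With this convention an exponential factor $q(z)$ of solutions is sent to its Legendre transform $\widehat q(w)=q(z(w))-z(w)w$, where $w=dq/dz$. For class $\Theta_{a,b}$ the exponential factors of the Fourier transform are, after rescaling $w$ by a positive real, $-\widehat q_i$, $i\in\mathbb Z/(b-a)$, with $\widehat q_i=e^{2\pi\sqrt{-1}\,i/(b-a)}w^{b/(b-a)}$, evaluated at $w=Re^{\sqrt{-1}\theta}$ as $\widehat q_i(Re^{\sqrt{-1}\theta})=R^{b/(b-a)}e^{\sqrt{-1}(2\pi i+b\theta)/(b-a)}$, each with multiplicity one; this class is denoted $\widehat\Theta_{b-a,b}$. A Stokes filtered local system $(\widehat V,F)$ of type $\widehat\Theta_{b-a,b}$ is defined as follows. Over a direction $d=[\theta]$ (argument of $w$) let $\widehat I_d=\{[-\widehat q_i,\theta]: i\in\mathbb Z/(b-a)\}$, with the identification $[-\widehat q_i,\theta+2\pi]=[-\widehat q_{i+b},\theta]$, and write $[-\widehat q_i,\theta]<_d[-\widehat q_j,\theta]$ iff $\mathrm{Re}(-\widehat q_i(e^{\sqrt{-1}\theta}))<\mathrm{Re}(-\widehat q_j(e^{\sqrt{-1}\theta}))$; directions where this is not a total order are the Stokes directions of $\widehat\Theta_{b-a,b}$. Then $\widehat V$ is a $(b-a)$-dimensional complex vector space (a constant local system) with, for each non-Stokes direction $d$, subspaces $F_d(\mathtt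 i)\subset\widehat V$, $\mathtt i\in\widehat I_d$, increasing for $<_d$, with $\dim F_d(\mathtt i)/F_d(<\mathtt i)=1$ where $F_d(<\mathtt i)=\sum_{\mathtt j<_d\mathtt i}F_d(\mathtt j)$, locally constant in $d$, and such that near each Stokes direction $d$ there is a locally constant grading $\widehat V=\bigoplus_{\mathtt i\in\widehat I_{d'}}\widehat V(\mathtt i)$ with $F_{d'}(\mathtt i)=\bigoplus_{\mathtt j\le_{d'}\mathtt i}\widehat V(\mathtt j)$ for all non-Stokes $d'$ near $d$. At a non-Stokes direction $d$ its recessive subspace is $F_d(\mathtt i)$ for $\mathtt i$ the minimum of $\widehat I_d$ (a line), and its subdominant subspace is $F_d(<\mathtt i)$ for $\mathtt i$ the maximum of $\widehat I_d$ (a hyperplane). Put $\widehat\theta_{i,l}=\frac{2\pi}{b}\left(-i+l\frac{b-a}2\right)$; $\widehat V^{\mathrm{rec}}_{i,l}$ ($l$ even) is the recessive line near $[\widehat\theta_{i,l}]$ and $\widehat V^{\mathrm{sub}}_{i,l}$ ($l$ odd) is the subdominant hyperplane near $[\widehat\theta_{i,l}]$. Define $\widehat\Phi^{\mathrm{rec}}_{b-a,b}(\widehat V,F)=(\widehat V,(\widehat V^{\mathrm{rec}}_{-1,0},\dots,\widehat V^{\mathrm{rec}}_{-b,0}))$ and $\widehat\Phi^{\mathrm{sub}}_{b-a,b}(\widehat V,F)=(\widehat V^*,((\widehat V^{\mathrm{sub}}_{-1,1})^0,\dots,(\widehat V^{\mathrm{sub}}_{-b,1})^0))$. **Categorical Gale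 transform.** Given $P\in\mathbf P_{a,b}$, write $P=(V^*,(V_1^0,\dots,V_b^0))$ with $V_i\subset V$ hyperplanes. Put $W_i=V/V_i$, $W=\bigoplus_{i=1}^bW_i$, let $\alpha:V\to W$ be the sum of the projections, $\widehat V=W/\mathrm{Im}(\alpha)$, and let $\widehat V_i$ be the image of $W_i$ in $\widehat V$. Then $\mathscr G(P)=(\widehat V,(\widehat V_1,\dots,\widehat V_b))\in\mathbf P_{b-a,b}$. *)

(* Defs.v *)
From HB Require Import structures.
From mathcomp Require Import all_boot all_order all_algebra.
From mathcomp Require Import complex.
From mathcomp Require Import all_classical all_reals all_analysis.

Set Implicit Arguments.
Unset Strict Implicit.
Unset Printing Implicit Defensive.

Import Order.TTheory GRing.Theory Num.Theory.
Import numFieldNormedType.Exports.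

Local Open Scope classical_set_scope.
Local Open Scope complex_scope.
Local Open Scope ring_scope.

Definition dsumv (K : fieldType) (n : nat) (T : 'I_n -> vectType K) : Type :=
  {dffun forall i : 'I_n, T i}.

Section DirectSum.
Import VectorInternalTheory.
Variables (K : fieldType) (n : nat) (T : 'I_n -> vectType K).
Local Notation W := (dsumv T).
Implicit Types w x y : W.

HB.instance Definition _ := Choice.copy W {dffun forall i : 'I_n, T i}.

Definition dsum_app w (i : 'I_n) : T i := (w : {dffun forall i : 'I_n, T i}) i.
Definition dsum_mk (f : forall i : 'I_n, T i) : W := finfun f.

Lemma dsum_mkE f i : dsum_app (dsum_mk f) i = f i.
Proof. by rewrite /dsum_app ffunE. Qed.

Lemma dsumP x y : (forall i, dsum_app x i = dsum_app y i) -> x = y.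
Proof. by move=> xy; apply/ffunP. Qed.

Let wzero : W := dsum_mk (fun i => 0).
Let wopp x : W := dsum_mk (fun i => - dsum_app x i).
Let wadd x y : W := dsum_mk (fun i => dsum_app x i + dsum_app y i).
Let wscale (k : K) x : W := dsum_mk (fun i => k *: dsum_app x i).

Let waddA : associative wadd.
Proof. by move=> x y z; apply: dsumP => i; rewrite !dsum_mkE addrA. Qed.
Let waddC : commutative wadd.
Proof. by move=> x y; apply: dsumP => i; rewrite !dsum_mkE addrC. Qed.
Let wadd0 : left_id wzero wadd.
Proof. by move=> x; apply: dsumP => i; rewrite !dsum_mkE add0r. Qed.
Let waddN : left_inverse wzero wopp wadd.
Proof. by move=> x; apply: dsumP => i; rewrite !dsum_mkE addNr. Qed.

HB.instance Definition _ := GRing.isZmodule.Build W waddA waddC wadd0 waddN.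

Lemma dsum_appD x y i : dsum_app (x + y) i = dsum_app x i + dsum_app y i.
Proof. exact: dsum_mkE. Qed.

Let wscaleA k l x : wscale k (wscale l x) = wscale (k * l) x.
Proof. by apply: dsumP => i; rewrite !dsum_mkE scalerA. Qed.
Let wscale1 : left_id 1 wscale.
Proof. by move=> x; apply: dsumP => i; rewrite !dsum_mkE scale1r. Qed.
Let wscaleDr : right_distributive wscale +%R.
Proof.
by move=> k x y; apply: dsumP => i; rewrite dsum_appD !dsum_mkE scalerDr.
Qed.
Let wscaleDl x : {morph wscale^~ x : k l / k + l}.
Proof.
by move=> k l; apply: dsumP => i; rewrite dsum_appD !dsum_mkE scalerDl.
Qed.

HB.instance Definition _ :=
  GRing.Zmodule_isLmodule.Build K W wscaleA wscale1 wscaleDr wscaleDl.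

Lemma dsum_appZ k x i : dsum_app (k *: x) i = k *: dsum_app x i.
Proof. exact: dsum_mkE. Qed.

Let W_vect_iso : SemiVector.axiom (\sum_i dim (T i)) W.
Proof.
have lin : linear (fun w => \mxrow_i v2r (dsum_app w i)).
  move=> k x y; apply/mxrowP => i.
  rewrite submxrowD; apply/rowP => j.
  have -> : submxrow (k *: \mxrow_i v2r (dsum_app x i)) i =
            k *: submxrow (\mxrow_i v2r (dsum_app x i)) i by apply/rowP => l; rewrite !mxE.
  by rewrite !mxrowK dsum_appD dsum_appZ linearP.
exists (fun w => \mxrow_i v2r (dsum_app w i)); first exact: GRing.semilinear_linear.
exists (fun r : 'rV_(\sum_i dim (T i)) =>
          dsum_mk (fun i : 'I_n => r2v (submxrow r i) : T i)).
  by move=> w; apply: dsumP => i; rewrite dsum_mkE mxrowK v2rK.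
by move=> r; apply/mxrowP => i; rewrite mxrowK dsum_mkE r2vK.
Qed.

HB.instance Definition _ := LSemiModule_hasFinDim.Build K W W_vect_iso.

Definition dsum_in (i : 'I_n) (x : T i) : W :=
  dsum_mk (eqtype.dfwith (fun j => 0 : T j) x).

Lemma dsum_in_linear i : linear (dsum_in (i := i)).
Proof.
move=> k x y; apply: dsumP => j; rewrite dsum_appD dsum_appZ !dsum_mkE.
have [<-|nij] := eqVneq i j; first by rewrite !eqtype.dfwith_in.
by rewrite !eqtype.dfwith_out // scaler0 addr0.
Qed.

End DirectSum.

Section LinearAlgebra.
Variable K : fieldType.
Implicit Types V : vectType K.

(* V / U, modelled on a complement of U; lker_quotp and limg_quotp say that
   quotp U is a surjection with kernel U. *)
Definition quotv V (U : {vspace V}) : vectType K := subvs_of (U^C)%VS.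
Definition quotp V (U : {vspace V}) : 'Hom(V, quotv U) :=
  (linfun (vsproj (U^C)%VS) \o daddv_pi (U^C)%VS U)%VF.

Lemma lker_quotp V (U : {vspace V}) : lker (quotp U) = U.
Proof.
have UC0 : ((U^C :&: U) = 0)%VS by rewrite capvC capv_compl.
apply/vspaceP => x; rewrite memv_ker comp_lfunE lfunE /=.
have := daddv_pi_add UC0 (w := x); rewrite addvC addv_complf memvf => /(_ isT) xE.
apply/eqP/idP => [/(congr1 vsval)|xU].
  rewrite vsprojK ?memv_pi // => p0; move: xE; rewrite p0 /= add0r => <-.
  exact: memv_pi.
suff -> : daddv_pi (U^C)%VS U x = 0 by rewrite linear0.
have xx : daddv_pi U (U^C)%VS x = x by rewrite daddv_pi_id // capv_compl.
by move: xE; rewrite xx -[RHS]add0r => /addIr.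
Qed.

Lemma limg_quotp V (U : {vspace V}) : limg (quotp U) = fullv.
Proof.
apply/vspaceP => x; rewrite memvf; apply/memv_imgP; exists (vsval x).
  exact: memvf.
have UC0 : ((U^C :&: U) = 0)%VS by rewrite capvC capv_compl.
by rewrite comp_lfunE lfunE /= (daddv_pi_id UC0 (subvsP x)) vsvalK.
Qed.

Lemma quotp_factor V V' (U : {vspace V}) (g : 'Hom(V, V')) x :
  (U <= lker g)%VS -> g ((quotp U)^-1%VF (quotp U x)) = g x.
Proof.
move=> Ug; apply/eqP; rewrite -subr_eq0 -linearB -memv_ker.
have kerU := lker_quotp U; apply: (subvP Ug).
suff : (quotp U)^-1%VF (quotp U x) - x \in lker (quotp U) by rewrite kerU.
rewrite memv_ker linearB subr_eq0; apply/eqP.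
by apply: limg_lfunVK; rewrite limg_quotp memvf.
Qed.

Definition dualv V : vectType K := 'Hom(V, K^o).

Definition precomp V V' (f : 'Hom(V, V')) : 'Hom(dualv V', dualv V) :=
  linfun (fun g : 'Hom(V', K^o) => (g \o f)%VF).

Lemma linfunE V V' (f : V -> V') : linear f -> linfun f =1 f.
Proof.
move=> lin; pose h : {linear V -> V'} :=
  HB.pack f (GRing.isLinear.Build _ _ _ _ f lin).
exact: (lfunE h).
Qed.

Lemma precompE V V' (f : 'Hom(V, V')) (g : dualv V') :
  precomp f g = (g \o f)%VF.
Proof.
apply: linfunE => k x y.
by apply/lfunP => z; rewrite !lfunE /= !lfunE /= !lfunE.
Qed.

Definition annv V (U : {vspace V}) : {vspace dualv V} :=
  lker (precomp (linfun (vsval : subvs_of U -> V))).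

Lemma mem_annv V (U : {vspace V}) (g : dualv V) :
  (g \in annv U) = (U <= lker (g : 'Hom(V, K^o)))%VS.
Proof.
rewrite memv_ker precompE; apply/eqP/subvP => [g0 x xU|gU].
  have /lfunP/(_ (vsproj U x)) := g0.
  by rewrite comp_lfunE !lfunE /= vsprojK // memv_ker => ->.
apply/lfunP => x; rewrite comp_lfunE !lfunE /=; apply/eqP.
by rewrite -memv_ker gU ?subvsP.
Qed.

(* For f bijective, the isomorphism of duals covariant in f. *)
Definition contragredient V V' (f : 'Hom(V, V')) : 'Hom(dualv V, dualv V') :=
  precomp (f^-1)%VF.

End LinearAlgebra.

(* 'I_b is 0-based: the component [i : 'I_b] is the line V_(i+1). *)
Record config (K : fieldType) (b : nat) := Config {
  cspace : vectType K;
  cline : 'I_b -> {vspace cspace}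
}.

(* Objects and morphisms of the groupoid P_(a,b). *)
Definition in_P (K : fieldType) (a b : nat) (P : config K b) : Prop :=
  [/\ \dim {:cspace P} = a,
      forall i, \dim (cline P i) = 1%N
    & forall i, (\sum_(j < a) cline P (iter j (@ordS b) i))%VS = fullv].

Definition P_iso (K : fieldType) (b : nat) (P Q : config K b)
    (f : 'Hom(cspace P, cspace Q)) : Prop :=
  [/\ lker f = 0%VS, limg f = fullv
    & forall i, (f @: cline P i)%VS = cline Q i].

Section Gale.
Variables (K : fieldType) (b : nat).
Implicit Types P Q : config K b.

(* P = (U, (L_i)) is written (V^*, (V_i^0)) by taking V := U^* (so that
   U = V^* by biduality) and V_i := L_i^0. *)
Definition gale_V P : vectType K := dualv (cspace P).
Definition gale_hyp P (i : 'I_b) : {vspace gale_V P} := annv (cline P i).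

Definition gale_W P : vectType K := dsumv (fun i => quotv (gale_hyp P i)).

Definition gale_alpha P : 'Hom(gale_V P, gale_W P) :=
  linfun (fun v => dsum_mk (fun i => quotp (gale_hyp P i) v) : gale_W P).

Definition gale_proj P : 'Hom(gale_W P, quotv (limg (gale_alpha P))) :=
  quotp (limg (gale_alpha P)).

Definition gale P : config K b :=
  Config (fun i => limg (gale_proj P \o
     linfun (dsum_in (i := i) : quotv (gale_hyp P i) -> gale_W P))%VF).

Lemma gale_alphaE P v i :
  dsum_app (gale_alpha P v : dsumv _) i = quotp (gale_hyp P i) v.
Proof.
rewrite [gale_alpha P v]linfunE ?dsum_mkE // => k x y.
by apply: dsumP => j; rewrite dsum_appD dsum_appZ !dsum_mkE linearP.
Qed.

(* The action of the Gale transform on an isomorphism f : P -> Q; pseudo-inverses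
   of surjections are used to define the maps induced on quotients. *)
Definition gale_W_map P Q (f : 'Hom(cspace P, cspace Q)) :
    'Hom(gale_W P, gale_W Q) :=
  linfun (fun w : dsumv (fun i => quotv (gale_hyp P i)) =>
    dsum_mk (fun i =>
      (quotp (gale_hyp Q i) \o contragredient f \o (quotp (gale_hyp P i))^-1)%VF
        (dsum_app w i)) : gale_W Q).

Definition gale_map P Q (f : 'Hom(cspace P, cspace Q)) :
    'Hom(cspace (gale P), cspace (gale Q)) :=
  (gale_proj Q \o gale_W_map f \o (gale_proj P)^-1)%VF.

Lemma gale_W_mapE P Q (f : 'Hom(cspace P, cspace Q)) w i :
  dsum_app (gale_W_map f w : dsumv _) i =
  (quotp (gale_hyp Q i) \o contragredient f \o (quotp (gale_hyp P i))^-1)%VF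
    (dsum_app (w : dsumv _) i).
Proof.
rewrite [gale_W_map f w]linfunE ?dsum_mkE // => k x y.
apply: dsumP => j; rewrite dsum_appD dsum_appZ !dsum_mkE -linearP.
by congr (_ _); exact: dsum_appD.
Qed.

Section Functoriality.
Variables (P Q : config K b) (f : 'Hom(cspace P, cspace Q)).

Lemma gale_W_map_quotp v i (w : gale_W P) :
  P_iso f ->
  dsum_app (w : dsumv _) i = quotp (gale_hyp P i) v ->
  dsum_app (gale_W_map f w : dsumv _) i =
  quotp (gale_hyp Q i) (contragredient f v).
Proof.
move=> [/eqP f0 fT fL] wi.
rewrite gale_W_mapE wi comp_lfunE.
rewrite (quotp_factor (g := (quotp (gale_hyp Q i) \o contragredient f)%VF)).
  by rewrite comp_lfunE.
apply/subvP => g; rewrite mem_annv => gP.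
rewrite memv_ker comp_lfunE -memv_ker lker_quotp mem_annv precompE -fL.
apply/subvP => _ /memv_imgP[x xP ->].
by rewrite memv_ker comp_lfunE lker0_lfunK // -memv_ker (subvP gP).
Qed.

Lemma gale_map_proj w :
  P_iso f -> gale_map f (gale_proj P w) = gale_proj Q (gale_W_map f w).
Proof.
move=> iso_f; rewrite comp_lfunE.
rewrite (quotp_factor (g := (gale_proj Q \o gale_W_map f)%VF)) ?comp_lfunE //.
apply/subvP => _ /memv_imgP[v _ ->].
rewrite memv_ker comp_lfunE -memv_ker lker_quotp.
apply/memv_imgP; exists (contragredient f v); first exact: memvf.
apply: dsumP => i; rewrite gale_alphaE.
by apply: gale_W_map_quotp iso_f _; rewrite gale_alphaE.
Qed.

End Functoriality.

End Gale.

(* A module over the Weyl algebra C<z, d/dz>. *)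
Record weyl_module (R : realType) := WeylModule {
  wm_sort :> lmodType R[i];
  wm_z : wm_sort -> wm_sort;
  wm_d : wm_sort -> wm_sort;
  wm_z_linear : linear wm_z;
  wm_d_linear : linear wm_d;
  wm_comm : forall m, wm_d (wm_z m) - wm_z (wm_d m) = m
}.

Section Connections.
Variable R : realType.
Local Notation C := R[i].
Implicit Types E : weyl_module R.

Lemma wm_zZ E k (m : E) : wm_z (k *: m) = k *: wm_z m.
Proof. by rewrite (GRing.scalable_linear (@wm_z_linear R E)). Qed.

Lemma wm_dZ E k (m : E) : wm_d (k *: m) = k *: wm_d m.
Proof. by rewrite (GRing.scalable_linear (@wm_d_linear R E)). Qed.

(* The action of p(z). *)
Definition wm_poly E (p : {poly C}) (m : E) : E :=
  \sum_(k < size p) p`_k *: iter k (@wm_z R E) m.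

(* An algebraic connection of rank n on A^1 is a Weyl module which is free of
   rank n over C[z] (all vector bundles on A^1 are trivial). *)
Definition wm_basis E (n : nat) (e : 'I_n -> E) : Prop :=
  forall m : E, exists! p : {ffun 'I_n -> {poly C}},
    m = \sum_j wm_poly (p j) (e j).

Definition wm_iso E E' (phi : E -> E') : Prop :=
  [/\ linear phi, bijective phi,
      forall m, phi (wm_z m) = wm_z (phi m)
    & forall m, phi (wm_d m) = wm_d (phi m)].

(* Fourier transform: z = - d/dw and d/dz = w, so that the new coordinate acts
   as d/dz and its derivation as - z. *)
Lemma fourier_z_linear E : linear (fun m : E => - wm_z m).
Proof. by move=> k x y; rewrite wm_z_linear opprD scalerN. Qed.

Lemma fourier_comm E (m : E) : - wm_z (wm_d m) - wm_d (- wm_z m) = m.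
Proof.
have dN x : wm_d (- x) = - wm_d x :> E.
  by rewrite -scaleN1r wm_dZ scaleN1r.
by rewrite dN opprK addrC wm_comm.
Qed.

Definition fourier E : weyl_module R :=
  WeylModule (@wm_d_linear R E) (@fourier_z_linear E) (@fourier_comm E).

(* Rescaling z = c z'. *)
Section Rescale.
Variables (c : {posnum R}) (E : weyl_module R).
Let rz (m : E) : E := (c%:num^-1)%:C *: wm_z m.
Let rd (m : E) : E := (c%:num)%:C *: wm_d m.

Lemma rescale_z_linear : linear rz.
Proof. by move=> k x y; rewrite /rz wm_z_linear scalerDr !scalerA mulrC. Qed.

Lemma rescale_d_linear : linear rd.
Proof. by move=> k x y; rewrite /rd wm_d_linear scalerDr !scalerA mulrC. Qed.

Lemma rescale_comm m : rd (rz m) - rz (rd m) = m.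
Proof.
have cc : (c%:num)%:C * (c%:num^-1)%:C = 1 :> C.
  by rewrite -rmorphM /= divff // gt_eqF.
by rewrite /rz /rd wm_dZ wm_zZ !scalerA cc mulrC cc !scale1r wm_comm.
Qed.

Definition rescale : weyl_module R :=
  WeylModule rescale_z_linear rescale_d_linear rescale_comm.
End Rescale.

(* [IrrClass neg r b] is the class with the r exponential factors
   +/- exp(2 pi sqrt(-1) i / r) z^(b/r), with the sign - iff neg. *)
Record irr_class := IrrClass { ic_neg : bool; ic_rank : nat; ic_num : nat }.

Definition Theta (r b : nat) := IrrClass false r b.
Definition Theta_hat (r b : nat) := IrrClass true r b.

Definition polar (rho t : R) : C := (rho * cos t) +i* (rho * sin t).

Implicit Types Th : irr_class.

Definition expfac Th (i : int) (rho t : R) : C :=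
  (-1) ^+ ic_neg Th *
  polar (rho `^ ((ic_num Th)%:R / (ic_rank Th)%:R))
        ((2 * pi * i%:~R + (ic_num Th)%:R * t) / (ic_rank Th)%:R).

(* The coefficient of z^(b/r) in the i-th exponential factor. *)
Definition expfac_coef Th (i : int) : C :=
  (-1) ^+ ic_neg Th * polar 1 (2 * pi * i%:~R / (ic_rank Th)%:R).

(* Formal Laurent series sum_n f_n t^n. *)
Definition laurent (f : int -> C) : Prop :=
  exists n0 : int, forall n, n < n0 -> f n = 0.

Definition laurent_mul (f g : int -> C) (n : int) : C :=
  \sum_(k \in [set: int]) f k * g (n - k).

(* A formal solution of E of the form exp(q_i) z^lam f with f in C((t)), where
   t = z^(-1/r); that is, a morphism of Weyl modules
   Y : E -> exp(q_i) z^lam C((t)).  Since q_i = k t^(-b) with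
   k = expfac_coef Th i, one has z t^n = t^(n - r) and
   d/dz (exp(q_i) z^lam t^n) =
     exp(q_i) z^lam ((lam - n/r) t^(n + r) + (b/r) k t^(n + r - b)). *)
Definition formal_solution Th (i : int) (lam : C) E (Y : E -> int -> C) : Prop :=
  let r := (ic_rank Th)%:Z in let b := (ic_num Th)%:Z in
  [/\ forall m, laurent (Y m),
      forall k m m' n, Y (k *: m + m') n = k * Y m n + Y m' n,
      forall m n, Y (wm_z m) n = Y m (n + r)
    & forall m n, Y (wm_d m) n =
        (lam - (n - r)%:~R / r%:~R) * Y m (n - r)
        + b%:~R / r%:~R * expfac_coef Th i * Y m (n - r + b)].

(* E is a connection of rank r and its formalisation at infinity is, over
   C((z^(-1/r))), the direct sum of the rank one connections with solutions
   exp(q_i) z^(lam_i), i in Z/r, the isomorphism being given by the (invertible)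
   matrix (Y_i(e_j)). *)
Definition irregular_class Th E : Prop :=
  exists e : 'I_(ic_rank Th) -> E, wm_basis e /\
  exists (lam : 'I_(ic_rank Th) -> C) (Y : 'I_(ic_rank Th) -> E -> int -> C),
    (forall i : 'I_(ic_rank Th), formal_solution Th (i : nat)%:Z (lam i) (Y i)) /\
    exists H : 'I_(ic_rank Th) -> 'I_(ic_rank Th) -> int -> C,
      (forall j l, laurent (H j l)) /\
      forall i l n, \sum_j laurent_mul (Y i (e j)) (H j l) n
                    = ((i == l) && (n == 0))%:R.

(* A direction is given by a real argument t, and the element [q_i, t] of I_t by
   i : int modulo r; the identification [q_i, t + 2 pi] = [q_(i+b), t] is imposed
   on the data indexed by I_t. *)
Definition idx_eq Th (i j : int) : bool := (i == j %[mod (ic_rank Th)%:Z])%Z.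

Definition dir_lt Th (t : R) (i j : int) : bool :=
  complex.Re (expfac Th i 1 t) < complex.Re (expfac Th j 1 t).

Definition dir_le Th (t : R) (i j : int) : bool :=
  idx_eq Th i j || dir_lt Th t i j.

Definition non_stokes Th (t : R) : Prop :=
  forall i j, [|| idx_eq Th i j, dir_lt Th t i j | dir_lt Th t j i].

Definition filt_lt Th (V : vectType C) (F : R -> int -> {vspace V}) (t : R)
    (i : int) : {vspace V} :=
  (\sum_(j < ic_rank Th | dir_lt Th t (j : nat)%:Z i) F t (j : nat)%:Z)%VS.

(* The values of ss_F at Stokes directions are irrelevant. *)
Record stokes_system Th := StokesSystem {
  ss_space :> vectType C;
  ss_F : R -> int -> {vspace ss_space};
  ss_dim : \dim {:ss_space} = ic_rank Th;
  ss_mod : forall t i j, non_stokes Th t -> idx_eq Th i j ->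
    ss_F t i = ss_F t j;
  ss_period : forall t i, non_stokes Th t ->
    ss_F (t + 2 * pi) i = ss_F t (i + (ic_num Th)%:Z);
  ss_incr : forall t i j, non_stokes Th t -> dir_lt Th t i j ->
    (ss_F t i <= ss_F t j)%VS;
  ss_gr : forall t i, non_stokes Th t ->
    \dim (ss_F t i) = (\dim (filt_lt Th ss_F t i)).+1;
  ss_loc_cst : forall t, non_stokes Th t ->
    \forall t' \near t, non_stokes Th t' -> forall i, ss_F t' i = ss_F t i;
  ss_grading : forall t, ~ non_stokes Th t ->
    exists G : int -> {vspace ss_space},
      [/\ forall i j, idx_eq Th i j -> G i = G j,
          directv (\sum_(j < ic_rank Th) G (j : nat)%:Z)%VS,
          (\sum_(j < ic_rank Th) G (j : nat)%:Z)%VS = fullv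
        & \forall t' \near t, non_stokes Th t' -> forall i,
            ss_F t' i =
            (\sum_(j < ic_rank Th | dir_le Th t' (j : nat)%:Z i)
               G (j : nat)%:Z)%VS]
}.

(* The recessive line and the subdominant hyperplane at directions near t.  They
   are selected by a choice operator, the direction t itself being possibly a
   Stokes direction. *)
Definition recessive Th (S : stokes_system Th) (t : R) : {vspace S} :=
  xget 0%VS [set L : {vspace S} | \forall t' \near t, non_stokes Th t' ->
    forall i, (forall j, dir_le Th t' i j) -> ss_F S t' i = L].

Definition subdominant Th (S : stokes_system Th) (t : R) : {vspace S} :=
  xget 0%VS [set H : {vspace S} | \forall t' \near t, non_stokes Th t' ->
    forall i, (forall j, dir_le Th t' j i) -> filt_lt Th (@ss_F Th S) t' i = H].

(* theta_(i,l), for r = a, and its hatted version, for r = b - a. *)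
Definition theta (r b : nat) (i l : int) : R :=
  2 * pi / b%:R * (- i%:~R + l%:~R * (r%:R / 2)).

Section Configurations.
Variables r b : nat.

Definition Phi_rec (S : stokes_system (Theta r b)) : config C b :=
  Config (fun k : 'I_b => recessive S (theta r b (k.+1)%:Z 1)).

Definition Phi_sub (S : stokes_system (Theta r b)) : config C b :=
  Config (fun k : 'I_b => annv (subdominant S (theta r b (k.+1)%:Z 0))).

Definition Phi_rec_hat (S : stokes_system (Theta_hat r b)) : config C b :=
  Config (fun k : 'I_b => recessive S (theta r b (- (k.+1)%:Z) 0)).

Definition Phi_sub_hat (S : stokes_system (Theta_hat r b)) : config C b :=
  Config (fun k : 'I_b => annv (subdominant S (theta r b (- (k.+1)%:Z) 1))).

End Configurations.

(* Solutions of E are the morphisms of Weyl modules from E to entire functions: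
   for E = D/DP they are the entire solutions of P u = 0. *)
Definition solution E (u : E -> C -> C) : Prop :=
  [/\ forall k m m' x, u (k *: m + m') x = k * u m x + u m' x,
      forall m x, u (wm_z m) x = x * u m x
    & forall m (x : C), is_derive (x : C^o) 1 (u m : C^o -> C^o) (u (wm_d m) x)].

(* exp(- q_i) f has moderate growth near the direction t. *)
Definition moderate Th (t : R) (i : int) (f : C -> C) : Prop :=
  exists (N : nat) (A rho0 eps : R), [/\ 0 < rho0, 0 < eps
    & forall rho t', rho0 <= rho -> `|t' - t| < eps ->
        `|f (polar rho t')| <=
        (A * rho ^+ N * expR (complex.Re (expfac Th i rho t')))%:C].

(* A Stokes filtered local system of type Th, together with an identification
   with the space of solutions of E filtered by growth rate. *)
Record stokes_of Th E := StokesOf {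
  so_system :> stokes_system Th;
  so_sol : so_system -> E -> C -> C;
  so_linear : forall k v v' m x,
    so_sol (k *: v + v') m x = k * so_sol v m x + so_sol v' m x;
  so_inj : injective so_sol;
  so_solution : forall u, solution u <-> exists v, so_sol v = u;
  so_growth : forall t i v, non_stokes Th t ->
    (v \in ss_F so_system t i <->
     forall m, moderate Th t i (so_sol v m))
}.

(* f is the map on solutions induced (covariantly) by the isomorphism phi. *)
Definition induced_map Th E E' (phi : E -> E') (S : stokes_of Th E)
    (S' : stokes_of Th E') (f : 'Hom(S, S')) : Prop :=
  forall v m x, so_sol (f v) (phi m) x = so_sol v m x.

End Connections.

(* Main.v *)
(** A relation between the recessive lines of E is a family of solutions v_j
    with sum zero, v_j decaying like exp(- |z|^(b/a)) near its direction.
    Integrating exp(- c z w) v_j along a slightly rotated ray and summing over j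
    gives a solution of the Fourier transform: the boundary terms at 0 cancel as
    the sum of the v_j vanishes. This Laplace transform is injective: when it
    vanishes, the Cauchy integral of the v_j along the rays is a solution of E on
    each sector between consecutive rays and can be estimated as if multiplied by
    exp(w (zeta - z)) for any w, so it decays faster than any solution and is
    zero; its jump across a ray is v_j. By Young's inequality, sharp for the
    chosen constant c, near suitable directions only the j-th summand can grow
    like the dominant solution of the Fourier transform, so that v_j = 0 puts
    the transform in a subdominant hyperplane.

    Both decay statements come from Wronskians: a Wronskian of solutions is a
    constant times exp of the trace, so replacing one solution in a basis adapted
    to the filtration by a too small one forces the determinant to vanish.

    The lines of a Stokes filtration extend to a periodic sequence in which the
    filtration is given by spans of consecutive lines, so that every subdominant
    hyperplane is spanned by recessive lines. The space of relations has
    dimension b - a, and the incidences above identify it with the Gale transform.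

    Formally, stationary phase sends t^n to a series in s with polynomial
    coefficients in n, which turns formal solutions of E into those of the
    Fourier transform. Counting symbols for the pole order filtration shows that
    E has b - a generators over C[d/dz], which the independence of the formal
    solutions makes a basis. *)
Require Import Defs.
From HB Require Import structures.
From mathcomp Require Import all_boot all_order all_algebra.
From mathcomp Require Import complex.
From mathcomp Require Import all_classical all_reals all_analysis.
From mathcomp Require Import perm measurable_realfun.
From mathcomp Require Import ring lra zify.
Set Implicit Arguments.
Unset Strict Implicit.
Unset Printing Implicit Defensive.
Import Order.TTheory GRing.Theory Num.Theory.
Import numFieldNormedType.Exports.
Local Open Scope classical_set_scope.
Local Open Scope complex_scope.
Local Open Scope ring_scope.

(** * Complex derivatives and the complex exponential *)

(** Directions are parametrised by a real number [y] in which every step of a Stokes filtration is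
    given by consecutive integers around [y]; the combinatorics of filtrations becomes that of
    windows of integers.

    Both isomorphisms are explicit. In the recessive case the transform of a relation [v] goes to
    the class of the partial sums of the [v i], the values of a step function on the circle with
    jumps [v i]. The subdominant case is the transpose. Naturality holds because both maps are
    characterised on all relations, independently of choices.

    One constant [c] serves twice: it normalises the formal Legendre transform and it makes Young's
    inequality sharp. Sharpness leaves no room by itself; the room comes from the angles. Away from
    the critical ray the cosines that occur are at most [cos (pi / b)], and the rates [la], [c0],
    [c1] lie, in this order, between that number and 1.

    No contour is deformed: integrals run along fixed rays, and the jump of a Cauchy integral is
    read off from a Poisson kernel. *)

Section ComplexModulus.
Variable R : realType.
Local Notation C := R[i].
Implicit Types z w : C.

(** The norm of [R[i]] takes values in [R[i]]; estimates use this real-valued modulus instead. *)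
Definition nrm z : R := ComplexField.Normc.normc z.

Lemma normrE z : `|z| = (nrm z)%:C.
Proof. by []. Qed.

Lemma nrmE z : nrm z = Num.sqrt (complex.Re z ^+ 2 + complex.Im z ^+ 2).
Proof. by case: z => ? ?. Qed.

Lemma nrm_ge0 z : 0 <= nrm z.
Proof. by rewrite nrmE sqrtr_ge0. Qed.

Lemma nrm0 : nrm 0 = 0. Proof. by rewrite nrmE /= expr0n addr0 sqrtr0. Qed.

Lemma nrm_eq0 z : (nrm z == 0) = (z == 0).
Proof.
apply/eqP/eqP => [/ComplexField.Normc.eq0_normc //|->]; exact: nrm0.
Qed.

Lemma nrm_gt0 z : (0 < nrm z) = (z != 0).
Proof. by rewrite lt_neqAle nrm_ge0 andbT eq_sym nrm_eq0. Qed.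

Lemma nrmM z w : nrm (z * w) = nrm z * nrm w.
Proof. exact: ComplexField.Normc.normcM. Qed.

Lemma nrm1 : nrm 1 = 1.
Proof. exact: ComplexField.Normc.normc1. Qed.

Lemma nrmV z : nrm z^-1 = (nrm z)^-1.
Proof. exact: ComplexField.Normc.normcV. Qed.

Lemma nrmD z w : nrm (z + w) <= nrm z + nrm w.
Proof. by rewrite -lecR rmorphD /=; have := ler_normD z w. Qed.

Lemma nrmN z : nrm (- z) = nrm z.
Proof. by case: z => x y; rewrite /nrm /= !sqrrN. Qed.

Lemma nrm_sub z w : nrm z - nrm w <= nrm (z - w).
Proof. by rewrite lerBlDr -{1}[z](subrK w) nrmD. Qed.

Lemma nrmX z n : nrm (z ^+ n) = nrm z ^+ n.
Proof. by elim: n => [|n IH]; rewrite ?expr0 ?nrm1 // !exprS nrmM IH. Qed.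

Lemma nrm_sum (I : Type) (r : seq I) (P : pred I) (F : I -> C) :
  nrm (\sum_(i <- r | P i) F i) <= \sum_(i <- r | P i) nrm (F i).
Proof.
elim/big_rec2 : _ => [|i y1 y2 _ h]; first by rewrite nrm0.
by apply: le_trans (nrmD _ _) _; rewrite lerD2l.
Qed.

Lemma nrm_prod (I : Type) (r : seq I) (P : pred I) (F : I -> C) :
  nrm (\prod_(i <- r | P i) F i) = \prod_(i <- r | P i) nrm (F i).
Proof.
by elim/big_rec2 : _ => [|i y1 y2 _ <-]; rewrite ?nrm1 ?nrmM.
Qed.

Lemma nrmR (x : R) : nrm x%:C = `|x|.
Proof. by rewrite nrmE /= expr0n addr0 sqrtr_sqr. Qed.

Lemma nrm_Re z : `|complex.Re z| <= nrm z.
Proof. by rewrite nrmE -sqrtr_sqr ler_wsqrtr // lerDl sqr_ge0. Qed.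

Lemma nrm_Im z : `|complex.Im z| <= nrm z.
Proof. by rewrite nrmE -sqrtr_sqr ler_wsqrtr // lerDr sqr_ge0. Qed.

Lemma nrm_le z : nrm z <= `|complex.Re z| + `|complex.Im z|.
Proof.
rewrite nrmE -(ger0_norm (addr_ge0 (normr_ge0 _) (normr_ge0 _))) -sqrtr_sqr.
apply: ler_wsqrtr; rewrite sqrrD.
rewrite !(real_normK (num_real _)) lerD2r lerDl mulrn_wge0 // mulr_ge0 //.
Qed.

Lemma cReD z w : complex.Re (z + w) = complex.Re z + complex.Re w.
Proof. by case: z => ? ?; case: w. Qed.
Lemma cImD z w : complex.Im (z + w) = complex.Im z + complex.Im w.
Proof. by case: z => ? ?; case: w. Qed.
Lemma cReN z : complex.Re (- z) = - complex.Re z.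
Proof. by case: z => ? ?. Qed.
Lemma cImN z : complex.Im (- z) = - complex.Im z.
Proof. by case: z => ? ?. Qed.
Lemma cReM z w : complex.Re (z * w) =
  complex.Re z * complex.Re w - complex.Im z * complex.Im w.
Proof. by case: z => ? ?; case: w. Qed.
Lemma cImM z w : complex.Im (z * w) =
  complex.Re z * complex.Im w + complex.Im z * complex.Re w.
Proof. by case: z => ? ?; case: w. Qed.

Lemma cReZ (k : R) z : complex.Re (k%:C * z) = k * complex.Re z.
Proof. by rewrite cReM /= mul0r subr0. Qed.
Lemma cImZ (k : R) z : complex.Im (k%:C * z) = k * complex.Im z.
Proof. by rewrite cImM /= mul0r addr0. Qed.

Lemma complexP z w : complex.Re z = complex.Re w -> complex.Im z = complex.Im w ->
  z = w.
Proof. by case: z w => [x y] [x' y'] /= -> ->. Qed.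

End ComplexModulus.

Section ComplexDerivative.
Variable R : realType.
Local Notation C := R[i].
Implicit Types (f g : C -> C) (z w d : C).

(** Complex differentiability as a first-order expansion, without a quotient, so that [h = 0] needs
    no separate treatment; [cderP] links it to [is_derive]. *)
Definition cder f z d := forall e : R, 0 < e -> exists2 r : R, 0 < r &
  forall h : C, nrm h < r -> nrm (f (z + h) - f z - h * d) <= e * nrm h.

Lemma cderP f z d : is_derive (z : C^o) 1 (f : C^o -> C^o) d <-> cder f z d.
Proof.
have quotE (h : C) : h != 0 ->
    h^-1 *: (f (h *: 1 + z) - f z) - d = h^-1 * (f (z + h) - f z - h * d).
  move=> h0; rewrite !mulrBr mulrA mulVf // mul1r.
  by rewrite [h *: 1]mulr1 [h + z]addrC [h^-1 *: _]mulrBr.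
split=> [[df dE] e e0|fd].
- have : (fun h : C => h^-1 *: ((f : C^o -> C^o) (h *: (1 : C^o) + z) - f z))
      @ (0 : C^o)^' --> (d : C^o) by rewrite -dE; exact: df.
  move/(@cvgr_dist_le _ (C^o)) => /(_ e%:C); rewrite ltcR => /(_ e0).
  rewrite /prop_near1 /= /within /= => /nbhs_ballP [r /= r0 H].
  have rR : r = (complex.Re r)%:C by move: r0; rewrite ltcE /= => /andP[/eqP i0 _]; case: (r) i0 => ? ? /= ->.
  exists (complex.Re r); first by move: r0; rewrite ltcE => /andP[].
  move=> h hr; have [->|h0] := eqVneq h 0.
    by rewrite addr0 subrr mul0r subr0 nrm0 mulr0.
  have /(_ _ h0) := H h; rewrite /ball /= sub0r normrN rR => /(_ _).
  rewrite normrE ltcR => /(_ hr).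
  rewrite distrC quotE // normrE lecR nrmM nrmV.
  by rewrite mulrC ler_pdivrMr ?nrm_gt0.
- have H : (fun h : C => h^-1 *: ((f : C^o -> C^o) (h *: (1 : C^o) + z) - f z))
      @ (0 : C^o)^' --> (d : C^o).
    apply/cvgrPdist_le => e e0.
    have eR : e = (complex.Re e)%:C by move: e0; rewrite ltcE /= => /andP[/eqP i0 _]; case: (e) i0 => ? ? /= ->.
    have [|r r0 H] := fd (complex.Re e); first by move: e0; rewrite ltcE => /andP[].
    rewrite /prop_near1 /= /within /=; apply/nbhs_ballP.
    exists r%:C; first by rewrite /= ltcR.
    move=> h; rewrite /ball /= sub0r normrN normrE ltcR => hr h0.
    rewrite distrC quotE // normrE eR lecR nrmM nrmV mulrC ler_pdivrMr ?nrm_gt0 //.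
    exact: H.
  by split; [exact: cvgP H|exact: cvg_lim H].
Qed.

Lemma cder_cst (k : C) z : cder (fun=> k) z 0.
Proof.
move=> e e0; exists 1 => // h _.
by rewrite subrr mulr0 subr0 nrm0 mulr_ge0 ?nrm_ge0 // ltW.
Qed.

Lemma cder_id z : cder id z 1.
Proof.
move=> e e0; exists 1 => // h _.
by rewrite /= mulr1 [z + h]addrC addrK subrr nrm0 mulr_ge0 ?nrm_ge0 // ltW.
Qed.

Lemma cderD f g z d d' : cder f z d -> cder g z d' ->
  cder (fun x => f x + g x) z (d + d').
Proof. by move=> /cderP fd /cderP gd; apply/cderP; exact: is_deriveD. Qed.

Lemma cderM f g z d d' : cder f z d -> cder g z d' ->
  cder (fun x => f x * g x) z (d * g z + f z * d').
Proof.
move=> /cderP fd /cderP gd; apply/cderP.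
have := @is_deriveM C C^o (f : C^o -> C) (g : C^o -> C) z 1 d d' fd gd.
congr (is_derive _ _ _ _); rewrite addrC; congr (_ + _) => //.
by rewrite [d * _]mulrC.
Qed.

Lemma cder_ext f g z d : (forall x, f x = g x) -> cder f z d -> cder g z d.
Proof. by move=> /funext ->. Qed.

Lemma cderZ f (k : C) z d : cder f z d -> cder (fun x => k * f x) z (k * d).
Proof.
by move=> fd; have := cderM (cder_cst k z) fd; rewrite mul0r add0r.
Qed.

Lemma cder_sum (I : Type) (r : seq I) (F : I -> C -> C) (D : I -> C) z :
  (forall i, cder (F i) z (D i)) ->
  cder (fun x => \sum_(i <- r) F i x) z (\sum_(i <- r) D i).
Proof.
move=> FD; elim: r => [|i r IH].
  rewrite big_nil; apply: cder_ext (cder_cst 0 z) => x; by rewrite big_nil.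
rewrite big_cons; apply: cder_ext (cderD (FD i) IH) => x; by rewrite big_cons.
Qed.

(** Second-order remainder estimates, for the exponential as well as under integral signs, become
    derivatives through this criterion. *)
Lemma cder_quad f z d (K r : R) : 0 < r ->
  (forall h, nrm h < r -> nrm (f (z + h) - f z - h * d) <= K * nrm h ^+ 2) ->
  cder f z d.
Proof.
move=> r0 H e e0; have K1 : 0 < `|K| + 1 by rewrite ltr_wpDl.
exists (Num.min r (e / (`|K| + 1))) => [|h]; first by rewrite lt_min r0 divr_gt0.
rewrite lt_min => /andP[hr he]; apply: le_trans (H h hr) _.
rewrite expr2 mulrA ler_wpM2r ?nrm_ge0 //.
apply: (@le_trans _ _ ((`|K| + 1) * nrm h)).
  by rewrite ler_wpM2r ?nrm_ge0 // (le_trans (ler_norm _)) // lerDl.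
by rewrite mulrC -ler_pdivlMr // ltW.
Qed.

End ComplexDerivative.

Section RealParameter.
Variable R : realType.
Local Notation C := R[i].

Lemma rderP (f : R -> R) (t d : R) : is_derive t 1 f d <->
  (forall e : R, 0 < e -> exists2 r : R, 0 < r &
     forall h, `|h| < r -> `|f (t + h) - f t - h * d| <= e * `|h|).
Proof.
have quotE (h : R) : h != 0 ->
    h^-1 *: (f (h *: 1 + t) - f t) - d = h^-1 * (f (t + h) - f t - h * d).
  move=> h0; rewrite !mulrBr mulrA mulVf // mul1r.
  by rewrite [h *: 1]mulr1 [h + t]addrC [h^-1 *: _]mulrBr.
split=> [[df dE] e e0|fd].
- have : (fun h : R => h^-1 *: (f (h *: 1 + t) - f t)) @ (0 : R)^' --> d.
    by rewrite -dE; exact: df.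
  move/(@cvgr_dist_le _ _) => /(_ e e0).
  rewrite /prop_near1 /= /within /= => /nbhs_ballP [r /= r0 H].
  exists r => // h hr; have [->|h0] := eqVneq h 0.
    by rewrite addr0 subrr mul0r subr0 normr0 mulr0.
  have /(_ _ h0) := H h; rewrite /ball /= sub0r normrN => /(_ hr).
  rewrite distrC quotE // normrM normfV.
  by rewrite mulrC ler_pdivrMr ?normr_gt0.
- have H : (fun h : R => h^-1 *: (f (h *: 1 + t) - f t)) @ (0 : R)^' --> d.
    apply/cvgrPdist_le => e e0; have [r r0 H] := fd e e0.
    rewrite /prop_near1 /= /within /=; apply/nbhs_ballP; exists r => //=.
    move=> h; rewrite /ball /= sub0r normrN => hr h0.
    rewrite distrC quotE // normrM normfV mulrC ler_pdivrMr ?normr_gt0 //.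
    exact: H.
  by split; [exact: cvgP H|exact: cvg_lim H].
Qed.

(** Taken on real and imaginary parts so that the real mean value theorem and the real fundamental
    theorem apply. *)
Definition rcder (f : R -> C) (t : R) (d : C) :=
  is_derive t 1 (fun s => complex.Re (f s)) (complex.Re d) /\
  is_derive t 1 (fun s => complex.Im (f s)) (complex.Im d).

Lemma rcderP (f : R -> C) (t : R) (d : C) :
  (forall e : R, 0 < e -> exists2 r : R, 0 < r &
     forall h, `|h| < r -> nrm (f (t + h) - f t - h%:C * d) <= e * `|h|) ->
  rcder f t d.
Proof.
move=> H; split; apply/rderP => e e0; have [r r0 Hr] := H e e0;
  exists r => // h hr; apply: le_trans (Hr h hr).
- apply: le_trans (nrm_Re _).
  by rewrite !cReD !cReN cReZ.
- apply: le_trans (nrm_Im _).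
  by rewrite !cImD !cImN cImZ.
Qed.

Lemma rcder_ray (F : C -> C) (z0 d : C) (t : R) (D : C) :
  cder F (z0 + t%:C * d) D -> rcder (fun s => F (z0 + s%:C * d)) t (d * D).
Proof.
move=> FD; apply: rcderP => e e0.
have d1 : 0 < nrm d + 1 by rewrite ltr_wpDl ?nrm_ge0.
have [|r r0 H] := FD (e / (nrm d + 1)); first by rewrite divr_gt0.
exists (r / (nrm d + 1)) => [|h]; first by rewrite divr_gt0.
rewrite ltr_pdivlMr // => hr.
have hd : nrm (h%:C * d) <= `|h| * (nrm d + 1).
  by rewrite nrmM nrmR ler_wpM2l ?normr_ge0 // lerDl.
have /H : nrm (h%:C * d) < r by apply: le_lt_trans hd hr.
rewrite rmorphD /= mulrDl addrA mulrA => /le_trans; apply.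
apply: (@le_trans _ _ (e / (nrm d + 1) * (`|h| * (nrm d + 1)))).
  by rewrite ler_wpM2l //; apply: divr_ge0; exact: ltW.
by rewrite [`|h| * _]mulrC mulrA divfK ?gt_eqF.
Qed.

Lemma rcder_cont (f : R -> C) t d : rcder f t d ->
  {for t, continuous (fun s => complex.Re (f s))} /\
  {for t, continuous (fun s => complex.Im (f s))}.
Proof.
by move=> [[d1 _] [d2 _]]; split; apply: differentiable_continuous;
  exact/derivable1_diffP.
Qed.

(** The mean value theorem is applied to the two coordinates separately, which costs the factor
    2. *)
Lemma rcder_mvt (f f' : R -> C) (M : R) :
  (forall t : R, 0 <= t <= 1 -> rcder f t (f' t)) ->
  (forall t : R, 0 <= t <= 1 -> nrm (f' t) <= M) -> nrm (f 1 - f 0) <= 2 * M.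
Proof.
move=> fd fM.
have mv (g g' : R -> R) : (forall t : R, 0 <= t <= 1 -> is_derive t 1 g (g' t)) ->
    (forall t : R, 0 <= t <= 1 -> `|g' t| <= M) -> `|g 1 - g 0| <= M.
  move=> gd gM; have [||x /andP[]] := @MVT_segment R g g' 0 1 ler01.
  - by move=> x; rewrite in_itv /= => /andP[x0 x1]; apply: gd; rewrite (ltW x0) (ltW x1).
  - apply: derivable_within_continuous => x; rewrite in_itv /= => /gd; by case.
  by rewrite subr0 mulr1 !bnd_simp => x0 x1 ->; apply: gM; rewrite x0 x1.
apply: le_trans (nrm_le _) _; rewrite mulr_natl mulr2n cReD cReN cImD cImN lerD //.
- apply: mv (fun t => complex.Re (f t)) (fun t => complex.Re (f' t)) _ _ => t t01.
    by have [] := fd t t01.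
  exact: le_trans (nrm_Re _) (fM _ t01).
- apply: mv (fun t => complex.Im (f t)) (fun t => complex.Im (f' t)) _ _ => t t01.
    by have [] := fd t t01.
  exact: le_trans (nrm_Im _) (fM _ t01).
Qed.

Lemma cder0_cst (F : C -> C) (z w : C) :
  (forall s : R, 0 <= s <= 1 -> cder F (z + s%:C * (w - z)) 0) -> F z = F w.
Proof.
move=> H; apply/eqP; rewrite eq_sym -subr_eq0 -nrm_eq0.
rewrite eq_le nrm_ge0 andbT.
have := @rcder_mvt (fun s => F (z + s%:C * (w - z))) (fun=> 0) 0.
rewrite mulr0 rmorph0 mul0r addr0 rmorph1 mul1r addrCA subrr addr0; apply.
  by move=> t t01; rewrite -[0](mulr0 (w - z)); apply: rcder_ray; exact: H.
by move=> *; rewrite nrm0.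
Qed.

End RealParameter.

Section ComplexExponential.
Variable R : realType.
Local Notation C := R[i].
Implicit Types z w : C.

Lemma polarM (x y s t : R) : polar x s * polar y t = polar (x * y) (s + t).
Proof. by rewrite /polar cosD sinD; apply: complexP => /=; ring. Qed.

Lemma nrm_polar (x t : R) : nrm (polar x t) = `|x|.
Proof.
by rewrite nrmE /= !exprMn -mulrDr cos2Dsin2 mulr1 sqrtr_sqr.
Qed.

Lemma polar0 (x : R) : polar x 0 = x%:C.
Proof. by rewrite /polar cos0 sin0 mulr1 mulr0. Qed.

Lemma polarZ (x y t : R) : polar (x * y) t = x%:C * polar y t.
Proof. by apply: complexP; rewrite ?cReZ ?cImZ /= mulrA. Qed.

Lemma polar1E (x t : R) : polar x t = x%:C * polar 1 t.
Proof. by rewrite -{1}[x]mulr1 polarZ. Qed.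

Lemma polarX (x t : R) n : polar x t ^+ n = polar (x ^+ n) (n%:R * t).
Proof.
elim: n => [|n IH]; first by rewrite !expr0 mul0r polar0.
by rewrite !exprS IH polarM mulrSr mulrDl mul1r [t + _]addrC.
Qed.

Lemma polarDpi (x t : R) : polar x (t + pi) = - polar x t.
Proof. by rewrite /polar cosDpi sinDpi !mulrN. Qed.

Definition cexp z : C := polar (expR (complex.Re z)) (complex.Im z).

Lemma cexpD z w : cexp (z + w) = cexp z * cexp w.
Proof. by rewrite /cexp polarM cReD cImD expRD. Qed.

Lemma cexp0 : cexp 0 = 1.
Proof. by rewrite /cexp /= expR0 polar0. Qed.

Lemma nrm_cexp z : nrm (cexp z) = expR (complex.Re z).
Proof. by rewrite nrm_polar ger0_norm // expR_ge0. Qed.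

Lemma rcder_cexp_line z (t : R) :
  rcder (fun s => cexp (s%:C * z)) t (z * cexp (t%:C * z)).
Proof.
case: z => x y; split => /=.
- apply: (@is_derive_eq _ _ _ (fun s : R => expR (s * x - 0 * y) * cos (s * y + 0 * x))).
  by rewrite /= ?mul0r ?subr0 ?addr0 /GRing.scale /=; ring.
- apply: (@is_derive_eq _ _ _ (fun s : R => expR (s * x - 0 * y) * sin (s * y + 0 * x))).
  by rewrite /= ?mul0r ?subr0 ?addr0 /GRing.scale /=; ring.
Qed.

End ComplexExponential.

(* P f d reads "f has derivative d at x": left abstract, it covers both complex
   derivatives and the derivation of Laurent series. *)
Section Jacobi.
Variables (X : Type) (B : comNzRingType) (x : X) (P : (X -> B) -> B -> Prop).
Hypothesis P_sign : forall b : bool, P (fun=> (-1) ^+ b) 0.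
Hypothesis P_zero : P (fun=> 0) 0.
Hypothesis P_add : forall f g d d', P f d -> P g d' -> P (fun y => f y + g y) (d + d').
Hypothesis P_mul : forall f g d d', P f d -> P g d' ->
  P (fun y => f y * g y) (d * g x + f x * d').

Lemma P_sum (I : Type) (r : seq I) (F : I -> X -> B) (D : I -> B) :
  (forall i, P (F i) (D i)) ->
  P (fun y => \sum_(i <- r) F i y) (\sum_(i <- r) D i).
Proof.
move=> FD; elim: r => [|i r IH].
  by rewrite big_nil; under eq_fun do rewrite big_nil; exact: P_zero.
rewrite big_cons; under eq_fun do rewrite big_cons.
exact: P_add.
Qed.

Lemma P_prod (I : finType) (F : I -> X -> B) (D : I -> B) :
  (forall i, P (F i) (D i)) ->
  P (fun y => \prod_i F i y) (\sum_i D i * \prod_(j | j != i) F j x).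
Proof.
move=> FD.
suff H (r : seq I) : uniq r -> P (fun y => \prod_(i <- r) F i y)
    (\sum_(i <- r) D i * \prod_(j <- r | j != i) F j x).
  exact: H (index_enum_uniq _).
elim: r => [_|i r IH /= /andP[ir ur]].
  rewrite big_nil; under eq_fun do rewrite big_nil.
  exact: P_sign false.
under eq_fun do rewrite big_cons.
rewrite big_cons big_cons eqxx /=.
have -> : \sum_(k <- r) D k * \prod_(j <- i :: r | j != k) F j x =
    F i x * \sum_(k <- r) D k * \prod_(j <- r | j != k) F j x.
  rewrite big_distrr /= !big_seq; apply: eq_bigr => k kr.
  rewrite big_cons; case: eqP => [ik|_]; first by rewrite ik kr in ir.
  by rewrite mulrCA.
have -> : \prod_(j <- r | j != i) F j x = \prod_(j <- r) F j x.
  rewrite big_seq_cond [RHS]big_seq_cond; apply: eq_bigl => j.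
  by rewrite andbT; case: (boolP (j \in r)) => //= jr; apply: contraNneq ir => <-.
exact: P_mul (IH ur).
Qed.

(** Differentiating the Leibniz formula replaces one row at a time by its derivative, and the
    resulting determinants add up to [\tr (N *m \adj (M x))]. The hypothesis on [N] then avoids any
    inverse of [M x]. *)
Lemma jacobi n (M : X -> 'M[B]_n) (N A : 'M[B]_n) :
  (forall i j, P (fun y => M y i j) (N i j)) -> N = M x *m A ->
  P (fun y => \det (M y)) (\tr A * \det (M x)).
Proof.
move=> MN NE.
pose D := \sum_(s : {perm 'I_n}) (0 * \prod_i M x i (s i) +
  (-1) ^+ s * \sum_i N i (s i) * \prod_(j | j != i) M x j (s j)).
suff <- : D = \tr A * \det (M x).
  apply: P_sum => s; apply: P_mul (P_sign _) _.
  by apply: (@P_prod _ (fun i y => M y i (s i)) (fun i => N i (s i))).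
have -> : \tr A * \det (M x) = \tr (N *m \adj (M x)).
  rewrite NE -mulmxA mxtrace_mulC -mulmxA mul_adj_mx mul_mx_scalar linearZ /=.
  by rewrite mulrC.
have -> : \tr (N *m \adj (M x)) =
    \sum_i \det (\matrix_(k, j) (if k == i then N i j else M x k j)).
  apply: eq_bigr => i _; rewrite mxE (expand_det_row _ i).
  apply: eq_bigr => j _; rewrite !mxE eqxx; congr (_ * _).
  rewrite /cofactor; congr (_ * \det _).
  by apply/matrixP => k l; rewrite !mxE eq_sym (negbTE (neq_lift _ _)).
rewrite exchange_big /=; apply: eq_bigr => s _; rewrite mul0r add0r big_distrr /=.
apply: eq_bigr => i _; congr (_ * _).
rewrite [RHS](bigD1 i) //= mxE eqxx; congr (_ * _).
by apply: eq_bigr => j /negbTE ji; rewrite mxE ji.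
Qed.

End Jacobi.

Section ExponentialDerivative.
Variable R : realType.
Local Notation C := R[i].
Implicit Types z w h : C.

Lemma cexp_sub1 h : nrm (cexp h - 1) <= 2 * (nrm h * expR (nrm h)).
Proof.
have := @rcder_mvt R (fun s => cexp (s%:C * h)) (fun s => h * cexp (s%:C * h))
  (nrm h * expR (nrm h)) (fun t _ => rcder_cexp_line h t).
rewrite rmorph1 rmorph0 mul1r mul0r cexp0; apply => t /andP[t0 t1].
rewrite nrmM nrm_cexp ler_wpM2l ?nrm_ge0 // ler_expR cReZ.
apply: le_trans (_ : t * nrm h <= _).
  by rewrite ler_wpM2l // (le_trans (ler_norm _) (nrm_Re _)).
by rewrite ler_piMl ?nrm_ge0.
Qed.

Lemma rcderD (f g : R -> C) t d d' : rcder f t d -> rcder g t d' ->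
  rcder (fun s => f s + g s) t (d + d').
Proof.
move=> [f1 f2] [g1 g2]; split; rewrite ?cReD ?cImD.
  by under eq_fun do rewrite cReD; exact: is_deriveD.
by under eq_fun do rewrite cImD; exact: is_deriveD.
Qed.

Lemma cexp_sub2 h : nrm (cexp h - 1 - h) <= 4 * (nrm h ^+ 2 * expR (nrm h)).
Proof.
have D t : rcder (fun s => cexp (s%:C * h) + (0 + s%:C * - h)) t
    (h * cexp (t%:C * h) + - h * 1).
  apply: rcderD (rcder_cexp_line h t) _.
  exact: (@rcder_ray R id 0 (- h) t 1 (cder_id _)).
have := @rcder_mvt R _ _ (nrm h * (2 * (nrm h * expR (nrm h)))) (fun t _ => D t).
rewrite rmorph1 rmorph0 !mul1r !mul0r cexp0 !add0r addr0.
have -> : cexp h - h - 1 = cexp h - 1 - h by ring.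
have -> : 2 * (nrm h * (2 * (nrm h * expR (nrm h)))) =
   4 * (nrm h ^+ 2 * expR (nrm h)) by ring.
apply => t /andP[t0 t1].
rewrite mulNr -mulrBr nrmM ler_wpM2l ?nrm_ge0 //.
apply: le_trans (cexp_sub1 _) _.
have th : nrm (t%:C * h) <= nrm h.
  by rewrite nrmM nrmR ger0_norm // ler_piMl ?nrm_ge0.
by rewrite ler_wpM2l // ler_pM ?nrm_ge0 ?expR_ge0 // ler_expR.
Qed.

Lemma cder_cexp z : cder (@cexp R) z (cexp z).
Proof.
apply: (@cder_quad _ _ _ _ (nrm (cexp z) * (4 * expR 1)) 1) => // h h1.
rewrite cexpD -[X in _ * _ - X]mulr1 -mulrBr [h * _]mulrC -mulrBr nrmM -mulrA.
rewrite ler_wpM2l ?nrm_ge0 //; apply: le_trans (cexp_sub2 h) _.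
rewrite -mulrA ler_wpM2l // mulrC ler_wpM2r ?sqr_ge0 // ler_expR ltW //.
Qed.

Lemma cder_comp (f g : C -> C) z d d' : cder f (g z) d -> cder g z d' ->
  cder (f \o g) z (d' * d).
Proof.
move=> fd gd e e0.
have [r1 r10 H1] := gd 1 ltr01.
have n1 : 0 < nrm d' + 1 by rewrite ltr_wpDl ?nrm_ge0.
have n2 : 0 < nrm d + 1 by rewrite ltr_wpDl ?nrm_ge0.
have [|r2 r20 H2] := fd (e / 2 / (nrm d' + 1)); first by rewrite !divr_gt0.
have [|r3 r30 H3] := gd (e / 2 / (nrm d + 1)); first by rewrite !divr_gt0.
exists (Num.min r1 (Num.min r3 (r2 / (nrm d' + 1)))) => [|h].
  by rewrite !lt_min r10 r30 divr_gt0.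
rewrite !lt_min => /and3P[h1 h3]; rewrite ltr_pdivlMr // => h2.
set k := g (z + h) - g z.
have kh : nrm k <= nrm h * (nrm d' + 1).
  rewrite -[k](subrK (h * d')); apply: le_trans (nrmD _ _) _.
  by rewrite nrmM mulrDr mulr1 addrC lerD2l -[leRHS]mul1r H1.
have gk : g (z + h) = g z + k by rewrite [RHS]addrC /k subrK.
rewrite /comp gk.
have -> : f (g z + k) - f (g z) - h * (d' * d) =
  (f (g z + k) - f (g z) - k * d) + (k - h * d') * d by ring.
apply: le_trans (nrmD _ _) _.
have -> : e * nrm h = e / 2 * nrm h + e / 2 * nrm h by field.
apply: lerD.
  apply: le_trans (H2 _ (le_lt_trans kh h2)) _.
  rewrite -mulrA ler_wpM2l ?divr_ge0 ?(ltW e0) //.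
  by rewrite mulrC ler_pdivrMr.
rewrite nrmM; apply: le_trans (ler_wpM2r (nrm_ge0 _) (H3 _ h3)) _.
rewrite -!mulrA ler_wpM2l ?(ltW e0) // ler_wpM2l //.
by rewrite mulrCA ler_piMr ?nrm_ge0 // mulrC ler_pdivrMr // mul1r lerDl.
Qed.

Lemma cder_exprn n z : cder (fun x : C => x ^+ n) z (n%:R * z ^+ n.-1).
Proof.
elim: n => [|n IH]; first by rewrite mul0r; exact: cder_cst.
have := cderM (cder_id z) IH; rewrite mul1r => /cder_ext D.
have -> : n.+1%:R * z ^+ n.+1.-1 = z ^+ n + z * (n%:R * z ^+ n.-1).
  by case: n {IH D} => [|n] /=; rewrite ?expr0 ?exprS ?[n.+2%:R]mulrSr ?[n.+1%:R]mulrSr; ring.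
by apply: D => x; rewrite exprS.
Qed.

Lemma cder_scale (f : C -> C) k z d : cder f (k * z) d ->
  cder (fun x => f (k * x)) z (k * d).
Proof.
move=> fd; have kd : cder (fun x => k * x) z k.
  by have := cderZ k (cder_id z); rewrite mulr1.
exact: (cder_comp fd kd).
Qed.

Lemma cder_cexpZ k z : cder (fun x => cexp (k * x)) z (k * cexp (k * z)).
Proof. exact/cder_scale/cder_cexp. Qed.

Lemma cder_inv_sub (x0 z : C) : x0 != z ->
  cder (fun x => (x0 - x)^-1) z ((x0 - z)^-1 ^+ 2).
Proof.
move=> xz; have n0 : 0 < nrm (x0 - z) by rewrite nrm_gt0 subr_eq0.
have xz0 : x0 - z != 0 by rewrite subr_eq0.
apply: (@cder_quad _ _ _ _ (2 * (nrm (x0 - z))^-1 ^+ 3) (nrm (x0 - z) / 2)).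
  by rewrite divr_gt0.
move=> h hr.
have hl : nrm (x0 - z) / 2 <= nrm (x0 - (z + h)).
  have := nrm_sub (x0 - z) h; rewrite opprD addrA => /(le_trans _); apply.
  by rewrite lerBrDr -lerBrDl; apply: ltW; apply: lt_le_trans hr _; lra.
have h0 : x0 - (z + h) != 0.
  by rewrite -nrm_gt0 (lt_le_trans _ hl) // divr_gt0.
have -> : (x0 - (z + h))^-1 - (x0 - z)^-1 - h * (x0 - z)^-1 ^+ 2 =
    h ^+ 2 * ((x0 - z)^-1 ^+ 2 * (x0 - (z + h))^-1).
  by field; rewrite h0 xz0.
rewrite nrmM mulrC [nrm (h ^+ 2)]nrmX ler_wpM2r ?sqr_ge0 //.
rewrite nrmM [nrm (_ ^+ 2)]nrmX !nrmV.
have -> : 2 * (nrm (x0 - z))^-1 ^+ 3 =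
  (nrm (x0 - z))^-1 ^+ 2 * (nrm (x0 - z) / 2)^-1.
  by field; rewrite gt_eqF.
by rewrite ler_wpM2l ?sqr_ge0 // lef_pV2 // posrE ?divr_gt0 // nrm_gt0.
Qed.

Lemma cder_det n (M : C -> 'M[C]_n) (N A : 'M[C]_n) z :
  (forall i j, cder (fun y => M y i j) z (N i j)) -> N = M z *m A ->
  cder (fun y => \det (M y)) z (\tr A * \det (M z)).
Proof.
apply: (@jacobi _ _ _ (fun f d => cder f z d)).
- by move=> b; exact: cder_cst.
- exact: cder_cst.
- by move=> f g d d'; exact: cderD.
- by move=> f g d d'; exact: cderM.
Qed.

End ExponentialDerivative.

(** * Integrals along rays *)

Section HalfLineIntegral.
Variable R : realType.
Local Notation mu := (@lebesgue_measure R).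
Implicit Types f F : R -> R.

Definition hint f : R := Rintegral mu `[(0 : R), +oo[ f.

(** Two-sided continuity, at 0 as well: the integrands will be restrictions to a ray of functions
    that are complex differentiable at each of its points, the origin included. *)
Definition hcont f := forall t : R, 0 <= t -> {for t, continuous f}.
Definition hdom (B : R) f := forall t : R, 0 <= t -> `|f t| <= B * expR (- t).

Lemma is_derive_continuous f (t d : R) : is_derive t 1 f d ->
  {for t, continuous f}.
Proof.
by case=> fd _; apply: differentiable_continuous; exact/derivable1_diffP.
Qed.

Lemma hcont_within f : hcont f -> {within `[(0 : R), +oo[, continuous f}.
Proof.
move=> cf; apply/continuous_within_itvcyP; split.
  by move=> t; rewrite in_itv /= andbT => t0; apply: cf; exact: ltW.
by apply: cvg_at_right_filter; apply: cf.
Qed.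

Lemma hcont_measurable f : hcont f -> measurable_fun `[(0 : R), +oo[ f.
Proof.
move=> /hcont_within; exact: subspace_continuous_measurable_fun.
Qed.

Lemma expRN_derive (t : R) : is_derive t 1 (fun s => - expR (- s)) (expR (- t)).
Proof.
apply: is_derive_eq; rewrite /GRing.scale /=; ring.
Qed.

Lemma hcont_expRN : hcont (fun t => expR (- t)).
Proof.
move=> t _; apply: continuous_comp; first exact: (@continuousN _ R^o _ id).
exact: continuous_expR.
Qed.

Lemma expRN_integral : (\int[mu]_(t in `[(0%R : R), +oo[) (expR (- t))%:E = 1)%E.
Proof.
have E : (1 = 0%:E - (- expR (- 0))%:E :> \bar R)%E.
  by rewrite oppr0 expR0 -EFinB sub0r opprK.
rewrite E; apply: (@ge0_continuous_FTC2y R (fun t => expR (- t)) (fun t => - expR (- t)) 0 0).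
- by move=> *; exact: expR_ge0.
- exact: hcont_within hcont_expRN.
- by rewrite -oppr0; apply: cvgN; exact: cvgr_expR.
- by move=> x _; have [] := expRN_derive x.
- apply: cvg_at_right_filter; exact: is_derive_continuous (expRN_derive 0).
- by move=> x _; rewrite derive1E; have [_] := expRN_derive x.
Qed.

Lemma expRN_integrable : mu.-integrable `[(0 : R), +oo[ (EFin \o (fun t => expR (- t))).
Proof.
apply/integrableP; split.
  by apply/measurable_EFinP; exact: hcont_measurable hcont_expRN.
under eq_integral do rewrite /= ger0_norm ?expR_ge0 //.
by rewrite expRN_integral ltry.
Qed.

Lemma hint_expRN : hint (fun t => expR (- t)) = 1.
Proof. by rewrite /hint /Rintegral expRN_integral. Qed.

Lemma hdom_integrable f B : hcont f -> hdom B f ->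
  mu.-integrable `[(0 : R), +oo[ (EFin \o f).
Proof.
move=> cf df; apply: (@le_integrable _ _ _ mu _ _ _ (EFin \o (fun t => B * expR (- t)))) => //.
- by apply/measurable_EFinP; exact: hcont_measurable.
- move=> t /=; rewrite in_itv /= andbT => t0; rewrite lee_fin.
  exact: le_trans (df t t0) (ler_norm _).
- apply: (@eq_integrable _ _ _ mu _ _ (fun t => (B%:E * (expR (- t))%:E)%E)) => //.
  by apply: integrableZl => //; exact: expRN_integrable.
Qed.

Lemma hint_le f g : mu.-integrable `[(0 : R), +oo[ (EFin \o f) ->
  mu.-integrable `[(0 : R), +oo[ (EFin \o g) ->
  (forall t, 0 <= t -> f t <= g t) -> hint f <= hint g.
Proof.
move=> fi gi fg; apply: le_Rintegral => // t /=.
by rewrite in_itv /= andbT; exact: fg.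
Qed.

Lemma hint_eq f g : (forall t, 0 <= t -> f t = g t) -> hint f = hint g.
Proof.
move=> fg; apply: eq_Rintegral => t; rewrite inE /= in_itv /= andbT; exact: fg.
Qed.

Lemma hintZ f B k : hcont f -> hdom B f -> hint (fun t => k * f t) = k * hint f.
Proof. by move=> cf df; apply: RintegralZl => //; exact: hdom_integrable df. Qed.

Lemma hintD f g B B' : hcont f -> hdom B f -> hcont g -> hdom B' g ->
  hint (fun t => f t + g t) = hint f + hint g.
Proof.
by move=> cf df cg dg; apply: RintegralD => //;
  [exact: hdom_integrable df|exact: hdom_integrable dg].
Qed.

Lemma hint_bound f B : hcont f -> hdom B f -> `|hint f| <= B.
Proof.
move=> cf df; apply: le_trans (le_normr_Rintegral _ _) _ => //.
  exact: hdom_integrable df.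
have cn : hcont (fun t => `|f t|).
  by move=> t t0; apply: continuous_comp; [exact: cf|exact: norm_continuous].
have dn : hdom B (fun t => `|f t|) by move=> t /df; rewrite normr_id.
have de : hdom `|B| (fun t => B * expR (- t)).
  by move=> t t0; rewrite normrM [`|expR _|]ger0_norm ?expR_ge0.
have ce : hcont (fun t => B * expR (- t)).
  by move=> t t0; apply: continuousM; [exact: cst_continuous|exact: hcont_expRN].
have dE : hdom 1 (fun t => expR (- t)).
  by move=> t t0; rewrite mul1r ger0_norm ?expR_ge0.
rewrite -[leRHS]mulr1 -hint_expRN -(hintZ _ hcont_expRN dE).
apply: hint_le (hdom_integrable cn dn) (hdom_integrable ce de) _ => t t0.
by apply: le_trans (ler_norm _) _; exact: dn.
Qed.

Lemma hint_FTC f F B B' : hcont f -> hdom B f -> hdom B' F ->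
  (forall t : R, 0 <= t -> is_derive t 1 F (f t)) -> hint f = - F 0.
Proof.
move=> cf df dF FD.
have dE : hdom 1 (fun t => expR (- t)).
  by move=> t t0; rewrite mul1r ger0_norm ?expR_ge0.
have de : hdom `|B| (fun t => B * expR (- t)).
  by move=> t t0; rewrite normrM [`|expR _|]ger0_norm ?expR_ge0.
have ce : hcont (fun t => B * expR (- t)).
  by move=> t t0; apply: continuousM; [exact: cst_continuous|exact: hcont_expRN].
have cF : hcont F.
  move=> t t0; have [d _] := FD t t0.
  by apply: differentiable_continuous; exact/derivable1_diffP.
(* The half-line fundamental theorem invoked here concerns nonnegative integrands. Domination makes
   [f t + B * expR (- t)] nonnegative, and the added part integrates to [B]. *)
pose g t := f t + B * expR (- t); pose G t := F t + B * - expR (- t).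
have GD (t : R) : 0 <= t -> is_derive t 1 G (g t).
  move=> t0; have Ft := FD t t0; have Et := expRN_derive t.
  by apply: is_derive_eq; rewrite /g /GRing.scale /=; ring.
have cg : hcont g by move=> t t0; apply: continuousD; [exact: cf|exact: ce].
have : hint g = 0 - G 0.
  apply: (@Rintegral_ge0_continuous_FTC2y R g G 0 0).
  - move=> t t0; have := df t t0; rewrite ler_norml => /andP[h _].
    by rewrite /g -lerBlDr sub0r.
  - exact: hcont_within cg.
  - rewrite -[0]addr0 -{2}[0](mulr0 B) -{2}oppr0; apply: cvgD; last first.
      by apply: cvgMl_tmp; apply: cvgN; exact: cvgr_expR.
    apply/cvgrPdist_le => e e0.
    have H : B' * expR (- t) @[t --> +oo] --> 0.
      by rewrite -(mulr0 B'); apply: cvgMl_tmp; exact: cvgr_expR.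
    move/(@cvgrPdist_le _ R^o) : H => H.
    near=> t; rewrite sub0r normrN.
    apply: le_trans (dF _ _) _; first by near: t; exact: nbhs_pinfty_ge.
    have : `|0 - B' * expR (- t)| <= e.
      by near: t; exact: H.
    by rewrite sub0r normrN => /(le_trans (ler_norm _)).
  - by move=> t t0; have [] := GD t (ltW t0).
  - apply: cvg_at_right_filter; have [d _] := GD 0 (lexx _).
    by apply: differentiable_continuous; exact/derivable1_diffP.
  - move=> t; rewrite in_itv /= andbT => t0; rewrite derive1E.
    by have [_ ->] := GD t (ltW t0).
rewrite /g (hintD cf df ce de) (hintZ _ hcont_expRN dE) hint_expRN /G oppr0 expR0.
by move=> H; apply: (addIr (B * 1)); rewrite H; ring.
Unshelve. all: by end_near. Qed.

Lemma poisson_hcont f (t0 e : R) : 0 < e -> hcont f ->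
  hcont (fun t => f t / ((t - t0) ^+ 2 + e ^+ 2)).
Proof.
move=> e0 cf t tt; apply: continuousM; first exact: cf.
apply: continuousV; first by rewrite gt_eqF // ltr_wpDl ?sqr_ge0 // exprn_gt0.
apply: (@is_derive_continuous _ t (2 * (t - t0))).
by apply: is_derive_eq; rewrite /GRing.scale /=; ring.
Qed.

Lemma poisson_hdom f (t0 e B : R) : 0 < e -> hdom B f ->
  hdom (B / e ^+ 2) (fun t => f t / ((t - t0) ^+ 2 + e ^+ 2)).
Proof.
move=> e0 df t tt.
have den : 0 < (t - t0) ^+ 2 + e ^+ 2 by rewrite ltr_wpDl ?sqr_ge0 // exprn_gt0.
rewrite normrM normfV [`|_ + _|]gtr0_norm // mulrAC; apply: ler_pM => //.
- by rewrite invr_ge0 ltW.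
- exact: df.
- by rewrite lef_pV2 ?posrE ?exprn_gt0 // lerDr sqr_ge0.
Qed.

(** This is the Poisson kernel without its factor [e], so its mass near [t0] is of order [1 / e]. If
    [f t0] were positive, the integral would exceed every bound as [e] shrinks. *)
Lemma hint_poisson f B K e1 t0 : 0 < t0 -> hcont f -> hdom B f -> 0 < e1 ->
  (forall e, 0 < e < e1 -> `|hint (fun t => f t / ((t - t0) ^+ 2 + e ^+ 2))| <= K) ->
  f t0 <= 0.
Proof.
move=> t00 cf df e10 H; rewrite leNgt; apply/negP => ft0.
set c := f t0 / 2; have c0 : 0 < c by rewrite divr_gt0.
have /(@cvgr_dist_lt _ _ _ _ _ f (f t0)) /(_ c c0) /nbhs_ballP [d /= d0 Hd] := cf _ (ltW t00).
have B0 : 0 <= B.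
  have := le_trans (normr_ge0 _) (df 0 (lexx _)).
  by rewrite oppr0 expR0 mulr1.
have K0 : 0 <= K.
  by apply: le_trans (normr_ge0 _) (H (e1 / 2) _); rewrite divr_gt0 //= ltr_pdivrMr // ltr_pMr // ltr1n.
(* Chosen so that the lower bound [c / e - B / d ^+ 2] exceeds [K] as soon as [e <= c / M]. *)
pose M := K + B / d ^+ 2 + 1.
have M0 : 0 < M by rewrite ltr_wpDl // addr_ge0 // divr_ge0 // sqr_ge0.
pose e := Num.min (Num.min (d / 2) (e1 / 2)) (Num.min t0 (c / M)).
have e0 : 0 < e by rewrite !lt_min !divr_gt0 //= t00.
have ed : e < d by rewrite !gt_min; apply/orP; left; apply/orP; left; lra.
have ee1 : e < e1 by rewrite !gt_min; apply/orP; left; apply/orP; right; lra.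
have et0 : e <= t0 by rewrite !ge_min lexx !orbT.
have eM : e <= c / M by rewrite !ge_min lexx !orbT.
have den t : 0 < (t - t0) ^+ 2 + e ^+ 2 by rewrite ltr_wpDl ?sqr_ge0 // exprn_gt0.
pose A : set R := `[t0 - e, t0 + e]%classic.
(* A minorant with computable integral: on [A] the numerator exceeds [c] and the denominator is at
   most [2 * e ^+ 2]; within distance [d] of [t0] the integrand is positive; farther away it is at
   least [- B * expR (- t) / d ^+ 2]. *)
pose g t := c / (2 * e ^+ 2) * \1_A t - B / d ^+ 2 * expR (- t).
pose h t := f t / ((t - t0) ^+ 2 + e ^+ 2).
have mA : measurable A by exact: measurable_itv.
have hc : hcont h by exact: poisson_hcont.
have hd : hdom (B / e ^+ 2) h by exact: poisson_hdom.
have iA : mu.-integrable `[(0 : R), +oo[ (EFin \o \1_A).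
  by apply: (@integrableS _ _ _ mu setT) => //; exact: (integrable_indic_itv _ _ true false).
have i1 : mu.-integrable `[(0 : R), +oo[ (EFin \o (fun t => c / (2 * e ^+ 2) * \1_A t)).
  apply: (@eq_integrable _ _ _ mu _ _ (fun t => ((c / (2 * e ^+ 2))%:E * (\1_A t)%:E)%E)) => //.
  apply: integrableZl => //; exact: iA.
have i2 : mu.-integrable `[(0 : R), +oo[ (EFin \o (fun t => B / d ^+ 2 * expR (- t))).
  by apply: integrableZl (expRN_integrable).
have ig : mu.-integrable `[(0 : R), +oo[ (EFin \o g).
  apply: (@eq_integrable _ _ _ mu _ _ ((EFin \o (fun t => (c / (2 * e ^+ 2) * \1_A t)%R)) \-
    (EFin \o (fun t => (B / d ^+ 2 * expR (- t))%R)))%E) => //.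
  exact: integrableB i1 i2.
have gh : hint g <= hint h.
  apply: hint_le ig (hdom_integrable hc hd) _ => t tt; rewrite /g /h indicE.
  have Bd0 : 0 <= B / d ^+ 2 * expR (- t).
    by rewrite mulr_ge0 ?expR_ge0 // divr_ge0 ?sqr_ge0.
  have [td|td] := ltP `|t - t0| d.
    have ftc : c < f t.
      have /Hd : ball t0 d t by rewrite /ball /= distrC.
      rewrite ltr_norml => /andP[_]; rewrite /c; lra.
    have [tA|tA] := boolP (t \in A); last first.
      rewrite mulr0 sub0r; apply: le_trans (_ : 0 <= _); first by rewrite oppr_le0.
      by rewrite divr_ge0 // ltW // (lt_trans c0).
    rewrite mulr1 lerBlDr -[leLHS]addr0 lerD //.
    apply: ler_pM; rewrite ?(ltW c0) ?(ltW ftc) //.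
      by rewrite invr_ge0 mulr_ge0 ?sqr_ge0.
    rewrite lef_pV2 ?posrE ?mulr_gt0 ?exprn_gt0 //.
    rewrite mulr2n mulrDl mul1r lerD2r -(real_normK (num_real (t - t0))).
    rewrite lerXn2r ?nnegrE ?(ltW e0) // ler_distlC.
    by move: tA; rewrite inE /A /= in_itv /=; lra.
  have -> : (t \in A) = false.
    apply/negbTE/negP; rewrite inE /A /= in_itv /= => tA.
    move: td; rewrite leNgt => /negP; apply; apply: le_lt_trans ed.
    by rewrite ler_distlC; lra.
  rewrite mulr0 sub0r lerNl -mulNr; apply: le_trans (ler_norm _) _.
  rewrite normrM normrN normfV [`|_ + _|]gtr0_norm // mulrAC.
  apply: ler_pM => //; first by rewrite invr_ge0 ltW.
    exact: df.
  rewrite lef_pV2 ?posrE ?exprn_gt0 // -[leLHS]addr0 lerD ?sqr_ge0 //.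
  by rewrite -(real_normK (num_real (t - t0))) lerXn2r ?nnegrE // ltW.
have gE : hint g = c / e - B / d ^+ 2.
  rewrite /hint RintegralB // RintegralZl //.
  rewrite RintegralZl //; last exact: expRN_integrable.
  have E1 : Rintegral mu `[(0 : R), +oo[ (fun t => expR (- t)) = 1 := hint_expRN.
  rewrite E1 mulr1; congr (_ - _).
  rewrite /Rintegral integral_indic // setIidl; last first.
    by move=> t; rewrite /A /= !in_itv /= andbT; lra.
  have E2 : mu A = (2 * e)%:E.
    apply: etrans (lebesgue_measure_itv `[t0 - e, t0 + e]) _.
    by rewrite /= lte_fin ifT; [rewrite -EFinB; congr EFin; ring|lra].
  transitivity (c / (2 * e ^+ 2) * fine (2 * e)%:E).
    by congr (_ * fine _); exact: E2.
  by rewrite /=; field; rewrite gt_eqF.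
have := H e; rewrite e0 ee1 => /(_ isT) /(le_trans (ler_norm _)).
rewrite -/h => /(le_trans gh); rewrite gE.
have : M <= c / e.
  by rewrite ler_pdivlMr // mulrC -ler_pdivlMr.
rewrite /M; lra.
Qed.

End HalfLineIntegral.

Section RayIntegral.
Variable R : realType.
Local Notation C := R[i].
Implicit Types (f g : R -> C) (F G : C -> C) (e z w : C).

Definition cint f : C :=
  hint (fun t => complex.Re (f t)) +i* hint (fun t => complex.Im (f t)).

Definition ccont f := hcont (fun t => complex.Re (f t)) /\
  hcont (fun t => complex.Im (f t)).
Definition cdom (B : R) f := forall t : R, 0 <= t -> nrm (f t) <= B * expR (- t).

Lemma cdom_Re B f : cdom B f -> hdom B (fun t => complex.Re (f t)).
Proof. by move=> df t /df; apply: le_trans; exact: nrm_Re. Qed.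

Lemma cdom_Im B f : cdom B f -> hdom B (fun t => complex.Im (f t)).
Proof. by move=> df t /df; apply: le_trans; exact: nrm_Im. Qed.

Lemma cint_eq f g : (forall t, 0 <= t -> f t = g t) -> cint f = cint g.
Proof.
by move=> fg; congr Complex; apply: hint_eq => t /fg ->.
Qed.

Lemma hcontZ (k : R) (f : R -> R) : hcont f -> hcont (fun t => k * f t).
Proof. by move=> cf t /cf; apply: continuousM; exact: cst_continuous. Qed.

Lemma hdomZ (k B : R) (f : R -> R) : hdom B f -> hdom (`|k| * B) (fun t => k * f t).
Proof. by move=> df t /df h; rewrite normrM -mulrA ler_wpM2l. Qed.

Lemma hcontD (f g : R -> R) : hcont f -> hcont g -> hcont (fun t => f t + g t).
Proof. by move=> cf cg t t0; apply: continuousD; [exact: cf|exact: cg]. Qed.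

Lemma hdomD (B B' : R) (f g : R -> R) : hdom B f -> hdom B' g ->
  hdom (B + B') (fun t => f t + g t).
Proof.
move=> df dg t t0; rewrite mulrDl; apply: le_trans (ler_normD _ _) _.
by rewrite lerD ?df ?dg.
Qed.

Lemma cint_linear (k : C) f g B B' : ccont f -> cdom B f -> ccont g -> cdom B' g ->
  cint (fun t => k * f t + g t) = k * cint f + cint g.
Proof.
move=> [c1 c2] df [c3 c4] dg.
have d1 := cdom_Re df; have d2 := cdom_Im df.
have d3 := cdom_Re dg; have d4 := cdom_Im dg.
have lin2 (x y : R) (p q r : R -> R) P Q S : hcont p -> hdom P p -> hcont q ->
    hdom Q q -> hcont r -> hdom S r ->
    hint (fun t => (x * p t + y * q t) + r t) = (x * hint p + y * hint q) + hint r.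
  move=> cp dp cq dq cr dr.
  rewrite -(@hintZ _ p P x cp dp) -(@hintZ _ q Q y cq dq).
  have cx := @hcontZ x p cp; have dx := @hdomZ x P p dp.
  have cy := @hcontZ y q cq; have dy := @hdomZ y Q q dq.
  by rewrite -(hintD cx dx cy dy) -(hintD (hcontD cx cy) (hdomD dx dy) cr dr).
apply: complexP; rewrite ?cReD ?cImD.
- rewrite cReM -mulNr -(lin2 _ _ _ _ _ _ _ _ c1 d1 c2 d2 c3 d3).
  by apply: hint_eq => t _; rewrite cReD cReM mulNr.
- rewrite cImM -(lin2 _ _ _ _ _ _ _ _ c2 d2 c1 d1 c4 d4).
  by apply: hint_eq => t _; rewrite cImD cImM.
Qed.

Lemma cint_bound f B : ccont f -> cdom B f -> nrm (cint f) <= 2 * B.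
Proof.
move=> [c1 c2] df; apply: le_trans (nrm_le _) _; rewrite mulr_natl mulr2n /=.
by rewrite lerD // hint_bound //; [exact: cdom_Re|exact: cdom_Im].
Qed.

Lemma cint_FTC f g B B' : ccont f -> cdom B f -> cdom B' g ->
  (forall t : R, 0 <= t -> rcder g t (f t)) -> cint f = - g 0.
Proof.
move=> [c1 c2] df dg gf; apply: complexP; rewrite ?cReN ?cImN /=.
  by apply: hint_FTC c1 (cdom_Re df) (cdom_Re dg) _ => t /gf[].
by apply: hint_FTC c2 (cdom_Im df) (cdom_Im dg) _ => t /gf[].
Qed.

Lemma cint_poisson f B K (e1 t0 : R) : 0 < t0 -> ccont f -> cdom B f -> 0 < e1 ->
  (forall e : R, 0 < e < e1 ->
     nrm (cint (fun t => (((t - t0) ^+ 2 + e ^+ 2)^-1)%:C * f t)) <= K) ->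
  f t0 = 0.
Proof.
move=> t00 [c1 c2] df e10 H.
have HN (g : R -> R) : hcont g -> hdom B g ->
    (forall e : R, 0 < e < e1 -> `|hint (fun t => g t / ((t - t0) ^+ 2 + e ^+ 2))| <= K) ->
    g t0 = 0.
  move=> cg dg Hg; apply: le_anti; rewrite (hint_poisson t00 cg dg e10 Hg) /=.
  rewrite -oppr_le0; apply: (@hint_poisson _ (fun t => - g t) B K e1 t0) => //.
  - by move=> t t0'; apply: (@continuousN _ R^o); exact: cg.
  - by move=> t /dg; rewrite normrN.
  - move=> e he; apply: le_trans (Hg e he); have /andP[e0 _] := he.
    have E : hint (fun t => - g t / ((t - t0) ^+ 2 + e ^+ 2)) =
        -1 * hint (fun t => g t / ((t - t0) ^+ 2 + e ^+ 2)).
      rewrite -(@hintZ _ _ _ (-1) (@poisson_hcont _ _ t0 _ e0 cg) (@poisson_hdom _ _ t0 _ _ e0 dg)).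
      by apply: hint_eq => t _; rewrite mulN1r mulNr.
    by rewrite E mulN1r normrN.
apply: complexP.
- apply: (HN (fun t => complex.Re (f t)) c1 (cdom_Re df)) => e he.
  apply: le_trans (H e he); apply: le_trans (nrm_Re _) => /=.
  by under [X in _ <= `|X|]hint_eq do rewrite cReZ mulrC.
- apply: (HN (fun t => complex.Im (f t)) c2 (cdom_Im df)) => e he.
  apply: le_trans (H e he); apply: le_trans (nrm_Im _) => /=.
  by under [X in _ <= `|X|]hint_eq do rewrite cImZ mulrC.
Qed.

Definition rhol e F := forall t : R, 0 <= t -> exists d, cder F (t%:C * e) d.
(** Decay faster than every exponential is stable under multiplication by [cexp (w * z)], so Laplace
    integrals converge for every [w]. *)
Definition rdecay e F := forall k : R, exists B : R, forall t : R, 0 <= t ->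
  nrm (F (t%:C * e)) <= B * expR (- (k * t)).
Definition rnice e F := rhol e F /\ rdecay e F.

Definition rint e F : C := e * cint (fun t => F (t%:C * e)).

Lemma rhol_ccont e F : rhol e F -> ccont (fun t => F (t%:C * e)).
Proof.
move=> hF; split=> t /hF[d dF]; have := @rcder_ray _ F 0 e t d; rewrite add0r => /(_ dF);
  rewrite (_ : (fun s : R => F (0 + s%:C * e)) = (fun s : R => F (s%:C * e)));
  try (by apply/funext => s; rewrite add0r);
  by case/rcder_cont.
Qed.

Lemma rdecay_cdom e F : rdecay e F -> exists B, cdom B (fun t => F (t%:C * e)).
Proof.
move=> /(_ 1)[B HB]; exists B => t /HB; by rewrite mul1r.
Qed.

Lemma rdecay_ge0 e F : rdecay e F -> forall k : R, exists2 B : R, 0 <= B &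
  forall t : R, 0 <= t -> nrm (F (t%:C * e)) <= B * expR (- (k * t)).
Proof.
move=> dF k; have [B HB] := dF k; exists B => //.
by have := le_trans (nrm_ge0 _) (HB 0 (lexx _)); rewrite mulr0 oppr0 expR0 mulr1.
Qed.

Lemma rnice_linear e k F G : rnice e F -> rnice e G ->
  rnice e (fun z => k * F z + G z).
Proof.
move=> [hF dF] [hG dG]; split=> [t t0|c].
  have [d1 D1] := hF t t0; have [d2 D2] := hG t t0.
  by exists (k * d1 + d2); apply: cderD D2; exact: cderZ.
have [B1 H1] := dF c; have [B2 H2] := dG c; exists (nrm k * B1 + B2) => t t0.
apply: le_trans (nrmD _ _) _; rewrite mulrDl lerD ?H2 //.
by rewrite nrmM -mulrA ler_wpM2l ?nrm_ge0 ?H1.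
Qed.

Lemma rnice0 e : rnice e (fun=> 0).
Proof.
split=> [t t0|k]; first by exists 0; exact: cder_cst.
by exists 0 => t t0; rewrite nrm0 mul0r.
Qed.

Lemma rnice_mul e F G (A c : R) : 0 <= A -> rnice e F -> rhol e G ->
  (forall t : R, 0 <= t -> nrm (G (t%:C * e)) <= A * expR (c * t)) ->
  rnice e (fun z => G z * F z).
Proof.
move=> A0 [hF dF] hG bG; split=> [t t0|k].
  have [d1 D1] := hF t t0; have [d2 D2] := hG t t0.
  by exists (d2 * F (t%:C * e) + G (t%:C * e) * d1); exact: cderM.
have [B B0 HB] := rdecay_ge0 dF (k + c); exists (A * B) => t t0.
rewrite nrmM; apply: le_trans (_ : A * expR (c * t) * (B * expR (- ((k + c) * t))) <= _).
  by apply: ler_pM; rewrite ?nrm_ge0 ?bG ?HB.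
rewrite mulrACA -expRD ler_wpM2l ?mulr_ge0 // ler_expR; lra.
Qed.

Lemma le_expR (x : R) : x <= expR x.
Proof. by apply: le_trans (expR_ge1Dx x); rewrite lerDr. Qed.

Variables (e : C) (e1 : nrm e = 1).

Lemma nrm_ray (t : R) : 0 <= t -> nrm (t%:C * e) = t.
Proof. by move=> t0; rewrite nrmM e1 nrmR mulr1 ger0_norm. Qed.

Lemma rnice_z F : rnice e F -> rnice e (fun z => z * F z).
Proof.
move=> nF; apply: (@rnice_mul e F id 1 1) => //.
  by move=> t t0; exists 1; exact: cder_id.
by move=> t t0; rewrite /= nrm_ray // !mul1r le_expR.
Qed.

Lemma nrm_cexp_ray w (t : R) : 0 <= t -> nrm (cexp (w * (t%:C * e))) <= expR (nrm w * t).
Proof.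
move=> t0; rewrite nrm_cexp ler_expR; apply: le_trans (ler_norm _) _.
by apply: le_trans (nrm_Re _) _; rewrite nrmM nrm_ray.
Qed.

Lemma rnice_cexp w F : rnice e F -> rnice e (fun z => cexp (w * z) * F z).
Proof.
move=> nF; apply: (@rnice_mul e F _ 1 (nrm w)) => //.
  by move=> t t0; eexists; exact: cder_cexpZ.
by move=> t t0; rewrite mul1r nrm_cexp_ray.
Qed.

Lemma rnice_cauchy zeta (d : R) F : 0 < d ->
  (forall t : R, 0 <= t -> d <= nrm (t%:C * e - zeta)) -> rnice e F ->
  rnice e (fun z => (z - zeta)^-1 * F z).
Proof.
move=> d0 dz nF; apply: (@rnice_mul e F _ d^-1 0) => //.
- by rewrite invr_ge0 ltW.
- move=> t t0; exists (-1 * (zeta - t%:C * e)^-1 ^+ 2); apply: cder_ext (_ : cder (fun z => -1 * (zeta - z)^-1) _ _).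
    by move=> z; rewrite mulN1r -invrN opprB.
  apply: cderZ; apply: cder_inv_sub.
  have := lt_le_trans d0 (dz t t0); rewrite nrm_gt0 subr_eq0 eq_sym //.
- move=> t t0; rewrite mul0r expR0 mulr1 nrmV lef_pV2 ?posrE ?dz //.
  exact: lt_le_trans d0 (dz t t0).
Qed.

Lemma rint_linear k F G : rnice e F -> rnice e G ->
  rint e (fun z => k * F z + G z) = k * rint e F + rint e G.
Proof.
move=> [hF dF] [hG dG].
have [B HB] := rdecay_cdom dF; have [B' HB'] := rdecay_cdom dG.
by rewrite /rint (cint_linear k (rhol_ccont hF) HB (rhol_ccont hG) HB'); ring.
Qed.

Lemma rint_bound F (B : R) : rnice e F ->
  (forall t : R, 0 <= t -> nrm (F (t%:C * e)) <= B * expR (- t)) ->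
  nrm (rint e F) <= 2 * B.
Proof.
by move=> [hF dF] dB; rewrite nrmM e1 mul1r cint_bound //; exact: rhol_ccont.
Qed.

Lemma rint_FTC F G : rnice e F -> rnice e G ->
  (forall t : R, 0 <= t -> cder G (t%:C * e) (F (t%:C * e))) -> rint e F = - G 0.
Proof.
move=> nF nG GF; have nF' : rnice e (fun z => e * F z).
  have := rnice_linear e nF (rnice0 e).
  by under eq_fun do rewrite addr0.
have [hF dF] := nF'; have [hG dG] := nG.
have [B HB] := rdecay_cdom dF; have [B' HB'] := rdecay_cdom dG.
have := cint_FTC (rhol_ccont hF) HB HB'; rewrite mul0r => <-; last first.
  move=> t /GF D; have := @rcder_ray _ G 0 e t (F (t%:C * e)).
  rewrite add0r => /(_ D).
  by under eq_fun do rewrite add0r.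
have [hF1 dF1] := nF; have [B1 HB1] := rdecay_cdom dF1.
have [h0 d0] := rnice0 e; have [B0 HB0] := rdecay_cdom d0.
have := cint_linear e (rhol_ccont hF1) HB1 (rhol_ccont h0) HB0.
have -> : cint (fun t : R => 0) = 0 :> C.
  have := @cint_bound (fun=> 0) 0; rewrite mulr0 => H.
  apply/eqP; rewrite -nrm_eq0 eq_le nrm_ge0 andbT; apply: H.
    exact: (rhol_ccont h0).
  by move=> t t0; rewrite nrm0 mul0r.
by rewrite /rint addr0 => <-; apply: cint_eq => t t0; rewrite addr0.
Qed.

(** Differentiation under the integral sign by a direct estimate: a quadratic remainder, uniform
    along the ray, is integrated. *)
Lemma rint_param (Phi : C -> C -> C) (Psi : C -> C) w (K r : R) : 0 < r ->
  (forall h, nrm h < r -> rnice e (Phi (w + h))) -> rnice e Psi ->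
  (forall h, nrm h < r -> forall t : R, 0 <= t ->
     nrm (Phi (w + h) (t%:C * e) - Phi w (t%:C * e) - h * Psi (t%:C * e)) <=
     K * nrm h ^+ 2 * expR (- t)) ->
  cder (fun x => rint e (Phi x)) w (rint e Psi).
Proof.
move=> r0 nPhi nPsi H; apply: (@cder_quad _ _ _ _ (2 * K) r) => // h hr.
have n0 : rnice e (Phi w) by rewrite -[w]addr0; apply: nPhi; rewrite nrm0.
have nh := nPhi h hr.
have nX := rnice_linear (- h) nPsi (rnice_linear (-1) n0 nh).
have -> : rint e (Phi (w + h)) - rint e (Phi w) - h * rint e Psi =
    rint e (fun z => - h * Psi z + (-1 * Phi w z + Phi (w + h) z)).
  by rewrite !rint_linear //; [ring|exact: rnice_linear].
rewrite -mulrA; apply: rint_bound nX _ => t t0.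
apply: le_trans (H h hr t t0); rewrite le_eqVlt; apply/orP; left.
by apply/eqP; congr nrm; ring.
Qed.

Lemma laplace_der F w : rnice e F ->
  cder (fun x => rint e (fun z => cexp (- (x * z)) * F z)) w
       (rint e (fun z => cexp (- (w * z)) * (- z * F z))).
Proof.
move=> nF.
(* Of this rate, [nrm w] pays for the exponential in [w], 3 for [t ^+ 2 * expR (nrm h * t)] with
   [nrm h < 1], and 1 is left for integrability. *)
have [B B0 HB] := rdecay_ge0 nF.2 (nrm w + 4).
have E x : (fun z => cexp (- (x * z)) * F z) = (fun z => cexp ((- x) * z) * F z).
  by apply/funext => z; rewrite mulNr.
apply: (@rint_param (fun x z => cexp (- (x * z)) * F z) _ w (4 * B) 1) => //.
- by move=> h _; rewrite E; exact: rnice_cexp.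
- have -> : (fun z => cexp (- (w * z)) * (- z * F z)) =
      (fun z => -1 * (cexp ((- w) * z) * (z * F z)) + 0).
    by apply/funext => z; rewrite (mulNr w); ring.
  apply: rnice_linear (rnice0 e); apply: rnice_cexp; exact: rnice_z.
- move=> h h1 t t0; set z := t%:C * e.
  have -> : cexp (- ((w + h) * z)) * F z - cexp (- (w * z)) * F z -
      h * (cexp (- (w * z)) * (- z * F z)) =
      cexp ((- w) * z) * ((cexp (- (h * z)) - 1 - - (h * z)) * F z).
    by rewrite mulrDl opprD cexpD (mulNr w); ring.
  rewrite !nrmM; have := cexp_sub2 (- (h * z)).
  rewrite nrmN nrmM [nrm z]nrm_ray // => b2.
  have b1 := nrm_cexp_ray (- w) t0; rewrite nrmN -/z in b1.
  have b3 := HB t t0; rewrite -/z in b3.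
  have b4 : 4 * ((nrm h * t) ^+ 2 * expR (nrm h * t)) <= 4 * nrm h ^+ 2 * expR (3 * t).
    have -> : 4 * ((nrm h * t) ^+ 2 * expR (nrm h * t)) =
        4 * nrm h ^+ 2 * (t ^+ 2 * expR (nrm h * t)) by ring.
    have -> : expR (3 * t) = expR t ^+ 2 * expR t.
      by rewrite expr2 -!expRD; congr expR; ring.
    apply: ler_wpM2l; first by rewrite mulr_ge0 ?sqr_ge0.
    apply: ler_pM; rewrite ?sqr_ge0 ?expR_ge0 //.
      by rewrite lerXn2r ?nnegrE ?expR_ge0 ?le_expR.
    by rewrite ler_expR ler_piMl // ltW.
  apply: le_trans (_ : expR (nrm w * t) * ((4 * nrm h ^+ 2 * expR (3 * t)) *
      (B * expR (- ((nrm w + 4) * t)))) <= _).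
    apply: ler_pM; rewrite ?nrm_ge0 ?mulr_ge0 ?nrm_ge0 //.
    by apply: ler_pM; rewrite ?nrm_ge0 // (le_trans b2).
  have -> : expR (nrm w * t) * (4 * nrm h ^+ 2 * expR (3 * t) *
      (B * expR (- ((nrm w + 4) * t)))) = 4 * B * nrm h ^+ 2 *
      (expR (nrm w * t) * expR (3 * t) * expR (- ((nrm w + 4) * t))) by ring.
  rewrite -!expRD; apply: ler_wpM2l; first by rewrite !mulr_ge0 ?nrm_ge0.
  by rewrite ler_expR; lra.
Qed.

Lemma cauchy_der F zeta (d : R) : 0 < d ->
  (forall t : R, 0 <= t -> d <= nrm (t%:C * e - zeta)) -> rnice e F ->
  cder (fun x => rint e (fun z => (z - x)^-1 * F z)) zeta
       (rint e (fun z => (z - zeta)^-1 * ((z - zeta)^-1 * F z))).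
Proof.
move=> d0 dz nF; have d20 : 0 < d / 2 by rewrite divr_gt0.
have dh h : nrm h < d / 2 -> forall t : R, 0 <= t -> d / 2 <= nrm (t%:C * e - (zeta + h)).
  move=> hd t t0; have := nrm_sub (t%:C * e - zeta) h; rewrite opprD addrA.
  apply: le_trans; rewrite lerBrDr; have := dz t t0; lra.
have [B B0 HB] := rdecay_ge0 nF.2 1.
apply: (@rint_param (fun x z => (z - x)^-1 * F z) _ zeta (2 * d^-1 ^+ 3 * B) (d / 2)) => //.
- by move=> h hd; apply: (rnice_cauchy d20) nF; exact: dh.
- by apply: (rnice_cauchy d0 dz); exact: rnice_cauchy dz nF.
- move=> h hd t t0; set z := t%:C * e.
  have z1 := lt_le_trans d0 (dz t t0); have z2 := lt_le_trans d20 (dh h hd t t0).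
  have z10 : z - zeta != 0 by rewrite -nrm_gt0.
  have z20 : z - (zeta + h) != 0 by rewrite -nrm_gt0.
  have -> : (z - (zeta + h))^-1 * F z - (z - zeta)^-1 * F z -
      h * ((z - zeta)^-1 * ((z - zeta)^-1 * F z)) =
      h ^+ 2 * ((z - zeta)^-1 ^+ 2 * (z - (zeta + h))^-1 * F z).
    by field; rewrite z10 z20.
  rewrite nrmM [nrm (h ^+ 2)]nrmX nrmM nrmM [nrm (_ ^+ 2)]nrmX !nrmV.
  have b := HB t t0; rewrite mul1r -/z in b.
  have -> : 2 * d^-1 ^+ 3 * B * nrm h ^+ 2 * expR (- t) =
    nrm h ^+ 2 * (d^-1 ^+ 2 * (d / 2)^-1 * (B * expR (- t))).
    by field; rewrite gt_eqF.
  rewrite ler_wpM2l ?sqr_ge0 // ler_pM ?nrm_ge0 ?mulr_ge0 ?sqr_ge0 ?invr_ge0 ?nrm_ge0 //.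
  rewrite ler_pM ?sqr_ge0 ?invr_ge0 ?nrm_ge0 //.
    by rewrite lerXn2r ?nnegrE ?invr_ge0 ?nrm_ge0 ?(ltW d0) // lef_pV2 ?posrE ?dz.
  by rewrite lef_pV2 ?posrE ?dh.
Qed.

End RayIntegral.

Section CauchyJump.
Variable R : realType.
Local Notation C := R[i].
Implicit Types (F : C -> C).
Variables (e : C) (e1 : nrm e = 1).

(** The difference of the Cauchy kernels at the two points is, up to the unit factor [e],
    [2 * eps * 'i] times the kernel of [cint_poisson]. A jump of order [eps] therefore bounds the
    Poisson integrals, which forces the vanishing. This plays the role of the Plemelj formula. *)
Lemma cauchy_jump F (t0 K r : R) : 0 < t0 -> 0 < r -> rnice e F ->
  (forall eps : R, 0 < eps < r ->
    nrm (rint e (fun z => (z - (t0 +i* eps) * e)^-1 * F z) -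
         rint e (fun z => (z - (t0 -i* eps) * e)^-1 * F z)) <= K * eps) ->
  F (t0%:C * e) = 0.
Proof.
move=> t00 r0 nF H.
have [hF dF] := nF; have [B HB] := rdecay_cdom dF.
apply: (@cint_poisson _ (fun t => F (t%:C * e)) B (K / 2) r t0) => //.
  exact: rhol_ccont.
move=> eps he; have /andP[eps0 _] := he.
have e0 : e != 0 by rewrite -nrm_gt0 e1.
have den (t : R) : (t - t0) ^+ 2 + eps ^+ 2 != 0.
  by rewrite gt_eqF // ltr_wpDl ?sqr_ge0 // exprn_gt0.
have dz (s : R) : `|s| = eps -> forall t : R, 0 <= t ->
    eps <= nrm (t%:C * e - (t0 +i* s) * e).
  move=> se t tt; rewrite -mulrBl nrmM e1 mulr1 -se.
  by apply: le_trans (nrm_Im _); rewrite /= sub0r normrN.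
have s1 : `|eps| = eps by rewrite gtr0_norm.
have s2 : `|- eps| = eps by rewrite normrN gtr0_norm.
have n1 := rnice_cauchy eps0 (dz _ s1) nF.
have n2 := rnice_cauchy eps0 (dz _ s2) nF.
have := H eps he.
have -> : rint e (fun z => (z - (t0 +i* eps) * e)^-1 * F z) -
         rint e (fun z => (z - (t0 -i* eps) * e)^-1 * F z) =
    (2 * eps)%:C * 'i%C * cint (fun t => (((t - t0) ^+ 2 + eps ^+ 2)^-1)%:C * F (t%:C * e)).
  have i0 : (2 * eps)%:C * 'i%C != 0 :> C.
    by rewrite -nrm_gt0 nrmM nrmR nrmE /= expr0n add0r expr1n sqrtr1 mulr1 normr_gt0 mulf_neq0 ?gt_eqF.
  rewrite addrC -mulN1r -(rint_linear _ n2 n1).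
  set X := fun z => _ + _; have nX : rnice e X := rnice_linear (-1) n2 n1.
  have r00 : rint e (fun=> 0) = 0.
    apply/eqP; rewrite -nrm_eq0 eq_le nrm_ge0 andbT -[leRHS](mulr0 2).
    by apply: (rint_bound e1 (rnice0 e)) => t _; rewrite nrm0 mul0r.
  have := rint_linear (((2 * eps)%:C * 'i%C)^-1 * e) nX (rnice0 e).
  rewrite r00 addr0 => E.
  have {}E : e * cint (fun t => (((t - t0) ^+ 2 + eps ^+ 2)^-1)%:C * F (t%:C * e)) =
      ((2 * eps)%:C * 'i%C)^-1 * e * rint e X.
    rewrite -E; congr (_ * _); apply: cint_eq => t tt; rewrite addr0 /X.
    have c0 (s : R) : `|s| = eps -> t%:C * e - (t0 +i* s) * e != 0.
      by move=> se; rewrite -nrm_gt0 (lt_le_trans eps0) // dz.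
    have := c0 _ s1; have := c0 _ s2; rewrite -!mulrBl => c1 c2.
    have cc1 : t%:C - (t0 +i* eps) != 0 by apply: contraNneq c2 => ->; rewrite mul0r.
    have cc2 : t%:C - (t0 -i* eps) != 0 by apply: contraNneq c1 => ->; rewrite mul0r.
    have -> : (((t - t0) ^+ 2 + eps ^+ 2)^-1)%:C =
        ((t%:C - (t0 +i* eps)) * (t%:C - (t0 -i* eps)))^-1 :> C.
      rewrite fmorphV; congr (_^-1); by apply: complexP; rewrite ?cReM ?cImM /=; ring.
    have -> : (2 * eps)%:C * 'i%C = (t%:C - (t0 -i* eps)) - (t%:C - (t0 +i* eps)) :> C.
      by apply: complexP; rewrite ?cReM ?cImM /=; ring.
    have : (t%:C - (t0 -i* eps)) - (t%:C - (t0 +i* eps)) != 0 :> C.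
      apply: contraNneq i0 => h; apply/eqP; rewrite -h.
      by apply: complexP; rewrite ?cReM ?cImM /=; ring.
    move: (t%:C - (t0 -i* eps)) (t%:C - (t0 +i* eps)) cc1 cc2 => P Q Q0 P0 PQ.
    by field; rewrite P0 Q0 PQ e0.
  apply: (mulfI e0); rewrite [RHS]mulrCA E.
  by rewrite -mulrA [RHS]mulrA mulfV // mul1r.
rewrite !nrmM nrmR [nrm 'i%C]nrmE /= expr0n add0r expr1n sqrtr1 mulr1.
rewrite ger0_norm ?mulr_ge0 ?(ltW eps0) // => h.
rewrite ler_pdivlMr //; rewrite -(ler_pM2r eps0); apply: le_trans h.
by rewrite le_eqVlt; apply/orP; left; apply/eqP; ring.
Qed.

End CauchyJump.

(** * Solutions and their Wronskian *)

Section LocalSolutions.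
Variable R : realType.
Local Notation C := R[i].
Implicit Types (E : weyl_module R) (D : C -> Prop).

(** [D] is everything for entire solutions and a sector for Cauchy integrals, whose values off the
    sector are not constrained. *)
Definition lsol E D (g : E -> C -> C) : Prop :=
  [/\ forall k m m' x, D x -> g (k *: m + m') x = k * g m x + g m' x,
      forall m x, D x -> g (wm_z m) x = x * g m x
    & forall m x, D x -> cder (g m) x (g (wm_d m) x)].

Lemma solution_lsol E u : @solution R E u -> lsol (fun=> True) u.
Proof.
by move=> [u1 u2 u3]; split=> [k m m' x _|m x _|m x _];
  [exact: u1|exact: u2|apply/cderP; exact: u3].
Qed.

Lemma lsol_solution E u : lsol (fun=> True) u -> @solution R E u.
Proof.
by move=> [u1 u2 u3]; split=> [k m m' x|m x|m x];
  [exact: u1|exact: u2|apply/cderP; exact: u3].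
Qed.

Lemma lsol_sub E D D' (g : E -> C -> C) : (forall x, D' x -> D x) -> lsol D g -> lsol D' g.
Proof.
by move=> DD [g1 g2 g3]; split=> *; [apply: g1|apply: g2|apply: g3]; exact: DD.
Qed.

Section Basis.
Variables (E : weyl_module R) (n : nat) (e : 'I_n -> E).
Hypothesis eP : wm_basis e.

Lemma lsol0 D g x : lsol (E := E) D g -> D x -> g 0 x = 0.
Proof.
by move=> [g1 _ _] Dx; have := g1 (-1) 0 0 x Dx; rewrite scaler0 addr0 mulN1r addNr.
Qed.

Lemma lsol_sum D g x (I : Type) (s : seq I) (F : I -> E) : lsol D g -> D x ->
  g (\sum_(i <- s) F i) x = \sum_(i <- s) g (F i) x.
Proof.
move=> lg Dx; have [g1 _ _] := lg; elim: s => [|i s IH].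
  by rewrite !big_nil (lsol0 lg Dx).
by rewrite !big_cons -[F i]scale1r g1 // mul1r IH scale1r.
Qed.

Lemma lsolZ D g x k (m : E) : lsol D g -> D x -> g (k *: m) x = k * g m x.
Proof.
by move=> lg Dx; have [g1 _ _] := lg; rewrite -[_ *: _]addr0 g1 // (lsol0 lg Dx) addr0.
Qed.

Lemma lsol_poly D g x p (m : E) : lsol D g -> D x -> g (wm_poly p m) x = p.[x] * g m x.
Proof.
move=> lg Dx; rewrite /wm_poly (lsol_sum _ _ lg Dx) horner_coef mulr_suml.
apply: eq_bigr => k _; rewrite (lsolZ _ _ lg Dx) -mulrA; congr (_ * _).
have [_ g2 _] := lg; elim: (k : nat) => [|j IH]; first by rewrite mul1r.
by rewrite iterS g2 // IH exprS mulrA.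
Qed.

Lemma lsol_basis D g : lsol D g -> (forall j x, D x -> g (e j) x = 0) ->
  forall m x, D x -> g m x = 0.
Proof.
move=> lg g0 m x Dx; have [p [-> _]] := eP m.
rewrite (lsol_sum _ _ lg Dx) big1 // => j _.
by rewrite (lsol_poly _ _ lg Dx) g0 // mulr0.
Qed.

Definition conn : 'I_n -> {ffun 'I_n -> {poly C}} :=
  fun j => projT1 (cid (eP (wm_d (e j)))).

Lemma connE j : wm_d (e j) = \sum_k wm_poly (conn j k) (e k).
Proof. by rewrite /conn; case: cid => p /= [-> _]. Qed.

Lemma lsol_conn D g j x : lsol D g -> D x ->
  g (wm_d (e j)) x = \sum_k (conn j k).[x] * g (e k) x.
Proof.
move=> lg Dx; rewrite connE (lsol_sum _ _ lg Dx); apply: eq_bigr => k _.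
by rewrite (lsol_poly _ _ lg Dx).
Qed.

Definition wronskian (u : 'I_n -> E -> C -> C) (x : C) : C :=
  \det (\matrix_(i, j) u i (e j) x).

Lemma wronskian_der D u x : (forall i, lsol D (u i)) -> D x ->
  cder (wronskian u) x ((\sum_j (conn j j).[x]) * wronskian u x).
Proof.
move=> lu Dx.
pose A := (\matrix_(j, k) (conn j k).[x])^T : 'M[C]_n.
have -> : \sum_j (conn j j).[x] = \tr A by apply: eq_bigr => j _; rewrite !mxE.
apply: (@cder_det _ _ _ (\matrix_(i, j) u i (wm_d (e j)) x)).
  move=> i j; rewrite mxE; have [_ _ g3] := lu i.
  by apply: cder_ext (g3 _ _ Dx) => y; rewrite mxE.
apply/matrixP => i j; rewrite !mxE (lsol_conn _ (lu i) Dx).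
by apply: eq_bigr => k _; rewrite !mxE mulrC.
Qed.

(** Liouville's formula: the logarithmic derivative of the Wronskian is the trace of [conn], here
    the derivative of [sg * x ^+ b]. Convexity of [D] allows integration along the segment from [x]
    to [y]. *)
Lemma wronskian_exp D u (sg : C) (b : nat) :
  (forall x y (s : R), 0 <= s <= 1 -> D x -> D y -> D (x + s%:C * (y - x))) ->
  (forall x, \sum_j (conn j j).[x] = sg * (b%:R * x ^+ b.-1)) ->
  (forall i, lsol D (u i)) ->
  forall x y, D x -> D y ->
  wronskian u x * cexp (- (sg * x ^+ b)) = wronskian u y * cexp (- (sg * y ^+ b)).
Proof.
move=> cD trE lu x y Dx Dy.
apply: (@cder0_cst _ (fun x => wronskian u x * cexp (- (sg * x ^+ b)))) => s s01.
have Dz := cD _ _ _ s01 Dx Dy; move: (x + _) Dz => z Dz.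
have d1 := wronskian_der lu Dz.
have d2 : cder (fun x => cexp (- (sg * x ^+ b))) z
    ((- sg * (b%:R * z ^+ b.-1)) * cexp (- (sg * z ^+ b))).
  apply: (cder_comp (cder_cexp _)).
  apply: cder_ext (cderZ (- sg) (cder_exprn b z)) => w.
  by rewrite mulNr.
have := cderM d1 d2; congr (cder _ _ _); rewrite trE; ring.
Qed.

(* Gronwall's inequality on the segment from x0 to x1. *)
Lemma lsol_uniq g x0 : lsol (fun=> True) g -> (forall j, g (e j) x0 = 0) ->
  forall m x, g m x = 0.
Proof.
move=> lg g0 m x; apply: (lsol_basis lg) => // j {m} x1 _.
set d := x1 - x0.
pose y (k : 'I_n) (s : R) := g (e k) (x0 + s%:C * d).
pose y' (k : 'I_n) (s : R) := d * g (wm_d (e k)) (x0 + s%:C * d).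
have yD k s : rcder (y k) s (y' k s).
  by apply: rcder_ray; have [_ _ g3] := lg; exact: g3.
(* A common bound for all connection coefficients on the segment, where the modulus is at most
   [nrm x0 + nrm d]. *)
pose M := \sum_j \sum_k \sum_(l < size (conn j k)) nrm (conn j k)`_l * (nrm x0 + nrm d) ^+ l.
have M0 : 0 <= M.
  do 3!(apply: sumr_ge0 => ? _); rewrite mulr_ge0 ?nrm_ge0 // exprn_ge0 //.
  by rewrite addr_ge0 ?nrm_ge0.
have AM i k (s : R) : 0 <= s <= 1 -> nrm (conn i k).[x0 + s%:C * d] <= M.
  move=> /andP[s0 s1]; rewrite horner_coef; apply: le_trans (nrm_sum _ _ _) _.
  apply: (@le_trans _ _ (\sum_(l < size (conn i k)) nrm (conn i k)`_l * (nrm x0 + nrm d) ^+ l)).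
    apply: ler_sum => l _; rewrite nrmM nrmX ler_wpM2l ?nrm_ge0 //.
    rewrite lerXn2r ?nnegrE ?nrm_ge0 ?addr_ge0 ?nrm_ge0 //.
    apply: le_trans (nrmD _ _) _; rewrite lerD2l nrmM nrmR ger0_norm //.
    by rewrite ler_piMl ?nrm_ge0.
  rewrite /M (bigD1 i) //= (bigD1 k) //= -addrA lerDl addr_ge0 //;
    do ?[apply: sumr_ge0 => ? _]; rewrite mulr_ge0 ?nrm_ge0 // exprn_ge0 //;
    by rewrite addr_ge0 ?nrm_ge0.
clearbody M.
pose N (s : R) := \sum_k ((complex.Re (y k s)) ^+ 2 + (complex.Im (y k s)) ^+ 2).
pose N' (s : R) := \sum_k 2 * (complex.Re (y k s) * complex.Re (y' k s) +
   complex.Im (y k s) * complex.Im (y' k s)).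
have sq z : complex.Re z ^+ 2 + complex.Im z ^+ 2 = nrm z ^+ 2 :> R.
  by rewrite nrmE sqr_sqrtr // addr_ge0 ?sqr_ge0.
have ND (s : R) : is_derive s 1 N (N' s).
  rewrite /N /N'; have H k : is_derive s 1
     (fun s => (complex.Re (y k s)) ^+ 2 + (complex.Im (y k s)) ^+ 2)
     (2 * (complex.Re (y k s) * complex.Re (y' k s) + complex.Im (y k s) * complex.Im (y' k s))).
    have [d1 d2] := yD k s.
    by apply: is_derive_eq; rewrite /GRing.scale /=; ring.
  have := @is_derive_sum _ _ _ n _ s 1 _ H.
  by rewrite fct_sumE.
(* With this constant Cauchy-Schwarz and [2 u v <= u^2 + v^2] give [N' <= K N], so that
   [N s * expR (- (K * s))] does not increase from its value 0 at 0. *)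
pose K := 2 * (nrm d * M * n%:R).
have NK (s : R) : 0 <= s <= 1 -> N' s <= K * N s.
  move=> s01.
  have y'b k : nrm (y' k s) <= nrm d * M * \sum_l nrm (y l s).
    rewrite /y' nrmM -mulrA ler_wpM2l ?nrm_ge0 // (lsol_conn _ lg) //.
    apply: le_trans (nrm_sum _ _ _) _; rewrite mulr_sumr ler_sum // => l _.
    by rewrite nrmM ler_wpM2r ?nrm_ge0 // AM.
  have cs (z w : C) : complex.Re z * complex.Re w + complex.Im z * complex.Im w <= nrm z * nrm w.
    have -> : complex.Re z * complex.Re w + complex.Im z * complex.Im w =
        complex.Re (z * w^*) by case: z w => z1 z2 [w1 w2] /=; ring.
    apply: le_trans (ler_norm _) _; apply: le_trans (nrm_Re _) _.
    have -> : nrm (z * w^*) = nrm z * nrm w.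
      by rewrite nrmM; congr (_ * _); rewrite !nrmE; case: w => w1 w2 /=; rewrite sqrrN.
    exact: lexx.
  have c0 : 0 <= nrm d * M by rewrite mulr_ge0 ?nrm_ge0.
  apply: (@le_trans _ _ (\sum_k \sum_l nrm d * M * (nrm (y k s) ^+ 2 + nrm (y l s) ^+ 2))).
    rewrite /N' ler_sum // => k _.
    apply: le_trans (_ : 2 * (nrm (y k s) * (nrm d * M * \sum_l nrm (y l s))) <= _).
      rewrite ler_wpM2l //; apply: le_trans (cs _ _) _.
      by rewrite ler_wpM2l ?nrm_ge0.
    rewrite !mulr_sumr ler_sum // => l _.
    rewrite [leLHS](_ : _ = nrm d * M * (2 * (nrm (y k s) * nrm (y l s)))); last by ring.
    rewrite ler_wpM2l //; have := sqr_ge0 (nrm (y k s) - nrm (y l s)); lra.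
  under eq_bigr do rewrite -mulr_sumr big_split /= sumr_const card_ord.
  rewrite -mulr_sumr big_split /= sumr_const card_ord.
  under eq_bigr do rewrite -mulr_natr.
  rewrite -mulr_suml /K /N; under [X in _ <= _ * X]eq_bigr do rewrite sq.
  by rewrite -[_ *+ n]mulr_natr le_eqVlt; apply/orP; left; apply/eqP; ring.
have N0 : N 0 = 0.
  rewrite /N big1 // => k _; rewrite sq /y rmorph0 mul0r addr0 g0 nrm0 expr0n //.
have N1 : N 1 <= 0.
  pose f (s : R) := N s * expR (- (K * s)).
  have fD (s : R) : is_derive s 1 f ((N' s - K * N s) * expR (- (K * s))).
    have Ns := ND s; apply: is_derive_eq; rewrite /GRing.scale /=; ring.
  have := @ler0_derive1_nincr R f 0 1 _ _ _ 0 1 (lexx _) ler01 (lexx _).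
  rewrite /f N0 mul0r => H; have : N 1 * expR (- (K * 1)) <= 0.
    apply: H => [s _|s|].
    - by have [] := fD s.
    - rewrite in_itv /= => /andP[s0 s1]; rewrite derive1E; have [_ ->] := fD s.
      by rewrite mulr_le0_ge0 ?expR_ge0 // subr_le0 NK // !ltW.
    - by apply: derivable_within_continuous => s _; have [] := fD s.
  by rewrite pmulr_lle0 ?expR_gt0.
have : nrm (y j 1) ^+ 2 <= 0.
  apply: le_trans N1; rewrite /N (bigD1 j) //= sq lerDl sumr_ge0 // => k _.
  by rewrite addr_ge0 ?sqr_ge0.
move=> y0; have : nrm (y j 1) ^+ 2 == 0 by rewrite eq_le y0 sqr_ge0.
rewrite sqrf_eq0.
by rewrite nrm_eq0 /y rmorph1 mul1r addrC subrK => /eqP.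
Qed.

End Basis.
End LocalSolutions.

(** * Stokes filtrations *)

Section IntegerWindows.
Variable r : nat.
Hypothesis r0 : (0 < r)%N.
Implicit Types i j l : int.

Definition ieq i j : bool := (i == j %[mod r%:Z])%Z.

Lemma ieqP i j : reflect (exists q, i = j + q * r%:Z) (ieq i j).
Proof.
rewrite /ieq eqz_mod_dvd; apply: (iffP dvdzP) => [[q E]|[q ->]]; exists q.
  by rewrite -E addrC subrK.
by rewrite addrC addKr.
Qed.

Lemma ieq_refl i : ieq i i. Proof. by rewrite /ieq. Qed.
Lemma ieq_sym i j : ieq i j = ieq j i. Proof. by rewrite /ieq eq_sym. Qed.
Lemma ieq_trans i j l : ieq i j -> ieq j l -> ieq i l.
Proof. by rewrite /ieq => /eqP ->. Qed.

Lemma window_or i j : exists2 s, (s < r)%N & ieq i (j + s%:Z).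
Proof.
have rz : r%:Z != 0 by lia.
exists `|((i - j) %% r)%Z|%N.
  have := ltz_pmod (i - j) (d := r%:Z); have := modz_ge0 (i - j) rz; lia.
apply/ieqP; exists ((i - j) %/ r)%Z.
by have := divz_eq (i - j) r%:Z; have := modz_ge0 (i - j) rz; lia.
Qed.

Lemma ieq_window j s s' : (s < r)%N -> (s' < r)%N ->
  ieq (j + s%:Z) (j + s'%:Z) -> s = s'.
Proof.
move=> sr sr' /ieqP[q E]; have {}E : s%:Z = s'%:Z + q * r%:Z by lia.
have [|q0|q0] := ltgtP q 0; [nia|nia|lia].
Qed.

End IntegerWindows.

Section CosineOrder.
Variable R : realType.
Implicit Types (x y : R) (i j l : int).

Lemma cosD2piz x (q : int) : cos (x + 2 * pi * q%:~R) = cos x.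
Proof.
have H n z : cos (z + 2 * pi * n%:R) = cos z :> R.
  elim: n z => [|n IH] z; first by rewrite mulr0 addr0.
  have -> : z + 2 * pi * n.+1%:R = (z + 2 * pi * n%:R) + pi *+ 2.
    by rewrite -[n.+1]addn1 natrD; ring.
  by rewrite cosD2pi IH.
case: q => n; first exact: H.
by rewrite NegzE -[LHS](H n.+1); congr cos; rewrite mulrNz mulrN; apply: subrK.
Qed.

Lemma cos_gap (k a b : R) : 0 < k <= pi -> `|a| < k -> k < b < 2 * pi - k ->
  cos b < cos a.
Proof.
move=> /andP[k0 kpi] ak /andP[kb b2]; have p0 := pi_gt0 R.
have -> : cos a = cos `|a| by rewrite cos_norm.
have ka : cos k < cos `|a|.
  rewrite ltr_cos ?in_itv /= ?normr_ge0 ?(ltW k0) //=.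
  by apply: ltW; apply: lt_le_trans ak _.
apply: lt_trans ka; have [bp|pb] := leP b pi.
  by rewrite ltr_cos ?in_itv /= ?bp ?kpi ?(ltW k0) ?andbT //=; apply: ltW; exact: lt_trans kb.
have -> : cos b = cos (2 * pi - b).
  by rewrite -[LHS]cosN -(cosD2piz (- b) 1); congr cos; ring.
by rewrite ltr_cos ?in_itv /=; lra.
Qed.

Variable r : nat.
Hypothesis r0 : (0 < r)%N.
Let rR : 0 < r%:R :> R. Proof. by rewrite ltr0n. Qed.

(** Real part of an exponential factor at modulus 1, in a coordinate [y] on directions normalised so
    that index [i] is lowest at [y = i]; the change of coordinate is [dir]. *)
Definition sval y i : R := - cos (2 * pi * (i%:~R - y) / r%:R).
Definition slt y i j : bool := sval y i < sval y j.
Definition sns y : Prop := forall i j, [|| ieq r i j, slt y i j | slt y j i].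

Lemma sval_ieq y i j : ieq r i j -> sval y i = sval y j.
Proof.
move=> /ieqP[q ->]; congr (- _); rewrite -[RHS](cosD2piz _ q); congr cos.
by rewrite intrD intrM; field; rewrite gt_eqF.
Qed.

Lemma slt_ieq y i j i' j' : ieq r i i' -> ieq r j j' -> slt y i j = slt y i' j'.
Proof. by move=> /sval_ieq E /sval_ieq E'; rewrite /slt E E'. Qed.

(** Midpoint of the indices from [j] to [j + k - 1]. When [y] is within 1/2 of it, these are the [k]
    integers nearest to [y]. *)
Definition center j (k : nat) : R := j%:~R + (k%:R - 1) / 2.

(** [sval] increases with the distance from [y] to the class of the index modulo [r]. This distance
    is below [k / 2] inside the window and above [k / 2] outside, which is the situation of
    [cos_gap]. *)
Lemma slt_window y j k s i : (k <= r)%N -> `|y - center j k| < 2^-1 -> (s < k)%N ->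
  (forall s', (s' < k)%N -> ~~ ieq r i (j + s'%:Z)) -> slt y (j + s%:Z) i.
Proof.
move=> kr yc sk ni; have [q qr iq] := window_or r0 i j.
have kq : (k <= q)%N by rewrite leqNgt; apply/negP => /ni; rewrite iq.
rewrite (slt_ieq y (ieq_refl r _) iq) /slt ltrN2.
have p0 := pi_gt0 R.
have sk' : s%:R + 1 <= k%:R :> R by rewrite natr1 ler_nat.
have kq' : k%:R <= q%:R :> R by rewrite ler_nat.
have qr' : q%:R + 1 <= r%:R :> R by rewrite natr1 ler_nat.
have s0 : 0 <= s%:R :> R by [].
have k0 : 0 < k%:R :> R by rewrite ltr0n; lia.
have kr' : k%:R <= r%:R :> R by rewrite ler_nat.
move: yc; rewrite /center ltr_norml => /andP[y1 y2].
have E (n : nat) : 2 * pi * ((j + n%:Z)%:~R - y) / r%:R =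
    pi / r%:R * (2 * (j%:~R + n%:R - y)) :> R.
  by rewrite intrD; ring.
rewrite !E; have pr0 : 0 < pi / r%:R :> R by rewrite divr_gt0.
have E2 : 2 * pi = pi / r%:R * (2 * r%:R) :> R by field; rewrite gt_eqF.
apply: (@cos_gap (pi / r%:R * k%:R)).
- apply/andP; split; first exact: mulr_gt0.
  by rewrite mulrAC ler_pdivrMr // ler_pM2l.
- by rewrite normrM (gtr0_norm pr0) ltr_pM2l // ltr_norml; apply/andP; split; lra.
- by rewrite E2 -mulrBr !ltr_pM2l //; apply/andP; split; lra.
Qed.

Lemma sval_sym y i j : i%:~R + j%:~R = 2 * y -> sval y i = sval y j.
Proof.
move=> E; congr (- _); rewrite -cosN; congr cos.
have -> : i%:~R - y = - (j%:~R - y) :> R by lra.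
by ring.
Qed.

Lemma center_exists y k : (forall n : int, 2 * y != n%:~R) ->
  exists j, `|y - center j k| < 2^-1.
Proof.
move=> ny; set z := y - (k%:R - 1) / 2 + 2^-1; exists (Num.floor z).
have := floor_le_tmp z; have := floorD1_gt z; rewrite intrD /center => z1 z2.
have : (Num.floor z)%:~R != z.
  apply: contraNneq (ny (2 * Num.floor z + k%:Z - 2)) => E.
  by rewrite !(intrD, intrM, mulrNz) E /z; apply/eqP; rewrite -[k%:~R]/(k%:R); field.
rewrite neq_lt => /orP[z3|]; last by rewrite ltNge z2.
by rewrite ltr_norml; move: z1 z2 z3; rewrite /z; lra.
Qed.

Lemma center_nested y k j j' : `|y - center j k.+1| < 2^-1 ->
  `|y - center j' k| < 2^-1 -> j' = j \/ j' = j + 1.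
Proof.
rewrite /center -natr1 !ltr_norml => /andP[h1 h2] /andP[h3 h4].
have : (j - 1)%:~R < j'%:~R :> R by rewrite intrD mulrNz; lra.
have : j'%:~R < (j + 2)%:~R :> R by rewrite intrD; lra.
rewrite !ltr_int; lia.
Qed.

(** Two classes can tie only when [y] is halfway between representatives, so that [2 * y] is an
    integer. Otherwise the smallest window meeting either class meets just one of them, and that one
    is lower. *)
Lemma sns_dense y : (forall n : int, 2 * y != n%:~R) -> sns y.
Proof.
move=> ny i j; have [//|nij] := boolP (ieq r i j) => /=.
pose Pk k := exists2 l, `|y - center l k| < 2^-1 &
  exists2 s, (s < k)%N & ieq r i (l + s%:Z) || ieq r j (l + s%:Z).
have ex : exists k, `[< Pk k >].
  exists r; apply/asboolP; have [l ly] := center_exists r ny; exists l => //.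
  by have [s sr si] := window_or r0 i l; exists s => //; rewrite si.
case: (ex_minnP ex) => k /asboolP[l ly [s sk /orP si]] kmin.
have kr : (k <= r)%N.
  apply: kmin; apply/asboolP; have [l' ly'] := center_exists r ny; exists l' => //.
  by have [s' sr' si'] := window_or r0 i l'; exists s' => //; rewrite si'.
case: k => // k in sk ly kmin kr *.
have [l' ly'] := center_exists k ny.
have ll := center_nested ly ly'.
(* If the classes met the window at two different places, one of them would survive in the nested
   window of length [k], against minimality. *)
have nk i1 j1 s1 s2 : i1 = i \/ i1 = j -> j1 = i \/ j1 = j -> (s1 < k.+1)%N -> (s2 < k.+1)%N ->
    ieq r i1 (l + s1%:Z) -> ieq r j1 (l + s2%:Z) -> s1 = s2.
  move=> hi hj s1k s2k e1 e2; apply/eqP; apply: contraT => ns.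
  suff /kmin : `[< Pk k >] by rewrite ltnn.
  apply/asboolP; exists l' => //.
  have P1 (u : nat) (x : int) : x = i \/ x = j -> (u < k)%N -> ieq r x (l' + u%:Z) -> exists2 s, (s < k)%N &
     ieq r i (l' + s%:Z) || ieq r j (l' + s%:Z).
    by move=> [->|->] uk h; exists u; rewrite // h ?orbT.
  case: ll => E.
    have [|] := ltnP s1 k => h; first by apply: P1 hi h _; rewrite E.
    by apply: (P1 s2 j1) => //; [lia|rewrite E].
  have [|] := posnP s1 => h.
    apply: (P1 s2.-1 j1) => //; [lia|rewrite E].
    by rewrite (_ : l + 1 + _ = l + s2%:Z) //; lia.
  apply: (P1 s1.-1 i1) => //; [lia|rewrite E].
  by rewrite (_ : l + 1 + _ = l + s1%:Z) //; lia.
case: si => si.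
- rewrite (slt_ieq y si (ieq_refl r j)) (slt_window kr ly sk) // => s' s'k.
  apply/negP => e; have E := nk i j s s' (or_introl erefl) (or_intror erefl) sk s'k si e.
  by move/negP: nij; apply; apply: ieq_trans si _; rewrite E ieq_sym.
- rewrite (slt_ieq y si (ieq_refl r i)) (slt_window kr ly sk) ?orbT // => s' s'k.
  apply/negP => e; have E := nk i j s' s (or_introl erefl) (or_intror erefl) s'k sk e si.
  by move/negP: nij; apply; apply: ieq_trans e _; rewrite E ieq_sym.
Qed.

Lemma sns_near y (d : R) : 0 < d -> exists2 y', y < y' < y + d & sns y'.
Proof.
move=> d0; set z := Num.floor (2 * y).
have z1 := floor_le_tmp (2 * y); have z2 := floorD1_gt (2 * y).
rewrite intrD -/z in z1 z2.
pose m := Num.min d (((z + 1)%:~R - 2 * y) / 2).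
have m0 : 0 < m by rewrite lt_min d0 /= intrD; lra.
have md : m <= d by rewrite ge_min lexx.
have mz : m <= ((z + 1)%:~R - 2 * y) / 2 by rewrite ge_min lexx orbT.
rewrite intrD in mz.
exists (y + m / 2); first by apply/andP; split; lra.
apply: sns_dense => n; apply/eqP => E.
have : z%:~R < n%:~R :> R by rewrite -E; lra.
have : n%:~R < (z + 1)%:~R :> R by rewrite -E intrD; lra.
rewrite !ltr_int; lia.
Qed.

Lemma sns_near_left y (d : R) : 0 < d -> exists2 y', y - d < y' < y & sns y'.
Proof.
move=> d0; set z := Num.ceil (2 * y).
have z1 := ceil_ge (2 * y); have z2 := ceilB1_lt (2 * y).
rewrite intrB -/z in z1 z2.
pose m := Num.min d ((2 * y - (z - 1)%:~R) / 2).
have m0 : 0 < m by rewrite lt_min d0 /= intrB; lra.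
have md : m <= d by rewrite ge_min lexx.
have mz : m <= (2 * y - (z - 1)%:~R) / 2 by rewrite ge_min lexx orbT.
rewrite intrB in mz.
exists (y - m / 2); first by apply/andP; split; lra.
apply: sns_dense => n; apply/eqP => E.
have : (z - 1)%:~R < n%:~R :> R by rewrite -E intrB; lra.
have : n%:~R < z%:~R :> R by rewrite -E; lra.
rewrite !ltr_int; lia.
Qed.

End CosineOrder.

Section Windows.
Variables (K : fieldType) (V : vectType K).
Implicit Types (j : int) (k : nat).

Definition window (G : int -> {vspace V}) j k : {vspace V} :=
  (\sum_(s < k) G (j + (s : nat)%:Z)%R)%VS.

Lemma windowSr G j k : window G j k.+1 = (window G j k + G (j + k%:Z)%R)%VS.
Proof. by rewrite /window big_ord_recr. Qed.

Lemma windowSl G j k : window G j k.+1 = (G j + window G (j + 1)%R k)%VS.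
Proof.
rewrite /window big_ord_recl addr0; congr (_ + _)%VS; apply: eq_bigr => s _.
by congr (G _); rewrite lift0; lia.
Qed.

Lemma windowP G j k (U : {vspace V}) :
  (forall s, (s < k)%N -> (G (j + s%:Z)%R <= U)%VS) -> (window G j k <= U)%VS.
Proof. by move=> H; apply/subv_sumP => s _; apply: H. Qed.

Lemma window_sup G j k s : (s < k)%N -> (G (j + s%:Z)%R <= window G j k)%VS.
Proof. by move=> sk; apply: (sumv_sup (Ordinal sk)). Qed.

Lemma windowS2 G j k : (0 < k)%N ->
  window G j k.+1 = (window G j k + window G (j + 1)%R k)%VS.
Proof.
move=> k0; apply/eqP; rewrite eqEsubv subv_add; apply/and3P; split.
- apply: windowP => s sk; have [h|h] := ltnP s k.
    exact: subv_trans (window_sup _ _ h) (addvSl _ _).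
  apply: subv_trans (addvSr _ _).
  have -> : j + s%:Z = j + 1 + s.-1%:Z by lia.
  by apply: window_sup; lia.
- by apply: windowP => s sk; apply: window_sup; lia.
- apply: windowP => s sk; have -> : j + 1 + s%:Z = j + s.+1%:Z by lia.
  exact: window_sup.
Qed.

End Windows.

Section StokesFlags.
Variables (R : realType) (K : fieldType) (V : vectType K) (r : nat).
Hypothesis r0 : (0 < r)%N.
Variable F : R -> int -> {vspace V}.
Local Notation ns := (@sns R r).
Local Notation lt := (@slt R r).
Local Notation eqm := (ieq r).
Implicit Types (y : R) (i j l : int) (k : nat).

Definition lower y i : {vspace V} :=
  (\sum_(j < r | lt y (j : nat)%:Z i) F y (j : nat)%:Z)%VS.

Hypothesis dimV : \dim {:V} = r.
Hypothesis F_mod : forall y i j, ns y -> eqm i j -> F y i = F y j.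
Hypothesis F_incr : forall y i j, ns y -> lt y i j -> (F y i <= F y j)%VS.
Hypothesis F_gr : forall y i, ns y -> \dim (F y i) = (\dim (lower y i)).+1.
(** One form for two axioms: away from Stokes directions [G] is the filtration itself, at a Stokes
    direction it is the local grading. Comparing windows suffices, as they are the initial segments
    of the order. *)
Hypothesis F_loc : forall y, exists2 d : R, 0 < d & exists G : int -> {vspace V},
  forall y', `|y' - y| < d -> ns y' -> forall j k, (k <= r)%N ->
    `|y' - center R j k| < 2^-1 ->
    (\sum_(s < k) F y' (j + (s : nat)%:Z)%R = \sum_(s < k) G (j + (s : nat)%:Z)%R)%VS.

Lemma lower_window y i j k : ns y -> (forall s, (s < k)%N -> lt y (j + s%:Z) i) ->
  (forall i', lt y i' i -> exists2 s, (s < k)%N & eqm i' (j + s%:Z)) ->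
  lower y i = window (F y) j k.
Proof.
move=> nsy H1 H2; apply/eqP; rewrite eqEsubv; apply/andP; split.
  apply/subv_sumP => i' /H2[s sk /(F_mod nsy) ->]; exact: window_sup.
apply: windowP => s sk; have [q qr iq] := window_or r0 (j + s%:Z) 0.
rewrite add0r in iq; rewrite (F_mod nsy iq).
apply: (sumv_sup (Ordinal qr)) => //=.
by rewrite -(slt_ieq r0 y iq (ieq_refl r i)) H1.
Qed.

Lemma window_neq j s k s' : (s < r)%N -> (k < r)%N -> (s' < k)%N -> (k <= s)%N ->
  ~~ eqm (j + s%:Z) (j + s'%:Z).
Proof.
move=> sr kr s'k ks; apply/negP => /(ieq_window r0 sr) E.
by have := E (ltn_trans s'k kr); lia.
Qed.

Lemma slt_irr y i j : lt y i j -> lt y j i -> False.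
Proof. by rewrite /slt => h /(lt_trans h); rewrite ltxx. Qed.

Lemma slt_neq y i j : lt y i j -> ~~ eqm i j.
Proof. by rewrite /slt => h; apply/negP => /(sval_ieq r0 y) E; rewrite E ltxx in h. Qed.

(** The largest index of a window is its end farther from [y], so the side of the centre on which
    [y] lies decides which end is dropped to reach the next smaller step. For [0 < k] the two ends
    tie at the centre, which is a Stokes direction. *)
Lemma window_flag y j k : ns y -> (k < r)%N -> `|y - center R j k.+1| < 2^-1 ->
  exists i, [/\ window (F y) j k.+1 = F y i,
    (exists2 j', lower y i = window (F y) j' k & (0 < k)%N -> `|y - center R j' k| < 2^-1)
    & (exists2 s, (s < k.+1)%N & i = j + s%:Z)].
Proof.
move=> nsy kr yc.
have below s i' : (s < k.+1)%N -> lt y i' (j + s%:Z) ->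
    exists2 s', (s' < k.+1)%N & eqm i' (j + s'%:Z).
  move=> sk h; have [q qr iq] := window_or r0 i' j; exists q => //.
  rewrite ltnNge; apply/negP => kq.
  apply: (slt_irr h); apply: (slt_window r0 kr yc sk) => s' s'k; apply/negP => e.
  have e2 : eqm (j + q%:Z) (j + s'%:Z) by apply: ieq_trans e; rewrite ieq_sym.
  have := ieq_window r0 qr (leq_trans s'k kr) e2; lia.
have topE s : (s < k.+1)%N -> (forall s', (s' < k.+1)%N -> s' != s -> lt y (j + s'%:Z) (j + s%:Z)) ->
    window (F y) j k.+1 = F y (j + s%:Z).
  move=> sk H; apply/eqP; rewrite eqEsubv window_sup // andbT.
  apply: windowP => s' s'k; have [->|ns'] := eqVneq s' s; first exact: subvv.
  exact: F_incr (H _ s'k ns').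
have cE : center R j k.+1 = center R j k + 2^-1 by rewrite /center -natr1; lra.
have cE' : center R j k.+1 = center R (j + 1) k - 2^-1.
  by rewrite /center -natr1 intrD; lra.
have low s j' : (s < k.+1)%N -> (forall s', (s' < k.+1)%N -> s' != s -> lt y (j + s'%:Z) (j + s%:Z)) ->
    (forall s', (s' < k.+1)%N -> s' != s -> exists2 u, (u < k)%N & j + s'%:Z = j' + u%:Z) ->
    (forall u, (u < k)%N -> exists2 s', (s' < k.+1)%N && (s' != s) & j' + u%:Z = j + s'%:Z) ->
    lower y (j + s%:Z) = window (F y) j' k.
  move=> sk H1 H2 H3; apply: lower_window => // [u uk|i' h].
    by have [s' /andP[s'k ns'] ->] := H3 u uk; exact: H1.
  have [s' s'k e] := below s i' sk h; have ns' : s' != s.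
    by apply: contraTneq (slt_neq h) => <-; rewrite e.
  by have [u uk E] := H2 s' s'k ns'; exists u; rewrite -?E.
have caseA : (0 < k)%N ==> (y < center R j k.+1) -> exists i,
  [/\ window (F y) j k.+1 = F y i,
    (exists2 j', lower y i = window (F y) j' k & (0 < k)%N -> `|y - center R j' k| < 2^-1)
    & (exists2 s, (s < k.+1)%N & i = j + s%:Z)].
  move=> h; have yk : (0 < k)%N -> `|y - center R j k| < 2^-1.
    by move=> k0; move: h yc; rewrite k0 /= cE !ltr_norml => h /andP[h1 h2]; apply/andP; split; lra.
  have H1 s' : (s' < k.+1)%N -> s' != k -> lt y (j + s'%:Z) (j + k%:Z).
    move=> s'k nk; have sk : (s' < k)%N by lia.
    have k0 : (0 < k)%N by lia.
    apply: (slt_window r0 (ltnW kr) (yk k0) sk) => u uk.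
    apply: (@window_neq j k k u kr kr uk (leqnn k)).
  exists (j + k%:Z); split; [exact: topE| |by exists k].
  exists j => //; apply: low => // [s' s'k nk|u uk]; first by exists s' => //; lia.
  by exists u => //; lia.
have [yl|yg|ye] := ltgtP y (center R j k.+1).
- by apply: caseA; apply/implyP.
- have yk : `|y - center R (j + 1) k| < 2^-1.
    by move: yg yc; rewrite cE' !ltr_norml => h /andP[h1 h2]; apply/andP; split; lra.
  have H1 s' : (s' < k.+1)%N -> s' != 0%N -> lt y (j + s'%:Z) (j + 0%:Z).
    move=> s'k nk; have -> : j + s'%:Z = j + 1 + s'.-1%:Z by (have : (0 < s')%N by rewrite lt0n); lia.
    apply: (slt_window r0 (ltnW kr) yk) => [|u uk]; first by lia.
    rewrite ieq_sym (_ : j + 1 + u%:Z = j + u.+1%:Z); last by lia.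
    apply/negP => /(ieq_window r0 (leq_ltn_trans uk kr)) E.
    by have := E r0; lia.
  exists (j + 0%:Z); split; [exact: topE| |by exists 0%N].
  exists (j + 1) => //; apply: low => // [s' s'k nk|u uk].
    by exists s'.-1; lia.
  by exists u.+1; lia.
- apply: caseA; apply/implyP => k0; exfalso.
  have E : sval r y j = sval r y (j + k%:Z).
    have kE : k%:Z%:~R = k%:R :> R by [].
    by apply: sval_sym; rewrite ye /center intrD kE -[k.+1%:R]natr1; lra.
  have := nsy j (j + k%:Z); rewrite /slt E ltxx !orbF.
  rewrite -{1}[j]addr0 => /(ieq_window r0 r0 kr); lia.
Qed.

Lemma dim_window y j k : ns y -> (k <= r)%N -> `|y - center R j k| < 2^-1 ->
  \dim (window (F y) j k) = k.
Proof.
move=> nsy; elim: k j => [|k IH] j kr yc; first by rewrite /window big_ord0 dimv0.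
have [i [-> [j' E yc'] _]] := window_flag nsy kr yc.
rewrite F_gr // E; case: k => [|k] in IH kr yc E yc' *.
  by rewrite /window big_ord0 dimv0.
by rewrite IH //; [exact: ltnW|exact: yc'].
Qed.

Lemma lower_top y i l : ns y -> `|y - center R (l + 1) r.-1| < 2^-1 ->
  (forall j, lt y j i || eqm j i) -> lower y i = window (F y) (l + 1) r.-1.
Proof.
move=> nsy yc itop.
have wl u : (u < r.-1)%N -> lt y (l + 1 + u%:Z) l.
  move=> ur; apply: (slt_window r0 (leq_pred _) yc ur) => s' s'r.
  rewrite -[l in eqm l _]addr0 ieq_sym (_ : l + 1 + s'%:Z = l + s'.+1%:Z); last by lia.
  by apply/negP => /(ieq_window r0); have := ltn_predK r0 => h E; have := E ltac:(lia) r0; lia.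
have il : eqm i l.
  have [q qr iq] := window_or r0 i l; case: q => [|q] in qr iq *; first by rewrite addr0 in iq.
  have h : lt y i l.
    rewrite (slt_ieq r0 y iq (ieq_refl r l)) (_ : l + q.+1%:Z = l + 1 + q%:Z); last by lia.
    by apply: wl; lia.
  by have /orP[h2|h2] := itop l; [case: (slt_irr h h2)|rewrite ieq_sym].
apply: lower_window => // [s sk|i' h].
  by rewrite (slt_ieq r0 y (ieq_refl r _) il) wl.
have [q qr iq] := window_or r0 i' l; case: q => [|q] in qr iq *.
  have := slt_neq h; rewrite addr0 in iq.
  by rewrite (ieq_trans iq) // ieq_sym.
by exists q; [lia|rewrite (_ : l + 1 + q%:Z = l + q.+1%:Z) //; lia].
Qed.

(** A step survives the crossing of Stokes directions as long as [y] stays within 1/2 of the centre,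
    because its indices remain an initial segment. It is locally constant there by [F_loc], hence
    constant. *)
Lemma window_cst j k y y' : (k <= r)%N -> ns y -> ns y' ->
  `|y - center R j k| < 2^-1 -> `|y' - center R j k| < 2^-1 ->
  window (F y) j k = window (F y') j k.
Proof.
move=> kr; set c := center R j k.
have X z : exists U, exists2 d : R, 0 < d & forall z', `|z' - z| < d -> ns z' ->
    `|z' - c| < 2^-1 -> window (F z') j k = U.
  have [d d0 [G H]] := F_loc z; exists (window G j k), d => // z' zd nz zc.
  exact: H.
pose U z := projT1 (cid (X z)).
have UP z : exists2 d : R, 0 < d & forall z', `|z' - z| < d -> ns z' ->
    `|z' - c| < 2^-1 -> window (F z') j k = U z by rewrite /U; case: cid.
have UE z : ns z -> `|z - c| < 2^-1 -> window (F z) j k = U z.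
  by move=> nz zc; have [d d0 H] := UP z; apply: H => //; rewrite subrr normr0.
have Uloc z : `|z - c| < 2^-1 -> exists2 d : R, 0 < d & forall z', `|z' - z| < d -> U z' = U z.
  rewrite ltr_norml => /andP[zc1 zc2]; have [d d0 H] := UP z.
  pose d' := Num.min (d / 2) (Num.min (2^-1 - (z - c)) (2^-1 + (z - c)) / 2).
  have d'0 : 0 < d'.
    by rewrite lt_min divr_gt0 //= divr_gt0 // lt_min; apply/andP; split; lra.
  have d'1 : d' <= d / 2 by rewrite ge_min lexx.
  have d'2 : d' <= Num.min (2^-1 - (z - c)) (2^-1 + (z - c)) / 2 by rewrite ge_min lexx orbT.
  have d'3 : d' <= (2^-1 - (z - c)) / 2.
    by apply: le_trans d'2 _; rewrite ler_pM2r ?invr_gt0 // ge_min lexx.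
  have d'4 : d' <= (2^-1 + (z - c)) / 2.
    by apply: le_trans d'2 _; rewrite ler_pM2r ?invr_gt0 // ge_min lexx orbT.
  exists d' => // z'; rewrite ltr_norml => /andP[h1 h2].
  have [e e0 H'] := UP z'; pose e' := Num.min e d'.
  have e'0 : 0 < e' by rewrite lt_min e0.
  have [w /andP[w1 w2] nw] := sns_near r0 z' e'0.
  have we : w < z' + e by apply: lt_le_trans w2 _; rewrite lerD2l ge_min lexx.
  have wd : w < z' + d' by apply: lt_le_trans w2 _; rewrite lerD2l ge_min lexx orbT.
  have wc : `|w - c| < 2^-1 by rewrite ltr_norml; apply/andP; split; lra.
  by rewrite -(H' w) // ?(H w) // ltr_norml; apply/andP; split; lra.
move=> nsy nsy' yc yc'; rewrite UE // [RHS]UE //.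
wlog yy : y y' nsy nsy' yc yc' / y <= y'.
  by move=> W; have [h|/ltW h] := leP y y'; [exact: W|symmetry; exact: W].
(* Connectedness of the interval: the indicator of the points where the value differs from [U y] has
   zero derivative, so the mean value theorem makes it constant. *)
pose f z : R := if `[< U z = U y >] then 0 else 1.
have fD z : y <= z <= y' -> is_derive z 1 f 0.
  move=> /andP[z1 z2]; have [|d d0 H] := Uloc z.
    move: yc yc'; rewrite !ltr_norml => /andP[h1 h2] /andP[h3 h4].
    by apply/andP; split; lra.
  apply/rderP => e e0; exists d => // h hd.
  by rewrite /f H ?subrr ?mulr0 ?subr0 ?normr0 ?mulr_ge0 ?(ltW e0) // addrC addKr.
have [||z] := @MVT_segment R f (fun=> 0) y y' yy.
- by move=> z; rewrite in_itv /= => /andP[h1 h2]; apply: fD; rewrite (ltW h1) (ltW h2).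
- by apply: derivable_within_continuous => z; rewrite in_itv /= => /fD[].
move=> _; rewrite mul0r /f; case: asboolP => [<- //|_].
by case: asboolP => // _ /eqP; rewrite subr0 oner_eq0.
Qed.

(** By [window_cst] the choice of the point is immaterial. It is taken slightly to the right of the
    centre because the centre may be a Stokes direction. *)
Definition step j k : {vspace V} :=
  window (F (s2val (cid2 (sns_near r0 (center R j k) (d := 2^-1) ltac:(by rewrite invr_gt0))))) j k.

Lemma stepE y j k : (k <= r)%N -> ns y -> `|y - center R j k| < 2^-1 ->
  window (F y) j k = step j k.
Proof.
move=> kr nsy yc; rewrite /step; case: cid2 => z /= /andP[z1 z2] nz.
by apply: window_cst => //; rewrite ltr_norml; apply/andP; split; lra.
Qed.

(** Around the centre [c] of the longer window a single family [G] describes all nearby filtrations.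
    Just left of [c] the shorter window at [j] is a step, just right of it the one at [j + 1]. All
    three are windows of the same [G], for which the identity is formal. *)
Lemma stepS j k : (0 < k < r)%N -> step j k.+1 = (step j k + step (j + 1)%R k)%VS.
Proof.
move=> /andP[k0 kr]; set c := center R j k.+1; have [d d0 [G H]] := F_loc c.
pose m := Num.min d 2^-1.
have m0 : 0 < m by rewrite lt_min d0 invr_gt0 /=.
have md : m <= d by rewrite ge_min lexx.
have m2 : m <= 2^-1 by rewrite ge_min lexx orbT.
have [y /andP[y1 y2] nsy] := sns_near_left r0 c m0.
have [z /andP[z1 z2] nsz] := sns_near r0 c m0.
have cE : c = center R j k + 2^-1 by rewrite /c /center -[k.+1%:R]natr1; lra.
have cE' : c = center R (j + 1) k - 2^-1.
  by rewrite /c /center -[k.+1%:R]natr1 intrD; lra.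
have yc : `|y - c| < d by rewrite ltr_norml; apply/andP; split; lra.
have zc : `|z - c| < d by rewrite ltr_norml; apply/andP; split; lra.
have yc1 : `|y - c| < 2^-1 by rewrite ltr_norml; apply/andP; split; lra.
have yc2 : `|y - center R j k| < 2^-1 by rewrite ltr_norml; apply/andP; split; lra.
have zc2 : `|z - center R (j + 1) k| < 2^-1 by rewrite ltr_norml; apply/andP; split; lra.
rewrite -(stepE _ nsy yc1) // -(stepE _ nsy yc2) 1?ltnW // -(stepE _ nsz zc2) 1?ltnW //.
have -> : window (F y) j k.+1 = window G j k.+1 by apply: H.
have -> : window (F y) j k = window G j k by apply: H => //; exact: ltnW.
have -> : window (F z) (j + 1) k = window G (j + 1) k by apply: H => //; exact: ltnW.
exact: windowS2.
Qed.

(** The recessive line at directions near [y = l]. *)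
Definition rline l : {vspace V} := step l 1.

Lemma step_rline j k : (0 < k <= r)%N -> step j k = window rline j k.
Proof.
elim: k j => // k IH j /= kr; case: k => [|k] in IH kr *.
  by rewrite /window big_ord1 addr0.
rewrite stepS ?kr // [RHS]windowS2 // !IH ?(ltnW kr) //.
Qed.

Lemma window_rline y j k : (k <= r)%N -> ns y -> `|y - center R j k| < 2^-1 ->
  window (F y) j k = window rline j k.
Proof.
case: k => [|k] kr nsy yc; first by rewrite /window !big_ord0.
by rewrite (stepE kr nsy yc) step_rline.
Qed.

Lemma dim_rline j k : (k <= r)%N -> \dim (window rline j k) = k.
Proof.
move=> kr; have h : 0 < 2^-1 :> R by rewrite invr_gt0.
have [z /andP[z1 z2] nsz] := sns_near r0 (center R j k) h.
have zc : `|z - center R j k| < 2^-1 by rewrite ltr_norml; apply/andP; split; lra.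
by rewrite -(window_rline kr nsz zc) dim_window.
Qed.

Lemma rlineE y l i : ns y -> `|y - l%:~R| < 2^-1 -> eqm i l -> F y i = rline l.
Proof.
move=> nsy yl il; rewrite (F_mod nsy il).
have := @window_rline y l 1 r0 nsy; rewrite /window !big_ord1 !addr0; apply.
by rewrite /center subrr mul0r addr0.
Qed.

Lemma bottom_eq y l i : `|y - l%:~R| < 2^-1 ->
  (forall j, eqm i j || lt y i j) -> eqm i l.
Proof.
move=> yl ib; have /orP[//|h] := ib l; apply: contraT => ni.
case: (slt_irr h); rewrite -[l]addr0; apply: (@slt_window _ _ r0 y l 1 0) => //.
  by rewrite /center subrr mul0r addr0.
by case=> // _; rewrite addr0.
Qed.

Lemma lowerE y l i : ns y -> `|y - (l%:~R + r%:R / 2)| < 2^-1 ->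
  (forall j, lt y j i || eqm j i) -> lower y i = window rline (l + 1) r.-1.
Proof.
move=> nsy yl it.
have cE : center R (l + 1) r.-1 = l%:~R + r%:R / 2.
  by rewrite /center intrD -[in RHS](prednK r0) -[r.-1.+1%:R]natr1; lra.
have yc : `|y - center R (l + 1) r.-1| < 2^-1 by rewrite cE.
by rewrite (lower_top nsy yc it) window_rline // leq_pred.
Qed.

Lemma top_exists y l : ns y -> `|y - (l%:~R + r%:R / 2)| < 2^-1 ->
  forall j, lt y j l || eqm j l.
Proof.
move=> nsy yl j.
have cE : center R (l + 1) r.-1 = l%:~R + r%:R / 2.
  by rewrite /center intrD -[in RHS](prednK r0) -[r.-1.+1%:R]natr1; lra.
have yc : `|y - center R (l + 1) r.-1| < 2^-1 by rewrite cE.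
have [q qr iq] := window_or r0 j l; case: q => [|q] in qr iq *.
  by rewrite addr0 in iq; rewrite iq orbT.
apply/orP; left; rewrite (slt_ieq r0 y iq (ieq_refl r l)).
rewrite (_ : l + q.+1%:Z = l + 1 + q%:Z); last by lia.
apply: (slt_window r0 (leq_pred _) yc) => [|s' s'r]; first by lia.
rewrite -[l in ieq _ l _]addr0 (_ : l + 1 + s'%:Z = l + s'.+1%:Z); last by lia.
by apply/negP => /(ieq_window r0 r0) E; have := E ltac:(lia).
Qed.

End StokesFlags.

Section StokesSystem.
Variables (R : realType) (Th : irr_class) (S : @stokes_system R Th).
Local Notation r := (ic_rank Th).
Local Notation b := (ic_num Th).
Hypotheses (r0 : (0 < r)%N) (b0 : (0 < b)%N).
Implicit Types (t y : R) (i j l : int).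

Let rR : 0 < r%:R :> R. Proof. by rewrite ltr0n. Qed.
Let bR : 0 < b%:R :> R. Proof. by rewrite ltr0n. Qed.
Let p0 : 0 < pi :> R := pi_gt0 R.

(* The direction at which index l is the lowest when y = l. *)
Definition shift : R := if ic_neg Th then 0 else r%:R / 2.
(** The sign is negative because in the arguments [2 pi i + b t] the lowest index goes down as [t]
    goes up; a full turn lowers [y] by [b]. *)
Definition dir y : R := (shift - y) * (2 * pi / b%:R).
Definition undir t : R := shift - t * b%:R / (2 * pi).

Lemma dirK y : undir (dir y) = y.
Proof. by rewrite /undir /dir; (move: (gt_eqF p0) (gt_eqF bR) (gt_eqF rR); move: (pi : R) => q q0 qb qr; field; rewrite ?q0 ?qb ?qr //). Qed.

Lemma undirK t : dir (undir t) = t.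
Proof. by rewrite /undir /dir; (move: (gt_eqF p0) (gt_eqF bR) (gt_eqF rR); move: (pi : R) => q q0 qb qr; field; rewrite ?q0 ?qb ?qr //). Qed.

Lemma Re_expfac (rho t : R) i : complex.Re (expfac Th i rho t) =
  rho `^ (b%:R / r%:R) * sval r (undir t) i.
Proof.
rewrite /expfac /sval /undir /shift /polar.
case: (ic_neg Th); rewrite ?expr1 ?expr0 ?mulN1r ?mul1r ?cReN /=.
  rewrite mulrN; congr (- (_ * cos _)); (move: (gt_eqF p0) (gt_eqF bR) (gt_eqF rR); move: (pi : R) => q q0 qb qr; field; rewrite ?q0 ?qb ?qr //).
congr (_ * _); rewrite -cosDpi; congr cos; (move: (gt_eqF p0) (gt_eqF bR) (gt_eqF rR); move: (pi : R) => q q0 qb qr; field; rewrite ?q0 ?qb ?qr //).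
Qed.

Lemma dir_ltE y i j : dir_lt Th (dir y) i j = slt r y i j.
Proof. by rewrite /dir_lt !Re_expfac dirK powR1 !mul1r. Qed.

Lemma idx_eqE i j : idx_eq Th i j = ieq r i j. Proof. by []. Qed.

Lemma non_stokesE y : non_stokes Th (dir y) <-> sns r y.
Proof. by split=> H i j; have := H i j; rewrite !dir_ltE. Qed.

Lemma near_dir y (Q : R -> Prop) : (\forall t' \near dir y, Q t') <->
  exists2 d : R, 0 < d & forall y', `|y' - y| < d -> Q (dir y').
Proof.
have k0 : 0 < 2 * pi / b%:R :> R by rewrite divr_gt0 // mulr_gt0.
have E y' : dir y - dir y' = (y' - y) * (2 * pi / b%:R).
  by rewrite /dir; ring.
split=> [/nbhs_ballP[d /= d0 H]|[d d0 H]].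
  exists (d / (2 * pi / b%:R)) => [|y' hy]; first by rewrite divr_gt0.
  apply: H; rewrite /ball /= E normrM (gtr0_norm k0).
  by rewrite -ltr_pdivlMr.
apply/nbhs_ballP; exists (d * (2 * pi / b%:R)) => /=; first by rewrite mulr_gt0.
move=> t' /= ht; rewrite -[t']undirK; apply: H.
rewrite -(ltr_pM2r k0); apply: le_lt_trans ht.
by rewrite -{2}[t']undirK E normrM (gtr0_norm k0).
Qed.

Definition yF y i : {vspace S} := ss_F S (dir y) i.

Lemma yF_mod y i j : sns r y -> ieq r i j -> yF y i = yF y j.
Proof. by move=> /non_stokesE ns; exact: ss_mod. Qed.

Lemma yF_incr y i j : sns r y -> slt r y i j -> (yF y i <= yF y j)%VS.
Proof. by move=> /non_stokesE ns h; apply: ss_incr; rewrite ?dir_ltE. Qed.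

Lemma filt_ltE y i : filt_lt Th (@ss_F R Th S) (dir y) i = lower r yF y i.
Proof. by apply: eq_bigl => j; rewrite dir_ltE. Qed.

Lemma yF_gr y i : sns r y -> \dim (yF y i) = (\dim (lower r yF y i)).+1.
Proof. by move=> /non_stokesE ns; rewrite /yF ss_gr // filt_ltE. Qed.

Lemma yF_period y i : sns r y -> yF (y - b%:R) i = yF y (i + b%:Z).
Proof.
move=> /non_stokesE ns; rewrite /yF -ss_period //; congr (ss_F S _ i).
by rewrite /dir; (move: (gt_eqF p0) (gt_eqF bR) (gt_eqF rR); move: (pi : R) => q q0 qb qr; field; rewrite ?q0 ?qb ?qr //).
Qed.

Lemma yF_loc y : exists2 d : R, 0 < d & exists G : int -> {vspace S},
  forall y', `|y' - y| < d -> sns r y' -> forall j k, (k <= r)%N ->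
    `|y' - center R j k| < 2^-1 ->
    window (yF y') j k = window G j k.
Proof.
have [ns|ns] := pselect (non_stokes Th (dir y)).
  have /near_dir[d d0 H] := ss_loc_cst S ns; exists d => //; exists (yF y).
  move=> y' yd /non_stokesE ns' j k _ _; apply: eq_bigr => s _.
  exact: H.
(* At a Stokes direction the window consists of the lowest indices for every nearby [y'] within 1/2
   of its centre, so summing the filtration over the window is summing the graded pieces. *)
have [G [Gmod Gdir Gfull /near_dir[d d0 H]]] := ss_grading S ns.
exists d => //; exists G => y' yd nsy' j k kr yc.
have FE i : yF y' i = (\sum_(l < r | dir_le Th (dir y') (l : nat)%:Z i) G (l : nat)%:Z)%VS.
  by apply: H => //; apply/non_stokesE.
apply/eqP; rewrite eqEsubv; apply/andP; split; apply: windowP => s sk.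
  rewrite FE; apply/subv_sumP => l; rewrite /dir_le dir_ltE => /orP[h|h].
    by rewrite (Gmod _ _ h) window_sup.
  have [q qr iq] := window_or r0 l j.
  have qk : (q < k)%N.
    rewrite ltnNge; apply/negP => kq; apply: (slt_irr h).
    apply: (slt_window r0 kr yc sk) => s' s'k; apply/negP => e.
    have e2 : ieq r (j + q%:Z) (j + s'%:Z) by apply: ieq_trans e; rewrite ieq_sym.
    by have := ieq_window r0 qr (leq_trans s'k kr) e2; lia.
  by rewrite (Gmod _ _ iq) window_sup.
have [q qr iq] := window_or r0 (j + s%:Z) 0; rewrite add0r in iq.
apply: subv_trans (window_sup _ _ sk); rewrite FE (Gmod _ _ iq).
by apply: (sumv_sup (Ordinal qr)) => //=; rewrite /dir_le idx_eqE ieq_sym iq.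
Qed.

Definition line l : {vspace S} := rline r0 yF l.

Lemma dim_line_window j k : (k <= r)%N -> \dim (window line j k) = k.
Proof. exact: (dim_rline r0 (ss_dim S) (@yF_mod) (@yF_incr) (@yF_gr) yF_loc). Qed.

Lemma yF_line y l i : sns r y -> `|y - l%:~R| < 2^-1 -> ieq r i l -> yF y i = line l.
Proof. exact: (rlineE r0 (@yF_mod) yF_loc). Qed.

Lemma lower_line y l i : sns r y -> `|y - (l%:~R + r%:R / 2)| < 2^-1 ->
  (forall j, slt r y j i || ieq r j i) -> lower r yF y i = window line (l + 1) r.-1.
Proof. exact: (lowerE r0 (ss_dim S) (@yF_mod) yF_loc). Qed.

Lemma half_gt0 : 0 < 2^-1 :> R. Proof. by rewrite invr_gt0. Qed.

(** The identification of [[q_i, t + 2 pi]] with [[q_(i+b), t]], read in the coordinate [y]. *)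
Lemma line_period l : line (l + b%:Z) = line l.
Proof.
have [y /andP[y1 y2] nsy] := sns_near r0 (l + b%:Z)%:~R half_gt0.
have nsy' : sns r (y - b%:R).
  apply/non_stokesE => i j.
  have -> : dir (y - b%:R) = dir y + 2 * pi by rewrite /dir; (move: (gt_eqF p0) (gt_eqF bR) (gt_eqF rR); move: (pi : R) => q q0 qb qr; field; rewrite ?q0 ?qb ?qr //).
  have /non_stokesE := nsy; have E k rho : expfac Th k rho (dir y + 2 * pi) =
      expfac Th (k + b%:Z) rho (dir y).
    rewrite /expfac intrD; congr (_ * polar _ (_ / _)).
    by rewrite -[b%:Z%:~R]/(b%:R); ring.
  move=> /(_ (i + b%:Z) (j + b%:Z)); rewrite /dir_lt !E.
  suff -> : idx_eq Th (i + b%:Z) (j + b%:Z) = idx_eq Th i j by [].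
  by rewrite /idx_eq !eqz_mod_dvd; congr (_ %| _)%Z; lia.
have e1 : `|y - (l + b%:Z)%:~R| < 2^-1 by rewrite ltr_norml; apply/andP; split; lra.
have e2 : `|y - b%:R - l%:~R| < 2^-1.
  move: y1 y2; rewrite intrD -[b%:Z%:~R]/(b%:R) => y1 y2.
  by rewrite ltr_norml; apply/andP; split; lra.
rewrite -(yF_line nsy e1 (ieq_refl r _)) -(yF_line nsy' e2 (ieq_refl r _)).
by rewrite yF_period.
Qed.

(** The choice operator returns this line because non-Stokes directions accumulate at every
    direction, so that no other line has the defining property. *)
Lemma recessiveE l : recessive S (dir l%:~R) = line l.
Proof.
have H : \forall t' \near dir l%:~R, non_stokes Th t' ->
    forall i, (forall j, dir_le Th t' i j) -> ss_F S t' i = line l.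
  apply/near_dir; exists 2^-1; first exact: half_gt0.
  move=> y yl /non_stokesE nsy i ib; apply: yF_line => //.
  apply: (bottom_eq r0 yl) => j; have := ib j; by rewrite /dir_le dir_ltE.
apply: xget_unique => // L /near_dir[d d0 HL].
have m0 : 0 < Num.min d 2^-1 by rewrite lt_min d0 half_gt0.
have [y /andP[y1 y2] nsy] := sns_near r0 l%:~R m0.
have m1 : Num.min d 2^-1 <= d by rewrite ge_min lexx.
have m2 : Num.min d 2^-1 <= 2^-1 by rewrite ge_min lexx orbT.
have yl : `|y - l%:~R| < 2^-1 by rewrite ltr_norml; apply/andP; split; lra.
rewrite -(yF_line nsy yl (ieq_refl r _)) /yF (HL y) //.
- by rewrite ltr_norml; apply/andP; split; lra.
- exact/non_stokesE.
- move=> j; rewrite /dir_le dir_ltE idx_eqE.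
  have [//|nj] := boolP (ieq r l j) => /=.
  rewrite -[l in slt _ _ l]addr0; apply: (@slt_window _ _ r0 y l 1 0) => //.
    by rewrite /center subrr mul0r addr0.
  by case=> // _; rewrite addr0 ieq_sym.
Qed.

Lemma subdominantE l : subdominant S (dir (l%:~R + r%:R / 2)) = window line (l + 1) r.-1.
Proof.
have H : \forall t' \near dir (l%:~R + r%:R / 2), non_stokes Th t' ->
    forall i, (forall j, dir_le Th t' j i) ->
    filt_lt Th (@ss_F R Th S) t' i = window line (l + 1) r.-1.
  apply/near_dir; exists 2^-1; first exact: half_gt0.
  move=> y yl /non_stokesE nsy i it; rewrite filt_ltE; apply: lower_line => // j.
  by have := it j; rewrite /dir_le dir_ltE orbC.
apply: xget_unique => // L /near_dir[d d0 HL].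
have m0 : 0 < Num.min d 2^-1 by rewrite lt_min d0 half_gt0.
have [y /andP[y1 y2] nsy] := sns_near r0 (l%:~R + r%:R / 2) m0.
have m1 : Num.min d 2^-1 <= d by rewrite ge_min lexx.
have m2 : Num.min d 2^-1 <= 2^-1 by rewrite ge_min lexx orbT.
have yl : `|y - (l%:~R + r%:R / 2)| < 2^-1 by rewrite ltr_norml; apply/andP; split; lra.
have tp := top_exists r0 (ss_dim S) nsy yl.
rewrite -(lower_line nsy yl tp) -filt_ltE (HL y) //.
- by rewrite ltr_norml; apply/andP; split; lra.
- exact/non_stokesE.
- by move=> j; rewrite /dir_le dir_ltE idx_eqE orbC.
Qed.

End StokesSystem.

(** * Gale duality of periodic line configurations *)

Section DualSpaces.
Variable K : fieldType.
Implicit Types V W : vectType K.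

Lemma dim_dualv V : \dim {:dualv V} = \dim {:V}.
Proof. by rewrite !dimvf /= /dim /= muln1. Qed.

Lemma dim_annv V (U : {vspace V}) : (\dim (annv U) + \dim U)%N = \dim {:V}.
Proof.
pose f := precomp (linfun (vsval : subvs_of U -> V)).
have fT : limg f = fullv.
  apply/vspaceP => g; rewrite memvf; apply/memv_imgP.
  exists ((g : 'Hom(subvs_of U, K^o)) \o linfun (vsproj U))%VF; first exact: memvf.
  rewrite precompE; apply/lfunP => x.
  by rewrite !comp_lfunE !lfunE /= vsvalK.
have d2 : \dim {:dualv (subvs_of U)} = \dim U by rewrite dim_dualv dimvf.
have := limg_ker_dim f fullv; rewrite fT capfv => E.
by rewrite -(dim_dualv V) -d2; exact: E.
Qed.

Lemma annv_add V (U U' : {vspace V}) : (annv U + annv U')%VS = annv (U :&: U')%VS.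
Proof.
apply/eqP; rewrite -(dimv_leqif_eq _); last first.
  rewrite subv_add; apply/andP; split; apply/subvP => g; rewrite !mem_annv => h;
    apply: subv_trans h; [exact: capvSl|exact: capvSr].
have E : (annv U :&: annv U')%VS = annv (U + U')%VS.
  by apply/vspaceP => g; rewrite memv_cap !mem_annv subv_add.
have h1 := dimv_sum_cap (annv U) (annv U'); rewrite E in h1.
have h2 := dim_annv U; have h3 := dim_annv U'; have h4 := dim_annv (U + U').
have h5 := dim_annv (U :&: U'); have h6 := dimv_sum_cap U U'.
apply/eqP; lia.
Qed.

Lemma exists_functional V (x : V) : x != 0 -> exists g : 'Hom(V, K^o), g x = 1.
Proof.
move=> x0; have xX : free [:: x] by rewrite free_cons /= span_nil memv0 x0 nil_free.
pose g (y : V) : K^o := coord [tuple x] ord0 (projv <[x]> y).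
have lg : linear g by move=> k u v; rewrite /g !linearP.
exists (linfun g); rewrite linfunE // /g projv_id ?memv_line //.
by have := coord_free ord0 ord0 xX; rewrite eqxx.
Qed.

Lemma annv_bidual V (U : {vspace V}) (x : V) :
  (forall g : dualv V, g \in annv U -> (g : 'Hom(V, K^o)) x = 0) -> x \in U.
Proof.
move=> H; apply: contraT => xU.
have : quotp U x != 0 by rewrite -memv_ker lker_quotp.
case/exists_functional => g gx.
have := H ((g \o quotp U)%VF); rewrite comp_lfunE gx mem_annv => E.
have /E/eqP : (U <= lker (g \o quotp U))%VS.
  by apply/subvP => u uU; rewrite memv_ker comp_lfunE -{1}(lker_quotp U) memv_ker in uU *;
     rewrite (eqP uU) linear0.
by rewrite oner_eq0.
Qed.

Definition evalv V (x : V) : dualv (dualv V) :=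
  linfun (fun g : dualv V => (g : 'Hom(V, K^o)) x : K^o).

Lemma evalvE V (x : V) (g : dualv V) :
  (evalv x : 'Hom(dualv V, K^o)) g = (g : 'Hom(V, K^o)) x.
Proof. by apply: linfunE => k u v; rewrite add_lfunE scale_lfunE. Qed.

Lemma evalv_linear V : linear (@evalv V).
Proof.
by move=> k x y; apply/lfunP => g; rewrite evalvE !lfunE /= !lfunE /= !evalvE linearP.
Qed.

Lemma evalvB V (x y : V) : evalv (x - y) = evalv x - evalv y.
Proof. by rewrite addrC -scaleN1r evalv_linear scaleN1r addrC. Qed.

Lemma evalv_annv V (U : {vspace V}) x : (evalv x \in annv (annv U)) = (x \in U).
Proof.
rewrite mem_annv; apply/subvP/idP => [H|xU g].
  by apply: annv_bidual => g /H; rewrite memv_ker evalvE => /eqP.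
by rewrite mem_annv => /subvP/(_ _ xU); rewrite !memv_ker evalvE.
Qed.

Lemma evalv_surj V (y : dualv (dualv V)) : exists x, evalv x = y.
Proof.
pose f := linfun (@evalv V); have fE x : f x = evalv x by apply: linfunE; exact: evalv_linear.
have f0 : lker f = 0%VS.
  apply/eqP; rewrite -subv0; apply/subvP => x; rewrite memv_ker fE => /eqP x0.
  apply: annv_bidual => g _; by rewrite -evalvE x0 lfunE.
have fT : limg f = fullv.
  apply/eqP; rewrite -(dimv_leqif_eq (subvf _)).
  have := limg_ker_dim f fullv; rewrite f0 capv0 dimv0 add0n => ->.
  by rewrite !dim_dualv.
have : y \in limg f by rewrite fT memvf.
by case/memv_imgP => x _ ->; exists x.
Qed.

(** The two isomorphisms are defined through representatives, relations among solutions or families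
    of functionals; this lemma turns such a definition into a linear map. *)
Lemma linear_relation V W (Rel : V -> W -> Prop) :
  (forall k x y x' y', Rel x y -> Rel x' y' -> Rel (k *: x + x') (k *: y + y')) ->
  (forall x, exists y, Rel x y) -> (forall y, Rel 0 y -> y = 0) ->
  exists f : 'Hom(V, W), forall x y, Rel x y -> f x = y.
Proof.
move=> Rl Rt R0; pose h x := projT1 (cid (Rt x)).
have hR x : Rel x (h x) by rewrite /h; case: cid.
have hE x y : Rel x y -> h x = y.
  move=> xy; have := Rl (-1) _ _ _ _ xy (hR x); rewrite scaleN1r addNr => /R0.
  by rewrite scaleN1r addrC => /eqP; rewrite subr_eq0 => /eqP.
have hl : linear h by move=> k x y; apply: hE; apply: Rl; exact: hR.
by exists (linfun h) => x y xy; rewrite linfunE // (hE _ _ xy).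
Qed.

End DualSpaces.

Section GaleClass.
Variables (K : fieldType) (b : nat).
Implicit Types P Q : config K b.

(** Elements of the Gale transform are handled through families of representatives; the families
    congruent to one constant [v] modulo the hyperplanes represent 0. *)
Definition gclass P (xi : 'I_b -> gale_V P) : cspace (gale P) :=
  gale_proj P (dsum_mk (fun i => quotp (gale_hyp P i) (xi i)) : gale_W P).

Lemma gclass_linear P k (xi xi' : 'I_b -> gale_V P) :
  gclass (fun i => k *: xi i + xi' i) = k *: gclass xi + gclass xi'.
Proof.
rewrite /gclass -linearP; congr (gale_proj P _); apply: dsumP => i.
by rewrite dsum_appD dsum_appZ !dsum_mkE linearP.
Qed.

Lemma gclass_eq0 P (xi : 'I_b -> gale_V P) : gclass xi = 0 <->
  exists v, forall i, xi i - v \in gale_hyp P i.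
Proof.
split=> [/eqP|[v H]].
  rewrite -memv_ker lker_quotp => /memv_imgP[v _ E]; exists v => i.
  have := congr1 (fun w : gale_W P => dsum_app (w : dsumv _) i) E.
  rewrite dsum_mkE gale_alphaE => e.
  by rewrite -[gale_hyp P i]lker_quotp memv_ker linearB /= e subrr.
apply/eqP; rewrite -memv_ker lker_quotp; apply/memv_imgP; exists v; first exact: memvf.
apply: dsumP => i; rewrite dsum_mkE gale_alphaE.
apply/eqP; rewrite -subr_eq0 -linearB -memv_ker.
by have := H i; rewrite -{1}[gale_hyp P i]lker_quotp.
Qed.

Lemma gclass_shift P (xi : 'I_b -> gale_V P) v :
  gclass (fun i => xi i - v) = gclass xi.
Proof.
apply/eqP; rewrite -subr_eq0; apply/eqP.
have := gclass_linear (-1) xi (fun i => xi i - v); rewrite scaleN1r addrC => <-.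
by apply/gclass_eq0; exists (- v) => i; rewrite scaleN1r addKr subrr mem0v.
Qed.

Lemma gclass_line P (xi : 'I_b -> gale_V P) i :
  (forall j, j != i -> xi j \in gale_hyp P j) -> gclass xi \in cline (gale P) i.
Proof.
move=> H; apply/memv_imgP; exists (quotp (gale_hyp P i) (xi i)); first exact: memvf.
rewrite comp_lfunE; congr (gale_proj P _); apply: dsumP => j.
rewrite [linfun _ _]linfunE; last exact: dsum_in_linear.
rewrite !dsum_mkE; have [<-|ij] := eqVneq i j; first by rewrite eqtype.dfwith_in.
rewrite eqtype.dfwith_out //; apply/eqP; rewrite -memv_ker lker_quotp.
by apply: H; rewrite eq_sym.
Qed.

Lemma dim_quotv V (U : {vspace V}) : (\dim {:@quotv K V U} + \dim U)%N = \dim {:V}.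
Proof.
by have := limg_ker_dim (quotp U) fullv; rewrite limg_quotp lker_quotp capfv => <-; rewrite addnC.
Qed.

Lemma dim_gale_line P i : (\dim (cline (gale P) i) <= \dim {:quotv (gale_hyp P i)})%N.
Proof.
rewrite /gale /=; set f := (_ \o _)%VF.
by have := limg_ker_dim f fullv => <-; rewrite leq_addl.
Qed.

Lemma gale_map_class P Q (f : 'Hom(cspace P, cspace Q)) (xi : 'I_b -> gale_V P) :
  P_iso f -> gale_map f (gclass xi) = gclass (fun i => contragredient f (xi i)).
Proof.
move=> fi; rewrite /gclass gale_map_proj //; congr (gale_proj Q _).
apply: dsumP => i; rewrite dsum_mkE; apply: gale_W_map_quotp => //.
by rewrite dsum_mkE.
Qed.

Lemma dim_gale P : (forall i, \dim {:quotv (gale_hyp P i)} = 1%N) ->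
  (forall v, (forall i, v \in gale_hyp P i) -> v = 0) ->
  (\dim {:cspace (gale P)} + \dim {:gale_V P})%N = b.
Proof.
move=> dq inj; have dW : \dim {:gale_W P} = b.
  rewrite dimvf; transitivity (\sum_(i < b) dim (quotv (gale_hyp P i)))%N; first by [].
  rewrite (eq_bigr (fun=> 1%N)); first by rewrite sum1_card card_ord.
  by move=> i _; rewrite -dimvf dq.
have ker0 : lker (gale_alpha P) = 0%VS.
  apply/eqP; rewrite -subv0; apply/subvP => v; rewrite memv_ker => /eqP v0.
  rewrite (inj v) ?mem0v // => i; rewrite -[gale_hyp P i]lker_quotp memv_ker.
  by rewrite -gale_alphaE v0; apply/eqP; rewrite dsum_mkE.
have := limg_ker_dim (gale_alpha P) fullv; rewrite ker0 capv0 dimv0 add0n => <-.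
by rewrite dim_quotv dW.
Qed.

Lemma dim_annv_quot P i : \dim (cline P i) = 1%N -> \dim {:quotv (gale_hyp P i)} = 1%N.
Proof.
move=> d1; have := dim_quotv (gale_hyp P i); have := dim_annv (cline P i).
rewrite d1 /gale_hyp /gale_V dim_dualv; lia.
Qed.

End GaleClass.

Section PeriodicLines.
Variables (K : fieldType) (b : nat).
Hypothesis b0 : (0 < b)%N.

(* The lines of an object of P_(n,b), extended periodically to indices in Z. *)
Record plines (n : nat) (V : vectType K) (L : int -> {vspace V}) : Prop := PLines {
  pl_period : forall l, L (l + b%:Z) = L l;
  pl_dim : forall j k, (k <= n)%N -> \dim (window L j k) = k;
  pl_full : \dim {:V} = n
}.

Definition hyper n (V : vectType K) (L : int -> {vspace V}) j : {vspace V} :=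
  window L (j + 1) n.-1.

Lemma window0 (V : vectType K) (L : int -> {vspace V}) j : window L j 0 = 0%VS.
Proof. by rewrite /window big_ord0. Qed.

Lemma window1 (V : vectType K) (L : int -> {vspace V}) j : window L j 1 = L j.
Proof. by rewrite /window big_ord1 addr0. Qed.

Section One.
Variables (n : nat) (V : vectType K) (L : int -> {vspace V}).
Hypotheses (n0 : (0 < n)%N) (PL : plines n L).

Lemma pl_modn l q : L (l + (q * b)%N%:Z) = L l.
Proof.
elim: q => [|q IH]; first by rewrite mul0n addr0.
by rewrite mulSn addnC PoszD addrA (pl_period PL).
Qed.

Lemma pl_ord (l : nat) : L (l %% b)%N%:Z = L l%:Z.
Proof. by rewrite -(pl_modn _ (l %/ b)) -PoszD addnC -divn_eq. Qed.

Lemma pl_line j : \dim (L j) = 1%N.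
Proof. by rewrite -window1 (pl_dim PL). Qed.

Lemma window_full j : window L j n = fullv.
Proof. by apply/eqP; rewrite -(dimv_leqif_eq (subvf _)) (pl_dim PL) // (pl_full PL). Qed.

Lemma window_period j k : window L (j + b%:Z) k = window L j k.
Proof. by apply: eq_bigr => s _; rewrite addrAC (pl_period PL). Qed.

Lemma window_modn j q k : window L (j + (q * b)%N%:Z) k = window L j k.
Proof. by apply: eq_bigr => s _; rewrite addrAC pl_modn. Qed.

Lemma window_cap j k : (k < n)%N ->
  (window L j k :&: window L (j + 1) k)%VS = window L (j + 1) k.-1.
Proof.
case: k => [|k] kn; first by rewrite !window0 capv0.
symmetry; apply/eqP; rewrite -(dimv_leqif_eq _); last first.
  rewrite subv_cap windowSl addvSr /=; apply: windowP => s sk.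
  by apply: window_sup; exact: leqW.
rewrite (pl_dim PL) ?(ltnW (ltnW kn)) //=.
have := dimv_sum_cap (window L j k.+1) (window L (j + 1) k.+1).
rewrite -windowS2 // !(pl_dim PL) ?(ltnW kn) // => h; apply/eqP; lia.
Qed.

Lemma window_cap_hyper j k : (0 < k)%N -> (k < n)%N ->
  (window L (j + k%:Z) (n - k) :&: hyper n L (j + k%:Z))%VS = window L (j + k.+1%:Z) (n - k.+1).
Proof.
move=> k0 kn; have e : j + k.+1%:Z = j + k%:Z + 1 by lia.
rewrite e; set i := j + k%:Z.
symmetry; apply/eqP; rewrite -(dimv_leqif_eq _); last first.
  rewrite subv_cap; apply/andP; split; apply: windowP => s sk.
    rewrite -addrA -[1 + s%:Z]/(1%:Z + s%:Z) -PoszD; apply: window_sup; lia.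
  by apply: window_sup; lia.
have := dimv_sum_cap (window L i (n - k)) (hyper n L i).
have -> : (window L i (n - k) + hyper n L i)%VS = fullv.
  apply/eqP; rewrite eqEsubv subvf /= -(window_full i); apply: windowP => s sn.
  case: s sn => [|s] sn.
    by apply: subv_trans (addvSl _ _); apply: window_sup; lia.
  apply: subv_trans (addvSr _ _); rewrite (_ : i + s.+1%:Z = i + 1 + s%:Z); last lia.
  by apply: window_sup; lia.
rewrite (pl_full PL) /hyper !(pl_dim PL); lia.
Qed.

Lemma dim_hyper j : \dim (hyper n L j) = n.-1.
Proof. by rewrite (pl_dim PL) // leq_pred. Qed.

Lemma dim_annv_hyper j : \dim (annv (hyper n L j)) = 1%N.
Proof. by have := dim_annv (hyper n L j); rewrite dim_hyper (pl_full PL); lia. Qed.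

(** Intersecting consecutive hyperplanes shortens the window of lines one by one, by
    [window_cap_hyper], and annihilators turn intersections into sums. *)
Lemma window_annv j k : (0 < k <= n)%N ->
  window (fun l => annv (hyper n L l)) j k = annv (window L (j + k%:Z) (n - k)).
Proof.
elim: k => // k IH /= kn; case: k => [|k] in IH kn *.
  by rewrite window1 subn1.
rewrite windowSr IH ?(ltnW kn) // annv_add; congr annv.
exact: window_cap_hyper.
Qed.

Lemma annv_plines : plines n (fun l => annv (hyper n L l)).
Proof.
have F j : window (fun l => annv (hyper n L l)) j n = fullv.
  rewrite window_annv ?n0 ?leqnn // subnn window0; apply/vspaceP => g.
  by rewrite memvf mem_annv sub0v.
split=> [l|j k kn|]; last by rewrite dim_dualv (pl_full PL).
  by rewrite /hyper addrAC window_period.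
case: k kn => [|k] kn; first by rewrite window0 dimv0.
rewrite window_annv //.
by have := dim_annv (window L (j + k.+1%:Z) (n - k.+1)); rewrite (pl_dim PL) ?leq_subr // (pl_full PL); lia.
Qed.

Lemma in_P_plines (f : 'I_b -> {vspace V}) : (forall i : 'I_b, f i = L (i : nat)%:Z) ->
  in_P n (Config f).
Proof.
move=> fE; split=> [|i|i] /=; first exact: pl_full PL.
  by rewrite fE pl_line.
rewrite -(window_full (i : nat)%:Z); apply: eq_bigr => j _.
rewrite fE; have -> : ((iter j (@ordS b) i : 'I_b) : nat) = ((i + j) %% b)%N.
  elim: (j : nat) => [|s IH]; first by rewrite addn0 modn_small.
  by rewrite iterS /= IH -addn1 modnDml addn1 addnS.
by rewrite pl_ord PoszD.
Qed.

(** The directions of the Fourier transform carry the labels [-1], ..., [-b], so its lines come in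
    the opposite order. *)
Lemma rev_plines (c : int) : plines n (fun l => L (c - l)).
Proof.
split=> [l|j k kn|]; last exact: pl_full PL.
  by rewrite -[LHS](pl_period PL); congr L; lia.
rewrite -[RHS](pl_dim PL (c - j - k%:Z + 1) kn); congr (\dim _).
apply/eqP; rewrite eqEsubv; apply/andP; split; apply: windowP => s sk.
  rewrite (_ : c - (j + s%:Z) = c - j - k%:Z + 1 + (k - s.+1)%N%:Z); last by lia.
  by apply: window_sup; lia.
have -> : c - j - k%:Z + 1 + s%:Z = c - (j + (k - s.+1)%N%:Z) by lia.
by apply: (@window_sup _ _ (fun l => L (c - l))); lia.
Qed.

End One.

Section GaleDuality.
Variables (a : nat) (V W : vectType K) (L : int -> {vspace V}) (l : int -> {vspace W}).
Hypotheses (a0 : (0 < a)%N) (ab : (a < b)%N).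
Hypotheses (PL : plines a L) (Pl : plines (b - a) l).
Local Notation H := (hyper a L).
Local Notation h := (hyper (b - a) l).
Implicit Types (v : 'I_b -> V) (i : 'I_b).

Definition relation v := (forall i, v i \in L (i : nat)%:Z) /\ \sum_i v i = 0.

Variable lap : ('I_b -> V) -> W.
Hypothesis lap_linear : forall k v v', relation v -> relation v' ->
  lap (fun i => k *: v i + v' i) = k *: lap v + lap v'.
Hypothesis lap_inj : forall v, relation v -> lap v = 0 -> forall i, v i = 0.
Hypothesis lap_hyper : forall v i, relation v -> v i = 0 -> lap v \in h (i : nat)%:Z.

Let gen i : V := vpick (L (i : nat)%:Z).

Lemma genP i : L (i : nat)%:Z = <[gen i]>%VS.
Proof.
have d1 := pl_line a0 PL (i : nat)%:Z.
have L0 : gen i != 0 by rewrite vpick0 -dimv_eq0 d1.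
apply/eqP; rewrite eq_sym -(dimv_leqif_eq _).
  by rewrite d1 dim_vline L0.
by rewrite -memvE memv_pick.
Qed.

Lemma gen_neq0 i : gen i != 0.
Proof. by rewrite vpick0 -dimv_eq0 (pl_line a0 PL). Qed.

Let fam (c : 'rV[K]_b) i : V := c 0 i *: gen i.
Let tot : 'Hom('rV[K]_b, V) := linfun (fun c : 'rV[K]_b => \sum_i fam c i).

Lemma fam_linear k c c' i : fam (k *: c + c') i = k *: fam c i + fam c' i.
Proof. by rewrite /fam !mxE scalerDl scalerA. Qed.

Lemma totE c : tot c = \sum_i fam c i.
Proof.
apply: linfunE => k u w; rewrite scaler_sumr -big_split /=.
by apply: eq_bigr => i _; rewrite fam_linear.
Qed.

Lemma fam_relation c : c \in lker tot -> relation (fam c).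
Proof.
rewrite memv_ker totE => /eqP s0; split=> // i.
by rewrite genP memvZ // memv_line.
Qed.

Lemma relation_fam v : relation v -> exists2 c, c \in lker tot & forall i, fam c i = v i.
Proof.
move=> [vL v0]; have ex i : exists k, v i = k *: gen i.
  by have := vL i; rewrite genP => /vlineP[k ->]; exists k.
pose c : 'rV[K]_b := \row_i projT1 (cid (ex i)).
have cE i : fam c i = v i by rewrite /fam mxE; case: cid.
exists c => //; rewrite memv_ker totE (eq_bigr v) ?v0 // => i _; exact: cE.
Qed.

Lemma limg_tot : limg tot = fullv.
Proof.
apply/eqP; rewrite eqEsubv subvf /= -(window_full PL 0).
apply: windowP => s sa; rewrite add0r.
have sb : (s < b)%N by lia.
have -> : s%:Z = (Ordinal sb : nat)%:Z by [].
rewrite genP -memvE; apply/memv_imgP.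
exists (delta_mx 0 (Ordinal sb)); first exact: memvf.
rewrite totE (bigD1 (Ordinal sb)) //= big1 ?addr0 /fam ?mxE ?eqxx ?scale1r // => j ji.
by rewrite mxE (negbTE ji) andbF scale0r.
Qed.

Lemma dim_lker : \dim (lker tot) = (b - a)%N.
Proof.
have := limg_ker_dim tot fullv; rewrite limg_tot capfv (pl_full PL) => e.
apply: (@addIn a); rewrite e subnK ?(ltnW ab) //.
by rewrite dimvf /= /dim /= mul1n.
Qed.

(** [lap] is known to be linear on relations only; composing with a projection onto [lker tot] gives
    a linear map on the whole coordinate space. *)
Let Lam : 'Hom('rV[K]_b, W) := linfun (fun c => lap (fam (projv (lker tot) c))).

Lemma lap_ext v v' : (forall i, v i = v' i) -> lap v = lap v'.
Proof. by move=> e; congr lap; apply/funext. Qed.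

Lemma LamE c : c \in lker tot -> Lam c = lap (fam c).
Proof.
move=> cK; rewrite [Lam c]linfunE; first by rewrite projv_id.
move=> k u w; rewrite -lap_linear; try exact/fam_relation/memv_proj.
by apply: lap_ext => i; rewrite linearP fam_linear.
Qed.

Lemma Lam_inj c : c \in lker tot -> Lam c = 0 -> c = 0.
Proof.
move=> cK; rewrite LamE // => /(lap_inj (fam_relation cK)) c0.
apply/rowP => i; have /eqP := c0 i.
by rewrite /fam mxE scaler_eq0 (negbTE (gen_neq0 i)) orbF => /eqP.
Qed.

Lemma Lam_cap (U : {vspace 'rV[K]_b}) : (U <= lker tot)%VS -> \dim (Lam @: U) = \dim U.
Proof.
move=> UK; have := limg_ker_dim Lam U; suff -> : (U :&: lker Lam = 0)%VS by rewrite dimv0.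
apply/eqP; rewrite -subv0; apply/subvP => c; rewrite memv_cap memv_ker => /andP[cU /eqP c0].
by rewrite (Lam_inj (subvP UK _ cU) c0) mem0v.
Qed.

Lemma Lam_full : (Lam @: lker tot)%VS = fullv.
Proof.
apply/eqP; rewrite -(dimv_leqif_eq (subvf _)) Lam_cap ?subvv // (pl_full Pl).
by apply/eqP; rewrite dim_lker.
Qed.

Lemma lap_surj x : exists2 v, relation v & lap v = x.
Proof.
have : x \in (Lam @: lker tot)%VS by rewrite Lam_full memvf.
case/memv_imgP => c cK ->; exists (fam c); first exact: fam_relation.
by rewrite LamE.
Qed.

(** Converse of [lap_hyper] by dimension: the relations with vanishing [i]-th component have
    codimension at most 1 and map injectively into the hyperplane, so they fill it. *)
Lemma lap_hyperE v i : relation v -> lap v \in h (i : nat)%:Z -> v i = 0.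
Proof.
move=> vK vH; pose f : 'Hom('rV[K]_b, K^o) := linfun (fun c : 'rV[K]_b => c 0 i : K^o).
have fE (c : 'rV[K]_b) : f c = c 0 i by apply: linfunE => k u w; rewrite !mxE.
pose U := (lker tot :&: lker f)%VS.
have UK : (U <= lker tot)%VS by exact: capvSl.
have sub : (Lam @: U <= h (i : nat)%:Z)%VS.
  apply/subvP => _ /memv_imgP[c cU ->]; have cK := subvP UK _ cU.
  rewrite LamE //; apply: lap_hyper; first exact: fam_relation.
  by move: cU; rewrite memv_cap !memv_ker => /andP[_]; rewrite fE /fam => /eqP ->; rewrite scale0r.
have dU : (\dim (lker tot) <= (\dim U).+1)%N.
  have := limg_ker_dim f (lker tot); rewrite -/U => <-.
  rewrite -[X in (_ <= X)%N]addn1 leq_add2l.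
  by apply: leq_trans (dimvS (subvf _)) _; rewrite dimvf.
have E : (Lam @: U)%VS = h (i : nat)%:Z.
  apply/eqP; rewrite -(dimv_leqif_eq sub) Lam_cap //.
  have := dimvS sub; rewrite Lam_cap // (dim_hyper Pl).
  move: dU; rewrite dim_lker. move: (\dim U) (b - a)%N => d e h1 h2; apply/eqP; lia.
have [c cK cE] := relation_fam vK.
have lc : Lam c = lap v by rewrite LamE //; exact: lap_ext.
move: vH; rewrite -lc -E => /memv_imgP[c' c'U e].
have c'K := subvP UK _ c'U.
have : Lam (c - c') = 0 by rewrite linearB /= e subrr.
move=> /Lam_inj; rewrite rpredB // => /(_ isT) /eqP; rewrite subr_eq0 => /eqP cc.
rewrite -cE cc /fam; move: c'U; rewrite memv_cap memv_ker => /andP[_].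
by rewrite memv_ker fE /fam => /eqP ->; rewrite scale0r.
Qed.

Section SubEta.
Variable P : 'I_b -> {vspace V}.
Hypothesis PE : forall i, P i = L (i : nat)%:Z.
Local Notation Prec := (Config P).
Implicit Types xi : dualv W.

Let ap (U : vectType K) (g : dualv U) (x : U) : K := (g : 'Hom(U, K^o)) x.

(** The transpose construction: [xi] pulled back by [lap] is a functional on relations, extended to
    all families in the form of a sum of functionals [f i], each of which matters on the line [i]
    alone. The class of [f] absorbs the ambiguity. *)
Definition sub_rel xi (y : cspace (gale Prec)) := exists2 f : 'I_b -> dualv V,
  (forall v, relation v -> ap xi (lap v) = \sum_i ap (f i) (v i)) & y = gclass (P := Prec) f.

Lemma annv_line i (g : dualv V) : (g \in gale_hyp Prec i) = (ap g (gen i) == 0).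
Proof.
rewrite /gale_hyp mem_annv /= PE genP -memvE memv_ker.
by [].
Qed.

Lemma functional_gen i (k : K) : exists g : dualv V, ap g (gen i) = k.
Proof.
have [g g1] := exists_functional (gen_neq0 i).
by exists (k *: g); rewrite /ap scale_lfunE g1 /GRing.scale /= mulr1.
Qed.

Lemma sub_rel_linear k xi y xi' y' : sub_rel xi y -> sub_rel xi' y' ->
  sub_rel (k *: xi + xi') (k *: y + y').
Proof.
move=> [f fE ->] [f' fE' ->]; exists (fun i => k *: f i + f' i); last by rewrite gclass_linear.
move=> v vK; rewrite /ap add_lfunE scale_lfunE.
have -> : xi (lap v) = \sum_i ap (f i) (v i) := fE v vK.
have -> : xi' (lap v) = \sum_i ap (f' i) (v i) := fE' v vK.
rewrite scaler_sumr -big_split /=; apply: eq_bigr => i _.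
by rewrite add_lfunE scale_lfunE.
Qed.

Lemma sub_rel_total xi : exists y, sub_rel xi y.
Proof.
have ex i : exists g : dualv V, ap g (gen i) = ap xi (Lam (delta_mx 0 i)).
  exact: functional_gen.
pose f i := projT1 (cid (ex i)).
have fE i : ap (f i) (gen i) = ap xi (Lam (delta_mx 0 i)) by rewrite /f; case: cid.
exists (gclass (P := Prec) f), f => // v vK; have [c cK cE] := relation_fam vK.
have -> : lap v = Lam c by rewrite LamE //; symmetry; exact: lap_ext.
rewrite [in LHS](row_sum_delta c) /ap !linear_sum /=; apply: eq_bigr => i _.
rewrite -cE /fam; transitivity (c 0 i * ap (f i) (gen i)).
  by rewrite fE /ap !linearZ.
by rewrite /ap linearZ.
Qed.

(** A functional on families that kills the relations factors through the sum map [tot]; the factor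
    is the common functional required by [gclass_eq0]. *)
Lemma sub_rel0 y : sub_rel 0 y -> y = 0.
Proof.
move=> [f f0 ->]; apply/gclass_eq0.
pose z : 'Hom('rV[K]_b, K^o) := linfun (fun c : 'rV[K]_b => \sum_i ap (f i) (fam c i) : K^o).
have zE (c : 'rV[K]_b) : z c = \sum_i ap (f i) (fam c i).
  apply: linfunE => k u w; rewrite scaler_sumr -big_split /=; apply: eq_bigr => i _.
  by rewrite fam_linear /ap linearP.
have z0 c : c \in lker tot -> z c = 0.
  by move=> cK; rewrite zE -f0 ?/ap ?lfunE //; exact: fam_relation.
exists ((z \o tot^-1)%VF : dualv V) => i; rewrite annv_line /ap add_lfunE opp_lfunE.
have ti : tot (delta_mx 0 i) = gen i.
  rewrite totE (bigD1 i) //= big1 ?addr0 /fam ?mxE ?eqxx ?scale1r // => j ji.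
  by rewrite mxE (negbTE ji) andbF scale0r.
have zi : z (delta_mx 0 i) = ap (f i) (gen i).
  rewrite zE (bigD1 i) //= big1 ?addr0 /fam ?mxE ?eqxx ?scale1r // => j ji.
  by rewrite mxE (negbTE ji) andbF scale0r /ap linear0.
have e : z (tot^-1%VF (gen i)) = z (delta_mx 0 i).
  have : z (tot^-1%VF (gen i) - delta_mx 0 i) = 0.
    by apply: z0; rewrite memv_ker linearB /= limg_lfunVK ?limg_tot ?memvf // ti subrr.
  by rewrite linearB /= => /eqP; rewrite subr_eq0 => /eqP.
by rewrite comp_lfunE e zi /ap subrr.
Qed.

Lemma sub_eta : exists eta : 'Hom(dualv W, cspace (gale Prec)),
  (forall xi y, sub_rel xi y -> eta xi = y) /\
  forall (Q : 'I_b -> {vspace W}), (forall i, Q i = h (i : nat)%:Z) ->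
    P_iso (P := Config (fun i => annv (Q i))) (Q := gale Prec) eta.
Proof.
have [eta etaE] := linear_relation sub_rel_linear sub_rel_total sub_rel0.
exists eta; split=> // Q QE.
have dq i : \dim {:quotv (gale_hyp Prec i)} = 1%N.
  by apply: dim_annv_quot; rewrite /= PE (pl_line a0 PL).
have dg : \dim {:cspace (gale Prec)} = (b - a)%N.
  have := dim_gale dq; rewrite /gale_V dim_dualv (pl_full PL) => e.
  apply: (@addIn a); rewrite subnK ?(ltnW ab) //; apply: e => g gH.
  apply/lfunP => x; rewrite lfunE /=.
  have /memv_sumP : x \in window L 0 a by rewrite (window_full PL) memvf.
  case=> xs xsL ->; rewrite linear_sum big1 // => s _.
  have sb : (s < b)%N by exact: leq_trans (ltn_ord s) (ltnW ab).
  have := gH (Ordinal sb); rewrite /gale_hyp mem_annv /= PE => /subvP gL.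
  by apply/eqP; rewrite -memv_ker; apply: gL; have := xsL s isT; rewrite add0r.
have inj : lker eta = 0%VS.
  apply/eqP; rewrite -subv0; apply/subvP => xi; rewrite memv_ker => /eqP e0.
  have [y [f fE yE]] := sub_rel_total xi.
  have : eta xi = y by apply: etaE; exists f.
  rewrite e0 yE => /esym/gclass_eq0[g gH]; rewrite memv0; apply/eqP/lfunP => x.
  have [v vK <-] := lap_surj x; rewrite lfunE /=; have := fE v vK; rewrite /ap => ->.
  transitivity (\sum_i ap g (v i)); last by rewrite /ap -(linear_sum (g : 'Hom(V, K^o))) vK.2 linear0.
  apply: eq_bigr => i _; have := gH i; rewrite /gale_hyp mem_annv /= PE => /subvP/(_ (v i)).
  have vL : v i \in L (i : nat)%:Z by apply: vK.1.
  by move=> /(_ vL); rewrite memv_ker add_lfunE opp_lfunE subr_eq0 => /eqP.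
have dl : \dim (limg eta) = (b - a)%N.
  have := limg_ker_dim eta fullv; rewrite inj capv0 dimv0 add0n => ->.
  by rewrite dim_dualv (pl_full Pl).
split=> //= [|i].
  by apply/eqP; rewrite -(dimv_leqif_eq (subvf _)) dl dg.
have dQ : \dim (eta @: annv (Q i)) = 1%N.
  have := limg_ker_dim eta (annv (Q i)); rewrite inj capv0 dimv0 add0n => ->.
  by rewrite QE (dim_annv_hyper _ Pl) ?subn_gt0.
suff sub : (eta @: annv (Q i) <= cline (gale Prec) i)%VS.
  apply/eqP; rewrite -(dimv_leqif_eq sub) dQ eqn_leq -{1}dQ dimvS //=.
  by apply: leq_trans (dim_gale_line _ _) _; rewrite dq.
apply/subvP => _ /memv_imgP[xi + ->]; rewrite QE mem_annv => /subvP xiH.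
have xi0 v : relation v -> v i = 0 -> ap xi (lap v) = 0.
  move=> vK vi; have := xiH _ (lap_hyper vK vi).
  by rewrite memv_ker => /eqP.
(* The [i]-th components of relations lie in one line, so a single relation [v0] accounts for them;
   if they all vanish, the zero family serves. *)
have [v0 v0K v0E] : exists2 v0, relation v0 & forall v, relation v ->
    exists k, v i = k *: v0 i.
  have [[v0 [v0K v0i]]|N] := pselect (exists v, relation v /\ v i != 0); last first.
    exists (fun=> 0); first by split=> [j|]; rewrite ?mem0v // big1.
    move=> v vK; exists 0; rewrite scale0r; apply/eqP; apply: contraT => vi.
    by case: N; exists v.
  exists v0 => // v vK; have := vK.1 i; have := v0K.1 i; rewrite !genP.
  move=> /vlineP[k0 E0] /vlineP[k E]; exists (k / k0).
  rewrite E E0 scalerA divfK //; apply: contraNneq v0i => k00.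
  by rewrite E0 k00 scale0r.
have [g gE] : exists g : dualv V, ap g (v0 i) = ap xi (lap v0).
  have [z|z] := eqVneq (v0 i) 0; first by exists 0; rewrite xi0 // /ap lfunE.
  have [g g1] := exists_functional z; exists (ap xi (lap v0) *: g).
  by rewrite /ap scale_lfunE g1 /GRing.scale /= mulr1.
(* As [xi] kills the hyperplane [i], its value on [lap v] depends on [v i] alone, so a family
   concentrated at [i] represents it. *)
pose f (j : 'I_b) : dualv V := if j == i then g else 0.
have -> : eta xi = gclass (P := Prec) f.
  apply: etaE; exists f => // v vK; rewrite (bigD1 i) //= big1 ?addr0; last first.
    by move=> j /negbTE ji; rewrite /f ji /ap lfunE.
  rewrite /f eqxx; have [k kE] := v0E v vK.
  have : ap xi (lap (fun j => - k *: v0 j + v j)) = 0.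
    apply: xi0; last by rewrite kE scaleNr addNr.
    split=> [j|]; first by rewrite rpredD ?rpredZ //; [apply: v0K.1|apply: vK.1].
    by rewrite big_split /= -scaler_sumr v0K.2 vK.2 scaler0 addr0.
  rewrite lap_linear // /ap linearP /= scaleNr addrC => /eqP; rewrite subr_eq0 => /eqP ->.
  by rewrite kE; transitivity (k * ap g (v0 i)); [rewrite gE|rewrite /ap linearZ].
by apply: gclass_line => j /negbTE ji; rewrite /f ji mem0v.
Qed.
End SubEta.

Section RecEta.
Variable P : 'I_b -> {vspace dualv V}.
Hypothesis PE : forall i, P i = annv (H (i : nat)%:Z).
Local Notation Psub := (Config P).

(* v extended b-periodically to nat. *)
Let vz v (n : nat) : V := v (Ordinal (ltn_pmod n b0)).
Definition psum v (n : nat) : V := \sum_(k < n) vz v k.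

Lemma psumS v n : psum v n.+1 = psum v n + vz v n.
Proof. by rewrite /psum big_ord_recr. Qed.

Lemma psum_period v n : relation v -> psum v (n + b)%N = psum v n.
Proof.
move=> [_ v0]; elim: n => [|n IH].
  rewrite add0n {2}/psum big_ord0 -v0 /psum; apply: eq_bigr => k _; congr v.
  by apply: val_inj; rewrite /= modn_small.
rewrite addSn !psumS IH; congr (_ + v _); apply: val_inj => /=.
by rewrite modnDr.
Qed.

Lemma psum_mod v n : relation v -> psum v (n %% b)%N.+1 = psum v n.+1.
Proof.
move=> vK; rewrite [in RHS](divn_eq n b) -addnS addnC.
elim: (n %/ b)%N => [|q IH]; first by rewrite mul0n addn0.
by rewrite mulSn addnCA addnC psum_period.
Qed.

Lemma vz_line v n : relation v -> vz v n \in L n%:Z.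
Proof. by move=> [vL _]; rewrite -(pl_ord PL); exact: vL. Qed.

(** A discrete primitive of [v], which closes up after one period because the [v i] sum to zero.
    Another starting point changes it by a constant, which [gclass] ignores. *)
Definition rec_fam v i : V := psum v i.+1.

(** The configuration lives in the dual of [V], so its [gale_V] is the bidual; hence [evalv]. *)
Definition rec_class v : cspace (gale Psub) :=
  gclass (P := Psub) (fun i => evalv (rec_fam v i)).

Lemma rec_hyp i x : (evalv x \in gale_hyp Psub i) = (x \in H (i : nat)%:Z).
Proof. by rewrite /gale_hyp /= PE evalv_annv. Qed.

Lemma rec_class_linear k v v' :
  rec_class (fun i => k *: v i + v' i) = k *: rec_class v + rec_class v'.
Proof.
rewrite /rec_class -gclass_linear; congr gclass; apply/funext => i.
rewrite -evalv_linear; congr evalv; rewrite /rec_fam /psum scaler_sumr -big_split.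
by apply: eq_bigr.
Qed.

(* If all partial sums lie in the hyperplanes after a common shift w, they lie in
   smaller and smaller windows, hence are equal to w. *)
Lemma rec_class_inj v : relation v -> rec_class v = 0 -> forall i, v i = 0.
Proof.
move=> vK /gclass_eq0[w0 wH]; have [w wE] := evalv_surj w0.
have yH i : rec_fam v i - w \in H (i : nat)%:Z.
  by rewrite -rec_hyp evalvB wE; exact: wH.
pose y n := psum v n.+1 - w.
have yp n : y (n + b)%N = y n by rewrite /y -addSn psum_period.
have yS n : y n.+1 = y n + vz v n.+1 by rewrite /y psumS addrAC.
have shrink k n : y n \in window L (n%:Z + 1) (a.-1 - k).
  elim: k n => [|k IH] n.
    have := yH (Ordinal (ltn_pmod n b0)); rewrite /rec_fam /= psum_mod // subn0.
    rewrite /y /hyper -(window_modn PL _ (n %/ b)%N).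
    by rewrite (_ : _ + _ = n%:Z + 1) //; have := divn_eq n b; lia.
  (* Periodicity moves the index into the positive range, where the predecessor [y m] is
     available. *)
  suff S m : y m.+1 \in window L (m.+1%:Z + 1) (a.-1 - k.+1).
    have := S (n + b.-1)%N; rewrite -addnS prednK // yp.
    by rewrite PoszD addrAC (window_period PL).
  have [ak|ka] := leqP a.-1 k.
    have e1 : (a.-1 - k)%N = 0%N by apply/eqP; rewrite subn_eq0.
    by have := IH m.+1; rewrite subnS e1.
  have : y m.+1 \in (window L m.+1%:Z (a.-1 - k) :&: window L (m.+1%:Z + 1) (a.-1 - k))%VS.
    rewrite memv_cap IH andbT yS.
    have yL := IH m; rewrite (_ : m%:Z + 1 = m.+1%:Z) in yL; last by lia.
    rewrite rpredD //; apply: subvP (vz_line m.+1 vK).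
    have := @window_sup _ _ L m.+1%:Z (a.-1 - k) 0%N; rewrite addr0; apply.
    by rewrite subn_gt0.
  rewrite (window_cap a0 PL); last by lia.
  by rewrite subnS.
have y0 n : y n = 0.
  by have := shrink a.-1 n; rewrite subnn window0 memv0 => /eqP.
move=> i; have : vz v i = 0.
  have := yS (i + b.-1)%N; rewrite !y0 add0r -addnS prednK // => e.
  by rewrite [RHS]e; congr v; apply: val_inj; rewrite /= modnDr.
by rewrite /vz => <-; congr v; apply: val_inj; rewrite /= modn_small.
Qed.

Definition rec_rel (x : W) (y : cspace (gale Psub)) :=
  exists2 v, relation v /\ lap v = x & y = rec_class v.

Lemma rec_eta : exists eta : 'Hom(W, cspace (gale Psub)),
  (forall v, relation v -> eta (lap v) = rec_class v) /\
  forall (Q : 'I_b -> {vspace W}), (forall i, Q i = l (i : nat)%:Z) ->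
    P_iso (P := Config Q) (Q := gale Psub) eta.
Proof.
have [eta etaE] : exists f : 'Hom(W, cspace (gale Psub)), forall x y, rec_rel x y -> f x = y.
  apply: linear_relation.
  - move=> k x y x' y' [v [vK vx] ->] [v' [v'K v'x] ->].
    exists (fun i => k *: v i + v' i); last by rewrite rec_class_linear.
    split; last by rewrite lap_linear // vx v'x.
    split=> [i|]; first by rewrite rpredD ?rpredZ //; [apply: vK.1|apply: v'K.1].
    by rewrite big_split /= -scaler_sumr vK.2 v'K.2 scaler0 addr0.
  - by move=> x; have [v vK vx] := lap_surj x; exists (rec_class v), v.
  - move=> y [v [vK v0] ->]; have vi := lap_inj vK v0.
    apply/gclass_eq0; exists 0 => i; rewrite subr0 rec_hyp.
    by rewrite /rec_fam /psum big1 ?mem0v // => k _; exact: vi.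
have etaL v : relation v -> eta (lap v) = rec_class v by move=> vK; apply: etaE; exists v.
exists eta; split=> // Q QE.
have dq i : \dim {:quotv (gale_hyp Psub i)} = 1%N.
  by apply: dim_annv_quot; rewrite /= PE (dim_annv_hyper a0 PL).
have dg : \dim {:cspace (gale Psub)} = (b - a)%N.
  have := dim_gale dq; rewrite /gale_V !dim_dualv (pl_full PL) => e.
  apply: (@addIn a); rewrite subnK ?(ltnW ab) //; apply: e => g gH.
  have [x xE] := evalv_surj g; suff x0 : x = 0.
    rewrite -xE x0; apply/lfunP => f; rewrite evalvE [RHS]lfunE /=; exact: linear0.
  have xH i : x \in H (i : nat)%:Z by rewrite -rec_hyp xE.
  have xW k : (k < a)%N -> x \in window L k.+1%:Z (a - k.+1).
    elim: k => [|k IH] ka.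
      by have := xH (Ordinal b0); rewrite /hyper add0r subn1.
    have kb : (k.+1 < b)%N by exact: ltn_trans ka ab.
    have := window_cap_hyper a0 PL 0 (isT : (0 < k.+1)%N) ka; rewrite !add0r => <-.
    by rewrite memv_cap IH ?(ltnW ka) //; exact: (xH (Ordinal kb)).
  have := xW a.-1; rewrite prednK // leqnn subnn window0 memv0 => /(_ isT) /eqP.
  by [].
have inj : lker eta = 0%VS.
  apply/eqP; rewrite -subv0; apply/subvP => x; rewrite memv_ker => /eqP e0.
  have [v vK vx] := lap_surj x; rewrite memv0 -vx.
  have e := etaL v vK; rewrite vx e0 in e; have v0 := rec_class_inj vK (esym e).
  have -> : lap v = lap (fun i => -1 *: v i + v i).
    by apply: lap_ext => i; rewrite v0 scaler0 addr0.
  by rewrite lap_linear // scaleN1r addNr.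
have dl : \dim (limg eta) = (b - a)%N.
  have := limg_ker_dim eta fullv; rewrite inj capv0 dimv0 add0n => ->.
  by rewrite (pl_full Pl).
split=> //= [|i].
  by apply/eqP; rewrite -(dimv_leqif_eq (subvf _)) dl dg.
have dQ : \dim (eta @: Q i) = 1%N.
  have := limg_ker_dim eta (Q i); rewrite inj capv0 dimv0 add0n => ->.
  by rewrite QE (pl_line _ Pl) ?subn_gt0.
suff sub : (eta @: Q i <= cline (gale Psub) i)%VS.
  apply/eqP; rewrite -(dimv_leqif_eq sub) dQ eqn_leq -{1}dQ dimvS //=.
  by apply: leq_trans (dim_gale_line _ _) _; rewrite dq.
apply/subvP => _ /memv_imgP[x xQ ->]; have [v vK vx] := lap_surj x.
(* Subtracting the partial sum that precedes [i] makes all components but the [i]-th vanish. *)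
rewrite -vx etaL // /rec_class -(gclass_shift (P := Psub) _ (evalv (psum v i))).
apply: gclass_line => j ji.
rewrite -evalvB rec_hyp /rec_fam.
(* The line [i] of the transform lies in its hyperplanes [i + s] with [a < s < b], so [lap_hyperE]
   leaves at most [a + 1] consecutive nonzero components, from [i] to [i + a]. *)
have vz0 s : (a < s < b)%N -> vz v (i + s)%N = 0.
  move=> sab; rewrite /vz; apply: lap_hyperE => //=.
  rewrite vx; move: xQ; rewrite QE; apply: subvP.
  rewrite -(pl_period Pl) /hyper -(window_modn Pl _ ((i + s) %/ b)%N).
  have -> : ((i + s) %% b)%N%:Z + 1 + ((i + s) %/ b * b)%N%:Z = (i + s)%N%:Z + 1.
    by have := divn_eq (i + s) b; lia.
  have -> : (i : nat)%:Z + b%:Z = (i + s)%N%:Z + 1 + (b - s).-1%:Z by lia.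
  by apply: window_sup; lia.
pose s := ((j + b - i) %% b)%N.
have sb : (s < b)%N by rewrite ltn_pmod.
have s0 : (0 < s)%N.
  rewrite lt0n; apply: contra ji => /eqP s0; apply/eqP/val_inj => /=.
  have ib := ltn_ord i; have jb := ltn_ord j; have := divn_eq (j + b - i) b.
  rewrite -/s s0 addn0; case: ((j + b - i) %/ b)%N => [|[|q]] /=; nia.
have jE : psum v j.+1 = psum v (i + s).+1.
  have -> : (j : nat) = ((i + s) %% b)%N; last by rewrite psum_mod.
  rewrite modnDmr addnBA; last by rewrite ltnW // (leq_trans (ltn_ord i)) // leq_addl.
  by rewrite addKn modnDr modn_small.
have diff k n : psum v (n + k)%N - psum v n = \sum_(u < k) vz v (n + u)%N.
  elim: k => [|k IH]; first by rewrite addn0 subrr big_ord0.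
  by rewrite addnS psumS big_ord_recr /= -IH addrAC.
have HjE : H (j : nat)%:Z = window L (i + s).+1%:Z a.-1.
  have -> : (j : nat) = ((i + s) %% b)%N.
    rewrite modnDmr addnBA; last by rewrite ltnW // (leq_trans (ltn_ord i)) // leq_addl.
    by rewrite addKn modnDr modn_small.
  rewrite /hyper -(window_modn PL _ ((i + s) %/ b)%N).
  by congr (window L _ _); have := divn_eq (i + s) b; lia.
rewrite jE HjE.
(* The sum from [i] to [i + s] is minus the sum over the rest of the period. Its nonzero terms lie
   in lines after [i + s] and up to [i + a], all contained in the hyperplane of [j] since
   [0 < s]. *)
have tot0 : psum v (i + s).+1 - psum v i = - (psum v (i + b)%N - psum v (i + s).+1).
  by rewrite opprB psum_period.
rewrite tot0 memvN (_ : (i + b)%N = ((i + s).+1 + (b - s.+1))%N) ?diff; last by lia.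
apply: rpred_sum => u _; have [sa|sa] := leqP (s.+1 + u) a.
  apply: subvP (vz_line _ vK); rewrite PoszD; apply: window_sup; lia.
rewrite (_ : ((i + s).+1 + u)%N = (i + (s.+1 + u))%N); last by lia.
rewrite vz0 ?mem0v // sa /=; have := ltn_ord u; lia.
Qed.

End RecEta.

End GaleDuality.
End PeriodicLines.

(** * Formal solutions *)

Section LaurentSeries.
Variable R : realType.
Local Notation C := R[i].
Implicit Types (f g h : int -> C) (n k : int).

Definition lge n f := forall k, k < n -> f k = 0.

Lemma lge_le n n' f : n' <= n -> lge n f -> lge n' f.
Proof. by move=> nn fn k kn; apply: fn; exact: lt_le_trans kn nn. Qed.

Lemma laurent_mulE f g n1 n2 (k : nat) : lge n1 f -> lge n2 g ->
  laurent_mul f g (n1 + n2 + k%:Z) =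
  \sum_(i < k.+1) f (n1 + (i : nat)%:Z) * g (n2 + (k - i)%N%:Z).
Proof.
move=> fn gn; rewrite /laurent_mul.
pose s := [seq n1 + i%:Z | i <- iota 0 k.+1].
have us : uniq s by rewrite map_inj_uniq ?iota_uniq // => i j /addrI [].
rewrite -(@fsbig_widen _ _ _ _ [set` s]) //; last first.
  move=> l [_ /= ls]; rewrite /preimage /=.
  have [ln|nl] := ltP l n1; first by rewrite fn ?mul0r.
  have [lk|kl] := ltP (n1 + n2 + k%:Z - l) n2; first by rewrite gn ?mulr0.
  case: ls; rewrite /s; apply/mapP; exists `|l - n1|%N; last by lia.
  by rewrite mem_iota; lia.
rewrite -fsbig_seq // big_map.
have -> : iota 0 k.+1 = index_iota 0 k.+1 by rewrite /index_iota subn0.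
rewrite big_mkord.
apply: eq_bigr => i _; congr (_ * g _); have := ltn_ord i; lia.
Qed.

Lemma laurent_mul_lge f g n1 n2 : lge n1 f -> lge n2 g -> lge (n1 + n2) (laurent_mul f g).
Proof.
move=> fn gn k kn; rewrite /laurent_mul fsbig1 // => l _.
have [ln|nl] := ltP l n1; first by rewrite fn ?mul0r.
by rewrite gn ?mulr0 //; lia.
Qed.

(** In low degrees products of Laurent series are products of these truncations, so commutativity
    and associativity come from polynomials. *)
Definition trunc f n (N : nat) : {poly C} := \poly_(i < N) f (n + (i : nat)%:Z).

Lemma laurent_mul_trunc f g n1 n2 (k N : nat) : lge n1 f -> lge n2 g -> (k < N)%N ->
  laurent_mul f g (n1 + n2 + k%:Z) = (trunc f n1 N * trunc g n2 N)`_k.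
Proof.
move=> fn gn kN; rewrite laurent_mulE // coefM; apply: eq_bigr => i _.
rewrite !coef_poly !ifT //; first by apply: leq_ltn_trans (leq_subr _ _) kN.
by apply: leq_ltn_trans kN; rewrite -ltnS.
Qed.

Lemma laurent_ext f g n : lge n f -> lge n g ->
  (forall k : nat, f (n + k%:Z) = g (n + k%:Z)) -> f = g.
Proof.
move=> fn gn fg; apply/funext => l; have [ln|nl] := ltP l n; first by rewrite fn ?gn.
by have := fg `|l - n|%N; rewrite (_ : n + _ = l) //; lia.
Qed.

Record lseries := LSeries { lcoef :> int -> C; lcoefP : laurent lcoef }.

HB.instance Definition _ := gen_eqMixin lseries.
HB.instance Definition _ := gen_choiceMixin lseries.

Lemma lseries_eq (x y : lseries) : (forall n, x n = y n) -> x = y.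
Proof.
case: x y => x xP [y yP] /= /funext xy; case: _ / xy in yP *.
by congr LSeries; exact: Prop_irrelevance.
Qed.

Lemma lseriesP (x : lseries) : exists n, lge n x.
Proof. by case: (lcoefP x) => n xn; exists n. Qed.

Lemma laurent_add f g : laurent f -> laurent g -> laurent (fun n => f n + g n).
Proof.
move=> [n fn] [m gm]; exists (Num.min n m) => k; rewrite lt_min => /andP[kn km].
by rewrite fn // gm // addr0.
Qed.
Lemma laurent_opp f : laurent f -> laurent (fun n => - f n).
Proof. by move=> [n fn]; exists n => k kn; rewrite fn ?oppr0. Qed.
Lemma laurent0 : laurent (fun=> 0 : C). Proof. by exists 0. Qed.
Lemma laurent1 : laurent (fun n => (n == 0)%:R : C).
Proof. by exists 0 => k k0; rewrite lt_eqF. Qed.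
Lemma laurent_mulP f g : laurent f -> laurent g -> laurent (laurent_mul f g).
Proof. by move=> [n fn] [m gm]; exists (n + m); exact: laurent_mul_lge. Qed.

Let add (x y : lseries) := LSeries (laurent_add (lcoefP x) (lcoefP y)).
Let opp (x : lseries) := LSeries (laurent_opp (lcoefP x)).
Let mul (x y : lseries) := LSeries (laurent_mulP (lcoefP x) (lcoefP y)).
Let zero := LSeries laurent0.
Let one := LSeries laurent1.

Let addA : associative add.
Proof. by move=> x y z; apply: lseries_eq => n /=; rewrite addrA. Qed.
Let addC : commutative add.
Proof. by move=> x y; apply: lseries_eq => n /=; rewrite addrC. Qed.
Let add0 : left_id zero add.
Proof. by move=> x; apply: lseries_eq => n /=; rewrite add0r. Qed.
Let addN : left_inverse zero opp add.
Proof. by move=> x; apply: lseries_eq => n /=; rewrite addNr. Qed.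

HB.instance Definition _ := GRing.isZmodule.Build lseries addA addC add0 addN.

Let mulC : commutative mul.
Proof.
move=> x y; apply: lseries_eq => l.
have [n xn] := lseriesP x; have [m ym] := lseriesP y.
have H : laurent_mul x y = laurent_mul y x.
  apply: (@laurent_ext _ _ (n + m)).
  - exact: laurent_mul_lge.
  - by rewrite addrC; exact: laurent_mul_lge.
  - move=> k; rewrite (laurent_mul_trunc xn ym (ltnSn k)) mulrC.
    by rewrite -(laurent_mul_trunc ym xn (ltnSn k)) [m + n]addrC.
by rewrite /= H.
Qed.

Lemma trunc_mul f g n m N (P : {poly C}) (k : nat) : lge n f -> lge m g -> (k < N)%N ->
  (trunc (laurent_mul f g) (n + m) N * P)`_k = (trunc f n N * trunc g m N * P)`_k.
Proof.
move=> fn gm kN; rewrite !coefM; apply: eq_bigr => i _; congr (_ * _).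
have iN : (i < N)%N by apply: leq_ltn_trans kN; rewrite -ltnS.
by rewrite coef_poly iN (laurent_mul_trunc fn gm iN).
Qed.

Let mulA : associative mul.
Proof.
move=> x y z; apply: lseries_eq => l.
have [n xn] := lseriesP x; have [m ym] := lseriesP y; have [p zp] := lseriesP z.
have H : laurent_mul x (laurent_mul y z) = laurent_mul (laurent_mul x y) z.
  apply: (@laurent_ext _ _ (n + m + p)).
  - by rewrite -addrA; apply: laurent_mul_lge => //; exact: laurent_mul_lge.
  - by apply: laurent_mul_lge => //; exact: laurent_mul_lge.
  - move=> k; rewrite -[n + m + p in LHS]addrA.
    rewrite (laurent_mul_trunc xn (laurent_mul_lge ym zp) (ltnSn k)) mulrC trunc_mul //.
    rewrite (laurent_mul_trunc (laurent_mul_lge xn ym) zp (ltnSn k)) trunc_mul //.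
    by rewrite mulrC mulrA.
by rewrite /= H.
Qed.

Let mul1 : left_id one mul.
Proof.
move=> x; apply: lseries_eq => l; have [n xn] := lseriesP x.
have o1 : lge 0 one by move=> k k0; rewrite /= lt_eqF.
have H : laurent_mul one x = x.
  apply: (@laurent_ext _ _ n) => // [|k].
    by have := laurent_mul_lge o1 xn; rewrite add0r.
  rewrite -[n in LHS]add0r (laurent_mulE _ o1 xn) big_ord_recl big1 ?addr0 /=.
    by rewrite mul1r subn0.
  by move=> i _; rewrite mul0r.
by rewrite /= H.
Qed.

Let mulD : left_distributive mul add.
Proof.
move=> x y z; apply: lseries_eq => l.
have [n0 xn0] := lseriesP x; have [m0 ym0] := lseriesP y; have [p zp] := lseriesP z.
pose n := Num.min n0 m0.
have xn : lge n x by apply: lge_le xn0; rewrite ge_min lexx.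
have yn : lge n y by apply: lge_le ym0; rewrite ge_min lexx orbT.
have an : lge n (add x y) by move=> k kn /=; rewrite xn // yn // addr0.
have H : laurent_mul (add x y) z = (fun l => laurent_mul x z l + laurent_mul y z l).
  apply: (@laurent_ext _ _ (n + p)).
  - exact: laurent_mul_lge.
  - by move=> k kn; rewrite !(laurent_mul_lge _ zp kn) ?addr0.
  - move=> k; rewrite !laurent_mulE // -big_split /=; apply: eq_bigr => i _.
    by rewrite mulrDl.
by rewrite /= H.
Qed.

Let one0 : one != zero.
Proof.
apply/eqP => /(congr1 (fun x : lseries => x 0)) /= /eqP.
by rewrite oner_eq0.
Qed.

HB.instance Definition _ :=
  GRing.Zmodule_isComNzRing.Build lseries mulA mulC mul1 mulD one0.

Lemma lcoefD (x y : lseries) n : (x + y) n = x n + y n. Proof. by []. Qed.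
Lemma lcoefN (x : lseries) n : (- x) n = - x n. Proof. by []. Qed.
Lemma lcoef0 n : (0 : lseries) n = 0. Proof. by []. Qed.
Lemma lcoef1 n : (1 : lseries) n = (n == 0)%:R. Proof. by []. Qed.
Lemma lcoefM (x y : lseries) n : (x * y) n = laurent_mul x y n. Proof. by []. Qed.

Lemma lcoef_sum (I : Type) (r : seq I) (P : pred I) (F : I -> lseries) n :
  (\sum_(i <- r | P i) F i) n = \sum_(i <- r | P i) F i n.
Proof. by elim/big_rec2 : _ => // i y x _ <-. Qed.

Lemma lord_exists (x : lseries) : x != 0 -> exists2 n, lge n x & x n != 0.
Proof.
move=> x0; have [n0 xn0] := lseriesP x.
have ex : exists k : nat, x (n0 + k%:Z) != 0.
  apply: contrapT => N; move/eqP: x0; apply; apply: lseries_eq => l.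
  have [ln|nl] := ltP l n0; first by rewrite xn0.
  apply/eqP; apply: contraT => xl; case: N; exists `|l - n0|%N.
  by rewrite (_ : _ + _ = l) //; lia.
case: (ex_minnP ex) => k xk kmin; exists (n0 + k%:Z) => // l ln.
have [ln0|nl] := ltP l n0; first by rewrite xn0.
apply/eqP; apply: contraT => xl.
have := kmin `|l - n0|%N; rewrite (_ : n0 + `|l - n0|%N%:Z = l); last by lia.
by move=> /(_ xl); lia.
Qed.

Lemma lead_mul (x y : lseries) n m : lge n x -> lge m y -> (x * y) (n + m) = x n * y m.
Proof.
by move=> xn ym; rewrite lcoefM -[n + m]addr0 (laurent_mulE 0 xn ym) big_ord1 !addr0.
Qed.

(** The coefficients of the inverse of a power series, each solved for from the preceding ones. *)
Fixpoint invseq (c : nat -> C) (k : nat) : seq C :=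
  if k is k'.+1 then
    let s := invseq c k' in
    rcons s (((k' == 0%N)%:R - \sum_(i < k') c (k' - i)%N * s`_i) / c 0%N)
  else [::].

Lemma size_invseq c (k : nat) : size (invseq c k) = k.
Proof. by elim: k => //= k IH; rewrite size_rcons IH. Qed.

Lemma nth_invseq c (k j i : nat) : (i < k)%N -> (k <= j)%N -> (invseq c j)`_i = (invseq c k)`_i.
Proof.
move=> ik; elim: j => [|j IH]; first by lia.
rewrite leq_eqVlt => /orP[/eqP -> //|]; rewrite ltnS => kj.
by rewrite /= nth_rcons size_invseq (leq_trans ik kj) IH.
Qed.

Definition invcoef c (k : nat) := (invseq c k.+1)`_k.

Lemma invcoefE c (k : nat) : c 0%N != 0 ->
  \sum_(i < k.+1) c (k - i)%N * invcoef c i = (k == 0%N)%:R.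
Proof.
move=> c0; rewrite big_ord_recr /= subnn /invcoef /=.
rewrite nth_rcons size_invseq ltnn eqxx mulrC divfK //.
rewrite [X in X + _](_ : _ = \sum_(i < k) c (k - i)%N * (invseq c k)`_i).
  by rewrite addrC subrK.
apply: eq_bigr => i _; rewrite (@nth_invseq c i.+1 k i) //.
Qed.

Lemma inv_exists (x : lseries) : x != 0 -> exists y : lseries, y * x = 1.
Proof.
move=> /lord_exists[n xn x0].
pose c (k : nat) := x (n + k%:Z).
have c0 : c 0%N != 0 by rewrite /c addr0.
pose g (l : int) : C := if 0 <= l + n then invcoef c (absz (l + n)) else 0.
have gn : lge (- n) g by move=> l ln; rewrite /g ifF //; apply/negbTE; lia.
have gP : laurent g by exists (- n).
exists (LSeries gP); apply: lseries_eq => l; rewrite lcoefM lcoef1.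
have H : laurent_mul g x = (fun l => (l == 0)%:R).
  apply: (@laurent_ext _ _ 0).
  - by have := laurent_mul_lge gn xn; rewrite addNr.
  - by move=> k k0; rewrite lt_eqF.
  - move=> k; rewrite -{1}(addNr n) laurent_mulE // add0r -[RHS](invcoefE k c0).
    apply: eq_bigr => i _; rewrite mulrC; congr (_ * _).
    by rewrite /g addrAC addNr add0r.
by rewrite /= H.
Qed.

Let inv (x : lseries) : lseries :=
  if pselect (exists y, y * x = 1) is left ex then projT1 (cid ex) else 0.

Let mulV x : x != 0 -> inv x * x = 1.
Proof. by move=> /inv_exists ex; rewrite /inv; case: pselect => // e; case: cid. Qed.

Let inv0 : inv 0 = 0.
Proof.
rewrite /inv; case: pselect => // ex; exfalso; case: ex => y; rewrite mulr0 => /esym/eqP.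
by rewrite oner_eq0.
Qed.

HB.instance Definition _ := GRing.ComNzRing_isField.Build lseries mulV inv0.

End LaurentSeries.

Section Derivation.
Variable R : realType.
Local Notation C := R[i].
Local Notation K := (lseries R).
Implicit Types (x y : K) (n : int).

Lemma laurent_mono (c : C) n : laurent (fun l => c * (l == n)%:R).
Proof. by exists n => k kn; rewrite lt_eqF ?mulr0. Qed.
Definition lmono c n : K := LSeries (laurent_mono c n).

Lemma lge_mono c n : lge n (lmono c n).
Proof. by move=> k kn; rewrite /= lt_eqF ?mulr0. Qed.

Lemma lmonoM c n x l : (lmono c n * x) l = c * x (l - n).
Proof.
have [p xp] := lseriesP x.
have H : lmono c n * x = LSeries (laurent_mulP (lcoefP (lmono c n)) (lcoefP x)) by apply: lseries_eq.
have [lt|ge] := ltP l (n + p).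
  by rewrite lcoefM (laurent_mul_lge (@lge_mono c n) xp lt) xp ?mulr0 //; lia.
rewrite lcoefM (_ : l = n + p + (absz (l - n - p)%R)%:Z); last by lia.
rewrite (laurent_mulE _ (@lge_mono c n) xp) big_ord_recl /= addr0 eqxx mulr1 big1 ?addr0.
  congr (_ * x _); lia.
move=> i _; rewrite (_ : (_ == n) = false) ?mulr0 ?mul0r //.
by apply/negbTE; rewrite /bump /=; lia.
Qed.

Variable r : nat.

Lemma laurent_der x : laurent (fun n => - ((n - r%:Z)%:~R / r%:R) * x (n - r%:Z)).
Proof.
have [p xp] := lseriesP x; exists (p + r%:Z) => k kp; rewrite xp ?mulr0 //; lia.
Qed.
(** The derivation [d/dz] for [t = z^(-1/r)]: it sends [t^n] to [- (n/r) t^(n + r)]. *)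
Definition lder x : K := LSeries (laurent_der x).

Lemma lderE x n : lder x n = - ((n - r%:Z)%:~R / r%:R) * x (n - r%:Z). Proof. by []. Qed.

Lemma lge_der x n : lge n x -> lge (n + r%:Z) (lder x).
Proof. by move=> xn k kn; rewrite lderE xn ?mulr0 //; lia. Qed.

Lemma lderD x y : lder (x + y) = lder x + lder y.
Proof. by apply: lseries_eq => n; rewrite lcoefD !lderE lcoefD mulrDr. Qed.

Lemma lder0 : lder 0 = 0.
Proof. by apply: lseries_eq => n; rewrite lderE lcoef0 mulr0. Qed.

Lemma lder_sign (s : bool) : lder ((-1) ^+ s) = 0.
Proof.
apply: lseries_eq => n; rewrite lderE lcoef0.
have [->|n0] := eqVneq n r%:Z; first by rewrite subrr mul0r oppr0 mul0r.
case: s; rewrite ?expr0 ?expr1 ?lcoefN lcoef1 subr_eq0 (negbTE n0) ?oppr0 mulr0 //.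
Qed.

Lemma lder1 : lder 1 = 0.
Proof. exact: (lder_sign false). Qed.

Lemma lderM x y : lder (x * y) = lder x * y + x * lder y.
Proof.
have [n xn] := lseriesP x; have [p yp] := lseriesP y; apply: lseries_eq => l.
have xn' := lge_der xn; have yp' := lge_der yp.
rewrite lcoefD lderE !lcoefM.
have [lt|ge] := ltP l (n + p + r%:Z).
  rewrite (laurent_mul_lge xn yp) ?mulr0; last by lia.
  rewrite (laurent_mul_lge xn' yp) ?(laurent_mul_lge xn yp') ?addr0 //; lia.
pose k := absz (l - (n + p + r%:Z))%R.
have -> : l - r%:Z = n + p + k%:Z by rewrite /k; lia.
rewrite (_ : laurent_mul (lder x) y l = laurent_mul (lder x) y (n + r%:Z + p + k%:Z)); last first.
  by congr (laurent_mul _ _ _); rewrite /k; lia.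
rewrite (_ : laurent_mul x (lder y) l = laurent_mul x (lder y) (n + (p + r%:Z) + k%:Z)); last first.
  by congr (laurent_mul _ _ _); rewrite /k; lia.
rewrite !laurent_mulE // mulr_sumr -big_split /=; apply: eq_bigr => i _.
have -> : n + r%:Z + (i : nat)%:Z - r%:Z = n + (i : nat)%:Z by lia.
have -> : p + r%:Z + (k - i)%N%:Z - r%:Z = p + (k - i)%N%:Z by lia.
have -> : (n + p + k%:Z)%:~R = (n + (i : nat)%:Z)%:~R + (p + (k - i)%N%:Z)%:~R :> C.
  by rewrite -intrD; congr (_%:~R); have := ltn_ord i; lia.
by move: (x _) (y _) (_%:~R) (_%:~R) (r%:R^-1) => *; ring.
Qed.

Lemma lder_det (n : nat) (M N A : 'M[K]_n) : (forall i j, lder (M i j) = N i j) ->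
  N = M *m A -> lder (\det M) = \tr A * \det M.
Proof.
move=> MN NE.
apply: (@jacobi unit K tt (fun f d => lder (f tt) = d) _ _ _ _ n (fun=> M) N A) => //.
- exact: lder_sign.
- exact: lder0.
- by move=> f g d d' <- <-; exact: lderD.
- by move=> f g d d' <- <-; exact: lderM.
Qed.

(** [lder] raises orders by at least [r], and orders add in products. *)
Lemma lge_logder x y : x != 0 -> lder x = y * x -> lge r%:Z y.
Proof.
move=> x0 xy; have [->|y0] := eqVneq y 0; first by move=> k _; rewrite lcoef0.
have [n xn xn0] := lord_exists x0; have [p yp yp0] := lord_exists y0.
have [pr|] := ltP p r%:Z; last by move=> rp; apply: lge_le yp.
have := lead_mul yp xn; rewrite -xy (lge_der xn); last by lia.
by move=> /esym/eqP; rewrite mulf_eq0 (negbTE xn0) (negbTE yp0).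
Qed.

(* The series variable is t = z^(-1/r). *)
Definition lpoly (p : {poly C}) : K := \sum_(k < size p) lmono p`_k (- (r%:Z * (k : nat)%:Z)).

Lemma lpolyE p (l : nat) : (0 < r)%N -> lpoly p (- (r%:Z * l%:Z)) = p`_l.
Proof.
move=> r0; rewrite /lpoly lcoef_sum /=.
have [lp|pl] := ltnP l (size p); last first.
  rewrite nth_default // big1 // => k _; rewrite (_ : (_ == _) = false) ?mulr0 //.
  apply/negbTE/eqP => /oppr_inj/mulfI H; have /H [lk] : r%:Z != 0 by lia.
  by move: (ltn_ord k); rewrite -lk ltnNge pl.
rewrite (bigD1 (Ordinal lp)) //= eqxx mulr1 big1 ?addr0 // => k kl.
rewrite (_ : (_ == _) = false) ?mulr0 //.
apply/negbTE/eqP => /oppr_inj/mulfI H; have /H [lk] : r%:Z != 0 by lia.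
by move/eqP: kl; apply; apply: val_inj.
Qed.

Lemma lpoly_sum (I : finType) (F : I -> {poly C}) (l : nat) : (0 < r)%N ->
  (\sum_i lpoly (F i)) (- (r%:Z * l%:Z)) = (\sum_i F i)`_l.
Proof.
by move=> r0; rewrite lcoef_sum coef_sum; apply: eq_bigr => i _; rewrite lpolyE.
Qed.

Lemma lpoly_eq0 p : (0 < r)%N -> lpoly p = 0 -> p = 0.
Proof.
by move=> r0 p0; apply/polyP => l; rewrite -(lpolyE _ _ r0) p0 lcoef0 coef0.
Qed.

Lemma lpolyB p q : (0 < r)%N -> lpoly (p - q) = lpoly p - lpoly q.
Proof.
move=> r0; have E (p' : {poly C}) N : (size p' <= N)%N ->
    lpoly p' = \sum_(k < N) lmono p'`_k (- (r%:Z * (k : nat)%:Z)).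
  move=> sN; rewrite /lpoly -!(big_mkord predT (fun k => lmono p'`_k (- (r%:Z * k%:Z)))).
  rewrite [RHS](@big_cat_nat _ _ _ (size p')) //= [X in _ + X]big_nat_cond.
  rewrite [X in _ + X]big1 ?addr0 // => k /andP[/andP[sk _] _].
  by apply: lseries_eq => n /=; rewrite nth_default // mul0r.
pose N := maxn (size (p - q)) (maxn (size p) (size q)).
rewrite !(E _ N) /N ?leq_max ?leqnn ?orbT // -sumrN -big_split /=.
apply: eq_bigr => k _; apply: lseries_eq => n.
by rewrite lcoefD lcoefN /= coefB mulrBl.
Qed.

End Derivation.

Section FormalSolutions.
Variables (R : realType) (Th : irr_class) (E : weyl_module R).
Local Notation C := R[i].
Local Notation K := (lseries R).
Local Notation r := (ic_rank Th).
Local Notation b := (ic_num Th).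
Hypothesis r0 : (0 < r)%N.

Section OneSolution.
Variables (i : int) (lam : C) (Y : E -> int -> C).
Hypothesis YP : formal_solution Th i lam Y.

Let YL m : laurent (Y m). Proof. by case: YP. Qed.
Definition fsol m : K := LSeries (YL m).
(** Logarithmic derivative of [exp(q_i) z^lam], written in [t]. *)
Definition fexp : K := lmono lam r%:Z + lmono (b%:R / r%:R * expfac_coef R Th i) (r%:Z - b%:Z).

Lemma fsol_linear k m m' : fsol (k *: m + m') = lmono k 0 * fsol m + fsol m'.
Proof.
apply: lseries_eq => n; rewrite lcoefD lmonoM subr0 /=; case: YP => _ Y2 _ _.
exact: Y2.
Qed.

Lemma fsol0 : fsol 0 = 0.
Proof.
have := fsol_linear (-1) 0 0; rewrite scaler0 addr0 => ->; apply: lseries_eq => n.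
by rewrite lcoefD lmonoM subr0 mulN1r addNr.
Qed.

Lemma fsol_sum (I : Type) (s : seq I) (F : I -> E) : fsol (\sum_(j <- s) F j) = \sum_(j <- s) fsol (F j).
Proof.
elim: s => [|j s IH]; first by rewrite !big_nil fsol0.
rewrite !big_cons -IH -[F j in LHS]scale1r fsol_linear; congr (_ + _).
by apply: lseries_eq => n; rewrite lmonoM subr0 mul1r.
Qed.

Lemma fsolZ k m : fsol (k *: m) = lmono k 0 * fsol m.
Proof. by rewrite -[k *: m]addr0 fsol_linear fsol0 addr0. Qed.

Lemma fsol_z m : fsol (wm_z m) = lmono 1 (- r%:Z) * fsol m.
Proof.
apply: lseries_eq => n; rewrite lmonoM mul1r opprK /=; case: YP => _ _ Y3 _.
exact: Y3.
Qed.

Lemma fsol_d m : fsol (wm_d m) = lder r (fsol m) + fexp * fsol m.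
Proof.
apply: lseries_eq => n; rewrite mulrDl !lcoefD !lmonoM lderE /=; case: YP => _ _ _ Y4.
rewrite Y4 (_ : n - (r%:Z - b%:Z) = n - r%:Z + b%:Z) ; last by lia.
by rewrite -!pmulrn; move: (Y m _) (Y m _) (r%:R^-1) => *; ring.
Qed.

Lemma fsol_poly p m : fsol (wm_poly p m) = lpoly r p * fsol m.
Proof.
rewrite /wm_poly fsol_sum /lpoly mulr_suml; apply: eq_bigr => k _.
rewrite fsolZ; apply: lseries_eq => n; rewrite !lmonoM subr0; congr (_ * _).
rewrite opprK; move: n; elim: (k : nat) => [|j IH] n; first by rewrite mulr0 addr0.
rewrite iterS fsol_z lmonoM mul1r opprK IH; congr (lcoef _ _); lia.
Qed.

End OneSolution.

Lemma expfac_coef_sum : (1 < r)%N -> \sum_(i < r) expfac_coef R Th (i : nat)%:Z = 0.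
Proof.
move=> r1; rewrite /expfac_coef -mulr_sumr.
pose w : C := polar 1 (2 * pi / r%:R).
have wE (i : nat) : polar 1 (2 * pi * i%:Z%:~R / r%:R) = w ^+ i.
  have iE : i%:Z%:~R = i%:R :> R by [].
  rewrite /w polarX expr1n; congr (polar _ _); rewrite iE; ring.
under eq_bigr => i _ do rewrite wE.
have w1 : w ^+ r = 1.
  rewrite /w polarX expr1n [_ * (_ / _)](_ : _ = 2 * pi); last first.
    by have : r%:R != 0 :> R by [rewrite pnatr_eq0 -lt0n]; move: (pi : R) => q rn0; field.
  by rewrite /polar [2 * pi]mulr_natl cos2pi sin2pi mulr1 mulr0.
have wn1 : w != 1.
  rewrite /w /polar; apply/eqP => -[/eqP]; rewrite mul1r => /eqP c1 _.
  have p0 := pi_gt0 R; have rR : 2 <= r%:R :> R by rewrite ler_nat.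
  have rR0 : 0 < r%:R :> R by apply: lt_le_trans rR.
  have : cos (2 * pi / r%:R : R) < cos 0.
    have h : 2 * pi / r%:R <= pi :> R by rewrite ler_pdivrMr // mulrC ler_wpM2l // ltW.
    have h0 : 0 < 2 * pi / r%:R :> R by rewrite divr_gt0 ?mulr_gt0.
    by rewrite ltr_cos // in_itv /= ?lexx ?h ?(ltW h0) ?(ltW p0).
  by rewrite cos0 c1 ltxx.
have /eqP : (w - 1) * \sum_(i < r) w ^+ i = 0 by rewrite -subrX1 w1 subrr.
by rewrite mulf_eq0 subr_eq0 (negbTE wn1) /= => /eqP ->; rewrite mulr0.
Qed.

(** The coefficient of the sum of the exponential factors: they are proportional to all [r]-th roots
    of unity, whose sum is zero unless [r = 1]. *)
Definition trace_sign : C := if r == 1%N then (-1) ^+ ic_neg Th else 0.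

Lemma trace_coef_sum : \sum_(i < r) b%:R / r%:R * expfac_coef R Th (i : nat)%:Z = trace_sign * b%:R.
Proof.
rewrite -mulr_sumr /trace_sign; have [r1|nr1] := eqVneq r 1%N; last first.
  by rewrite expfac_coef_sum ?mulr0 ?mul0r //; lia.
rewrite (eq_bigr (fun=> (-1) ^+ ic_neg Th)); last first.
  move=> i _; have -> : (i : nat) = 0%N by have := ltn_ord i; lia.
  by rewrite /expfac_coef mulr0 mul0r /polar cos0 sin0 mulr0 mulr1 (_ : 1 +i* 0 = 1) ?mulr1.
by rewrite sumr_const card_ord r1 mulr1n divr1 mulrC.
Qed.

Lemma lmono_sum (I : finType) (F : I -> C) n : \sum_i lmono (F i) n = lmono (\sum_i F i) n.
Proof. by apply: lseries_eq => l; rewrite lcoef_sum /= mulr_suml. Qed.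

(** In the gauge of the formal solutions the trace is the sum of the [fexp] up to a logarithmic
    derivative, of order at least [r]. Being a polynomial in [z], the trace is then determined by
    the exponential factors. *)
Lemma trace_conn : (0 < b)%N -> irregular_class Th E ->
  exists (e : 'I_r -> E) (eP : wm_basis e),
    forall x, \sum_j (conn eP j j).[x] = trace_sign * (b%:R * x ^+ b.-1).
Proof.
move=> b0 [e [eP [lam [Y [YP [H [HL HP]]]]]]]; exists e, eP.
pose M : 'M[K]_r := \matrix_(i, j) fsol (YP i) (e j).
pose Hm : 'M[K]_r := \matrix_(j, l) LSeries (HL j l).
have MH : M *m Hm = 1%:M.
  apply/matrixP => i l; apply: lseries_eq => n; rewrite !mxE lcoef_sum.
  transitivity (\sum_j laurent_mul (Y i (e j)) (H j l) n).
    by apply: eq_bigr => j _; rewrite !mxE lcoefM.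
  rewrite HP; by case: (i == l) => /=; rewrite ?mulr1n ?mulr0n ?lcoef0 ?lcoef1.
have Mu : M \in unitmx by case/mulmx1_unit: MH.
pose A : 'M[K]_r := (\matrix_(j, k) lpoly r (conn eP j k))^T.
pose Psi : 'M[K]_r := diag_mx (\row_i fexp (i : nat)%:Z (lam i)).
(* The matrix [M] satisfies [M' = M A - Psi M = M A'], so Jacobi's formula makes [\tr A'] the
   logarithmic derivative of [\det M]. *)
pose A' := A - invmx M *m Psi *m M.
have dM : lder r (\det M) = \tr A' * \det M.
  apply: (@lder_det _ r r M (\matrix_(i, j) lder r (M i j)) A'); first by move=> i j; rewrite mxE.
  rewrite /A' mulmxBr !mulmxA mulmxV // mul1mx; apply/matrixP => i j.
  rewrite !mxE; have := fsol_d (YP i) (e j).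
  rewrite (connE eP j) fsol_sum.
  under eq_bigr => k _ do rewrite fsol_poly.
  move=> /eqP; rewrite -subr_eq => /eqP <-; congr (_ - _).
    by apply: eq_bigr => k _; rewrite !mxE mulrC.
  rewrite (bigD1 i) //= big1 ?addr0; first by rewrite !mxE eqxx mulr1n.
  by move=> k ki; rewrite !mxE eq_sym (negbTE ki) mulr0n mul0r.
have dM0 : \det M != 0 by rewrite -unitfE -unitmxE.
have trA' : \tr A' = \tr A - \sum_(i < r) fexp (i : nat)%:Z (lam i).
  rewrite /A' linearB /= mxtrace_mulC mulmxA mulmxV // mul1mx mxtrace_diag; congr (_ - _).
  by apply: eq_bigr => i _; rewrite mxE.
(* Order at least [r] leaves no terms in [z^l] with [l >= 0], and in these degrees the exponents
   [lam i] do not contribute. *)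
have := lge_logder dM0 dM; rewrite trA' => tA.
have trE : \sum_j conn eP j j = (trace_sign * b%:R) *: 'X^(b.-1).
  apply/polyP => l; rewrite coefZ coefXn -(lpoly_sum _ _ r0).
  have -> : \sum_j lpoly r (conn eP j j) = \tr A by apply: eq_bigr => j _; rewrite !mxE.
  have /eqP := tA (- (r%:Z * l%:Z)) ltac:(lia).
  rewrite lcoefD lcoefN subr_eq0 => /eqP ->.
  rewrite /fexp big_split /= !lmono_sum trace_coef_sum /=.
  rewrite [X in X + _](_ : _ = 0) ?add0r; last first.
    by rewrite (_ : (_ == _) = false) ?mulr0 //; apply/negbTE; lia.
  rewrite /trace_sign; have [r1|_] := eqVneq r 1%N; last by rewrite !mul0r.
  by rewrite r1; congr (_ * _%:R); apply/eqP/eqP; lia.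
move=> x; rewrite -horner_sum trE hornerZ hornerXn; ring.
Qed.

End FormalSolutions.

Section Independence.
Variables (R : realType) (Th : irr_class) (E : weyl_module R).
Local Notation C := R[i].
Local Notation K := (lseries R).
Local Notation r := (ic_rank Th).
Local Notation b := (ic_num Th).
Hypothesis (r0 : (0 < r)%N) (rb : (r < b)%N).
Variables (lam : 'I_r -> C) (Y : 'I_r -> E -> int -> C).
Hypothesis YP : forall i : 'I_r, formal_solution Th (i : nat)%:Z (lam i) (Y i).
Hypothesis Y0 : forall i, exists m n, Y i m n != 0.
Local Notation ps i := (fexp Th (i : nat)%:Z (lam i)).

Lemma expfac_coef_inj (i j : 'I_r) :
  expfac_coef R Th (i : nat)%:Z = expfac_coef R Th (j : nat)%:Z -> i = j.
Proof.
move=> /mulfI; rewrite expf_eq0 oppr_eq0 oner_eq0 andbF => /(_ isT).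
wlog ij : i j / (i < j)%N => [H e|].
  have [ij|ji|/val_inj //] := ltngtP i j; first exact: H ij e.
  by rewrite (H _ _ ji (esym e)).
have rR : r%:R != 0 :> R by rewrite pnatr_eq0 -lt0n.
rewrite /polar !mul1r => -[ce se]; exfalso.
pose d : R := 2 * pi * (j : nat)%:Z%:~R / r%:R - 2 * pi * (i : nat)%:Z%:~R / r%:R.
have cd : cos d = 1 by rewrite /d cosB ce se -!expr2 cos2Dsin2.
have dE : d / 2 = pi * ((j - i)%N%:R / r%:R).
  rewrite /d natrB ?(ltnW ij) // -!pmulrn; move: (pi : R) => q; by field.
have p0 := pi_gt0 R; have rR0 : 0 < r%:R :> R by rewrite ltr0n.
have : 0 < sin (d / 2).
  apply: sin_gt0_pi; rewrite dE mulr_gt0 ?divr_gt0 ?ltr0n ?subn_gt0 //=.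
  rewrite gtr_pMr // ltr_pdivrMr // mul1r ltr_nat.
  by have := ltn_ord j; lia.
have := cosD (d / 2) (d / 2); rewrite -splitr cd -!expr2 => e1 s0.
have := cos2Dsin2 (d / 2); move: e1 s0; move: (cos (d / 2)) (sin (d / 2)) => u v; nra.
Qed.

(* Solutions with distinct exponents are linearly independent over the
   Laurent series: a shortest relation h, normalised by h_i0 = 1, is killed by
   differentiation, so that h_i' = (psi_i - psi_i0) h_i, which is impossible
   as psi_i - psi_i0 has negative order. *)
Lemma fsol_free (h : 'I_r -> K) :
  (forall m, \sum_i h i * fsol (YP i) m = 0) -> forall i, h i = 0.
Proof.
move=> h0; have [N] := ubnP #|[pred i | h i != 0]|.
elim: N h h0 => // N IH h h0 cN i0; apply/eqP; apply: contraT => hi0.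
pose g i := (h i0)^-1 * h i.
have g0 m : \sum_i g i * fsol (YP i) m = 0.
  transitivity ((h i0)^-1 * \sum_i h i * fsol (YP i) m); last by rewrite h0 mulr0.
  by rewrite mulr_sumr; apply: eq_bigr => i _; rewrite mulrA.
have gi0 : g i0 = 1 by rewrite /g mulVf.
have gh i : g i != 0 -> h i != 0 by rewrite /g; apply: contraNneq => ->; rewrite mulr0.
pose k (i : 'I_r) := (ps i - ps i0) * g i - lder r (g i).
have k0 m : \sum_i k i * fsol (YP i) m = 0.
  have d0 : lder r (\sum_i g i * fsol (YP i) m) = 0 by rewrite g0 lder0.
  have dS : lder r (\sum_i g i * fsol (YP i) m) = \sum_i lder r (g i * fsol (YP i) m).
    by apply: (big_morph _ (@lderD R r) (@lder0 R r)).
  have := g0 (wm_d m); rewrite -[RHS](subrr (\sum_i g i * fsol (YP i) (wm_d m))).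
  move=> gd; have -> : \sum_i k i * fsol (YP i) m =
     \sum_i g i * fsol (YP i) (wm_d m) - ps i0 * (\sum_i g i * fsol (YP i) m)
     - lder r (\sum_i g i * fsol (YP i) m).
    rewrite dS mulr_sumr -!sumrB; apply: eq_bigr => i _.
    by rewrite fsol_d // lderM /k; ring.
  by rewrite d0 !g0 mulr0 !subr0.
have ki0 : k i0 = 0 by rewrite /k subrr mul0r gi0 lder1 subr0.
have kz : forall i, k i = 0.
  apply: (IH _ k0); rewrite ltnS in cN; apply: leq_trans cN; apply: proper_card; apply/properP; split.
    apply/fintype.subsetP => i; rewrite !inE; apply: contraNneq => hi.
    have gi : g i = 0 by rewrite /g hi mulr0.
    by rewrite /k gi mulr0 lder0 subr0.
  exists i0; rewrite !inE; first exact: hi0.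
  by rewrite negbK; apply/eqP; exact: ki0.
have gz i : i != i0 -> g i = 0.
  move=> ii0; apply/eqP; apply: contraT => gi.
  have [n gn gn0] := lord_exists gi.
  have /eqP := kz i; rewrite /k subr_eq0 => /eqP kE.
  pose q := fexp Th (i : nat)%:Z (lam i) - ps i0.
  have ql : lge (r%:Z - b%:Z) q.
    move=> l lr; rewrite lcoefD lcoefN !lcoefD /=.
    have l1 : (l == r%:Z) = false by apply/negbTE/eqP => E0; move: lr rb; lia.
    have l2 : (l == r%:Z - b%:Z) = false by rewrite lt_eqF.
    by rewrite l1 l2 !mulr0 addr0 subrr.
  have q0 : q (r%:Z - b%:Z) != 0.
    have l1 : (r%:Z - b%:Z == r%:Z) = false by apply/negbTE/eqP; lia.
    rewrite lcoefD lcoefN !lcoefD /= eqxx l1.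
    rewrite !mulr0 !add0r !mulr1 -mulrBr mulf_neq0 //.
      by rewrite mulf_neq0 ?invr_eq0 ?pnatr_eq0 //; lia.
    rewrite subr_eq0; apply: contraNneq ii0; by move/expfac_coef_inj => ->.
  have := lead_mul ql gn; rewrite -/q in kE; rewrite kE (lge_der gn); last by lia.
  by move=> /esym/eqP; rewrite mulf_eq0 (negbTE q0) (negbTE gn0).
have [m [n]] := Y0 i0; have := g0 m.
rewrite (bigD1 i0) //= big1 ?addr0 => [|i /gz ->]; last by rewrite mul0r.
by rewrite gi0 mul1r => /(congr1 (fun x : K => x n)) /= ->; rewrite eqxx.
Qed.

(** A row killed by the matrix of the [Y i] on the generators would be a relation between the
    solutions, excluded by [fsol_free]. Hence the matrix is invertible, and this also makes
    coordinates unique: as many generators as solutions form a basis. *)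
Lemma irregular_class_gen (e : 'I_r -> E) :
  (forall m, exists p : 'I_r -> {poly C}, m = \sum_j wm_poly (p j) (e j)) ->
  irregular_class Th E.
Proof.
move=> gen.
pose M : 'M[K]_r := \matrix_(i, j) fsol (YP i) (e j).
have Mu : M \in unitmx.
  rewrite -row_free_unit -kermx_eq0; apply/eqP/row_matrixP => s; rewrite row0.
  set u := row s (kermx M).
  have uM : u *m M = 0 by rewrite /u -row_mul mulmx_ker row0.
  suff H : forall i, u 0 i = 0 by apply/rowP => i; rewrite H mxE.
  apply: fsol_free => m; have [p ->] := gen m.
  under eq_bigr => i _ do rewrite fsol_sum mulr_sumr.
  rewrite exchange_big /= big1 // => j _.
  have /rowP/(_ j) := uM; rewrite !mxE => uj.
  transitivity (lpoly r (p j) * \sum_i u 0 i * M i j); last by rewrite uj mulr0.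
  rewrite mulr_sumr; apply: eq_bigr => i _.
  by rewrite fsol_poly // mulrCA; congr (_ * (_ * _)); rewrite ?mxE.
exists e; split.
  move=> m; have [p mp] := gen m; exists (finfun p); split.
    by rewrite mp; apply: eq_bigr => j _; rewrite ffunE.
  move=> p' mp'; apply/ffunP => j; rewrite ffunE; apply/eqP; rewrite -subr_eq0; apply/eqP.
  apply: (lpoly_eq0 r0).
  pose v : 'cV[K]_r := \col_j lpoly r (p j - p' j).
  suff : v = 0 by move=> /colP/(_ j); rewrite !mxE.
  rewrite -[v]mul1mx -(mulVmx Mu) -mulmxA (_ : M *m v = 0) ?mulmx0 //.
  apply/colP => i; rewrite !mxE.
  have := congr1 (fsol (YP i)) (etrans (esym mp) mp').
  rewrite !fsol_sum => /eqP; rewrite -subr_eq0 -sumrB => /eqP H0; rewrite -[RHS]H0.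
  by apply: eq_bigr => l _; rewrite !mxE !fsol_poly // lpolyB // mulrC mulrBl.
exists lam, Y; split=> //.
exists (fun j l => lcoef (invmx M j l)); split=> [j l|i l n]; first exact: lcoefP.
have /matrixP/(_ i l) := mulmxV Mu; rewrite !mxE => /(congr1 (fun x : K => x n)).
rewrite lcoef_sum => H; transitivity ((i == l)%:R * (n == 0)%:R : C); last first.
  by case: (i == l); rewrite ?mul1r ?mul0r.
rewrite -[X in X = _]/(\sum_j laurent_mul (fsol (YP i) (e j)) (invmx M j l) n).
transitivity (\sum_j (M i j * invmx M j l) n); first by apply: eq_bigr => j _; rewrite !mxE lcoefM.
rewrite H; case: (i == l) => /=; rewrite ?mul1r ?mul0r ?mulr1n ?mulr0n ?lcoef1 ?lcoef0 //.
Qed.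

End Independence.

(** * The formal Legendre transform *)

Section FiniteDifferences.
Variable R : realType.
Local Notation C := R[i].
Implicit Types p q A B : {poly C}.

Definition dif (h : C) p : {poly C} := p - (p \Po ('X - h%:P)).

Lemma difE h p x : (dif h p).[x] = p.[x] - p.[x - h].
Proof. by rewrite /dif hornerD hornerN horner_comp !hornerE. Qed.

Lemma difD h p q : dif h (p + q) = dif h p + dif h q.
Proof. by rewrite /dif comp_polyD; ring. Qed.

Lemma difB h p q : dif h (p - q) = dif h p - dif h q.
Proof. by rewrite /dif comp_polyB; ring. Qed.

Lemma difZ h k p : dif h (k *: p) = k *: dif h p.
Proof. by rewrite /dif comp_polyZ scalerBr. Qed.

Lemma difC h k : dif h k%:P = 0.
Proof. by rewrite /dif comp_polyC subrr. Qed.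

Lemma dif_dif h k p : dif h (dif k p) = dif k (dif h p).
Proof.
rewrite /dif !comp_polyB -!comp_polyA.
have E u v : ('X - u%:P : {poly C}) \Po ('X - v%:P) = 'X - (u + v)%:P.
  by rewrite comp_polyB comp_polyX comp_polyC polyCD; ring.
rewrite !E [k + h]addrC; ring.
Qed.

Lemma dif_Xn h n : h != 0 -> (size (dif h 'X^(n.+1)) <= n.+1)%N /\
  (dif h 'X^(n.+1))`_n = n.+1%:R * h.
Proof.
move=> h0.
have sz (i : 'I_n.+1) : size ('X^(n.+1.-1 - i) * ('X - h%:P) ^+ i : {poly C}) = n.+1.
  rewrite size_monicM ?monicXn ?expf_neq0 ?polyXsubC_eq0 //.
  by rewrite size_polyXn size_exp_XsubC; have := ltn_ord i; lia.
have lc (i : 'I_n.+1) : ('X^(n.+1.-1 - i) * ('X - h%:P) ^+ i : {poly C})`_n = 1.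
  have := sz i => si; have : ('X^(n.+1.-1 - i) * ('X - h%:P) ^+ i : {poly C}) \is monic.
    by rewrite monicMl ?monicXn // monic_exp // monicXsubC.
  by move=> /monicP; rewrite lead_coefE si.
have -> : dif h 'X^(n.+1) = h *: \sum_(i < n.+1) 'X^(n.+1.-1 - i) * ('X - h%:P) ^+ i.
  by rewrite /dif comp_Xn_poly subrXX opprB addrC subrK -mul_polyC.
split.
  apply: leq_trans (size_scale_leq _ _) _; apply: (leq_trans (size_sum _ _ _)).
  by apply/bigmax_leqP => i _; rewrite sz.
by rewrite coefZ coef_sum (eq_bigr (fun=> 1)) // sumr_const card_ord mulrC.
Qed.

Lemma dif_surj h p : h != 0 -> exists q, dif h q = p.
Proof.
move=> h0; have [N] := ubnP (size p); elim: N p => // N IH p.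
rewrite ltnS leq_eqVlt => /orP[/eqP sN|]; last exact: IH.
case: N IH sN => [|n] IH sN.
  by exists 0; move/eqP: sN; rewrite size_poly_eq0 => /eqP ->; rewrite -[0]polyC0 difC.
have [s1 c1] := dif_Xn n h0.
pose k := p`_n / (n.+1%:R * h).
have [|q qE] := IH (p - k *: dif h 'X^(n.+1)).
  rewrite ltnS; apply/leq_sizeP => j nj; rewrite coefB coefZ.
  have [->|jn] := eqVneq j n.
    by rewrite c1 /k divfK ?subrr // mulf_neq0 // pnatr_eq0.
  have nj' : (n.+1 <= j)%N by lia.
  by rewrite (nth_default _ (leq_trans s1 nj')) nth_default ?mulr0 ?subr0 ?sN.
by exists (q + k *: 'X^(n.+1)); rewrite difD difZ qE subrK.
Qed.

Lemma dif_ker h p : h != 0 -> dif h p = 0 -> p = (p.[0])%:P.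
Proof.
move=> h0 p0.
have per (k : nat) : p.[k%:R * h] = p.[0].
  elim: k => [|k IH]; first by rewrite mul0r.
  have := difE h p (k.+1%:R * h); rewrite p0 horner0 => /esym/eqP; rewrite subr_eq0 => /eqP ->.
  by rewrite -IH; congr (p.[_]); rewrite -natr1; ring.
apply/eqP; rewrite -subr_eq0; apply/eqP.
set q := p - _; pose rs := [seq (k%:R * h : C) | k <- iota 0 (size q)].
apply: (@roots_geq_poly_eq0 _ q rs).
- by apply/allP => _ /mapP[k _ ->]; rewrite /root /q !hornerE per subrr.
- rewrite map_inj_uniq ?iota_uniq // => i j /(mulIf h0)/eqP.
  by rewrite eqr_nat => /eqP.
- by rewrite size_map size_iota.
Qed.

Section Tau.
Variables (r m : nat) (lam : C).
Hypothesis (r0 : (0 < r)%N) (m0 : (0 < m)%N).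
Local Notation b := (m + r)%N.
Local Notation rC := (r%:R : C).
Local Notation mC := (m%:R : C).

(** The exponent given by stationary phase: [z] is of order [w^(r/m)], so [z^lam] contributes
    [lam r / m], and the Gaussian factor [q''^(-1/2)] contributes [(r - m) / (2 m)]. *)
Definition tau_mu : C := rC / (2 * mC) - 2^-1 + lam * rC / mC.
Definition tauA p : {poly C} := (rC^-1 *: 'X - lam%:P) * (p \Po ('X + rC%:P)).
Definition tauB (k : nat) p : {poly C} :=
  (mC^-1 *: 'X + (b%:R * k%:R / mC - tau_mu)%:P) * p.

Definition tau_compat k p := dif rC (tauA p) = dif mC (tauB k p).
(** The two equations say that the transform intertwines the actions of [d/dz] and of [z]; they are
    used in [ftc_step1] and [ftc_step2]. As differences in steps [m] and [r] commute, they force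
    [tau_compat] on [p]. *)
Definition tau_step k p q := dif mC q = tauA p /\ dif rC q = tauB k p.

Let rn0 : rC != 0. Proof. by rewrite pnatr_eq0 -lt0n. Qed.
Let mn0 : mC != 0. Proof. by rewrite pnatr_eq0 -lt0n. Qed.

Lemma horner_ext p q : (forall x, p.[x] = q.[x]) -> p = q.
Proof.
move=> pq; apply/eqP; rewrite -subr_eq0; apply/eqP; set s := p - q.
apply: (@roots_geq_poly_eq0 _ s [seq (k%:R : C) | k <- iota 0 (size s)]).
- by apply/allP => _ /mapP[k _ ->]; rewrite /root /s hornerD hornerN pq subrr.
- rewrite map_inj_uniq ?iota_uniq // => i j /eqP; by rewrite eqr_nat => /eqP.
- by rewrite size_map size_iota.
Qed.

Lemma tauA_E p x : (tauA p).[x] = (x / rC - lam) * p.[x + rC].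
Proof. by rewrite /tauA hornerM horner_comp !hornerE [x / _]mulrC. Qed.

Lemma tauB_E k p x : (tauB k p).[x] = ((x + b%:R * k%:R) / mC - tau_mu) * p.[x].
Proof. rewrite /tauB !(hornerM, hornerD, hornerZ, hornerX, hornerC); congr (_ * _); ring. Qed.

Lemma tau_compat0 k : tau_compat k 1.
Proof.
apply: horner_ext => x; rewrite !difE !tauA_E !tauB_E !hornerE; field.
by rewrite rn0 mn0.
Qed.

(** The equations express [q] at [x + r] and at [x - m] through [q] at [x] and the single value of
    [p] at [x + r]; passing from [k] to [k.+1] is what makes the two sides agree. *)
Lemma tau_step_compat k p q : tau_step k p q -> tau_compat k.+1 q.
Proof.
move=> [qm qr]; apply: horner_ext => x; rewrite !difE !tauA_E !tauB_E subrK.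
have e1 : q.[x + rC] = q.[x] + ((x + rC + b%:R * k%:R) / mC - tau_mu) * p.[x + rC].
  by rewrite -tauB_E -qr difE addrK; ring.
have e2 : q.[x - mC] = q.[x] - (x / rC - lam) * p.[x + rC].
  by rewrite -tauA_E -qm difE; ring.
rewrite e1 e2 -[k.+1%:R]natr1 natrD; move: (q.[x]) (p.[_]) tau_mu => u v w; field.
by rewrite rn0 mn0.
Qed.

(** For the constant 1 the two equations have a common solution up to the constant [b k / m], which
    measures the effect of changing the constant term of [tau k]. *)
Lemma tau_const (k : nat) : exists s : {poly C}, dif mC s = tauA 1 /\
  dif rC s = tauB k 1 - (b%:R * k%:R / mC)%:P.
Proof.
pose al := (2 * rC)^-1 - lam / mC.
have h1 (y : C) : (1 : {poly C}).[y] = 1 by rewrite -polyC1 hornerC.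
exists ((2 * mC * rC)^-1 *: 'X^2 + al *: 'X); split; apply: horner_ext => x;
  rewrite difE ?hornerD ?hornerN ?tauA_E ?tauB_E !(hornerD, hornerZ, hornerX, hornerXn, hornerC, h1) /al /tau_mu;
field;
  by rewrite rn0 mn0 ?pnatr_eq0.
Qed.

Lemma tau_next k p : tau_compat k p -> (k = 0%N -> p = 1) ->
  exists d q, tau_step k (p + d%:P) q /\ (k = 0%N -> d = 0).
Proof.
move=> cp k0; have [s [s1 s2]] := tau_const k.
have [kE|kn0] := eqVneq k 0%N.
  subst k.
  exists 0, s; split=> //; rewrite polyC0 addr0 (k0 erefl); split=> //.
  by rewrite s2 mulr0 mul0r subr0.
have bn0 : b%:R * k%:R / mC != 0 :> C.
  by rewrite mulf_neq0 ?invr_eq0 // mulf_neq0 // pnatr_eq0 //; lia.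
have [q0 q0E] := dif_surj (tauA p) mn0.
have : dif mC (dif rC q0 - tauB k p) = 0 by rewrite difB dif_dif q0E cp subrr.
move=> /(dif_ker mn0); set g := _.[0] => gE.
(* The value that cancels the obstruction [g]. It requires [k] to be nonzero; for [k = 0] the
   polynomial is 1 and there is no obstruction. *)
pose d := g / (b%:R * k%:R / mC).
exists d, (q0 + d *: s); split; last by move=> k00; move: kn0; rewrite k00 eqxx.
have A1 : tauA (p + d%:P) = tauA p + d *: tauA 1.
  by apply: horner_ext => x; rewrite !(hornerD, hornerZ, tauA_E, hornerC); ring.
have B1 : tauB k (p + d%:P) = tauB k p + d *: tauB k 1.
  by apply: horner_ext => x; rewrite !(hornerD, hornerZ, tauB_E, hornerC); ring.
split; rewrite difD difZ ?q0E ?s1 ?A1 // s2 B1 scalerBr.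
have -> : dif rC q0 = tauB k p + g%:P by rewrite -gE addrC subrK.
have -> : d *: (b%:R * k%:R / mC)%:P = g%:P by rewrite -mul_polyC -polyCM /d divfK.
by rewrite addrACA subrr addr0.
Qed.

(* The coefficients of the formal stationary phase expansion: the constant term
   of tau_k is what makes the two equations for tau_(k+1) compatible. *)
Lemma tau_exists : exists tau : nat -> {poly C}, tau 0%N = 1 /\
  forall k, tau_step k (tau k) (tau k.+1).
Proof.
pose OK k (s : {poly C} * {poly C}) := tau_step k s.1 s.2.
have [d0 [q0 [s0 dE]]] := tau_next (tau_compat0 0) (fun _ => erefl).
have nxt k (s : {poly C} * {poly C}) : OK k s -> exists s', OK k.+1 s' /\ exists d, s'.1 = s.2 + d%:P.
  move=> /tau_step_compat c; have [//|d [q [H _]]] := tau_next c.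
  by exists (s.2 + d%:P, q); split=> //; exists d.
pose st k := {s | OK k s}.
pose f k (s : st k) : st k.+1 := let H := cid (nxt k _ (projT2 s)) in exist _ (projT1 H) (proj1 (projT2 H)).
have i0 : OK 0%N (1, q0) by move: s0; rewrite dE // polyC0 addr0.
pose F := fix F k : st k := if k is k'.+1 then f k' (F k') else exist _ (1, q0) i0.
exists (fun k => (projT1 (F k)).1); split=> // k.
have [H1 H2] := projT2 (F k).
have [d ->] : exists d, (projT1 (F k.+1)).1 = (projT1 (F k)).2 + d%:P.
  by rewrite /= /f /=; case: cid => s' [].
by split; rewrite difD difC addr0.
Qed.

End Tau.
End FiniteDifferences.

(** * Generators of the module over C[d/dz] *)

Lemma exists_vspace (F : fieldType) (V : vectType F) (P : V -> Prop) :
  P 0 -> (forall k x y, P x -> P y -> P (k *: x + y)) ->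
  exists U : {vspace V}, forall x, x \in U <-> P x.
Proof.
move=> P0 Plin.
suff H N (U : {vspace V}) : (forall x, x \in U -> P x) -> (dim V - \dim U < N)%N ->
    exists U : {vspace V}, forall x, x \in U <-> P x.
  apply: (H (dim V - \dim (0%VS : {vspace V})).+1 0%VS) => // x.
  by rewrite memv0 => /eqP ->.
elim: N U => // N IH U UP UN.
have [all|/existsNP[x /not_implyP[Px /negP xU]]] := pselect (forall x, P x -> x \in U).
  by exists U => x; split; [exact: UP|exact: all].
apply: (IH (U + <[x]>)%VS) => [y|].
  move=> /memv_addP[u uU [_ /vlineP[k ->] ->]]; rewrite addrC.
  by apply: Plin => //; exact: UP.
have dU : \dim (U + <[x]>) = (\dim U).+1.
  rewrite dimv_disjoint_sum ?dim_vline.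
    by case: eqVneq xU => [->|_ _]; rewrite ?mem0v // addn1.
  apply/eqP; rewrite -subv0; apply/subvP => y; rewrite memv_cap memv0 => /andP[yU /vlineP[k yk]].
  have [k0|k0] := eqVneq k 0; first by rewrite yk k0 scale0r.
  by have := memvZ k^-1 yU; rewrite yk scalerA mulVf // scale1r (negbTE xU).
by have := dimvS (subvf (U + <[x]>)%VS); rewrite dU dimvf; lia.
Qed.

(** Let [S] be the sums of the increments of [g] over distance [m] and [T] the sums of [g]; then
    [T (k + m) = T k + S (k + m)]. If [S] ever exceeded [m], then [T] would gain [m + 1] in every
    [m] steps, against the slope 1 of the hypothesis. *)
Lemma growth (g : nat -> nat) (m c : nat) : (0 < m)%N ->
  (forall t, g t <= g (t + m))%N ->
  (forall n, \sum_(t < n) g t <= n + c)%N ->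
  forall n, (\sum_(t < n) (g t - (if m <= t then g (t - m) else 0)) <= m)%N.
Proof.
move=> m0 gm gc n; set w := fun t => (g t - (if m <= t then g (t - m) else 0))%N.
pose S n := (\sum_(t < n) w t)%N; pose T n := (\sum_(t < n) g t)%N.
have TS k : T (k + m)%N = (T k + S (k + m))%N.
  elim: k => [|k IH].
    rewrite add0n /T /S big_ord0 add0n; apply: eq_bigr => t _.
    by rewrite /w leqNgt ltn_ord subn0.
  rewrite addSn /T /S !big_ord_recr /= -/(T k) -/(T (k + m)%N) -/(S (k + m)%N) IH.
  by rewrite /w leq_addl addnK; have := gm k; lia.
have Smon k : (S n <= S (n + k))%N.
  by elim: k => [|k IH]; rewrite ?addn0 // addnS /S big_ord_recr /=; apply: leq_trans IH _; exact: leq_addr.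
rewrite leqNgt; apply/negP => Sn; rewrite -/(S n) in Sn.
have big j : (j * m.+1 <= T (n + j * m))%N.
  elim: j => [|j IH]; first by rewrite mul0n.
  rewrite (_ : n + j.+1 * m = n + j * m + m)%N ?TS; last by rewrite mulSn; lia.
  rewrite mulSn.
  have := Smon (j * m + m)%N; rewrite addnA; lia.
have := big (n + c).+1; have := gc (n + (n + c).+1 * m)%N; rewrite -/(T _); nia.
Qed.

Section WeylPoly.
Variables (R : realType) (E : weyl_module R).
Local Notation C := R[i].

Lemma wm_polyE (N : nat) (p : {poly C}) (x : E) : (size p <= N)%N ->
  wm_poly p x = \sum_(k < N) p`_k *: iter k (@wm_z R E) x.
Proof.
move=> sN; rewrite /wm_poly -!(big_mkord predT (fun k => p`_k *: iter k (@wm_z R E) x)).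
rewrite [RHS](@big_cat_nat _ _ _ (size p)) //= [X in _ + X]big_nat_cond.
rewrite [X in _ + X]big1 ?addr0 // => k /andP[/andP[sk _] _].
by rewrite nth_default // scale0r.
Qed.

Lemma wm_poly_lin k (p q : {poly C}) (x : E) :
  wm_poly (k *: p + q) x = k *: wm_poly p x + wm_poly q x.
Proof.
pose N := maxn (size (k *: p + q)) (maxn (size p) (size q)).
rewrite !(@wm_polyE N) ?leq_max ?leqnn ?orbT // scaler_sumr -big_split /=.
by apply: eq_bigr => i _; rewrite coefD coefZ scalerDl scalerA.
Qed.

Lemma wm_poly0 (x : E) : wm_poly 0 x = 0.
Proof. by rewrite /wm_poly size_poly0 big_ord0. Qed.

Lemma wm_poly1 (x : E) : wm_poly 1 x = x.
Proof. by rewrite /wm_poly size_poly1 big_ord1 coef1 scale1r. Qed.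

Lemma wm_z_sum (I : Type) (s : seq I) (F : I -> E) :
  wm_z (\sum_(i <- s) F i) = \sum_(i <- s) wm_z (F i).
Proof.
have z0 : wm_z (0 : E) = 0 by have := @wm_zZ R E 0 0; rewrite !scale0r.
have zD (x y : E) : wm_z (x + y) = wm_z x + wm_z y.
  by have := @wm_z_linear R E 1 x y; rewrite !scale1r.
exact: (big_morph _ zD z0).
Qed.

Lemma wm_polyXM (p : {poly C}) (x : E) : wm_poly ('X * p) x = wm_z (wm_poly p x).
Proof.
rewrite (@wm_polyE (size p).+1); last by apply: leq_trans (size_polyMleq _ _) _; rewrite size_polyX.
rewrite big_ord_recl mulrC coefMX /= scale0r add0r /wm_poly wm_z_sum.
by apply: eq_bigr => k _; rewrite coefMX /= wm_zZ.
Qed.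

End WeylPoly.

Section Generators.
Variables (R : realType) (Th : irr_class) (E : weyl_module R).
Local Notation C := R[i].
Local Notation K := (lseries R).
Local Notation r := (ic_rank Th).
Local Notation b := (ic_num Th).
Hypothesis (r0 : (0 < r)%N) (rb : (r < b)%N).
Variables (e : 'I_r -> E) (eP : wm_basis e).
Variables (lam : 'I_r -> C) (Y : 'I_r -> E -> int -> C).
Hypothesis YP : forall i : 'I_r, formal_solution Th (i : nat)%:Z (lam i) (Y i).
Variable Hm : 'M[K]_r.
Hypothesis MH : (\matrix_(i, j) fsol (YP i) (e j)) *m Hm = 1%:M.
Local Notation m := (b - r)%N.

(** Pole order at most [k] in [t] for all formal solutions at once; the symbol below collects the
    coefficients of [t^(-k)]. *)
Definition fil (k : int) (x : E) := forall i, lge (- k) (fsol (YP i) x).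
Definition symb (k : int) (x : E) : 'rV[C]_r := \row_i fsol (YP i) x (- k).

Lemma fil_linear k c x y : fil k x -> fil k y -> fil k (c *: x + y).
Proof.
move=> xk yk i l lk; rewrite fsol_linear lcoefD lmonoM subr0 (xk i) // (yk i) //.
by rewrite mulr0 addr0.
Qed.

Lemma fil0 k : fil k 0.
Proof. by move=> i l lk; rewrite fsol0 lcoef0. Qed.

Lemma symb_linear k c x y : symb k (c *: x + y) = c *: symb k x + symb k y.
Proof. by apply/rowP => i; rewrite !mxE fsol_linear lcoefD lmonoM subr0. Qed.

Lemma fil_le k k' x : k <= k' -> fil k x -> fil k' x.
Proof. by move=> kk xk i; apply: lge_le (xk i); rewrite lerN2. Qed.

Lemma fil_pred k x : fil k x -> symb k x = 0 -> fil (k - 1) x.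
Proof.
move=> xk /rowP s0 i l lk; have := s0 i; rewrite !mxE => si.
have [->//|ln] := eqVneq l (- k); apply: xk; lia.
Qed.

Definition dmul : 'M[C]_r := diag_mx (\row_i (b%:R / r%:R * expfac_coef R Th (i : nat)%:Z)).

Lemma dmul_unit : dmul \in unitmx.
Proof.
rewrite unitmxE unitfE det_diag; apply/prodf_neq0 => i _; rewrite mxE.
rewrite mulf_neq0 //; first by rewrite mulf_neq0 ?invr_eq0 ?pnatr_eq0; lia.
rewrite /expfac_coef mulf_neq0 ?expf_neq0 ?oppr_eq0 ?oner_eq0 //.
by rewrite -nrm_eq0 nrm_polar normr1 oner_eq0.
Qed.

(** The dominant part of [d/dz] is multiplication by the derivative of [q_i], of pole order [m]; on
    symbols it is the invertible diagonal matrix [dmul]. *)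
Lemma fil_d k x : fil k x -> fil (k + m%:Z) (wm_d x) /\ symb (k + m%:Z) (wm_d x) = symb k x *m dmul.
Proof.
move=> xk; split=> [i l lk|].
  rewrite fsol_d // lcoefD (lge_der (xk i)); last by lia.
  by rewrite add0r mulrDl lcoefD !lmonoM !(xk i) ?mulr0 ?addr0 //; lia.
apply/rowP => i; rewrite mul_mx_diag !mxE fsol_d // lcoefD (lge_der (xk i)); last by lia.
rewrite add0r mulrDl lcoefD !lmonoM (xk i) ?mulr0 ?add0r ; last by lia.
by rewrite mulrC; congr (lcoef _ _ * _); lia.
Qed.

Lemma fil_all x : exists n : nat, forall k, n%:Z <= k -> fil k x.
Proof.
have /choice[n nP] : forall i, exists n, lge n (fsol (YP i) x) by move=> i; exact: lseriesP.
exists (\max_i absz (n i)) => k nk i; apply: lge_le (nP i).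
have : (absz (n i) <= \max_i absz (n i))%N by exact: leq_bigmax.
lia.
Qed.

(** The inverse matrix [Hm] recovers coordinates in the basis from the values of the formal
    solutions, so bounded pole order means bounded degree, with a loss [h] independent of [k]. *)
Lemma fil_coef : exists h : nat, forall k p, fil k (\sum_j wm_poly (p j) (e j)) ->
  forall j (l : nat), k + h%:Z < r%:Z * l%:Z -> (p j)`_l = 0.
Proof.
have /choice[n nP] : forall i : 'I_r * 'I_r, exists n, lge n (Hm i.1 i.2) by move=> i; exact: lseriesP.
exists (\max_i absz (n i)) => k p pk j l kl; rewrite -(lpolyE _ _ r0).
pose M : 'M[K]_r := \matrix_(i, j) fsol (YP i) (e j).
pose v : 'cV[K]_r := \col_j lpoly r (p j).
pose u : 'cV[K]_r := \col_i fsol (YP i) (\sum_j wm_poly (p j) (e j)).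
have uv : u = M *m v.
  apply/colP => i; rewrite !mxE fsol_sum; apply: eq_bigr => s _.
  by rewrite !mxE fsol_poly // mulrC.
have : v = Hm *m u by rewrite uv mulmxA (mulmx1C MH) mul1mx.
move=> /colP/(_ j); rewrite !mxE => ->; rewrite lcoef_sum big1 // => i _.
rewrite mxE lcoefM; apply: (laurent_mul_lge (nP (j, i)) (pk i)).
have : (absz (n (j, i)) <= \max_i absz (n i))%N by exact: leq_bigmax.
lia.
Qed.

Definition hbound : nat := projT1 (cid fil_coef).
Lemma hboundP k p : fil k (\sum_j wm_poly (p j) (e j)) ->
  forall j (l : nat), k + hbound%:Z < r%:Z * l%:Z -> (p j)`_l = 0.
Proof. by rewrite /hbound; case: cid => h /= hP; exact: hP. Qed.

(* The degrees start at deg 0, where the filtration vanishes. *)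
Definition deg (t : nat) : int := t%:Z - hbound%:Z - 1.

Lemma fil_deg0 x : fil (deg 0) x -> x = 0.
Proof.
have [p [-> _]] := eP x => /hboundP p0; rewrite big1 // => j _.
rewrite (_ : p j = 0) ?wm_poly0 //; apply/polyP => l; rewrite coef0 p0 //.
by rewrite /deg; lia.
Qed.

Lemma symbs_ex k : exists U : {vspace 'rV[C]_r}, forall v, v \in U <->
  (exists2 x, fil k x & symb k x = v).
Proof.
apply: exists_vspace => [|c v w [x xk <-] [y yk <-]].
  exists 0; first exact: fil0.
  by apply/rowP => i; rewrite !mxE fsol0 lcoef0.
by exists (c *: x + y); [exact: fil_linear|exact: symb_linear].
Qed.
Definition symbs k : {vspace 'rV[C]_r} := projT1 (cid (symbs_ex k)).
Lemma symbsP k v : v \in symbs k <-> exists2 x, fil k x & symb k x = v.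
Proof. by rewrite /symbs; case: cid. Qed.

Lemma symbs0 : symbs (deg 0) = 0%VS.
Proof.
apply/vspaceP => v; rewrite memv0; apply/idP/eqP => [/symbsP[x /fil_deg0 -> <-]|->].
  by apply/rowP => i; rewrite !mxE fsol0 lcoef0.
exact: mem0v.
Qed.

Definition dim_symbs (t : nat) : nat := \dim (symbs (deg t)).

Definition ldmul : 'End('rV[C]_r) := linfun (mulmxr dmul).

Lemma ldmul_symbs k : (ldmul @: symbs k <= symbs (k + m%:Z))%VS.
Proof.
apply/subvP => _ /memv_imgP[v /symbsP[x xk <-] ->]; apply/symbsP.
by have [dk ds] := fil_d xk; exists (wm_d x) => //; rewrite ds lfunE.
Qed.

Lemma dim_ldmul k : \dim (ldmul @: symbs k) = \dim (symbs k).
Proof.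
have ker0 : lker ldmul = 0%VS.
  apply/vspaceP => v; rewrite memv_ker memv0 lfunE /=; apply/eqP/eqP => [v0|->].
    by rewrite -(mulmxK dmul_unit v) v0 mul0mx.
  by rewrite mul0mx.
by apply: limg_dim_eq; rewrite ker0 capv0.
Qed.

Lemma dim_symbs_growth t : (dim_symbs t <= dim_symbs (t + m))%N.
Proof.
rewrite /dim_symbs -dim_ldmul (_ : deg (t + m) = deg t + m%:Z) ?dimvS ?ldmul_symbs //.
rewrite /deg; lia.
Qed.

Section Count.
Variable d : nat.
Definition velt (c : 'M[C]_(r, d)) : E :=
  \sum_j \sum_(l < d) c j l *: iter l (@wm_z R E) (e j).

Lemma velt_linear : linear velt.
Proof.
move=> k x y; rewrite /velt scaler_sumr -big_split /=; apply: eq_bigr => j _.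
rewrite scaler_sumr -big_split /=; apply: eq_bigr => l _.
by rewrite !mxE scalerDl scalerA.
Qed.

Lemma velt_fil k x : fil k x -> k + hbound%:Z < r%:Z * d%:Z -> exists c, velt c = x.
Proof.
have [p [-> _]] := eP x => pk kd; exists (\matrix_(j, l) (p j)`_l).
rewrite /velt; apply: eq_bigr => j _; rewrite (@wm_polyE _ _ d).
  by apply: eq_bigr => l _; rewrite mxE.
apply/leq_sizeP => l dl; apply: (hboundP pk); apply: lt_le_trans kd _.
by rewrite -!PoszM lez_nat leq_mul2l dl orbT.
Qed.

Lemma fil_velt_ex t : exists U : {vspace 'M[C]_(r, d)}, forall c, c \in U <-> fil (deg t) (velt c).
Proof.
apply: exists_vspace => [|k x y xt yt]; last by rewrite velt_linear; exact: fil_linear.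
rewrite (_ : velt 0 = 0) //; first exact: fil0.
rewrite /velt big1 // => j _; rewrite big1 // => l _; by rewrite mxE scale0r.
Qed.

(** Symbol spaces are graded pieces of a filtration on elements whose coordinates have degree below
    [d], and these elements are parametrised by a space of dimension [r * d]. *)
Lemma sum_dim_symbs n : (n <= r * d)%N -> (\sum_(t < n.+1) dim_symbs t <= r * d)%N.
Proof.
move=> nd; have /choice[U UP] := fil_velt_ex.
suff H k : (k <= n)%N -> (\sum_(t < k.+1) dim_symbs t <= \dim (U k))%N.
  apply: leq_trans (H _ (leqnn _)) _; apply: leq_trans (dimvS (subvf _)) _.
  by rewrite dimvf /dim /=.
elim: k => [_|k IH kn]; first by rewrite big_ord1 /dim_symbs symbs0 dimv0.
rewrite big_ord_recr /=; set s := (\sum_(t < _) _)%N; have {}IH := IH (ltnW kn).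
have slin : linear (fun c => symb (deg k.+1) (velt c)).
  by move=> c x y; rewrite velt_linear symb_linear.
pose f : 'Hom('M[C]_(r, d), 'rV[C]_r) := linfun (fun c => symb (deg k.+1) (velt c)).
have fE c : f c = symb (deg k.+1) (velt c) by rewrite /f linfunE.
rewrite -(limg_ker_dim f (U k.+1)); apply: leq_add.
  apply: leq_trans IH _; apply: dimvS; apply/subvP => c /UP ck.
  rewrite memv_cap; apply/andP; split.
    by apply/UP; apply: fil_le ck; rewrite /deg; lia.
  rewrite memv_ker fE; apply/eqP/rowP => i; rewrite !mxE ck //; rewrite /deg; lia.
apply: dimvS; apply/subvP => v /symbsP[x xk <-].
have [|c cE] := @velt_fil (deg k.+1) x xk; first by rewrite /deg -PoszM; lia.
apply/memv_imgP; exists c; last by rewrite fE cE.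
by apply/UP; rewrite cE.
Qed.
End Count.

Lemma sum_dim_symbs_le n : (\sum_(t < n) dim_symbs t <= n + r)%N.
Proof.
case: n => [|n]; first by rewrite big_ord0.
apply: leq_trans (@sum_dim_symbs (n %/ r).+1 n _) _.
  by rewrite {1}(divn_eq n r) mulnS mulnC addnC leq_add2r ltnW // ltn_mod.
by rewrite mulnS mulnC addnC leq_add2r ltnW // ltnS leq_trunc_div.
Qed.

(** Symbols in degree [t] modulo those coming from degree [t - m] by differentiation, that is the
    number of new generators. *)
Definition wdim (t : nat) : nat :=
  (dim_symbs t - (if m <= t then dim_symbs (t - m) else 0))%N.

Lemma sum_wdim n : (\sum_(t < n) wdim t <= m)%N.
Proof.
have m0 : (0 < m)%N by rewrite subn_gt0.
exact: (growth m0 dim_symbs_growth sum_dim_symbs_le).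
Qed.

Definition dclosed (P : E -> Prop) : Prop :=
  [/\ P 0, forall k x y, P x -> P y -> P (k *: x + y) & forall x, P x -> P (wm_d x)].
(** The [C[d/dz]]-submodule generated by [s], as an intersection of stable subspaces. *)
Definition dspan (s : seq E) (x : E) : Prop :=
  forall P, dclosed P -> (forall y, y \in s -> P y) -> P x.

Lemma dspan_closed s : dclosed (dspan s).
Proof.
split=> [P [] //|k x y xs ys P cP sP|x xs P cP sP].
  by have [_ H _] := cP; apply: H; [exact: xs|exact: ys].
by have [_ _ H] := cP; apply: H; exact: xs.
Qed.

Lemma dspan_sub s s' x : {subset s <= s'} -> dspan s x -> dspan s' x.
Proof. by move=> ss xs P cP sP; apply: xs => // y /ss; exact: sP. Qed.

Lemma dspan_step s t : (forall x, fil (deg t) x -> dspan s x) ->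
  exists s', size s' = wdim t.+1 /\ forall x, fil (deg t.+1) x -> dspan (s ++ s') x.
Proof.
move=> st; set k := deg t.+1.
pose D := (ldmul @: symbs (k - m%:Z))%VS.
have m0 : (0 < m)%N by rewrite subn_gt0.
have Dk : (D <= symbs k)%VS.
  by have := ldmul_symbs (k - m%:Z); rewrite subrK.
(* A complement of the symbols of derivatives, whose basis is lifted to the new generators. Every
   [x] of degree [k] is then a combination of these lifts plus a derivative, modulo degree
   [k - 1]. *)
pose W := (symbs k :\: D)%VS.
have dW : \dim W = wdim t.+1.
  have := dimv_cap_compl (symbs k) D; rewrite (capv_idPr Dk) dim_ldmul /W /wdim.
  have [mt|tm] := leqP m t.+1.
    by rewrite (_ : k - m%:Z = deg (t.+1 - m)) /dim_symbs -/k; [lia|rewrite /k /deg; lia].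
  rewrite [X in (X + _)%N](_ : _ = 0%N) ?add0n ?subn0 //.
  apply/eqP; rewrite dimv_eq0 -symbs0; apply/eqP/vspaceP => v.
  rewrite symbs0 memv0; apply/idP/eqP => [/symbsP[x xk <-]|->]; last exact: mem0v.
  have -> : x = 0 by apply: fil_deg0; apply: fil_le xk; rewrite /k /deg; lia.
  by apply/rowP => i; rewrite !mxE fsol0 lcoef0.
have /choice[lift liftP] : forall v, exists x, v \in symbs k -> fil k x /\ symb k x = v.
  move=> v; have [vs|_] := boolP (v \in symbs k); last by exists 0.
  by have /symbsP[x xk xv] := vs; exists x.
exists [seq lift v | v <- vbasis W]; split; first by rewrite size_map size_tuple.
move=> x xk; set s' := s ++ _.
have [c0 clin cd] := dspan_closed s'.
have sx : symb k x \in symbs k by apply/symbsP; exists x.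
have : symb k x \in (W + D)%VS.
  have -> : (W + D = symbs k)%VS by rewrite /W addv_diff; exact/addv_idPl.
  exact: sx.
move=> /memv_addP[w wW [v /memv_imgP[u /symbsP[y yk <-] ->] sE]].
have Wk : (W <= symbs k)%VS by exact: diffvSl.
have sW : forall i : 'I_(\dim W), dspan s' (lift (vbasis W)`_i).
  move=> i P cP; apply; rewrite mem_cat map_f ?orbT //.
  by rewrite mem_nth // size_tuple.
have bP (i : 'I_(\dim W)) : fil k (lift (vbasis W)`_i) /\ symb k (lift (vbasis W)`_i) = (vbasis W)`_i.
  apply: liftP; apply: (subvP Wk); apply: vbasis_mem.
  by rewrite mem_nth // size_tuple.
pose z := \sum_i coord (vbasis W) i w *: lift (vbasis W)`_i.
have zP : [/\ dspan s' z, fil k z & symb k z = w].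
  rewrite [w in RHS](coord_vbasis wW) /z.
  elim/big_rec2 : _ => [|i v1 v2 _ [h1 h2 h3]].
    by split; [exact: c0|exact: fil0|apply/rowP => i; rewrite !mxE fsol0 lcoef0].
  have [f1 f2] := bP i.
  by split; [exact: clin|exact: fil_linear|rewrite symb_linear f2 h3].
have [z1 z2 z3] := zP.
have ys : dspan s' y.
  apply: (dspan_sub (s := s)); first by move=> a; rewrite mem_cat => ->.
  by apply: st; apply: fil_le yk; rewrite /k /deg; lia.
have [dy1 dy2] := fil_d yk; rewrite subrK in dy1 dy2.
have x'k : fil k (-1 *: (z + wm_d y) + x).
  apply: fil_linear => //; rewrite -[z]scale1r; exact: fil_linear.
have x's : symb k (-1 *: (z + wm_d y) + x) = 0.
  rewrite symb_linear -[z]scale1r symb_linear scale1r z3 dy2 sE lfunE /= scaleN1r.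
  by rewrite addNr.
have -> : x = 1 *: (z + wm_d y) + (-1 *: (z + wm_d y) + x).
  by rewrite scale1r scaleN1r addrA subrr add0r.
apply: (clin).
  by rewrite -[z]scale1r; apply: clin => //; exact: cd.
apply: (dspan_sub (s := s)); first by move=> a; rewrite mem_cat => ->.
apply: st; have := fil_pred x'k x's; congr (fil _ _); rewrite /k /deg; lia.
Qed.

Lemma dspan_finite : exists s : seq E, (size s <= m)%N /\ forall x, dspan s x.
Proof.
pose S n := (\sum_(t < n.+1) wdim t)%N.
have gen n : exists s : seq E, size s = S n /\ forall x, fil (deg n) x -> dspan s x.
  elim: n => [|n [s [sS sP]]].
    exists [::]; split.
      by rewrite /S big_ord1 /wdim /dim_symbs symbs0 dimv0 sub0n.
    by move=> x /fil_deg0 ->; have [] := dspan_closed [::].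
  have [s' [s'S s'P]] := dspan_step sP.
  by exists (s ++ s'); split=> //; rewrite size_cat sS s'S /S [RHS]big_ord_recr.
have Sm n : (S n <= m)%N by exact: sum_wdim.
(* The sums of [wdim] are bounded, so their maximum is attained; past [n0] no generator is added. *)
have [n0 n0P] : exists n0, forall n, (S n <= S n0)%N.
  have ex : exists k, `[< exists n, S n = k >] by exists (S 0%N); apply/asboolP; exists 0%N.
  have ub k : `[< exists n, S n = k >] -> (k <= m)%N by move=> /asboolP[n <-].
  case: (ex_maxnP ex ub) => k /asboolP[n0 n0k] kmax; exists n0 => n; rewrite n0k.
  by apply: kmax; apply/asboolP; exists n.
have [s [sS sP]] := gen n0; exists s; split; first by rewrite sS.
have H j : forall x, fil (deg (n0 + j)) x -> dspan s x.
  elim: j => [|j IH]; first by rewrite addn0.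
  have [s' [s'S s'P]] := dspan_step IH.
  have w0 : wdim (n0 + j).+1 = 0%N.
    have mon k : (S n0 <= S (n0 + k))%N.
      elim: k => [|k IHk]; first by rewrite addn0.
      by rewrite addnS {2}/S big_ord_recr /=; apply: leq_trans IHk (leq_addr _ _).
    have := n0P (n0 + j).+1; rewrite {1}/S big_ord_recr /= -/(S (n0 + j)%N).
    by have := mon j; lia.
  move: s'S s'P; rewrite w0 => /size0nil ->; rewrite cats0 addnS; exact.
move=> x; have [n nP] := fil_all x; apply: (H (n + hbound).+1); apply: nP.
rewrite /deg; lia.
Qed.

End Generators.

(* The formal Legendre transform t^n |-> rho^n sum_j kh^(-j) tau_j(n) s^(n + b j). *)
Section FormalTransform.
Variables (R : realType) (r m : nat) (lam rho kh : R[i]) (tau : nat -> {poly R[i]}).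
Local Notation C := R[i].
Local Notation b := (m + r)%N.
Hypothesis (r0 : (0 < r)%N) (m0 : (0 < m)%N) (rho0 : rho != 0) (kh0 : kh != 0).
Hypothesis (tau0 : tau 0%N = 1) (tauP : forall k, tau_step r m lam k (tau k) (tau k.+1)).
Implicit Types (f g : int -> C).

Definition ftc (j : nat) (n : int) : C := rho ^ n * kh ^- j * (tau j).[n%:~R].

Definition ftr f (N : int) : C :=
  \sum_(j \in [set: nat]) ftc j (N - (b * j)%N%:Z) * f (N - (b * j)%N%:Z).

Lemma ftrE f n N (J : nat) : lge n f -> N < n + (b * J)%N%:Z ->
  ftr f N = \sum_(j < J) ftc j (N - (b * (j : nat))%N%:Z) * f (N - (b * (j : nat))%N%:Z).
Proof.
move=> fn NJ; rewrite /ftr -(@fsbig_widen _ _ _ _ [set` index_iota 0 J]) //.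
  by rewrite -fsbig_seq ?iota_uniq // big_mkord.
move=> j [_ /= jJ]; rewrite /preimage /=.
have [lt|ge] := ltP (N - (b * j)%N%:Z) n; first by rewrite fn ?mulr0.
have Jj : (J <= j)%N by rewrite leqNgt; apply/negP => ltJ; apply: jJ; rewrite mem_index_iota.
have : (b * J <= b * j)%N by rewrite leq_mul2l Jj orbT.
lia.
Qed.

Lemma ftr_bound f (N : int) : laurent f -> exists n, lge n f /\
  exists J : nat, N < n + (b * J)%N%:Z.
Proof.
move=> [n fn]; exists n; split=> //; exists (absz (N - n)).+1.
have : (absz (N - n)%R < b * (absz (N - n)%R).+1)%N.
  have b0 : (0 < b)%N by rewrite addn_gt0 m0.
  by rewrite mulnS; have := leq_pmull (absz (N - n)%R) b0; lia.
lia.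
Qed.

Lemma ftr_lge f n : lge n f -> lge n (ftr f).
Proof.
by move=> fn N Nn; rewrite (@ftrE f n N 0) ?big_ord0 //; lia.
Qed.

(** In lowest order the term [j = 0] stands alone, so the transform of a nonzero series is
    nonzero. *)
Lemma ftr_lead f n : lge n f -> ftr f n = rho ^ n * f n.
Proof.
move=> fn; rewrite (@ftrE f n n 1) //; last by lia.
by rewrite big_ord1 muln0 subr0 /ftc tau0 hornerE expr0 invr1 !mulr1.
Qed.

Lemma ftr_linear k f g N : laurent f -> laurent g ->
  ftr (fun n => k * f n + g n) N = k * ftr f N + ftr g N.
Proof.
move=> lf lg; have [nf [fn [J1 J1P]]] := ftr_bound N lf; have [ng [gn [J2 J2P]]] := ftr_bound N lg.
pose J := maxn J1 J2.
have b0 : (0 < b)%N by rewrite addn_gt0 m0.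
have J1J : (b * J1 <= b * J)%N by rewrite leq_mul2l leq_max leqnn orbT.
have J2J : (b * J2 <= b * J)%N by rewrite leq_mul2l leq_max leqnn !orbT.
rewrite (ftrE fn (J := J)); last by lia.
rewrite (ftrE gn (J := J)); last by lia.
rewrite (@ftrE _ (Num.min nf ng) N J); last by lia.
  rewrite mulr_sumr -big_split /=; apply: eq_bigr => j _.
  by move: (ftc _ _) (f _) (g _) => *; ring.
move=> l; rewrite lt_min => /andP[l1 l2]; rewrite fn // gn // mulr0 addr0 //.
Qed.

Variable (c kp : C).
Hypothesis (c0 : c != 0) (kpE : kp = c * rho ^+ m) (khE : kh * rho ^+ r = - c).

Let ftc_step1 (j : nat) (n : int) :
  c * ftc j.+1 n = kp * ftc j.+1 (n - m%:Z) + (lam - n%:~R / r%:R) * ftc j (n + r%:Z).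
Proof.
have [tm _] := tauP j.
have := congr1 (fun p => p.[n%:~R]) tm; rewrite difE tauA_E => te.
have e1 : (tau j.+1).[n%:~R] = (tau j.+1).[n%:~R - m%:R] +
   (n%:~R / r%:R - lam) * (tau j).[n%:~R + r%:R] by rewrite -te; ring.
rewrite /ftc kpE e1.
have -> : (n - m%:Z)%:~R = n%:~R - m%:R :> C by rewrite intrB.
have -> : (n + r%:Z)%:~R = n%:~R + r%:R :> C by rewrite intrD.
rewrite expfzDr // expfzDr // -exprnN -exprnP exprSr invfM.
have -> : kh ^- j = kh ^- j * kh^-1 * kh by rewrite divfK.
have rm0 : rho ^+ m != 0 by rewrite expf_neq0.
have -> : c = - (kh * rho ^+ r) by rewrite khE opprK.
move: (tau _).[_] ((tau _).[_]) (rho ^ n) (kh ^- j) (rho ^+ r) (rho ^+ m) rm0 => u v w x y z z0.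
by field; rewrite z0 kh0 pnatr_eq0 -lt0n r0.
Qed.

Let ftc_step2 (j : nat) (n : int) :
  - c * ftc j.+1 (n - r%:Z) = kh * ftc j.+1 n +
   (tau_mu r m lam - (n + (b * j)%N%:Z)%:~R / m%:R) * ftc j n.
Proof.
have [_ tr] := tauP j.
have := congr1 (fun p => p.[n%:~R]) tr; rewrite difE tauB_E => te.
have e1 : (tau j.+1).[n%:~R] = (tau j.+1).[n%:~R - r%:R] +
   ((n%:~R + b%:R * j%:R) / m%:R - tau_mu r m lam) * (tau j).[n%:~R] by rewrite -te; ring.
rewrite /ftc e1.
have -> : (n - r%:Z)%:~R = n%:~R - r%:R :> C by rewrite intrB.
have -> : (n + (b * j)%N%:Z)%:~R = n%:~R + b%:R * j%:R :> C by rewrite intrD -natrM.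
rewrite expfzDr // -exprnN exprSr invfM.
have -> : kh ^- j = kh ^- j * kh^-1 * kh by rewrite divfK.
have rr0 : rho ^+ r != 0 by rewrite expf_neq0.
rewrite -khE; move: (tau_mu r m lam) (tau _).[_] ((tau _).[_]) (rho ^ n) (kh ^- j) (rho ^+ r) rr0 => mu u v w x z z0.
by field; rewrite z0 kh0 pnatr_eq0 -lt0n m0.
Qed.

Let ftc0 n : ftc 0 n = rho ^ n.
Proof. by rewrite /ftc tau0 hornerE expr0 invr1 !mulr1. Qed.

(** The operator [d/dz] becomes multiplication by [c w] with [w = s^(-m)]: the term [j + 1] on the
    right balances the terms [j + 1] and [j] on the left, by [ftc_step1]. *)
Lemma ftr_d f N : laurent f ->
  ftr (fun n => (lam - (n - r%:Z)%:~R / r%:R) * f (n - r%:Z) + kp * f (n + m%:Z)) N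
  = c * ftr f (N + m%:Z).
Proof.
move=> lf; have [n [fn [J JP]]] := ftr_bound (N + m%:Z) lf.
rewrite (ftrE fn (J := J.+1)); last by lia.
rewrite (@ftrE _ (n - m%:Z) N J.+1); last by lia.
  have split1 : \sum_(j < J.+1) ftc j (N - (b * (j : nat))%N%:Z) *
      ((lam - (N - (b * (j : nat))%N%:Z - r%:Z)%:~R / r%:R) * f (N - (b * (j : nat))%N%:Z - r%:Z) +
      kp * f (N - (b * (j : nat))%N%:Z + m%:Z)) =
    \sum_(j < J.+1) kp * ftc j (N - (b * (j : nat))%N%:Z) * f (N + m%:Z - (b * (j : nat))%N%:Z) +
    \sum_(j < J.+1) (lam - (N + m%:Z - (b * (j.+1 : nat))%N%:Z)%:~R / r%:R) * ftc j (N - (b * (j : nat))%N%:Z) *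
      f (N + m%:Z - (b * (j.+1 : nat))%N%:Z).
    rewrite -big_split /=; apply: eq_bigr => j _.
    have -> : N - (b * j)%N%:Z - r%:Z = N + m%:Z - (b * (j.+1))%N%:Z by rewrite mulnS; lia.
    have -> : N - (b * j)%N%:Z + m%:Z = N + m%:Z - (b * j)%N%:Z by lia.
    by move: (ftc _ _) (f _) (f _) => *; ring.
  rewrite split1 big_ord_recl [X in _ + X]big_ord_recr /=.
  rewrite [in X in _ + (_ + X)]fn ?mulr0 ?addr0; last first.
    by rewrite mulnS; lia.
  rewrite -addrA -big_split /= [in RHS]big_ord_recl mulrDr /=; congr (_ + _).
    by rewrite !ftc0 kpE muln0 !subr0 expfzDr // -exprnP; ring.
  rewrite mulr_sumr; apply: eq_bigr => j _; rewrite /bump /= add1n mulrA ftc_step1.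
  have -> : N + m%:Z - (b * j.+1)%N%:Z - m%:Z = N - (b * j.+1)%N%:Z by lia.
  have -> : N + m%:Z - (b * j.+1)%N%:Z + r%:Z = N - (b * j)%N%:Z by rewrite mulnS; lia.
  by rewrite [RHS]mulrDl.
by move=> l ln; rewrite !fn ?mulr0 ?addr0 //; lia.
Qed.

(** Likewise [- c z] becomes [d/dw] on series multiplied by the transformed exponential factor and
    by [w] to the power [tau_mu]. *)
Lemma ftr_z f N : laurent f ->
  - c * ftr (fun n => f (n + r%:Z)) N =
  (tau_mu r m lam - (N - m%:Z)%:~R / m%:R) * ftr f (N - m%:Z) + kh * ftr f (N + r%:Z).
Proof.
move=> lf; have [n [fn [J JP]]] := ftr_bound (N + r%:Z) lf.
rewrite (@ftrE f n (N + r%:Z) J.+1); [|by []|by lia].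
rewrite (@ftrE f n (N - m%:Z) J); [|by []|by lia].
rewrite (@ftrE _ (n - r%:Z) N J.+1); [| by move=> l ln; rewrite fn //; lia|by lia].
rewrite big_ord_recl [X in _ = _ + _ * X]big_ord_recl !mulrDr addrCA; congr (_ + _).
  by rewrite !ftc0 /= !muln0 !subr0 expfzDr // -khE -exprnP; ring.
rewrite !mulr_sumr -big_split /=; apply: eq_bigr => j _; rewrite /bump /= add1n.
have -> : N - (b * j.+1)%N%:Z + r%:Z = N + r%:Z - (b * j.+1)%N%:Z by lia.
have -> : N - m%:Z - (b * j)%N%:Z = N + r%:Z - (b * j.+1)%N%:Z by rewrite mulnS; lia.
have -> : N - (b * j.+1)%N%:Z = N + r%:Z - (b * j.+1)%N%:Z - r%:Z by lia.
rewrite [LHS]mulrA ftc_step2 (_ : _ + (b * j)%N%:Z = N - m%:Z); last by rewrite mulnS; lia.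
by move: (ftc _ _) (ftc _ _) (f _) => *; ring.
Qed.

End FormalTransform.

Section FormalFourier.
Variables (R : realType) (r m : nat).
Local Notation C := R[i].
Local Notation b := (m + r)%N.
Hypothesis (r0 : (0 < r)%N) (m0 : (0 < m)%N).

(** With the pairing [c z w], the Legendre transform of [z^(b/r)] has a coefficient of modulus 1
    exactly for this positive [c]; by [fscaleE] it is also the constant of [young]. *)
Definition fscale_val : R := b%:R / r%:R * (r%:R / m%:R) `^ (m%:R / b%:R).

Lemma fscale_gt0 : 0 < fscale_val.
Proof.
by rewrite mulr_gt0 ?powR_gt0 ?divr_gt0 ?ltr0n // addn_gt0 m0.
Qed.

Definition fscale : {posnum R} := PosNum fscale_gt0.
Local Notation c := fscale.
Local Notation rmod := ((m%:R / r%:R) `^ b%:R^-1 : R).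

Let rR0 : (0 : R) < r%:R. Proof. by rewrite ltr0n. Qed.
Let mR0 : (0 : R) < m%:R. Proof. by rewrite ltr0n. Qed.
Let bR0 : (0 : R) < b%:R. Proof. by rewrite ltr0n addn_gt0 m0. Qed.

Lemma rmod_gt0 : 0 < rmod.
Proof. by rewrite powR_gt0 // divr_gt0. Qed.

Lemma rmod_m : fscale_val * rmod ^+ m = b%:R / r%:R.
Proof.
rewrite /fscale_val -powR_mulrn ?powR_ge0 // -powRrM -[LHS]mulrA.
have e : b%:R^-1 * m%:R = m%:R / b%:R :> R by rewrite mulrC.
rewrite e -powRM ?divr_ge0 ?ltW //.
have -> : r%:R / m%:R * (m%:R / r%:R) = 1 :> R by field; rewrite !gt_eqF.
by rewrite powR1 mulr1.
Qed.

Lemma rmod_b : rmod ^+ b = m%:R / r%:R.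
Proof.
rewrite -powR_mulrn ?powR_ge0 // -powRrM mulVf ?gt_eqF // powRr1 // divr_ge0 ?ltW //.
Qed.

Lemma rmod_r : b%:R / m%:R * rmod ^+ r = fscale_val.
Proof.
have rm := rmod_gt0.
have rmm : rmod ^+ m != 0 by rewrite expf_neq0 ?gt_eqF.
apply: (mulIf rmm); rewrite rmod_m.
have -> : b%:R / m%:R * rmod ^+ r * rmod ^+ m = b%:R / m%:R * rmod ^+ b by rewrite exprD; ring.
by rewrite rmod_b; field; rewrite !gt_eqF.
Qed.

(** The class of [- i'] modulo [r], written as [i' * (r - 1)] to stay in [nat]. *)
Definition dual_idx (i' : nat) : 'I_r := Ordinal (ltn_pmod (i' * r.-1)%N r0).

(* rho^m = kappa_i / c and kappa^_i' rho^r = - c with i = - i' mod r. *)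
Definition frho (i' : nat) : C := polar rmod (- (2 * pi * i'%:R / (r%:R * m%:R))).

Lemma frho_neq0 i' : frho i' != 0.
Proof.
by rewrite -nrm_eq0 /frho nrm_polar gtr0_norm ?rmod_gt0 // gt_eqF ?rmod_gt0.
Qed.

Lemma polar_int (x : R) (k : nat) : polar 1 (x + 2 * pi * k%:R) = polar 1 x :> C.
Proof.
elim: k => [|k IH]; first by rewrite mulr0 addr0.
have -> : x + 2 * pi * k.+1%:R = x + 2 * pi * k%:R + pi + pi.
  by rewrite -[k.+1%:R]natr1; move: (pi : R) => q; ring.
by rewrite !polarDpi opprK.
Qed.

Lemma frho_m i' : b%:R / r%:R * expfac_coef R (Theta r b) (dual_idx i' : nat)%:Z =
  (c%:num)%:C * frho i' ^+ m.
Proof.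
have kE (k : nat) : k%:Z%:~R = k%:R :> R by [].
rewrite /expfac_coef /= expr0 mul1r /frho polarX [in RHS]polar1E mulrA -rmorphM /= -/fscale_val rmod_m kE.
congr (_ * _); first by rewrite rmorphM /= fmorphV /= !rmorph_nat.
set i := ((i' * r.-1) %% r)%N; set q := ((i' * r.-1) %/ r)%N.
have e1 : i%:R + r%:R * q%:R = i'%:R * (r%:R - 1) :> R.
  have := divn_eq (i' * r.-1) r; rewrite -/i -/q => /(congr1 (fun n => n%:R : R)).
  rewrite natrM natrD natrM -subn1 natrB // => ->; ring.
rewrite -(polar_int _ q) -[in RHS](polar_int _ i'); congr polar.
have -> : i%:R = i'%:R * (r%:R - 1) - r%:R * q%:R :> R by rewrite -e1 addrK.
have h1 := gt_eqF rR0; have h2 := gt_eqF mR0; move: (pi : R) => p; field.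
by rewrite h1 h2.
Qed.

Lemma frho_r i' : b%:R / m%:R * expfac_coef R (Theta_hat m b) i'%:Z * frho i' ^+ r = - (c%:num)%:C.
Proof.
have kE (k : nat) : k%:Z%:~R = k%:R :> R by [].
rewrite /expfac_coef /= expr1 mulN1r mulrN mulNr -mulrA /frho polarX polarM mul1r kE; congr (- _).
have -> : 2 * pi * i'%:R / m%:R + r%:R * - (2 * pi * i'%:R / (r%:R * m%:R)) = 0 :> R.
  have h1 := gt_eqF rR0; have h2 := gt_eqF mR0; move: (pi : R) => p; field.
  by rewrite h1 h2.
by rewrite polar0 -rmod_r !rmorphM /= fmorphV /= !rmorph_nat.
Qed.

Variable E : weyl_module R.
Local Notation F := (rescale c (fourier E)).

Section OneSolution.
Variables (i' : nat) (lam : C) (Y : E -> int -> C) (tau : nat -> {poly C}).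
Hypothesis (tau0 : tau 0%N = 1) (tauP : forall k, tau_step r m lam k (tau k) (tau k.+1)).
Hypothesis YP : formal_solution (Theta r b) (dual_idx i' : nat)%:Z lam Y.
Local Notation kh := (b%:R / m%:R * expfac_coef R (Theta_hat m b) i'%:Z).
Local Notation T := (ftr r m (frho i') kh tau).

Let kh0 : kh != 0.
Proof.
apply/eqP => k0; have := frho_r i'; rewrite k0 mul0r => /esym/eqP.
by rewrite oppr_eq0 -nrm_eq0 nrmR gtr0_norm ?fscale_gt0 // gt_eqF // fscale_gt0.
Qed.

Let c0 : (c%:num)%:C != 0 :> C.
Proof. by rewrite -nrm_eq0 nrmR gtr0_norm ?fscale_gt0 // gt_eqF // fscale_gt0. Qed.

Let TZ k f N : laurent f -> T (fun n => k * f n) N = k * T f N.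
Proof.
move=> lf; have := ftr_linear tau r0 m0 (frho_neq0 i') kh0 k N lf (laurent0 R).
rewrite (_ : (fun n => k * f n + 0) = (fun n => k * f n)); last by apply/funext => n; rewrite addr0.
move=> ->; rewrite {2}/ftr fsbig1 ?addr0 // => j _; by rewrite mulr0.
Qed.

Lemma fourier_formal : @formal_solution R (Theta_hat m b) i'%:Z (tau_mu r m lam) F (fun x => T (Y x)).
Proof.
have [Y1 Y2 Y3 Y4] := YP.
have Y0 n : Y 0 n = 0 by have := Y2 (-1) 0 0 n; rewrite scaler0 addr0 mulN1r addNr.
have YZ k x n : Y (k *: x) n = k * Y x n by rewrite -[k *: x]addr0 Y2 Y0 addr0.
split=> /= [x|k x y n|x n|x n].
- by have [p xp] := Y1 x; exists p; apply: ftr_lge => //; exact: frho_neq0.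
- rewrite -ftr_linear ?frho_neq0 //; congr (ftr _ _ _ _ _ _ n); apply/funext => l; exact: Y2.
- rewrite (_ : Y _ = fun l => (c%:num^-1)%:C * Y (wm_d x) l); last by apply/funext => l; exact: YZ.
  rewrite TZ //; have -> := funext (Y4 x).
  have := @ftr_d R r m lam (frho i') kh tau r0 m0 (frho_neq0 i') kh0 tau0 tauP (c%:num)%:C
     (b%:R / r%:R * expfac_coef R (Theta r b) (dual_idx i' : nat)%:Z) c0 (frho_m i') (frho_r i')
     (Y x) n (Y1 x).
  rewrite (_ : (fun n0 => _ + _ * Y x (n0 + m%:Z)) = (fun n0 => (lam - (n0 - r%:Z)%:~R / r%:R) * Y x (n0 - r%:Z) +
    b%:R / r%:R * expfac_coef R (Theta r b) (dual_idx i' : nat)%:Z * Y x (n0 - r%:Z + b%:Z))).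
    by move=> ->; rewrite mulrA -rmorphM /= mulVf ?gt_eqF ?fscale_gt0 // mul1r.
  by apply/funext => l; congr (_ + _ * Y x _); rewrite PoszD; lia.
- rewrite (_ : Y _ = fun l => (- (c%:num)%:C) * Y x (l + r%:Z)); last first.
    by apply/funext => l; rewrite YZ -scaleN1r YZ Y3 mulN1r mulrN mulNr.
  rewrite TZ; last by have [p xp] := Y1 x; exists (p - r%:Z) => l lp; rewrite xp //; lia.
  rewrite (@ftr_z R r m lam (frho i') kh tau r0 m0 (frho_neq0 i') kh0 tau0 tauP (c%:num)%:C
     c0 (frho_r i') (Y x) n (Y1 x)).
  congr (_ + _ * ftr _ _ _ _ _ _ _); rewrite PoszD; lia.
Qed.

Lemma fourier_formal_neq0 : (exists x n, Y x n != 0) -> exists x n, T (Y x) n != 0.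
Proof.
move=> [x [n xn]]; have f0 : fsol YP x != 0.
  by apply: contraNneq xn => /(congr1 (fun f : lseries R => f n)) /= ->.
have [p xp xp0] := lord_exists f0; exists x, p.
rewrite ftr_lead //; last exact: frho_neq0.
rewrite mulf_eq0 negb_or; apply/andP; split; last exact: xp0.
by apply: expfz_neq0; exact: frho_neq0.
Qed.
End OneSolution.

Theorem irregular_class_fourier :
  irregular_class (Theta r b) E -> irregular_class (Theta_hat m b) F.
Proof.
move=> [e [eP [lam [Y [YP [H [HL HP]]]]]]].
have rb : (r < b)%N by rewrite -[X in (X < _)%N]add0n ltn_add2r.
have MH : (\matrix_(i, j) fsol (YP i) (e j)) *m (\matrix_(j, l) LSeries (HL j l)) = 1%:M.
  apply/matrixP => i l; apply: lseries_eq => n; rewrite !mxE lcoef_sum.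
  transitivity (\sum_j laurent_mul (Y i (e j)) (H j l) n).
    by apply: eq_bigr => j _; rewrite !mxE lcoefM.
  by rewrite HP; case: (i == l) => /=; rewrite ?mulr1n ?mulr0n ?lcoef0 ?lcoef1.
have Y0 i : exists x n, Y i x n != 0.
  apply: contrapT => N; have /matrixP/(_ i i) := MH; rewrite !mxE eqxx big1 => [/esym/eqP|j _].
    by rewrite oner_eq0.
  rewrite !mxE (_ : fsol _ _ = 0) ?mul0r //; apply: lseries_eq => n /=.
  by apply/eqP; apply: contraT => yn; case: N; exists (e j), n.
have /choice[tau tauP] : forall i', exists tau : nat -> {poly C}, tau 0%N = 1 /\
    forall k, tau_step r m (lam (dual_idx i')) k (tau k) (tau k.+1).
  by move=> i'; exact: tau_exists.
pose Yh (i' : 'I_m) x := ftr r m (frho i')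
  (b%:R / m%:R * expfac_coef R (Theta_hat m b) (i' : nat)%:Z) (tau i') (Y (dual_idx i') x).
have YhP (i' : 'I_m) : @formal_solution R (Theta_hat m b) (i' : nat)%:Z
    (tau_mu r m (lam (dual_idx i'))) F (Yh i').
  by have [t0 tP] := tauP i'; exact: fourier_formal.
have Yh0 i' : exists x n, Yh i' x n != 0.
  by have [t0 tP] := tauP i'; exact: (fourier_formal_neq0 t0 (YP (dual_idx i')) (Y0 (dual_idx i'))).
have mb : (m < b)%N by rewrite -[X in (X < _)%N]addn0 ltn_add2l.
have [s [sm sP]] := @dspan_finite R (Theta r b) E r0 rb e eP lam Y YP _ MH.
rewrite /= addnK in sm.
apply: (@irregular_class_gen R (Theta_hat m b) F m0 mb _ Yh YhP Yh0 (fun j => s`_j)) => x.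
apply: (sP x (fun x => exists p : 'I_m -> {poly C}, x = \sum_j wm_poly (E := F) (p j) s`_j)).
  split=> [|k y z [p ->] [q ->]|y [p ->]].
  - by exists (fun=> 0); rewrite big1 // => j _; rewrite wm_poly0.
  - exists (fun j => k *: p j + q j); rewrite scaler_sumr -big_split /=.
    by apply: eq_bigr => j _; rewrite wm_poly_lin.
  (* The coordinate of [F] acts as [c^-1] times the derivation of [E], whence the factor [c] on the
     coefficients. *)
  - exists (fun j => (c%:num)%:C *: ('X * p j) + 0).
    rewrite [RHS](eq_bigr (fun j => (c%:num)%:C *: @wm_z R F (wm_poly (E := F) (p j) s`_j))); last first.
      by move=> j _; rewrite wm_poly_lin wm_poly0 addr0 wm_polyXM.
    rewrite -scaler_sumr -wm_z_sum /= scalerA -rmorphM /= divff ?gt_eqF ?fscale_gt0 //.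
    by rewrite rmorph1 scale1r.
move=> y ys; have ism : (index y s < m)%N by apply: leq_trans sm; rewrite index_mem.
exists (fun j => (j == Ordinal ism)%:R); rewrite (bigD1 (Ordinal ism)) //= eqxx wm_poly1.
rewrite nth_index // big1 ?addr0 // => j /negbTE ->; by rewrite wm_poly0.
Qed.

End FormalFourier.

(** * Growth of solutions and determinants *)

Section RealBounds.
Variable R : realType.

Lemma pow_le_exp (N : nat) (d x : R) : 0 < d -> 0 <= x -> x ^+ N <= (N.+1%:R / d) ^+ N * expR (d * x).
Proof.
move=> d0 x0; have N0 : 0 < N.+1%:R :> R by rewrite ltr0n.
have h : (d * x / N.+1%:R) ^+ N <= expR (d * x).
  apply: (@le_trans _ _ (expR (d * x / N.+1%:R) ^+ N)).
    apply: lerXn2r; rewrite ?nnegrE ?expR_ge0 //; last exact: le_expR.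
    exact: divr_ge0 (mulr_ge0 (ltW d0) x0) (ltW N0).
  rewrite -expRM_natl ler_expR -[N.+1%:R]natr1 mulrCA ler_piMr ?mulr_ge0 ?(ltW d0) //.
  by rewrite ler_pdivrMr ?ltr_wpDl // mul1r lerDl.
have -> : x ^+ N = (N.+1%:R / d) ^+ N * (d * x / N.+1%:R) ^+ N.
  by rewrite -exprMn; congr (_ ^+ _); field; rewrite !gt_eqF.
by apply: ler_wpM2l => //; rewrite exprn_ge0 // divr_ge0 ?ltW.
Qed.

Lemma exp_small (K d : R) (eps : R) : 0 < d -> 0 < eps ->
  exists rho : R, forall x, rho <= x -> K * expR (- (d * x)) < eps.
Proof.
move=> d0 e0; exists ((`|K| + 1) / (eps * d)) => x xr.
have K1 : 0 < `|K| + 1 by rewrite ltr_wpDl.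
have x0 : 0 < x by apply: lt_le_trans xr; rewrite divr_gt0 // mulr_gt0.
apply: (@le_lt_trans _ _ (`|K| * expR (- (d * x)))).
  by rewrite ler_wpM2r ?expR_ge0 // ler_norm.
rewrite expRN ltr_pdivrMr ?expR_gt0 //.
apply: (@lt_le_trans _ _ (`|K| + 1)); first by rewrite ltrDl.
apply: (@le_trans _ _ (eps * (d * x))); last by apply: ler_wpM2l; [exact: ltW|exact: le_expR].
by move: xr; rewrite ler_pdivrMr ?mulr_gt0 // mulrC mulrA.
Qed.

Lemma le_powR (x p : R) : 1 <= x -> 1 <= p -> x <= x `^ p.
Proof.
move=> x1 p1; rewrite -{1}[x]powRr1 ?(le_trans ler01) //.
by apply: ler_powR.
Qed.
End RealBounds.

Section Det.
Variables (R : realType) (Th : irr_class) (E : weyl_module R).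
Local Notation C := R[i].
Local Notation r := (ic_rank Th).
Local Notation b := (ic_num Th).
Local Notation p := (b%:R / r%:R : R).
Hypothesis (r0 : (0 < r)%N) (rb : (r < b)%N).
Variable V : stokes_of Th E.
Variables (e : 'I_r -> E) (eP : wm_basis e).
Hypothesis trE : forall x, \sum_j (conn eP j j).[x] = trace_sign R Th * (b%:R * x ^+ b.-1).

Let b0 : (0 < b)%N. Proof. exact: ltn_trans rb. Qed.

Lemma p_ge1 : 1 <= p.
Proof. by rewrite ler_pdivlMr ?ltr0n // mul1r ler_nat ltnW. Qed.

Lemma expfacE (i : int) rho t : expfac Th i rho t =
  polar (rho `^ p) (b%:R * t / r%:R) * expfac_coef R Th i.
Proof.
rewrite /expfac /expfac_coef mulrCA polarM mulr1; congr (_ * polar _ _).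
by rewrite mulrDl addrC.
Qed.

Lemma Re_trace_sign (rho t : R) : 0 <= rho ->
  complex.Re (trace_sign R Th * polar rho t ^+ b) =
  rho `^ p * \sum_(i < r) sval r (undir Th t) (i : nat)%:Z.
Proof.
move=> rho0; rewrite mulr_sumr; under eq_bigr => i _ do rewrite -(Re_expfac r0 b0).
have ReS (F : 'I_r -> C) : \sum_i complex.Re (F i) = complex.Re (\sum_i F i).
  by apply/esym; apply: (big_morph (@complex.Re R)) => // x y; rewrite cReD.
rewrite ReS; congr complex.Re; under eq_bigr => i _ do rewrite expfacE.
rewrite -mulr_sumr /trace_sign; have [r1|nr1] := eqVneq r 1%N; last first.
  by rewrite expfac_coef_sum ?mulr0 ?mul0r //; lia.
rewrite (eq_bigr (fun=> (-1) ^+ ic_neg Th)); last first.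
  move=> i _; have -> : (i : nat) = 0%N by have := ltn_ord i; lia.
  by rewrite /expfac_coef mulr0 mul0r polar0 mulr1.
rewrite sumr_const card_ord r1 mulr1n !divr1 mulrC polarX powR_mulrn //.
Qed.

Variables (t : R).
Hypothesis tS : non_stokes Th t.
Local Notation s i := (sval r (undir Th t) (i : nat)%:Z).

Lemma adapted_ex : exists v : 'I_r -> V,
  (forall i : 'I_r, v i \in ss_F V t (i : nat)%:Z) /\
  (forall i : 'I_r, v i \notin filt_lt Th (@ss_F _ _ V) t (i : nat)%:Z).
Proof.
have /choice[v vP] : forall i : 'I_r, exists v : V, v \in ss_F V t (i : nat)%:Z /\
   v \notin filt_lt Th (@ss_F _ _ V) t (i : nat)%:Z.
  move=> i; apply: contrapT => N.
  have : (ss_F V t (i : nat)%:Z <= filt_lt Th (@ss_F _ _ V) t (i : nat)%:Z)%VS.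
    apply/subvP => v vF; apply: contraT => vn; case: N; exists v; split=> //.
  by move=> /dimvS; rewrite ss_gr // ltnn.
by exists v; split=> i; have [] := vP i.
Qed.

Variable v : 'I_r -> V.
Hypothesis vF : forall i : 'I_r, v i \in ss_F V t (i : nat)%:Z.
Hypothesis vn : forall i : 'I_r, v i \notin filt_lt Th (@ss_F _ _ V) t (i : nat)%:Z.

Lemma dir_ltS i j : dir_lt Th t i j = (sval r (undir Th t) i < sval r (undir Th t) j).
Proof. by rewrite -{1}(undirK r0 b0 t) dir_ltE. Qed.

(** A relation would put the vector of largest index that occurs into the span of the smaller
    steps. *)
Lemma adapted_free (c : 'I_r -> C) : \sum_i c i *: v i = 0 -> forall i, c i = 0.
Proof.
move=> c0 i0; apply/eqP; apply: contraT => ci0.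
pose k := [arg max_(i > i0 | c i != 0) s i]%O.
have : c k != 0 /\ forall j, c j != 0 -> s j <= s k.
  by rewrite /k; case: arg_maxP => // i ci imax; split.
case=> ck kmax; exfalso; move/negP: (vn k); apply.
have -> : v k = - (c k)^-1 *: \sum_(j | j != k) c j *: v j.
  move: c0; rewrite (bigD1 k) //= => /eqP; rewrite addr_eq0 => /eqP h.
  by rewrite -[v k](scalerK ck) h scalerN scaleNr.
apply: memvZ; apply: memv_suml => j jk.
have [->|cj] := eqVneq (c j) 0; first by rewrite scale0r mem0v.
apply: memvZ; have jk' : dir_lt Th t (j : nat)%:Z (k : nat)%:Z.
  have /or3P[ij|//|] := tS (j : nat)%:Z (k : nat)%:Z.
    exfalso; move/eqP: jk; apply; apply: val_inj.
    move: ij; rewrite /idx_eq !modz_small ?ltz_nat ?ltn_ord //.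
    by move/eqP => [].
  by rewrite dir_ltS => kj; have := kmax j cj; rewrite leNgt kj.
rewrite /filt_lt; apply: (subvP (sumv_sup j jk' (subvv _))); exact: vF.
Qed.

Lemma so_solD (c : 'I_r -> C) m x : so_sol (\sum_i c i *: v i) m x = \sum_i c i * so_sol (v i) m x.
Proof.
have s0 : so_sol (0 : V) m x = 0.
  by have := so_linear (-1) (0 : V) 0 m x; rewrite scaler0 addr0 mulN1r addNr.
elim/big_rec2 : _ => // i y1 y2 _ IH; by rewrite so_linear -IH.
Qed.

Lemma so_lsol (w : V) : lsol (fun=> True) (so_sol w).
Proof. by apply: solution_lsol; apply/so_solution; exists w. Qed.

Definition wmat (x : C) : 'M[C]_r := \matrix_(i, j) so_sol (v i) (e j) x.

(** By [lsol_uniq], a relation between the rows at one point is a relation between the solutions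
    themselves. *)
Lemma wmat_unit x : wmat x \in unitmx.
Proof.
rewrite -row_free_unit -kermx_eq0; apply/eqP/row_matrixP => l; rewrite row0.
set u := row l (kermx (wmat x)).
have uM : u *m wmat x = 0 by rewrite /u -row_mul mulmx_ker row0.
have u0 : so_sol (\sum_i u 0 i *: v i) = so_sol (0 : V).
  apply/funext => m; apply/funext => z.
  rewrite (lsol_uniq eP (x0 := x) (so_lsol _)); last first.
    move=> j; rewrite so_solD; have /rowP/(_ j) := uM; rewrite mxE [RHS]mxE => uj.
    by rewrite -[RHS]uj; apply: eq_bigr => i _; rewrite [wmat x i j]mxE.
  have := so_linear (-1) (0 : V) 0 m z; rewrite scaler0 addr0 mulN1r addNr.
  by move=> ->.
by apply/rowP => i; rewrite [RHS]mxE; exact: (@adapted_free (fun i => u 0 i) (so_inj u0)).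
Qed.

(** The rate [d] absorbs the power of [rho] that moderate growth allows. *)
Lemma adapted_bound (d : R) : 0 < d -> exists2 B : R, 0 < B & exists2 rho1 : R, 1 <= rho1 &
  forall i j (rho : R), rho1 <= rho ->
  nrm (so_sol (v i) (e j) (polar rho t)) <= B * expR ((s i + d) * rho `^ p).
Proof.
move=> d0.
have /choice[f fP] : forall ij : 'I_r * 'I_r, exists f : R * R, [/\ 0 < f.1, 1 <= f.2 &
    forall rho : R, f.2 <= rho -> nrm (so_sol (v ij.1) (e ij.2) (polar rho t)) <=
     f.1 * expR ((s ij.1 + d) * rho `^ p)].
  move=> [i j] /=; have /so_growth/(_ (e j)) := vF i; case/(_ tS) => N [A [rho0 [eps [h1 h2 H]]]].
  exists ((`|A| + 1) * ((N.+1%:R / d) ^+ N + 1), rho0 + 1).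
  have c1 : 0 < (N.+1%:R / d) ^+ N + 1 by rewrite ltr_wpDl // exprn_ge0 // divr_ge0 // ltW.
  have A1 : 0 < `|A| + 1 by rewrite ltr_wpDl.
  split=> /=; [by rewrite mulr_gt0|by rewrite lerDr ltW|] => rho hr.
  have r1 : 1 <= rho by apply: le_trans hr; rewrite lerDr ltW.
  have rr0 : 0 <= rho by apply: le_trans r1.
  have : nrm (so_sol (v i) (e j) (polar rho t)) <= A * rho ^+ N * expR (complex.Re (expfac Th (i : nat)%:Z rho t)).
    rewrite -lecR -normrE; apply: H; last by rewrite subrr normr0.
    by apply: le_trans hr; rewrite lerDl.
  rewrite (Re_expfac r0 b0) => hb; apply: le_trans hb _.
  have eE : expR ((s i + d) * rho `^ p) = expR (rho `^ p * s i) * expR (d * rho `^ p).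
    by rewrite -expRD; congr expR; ring.
  rewrite eE; have := expR_ge0 (rho `^ p * s i); move: (expR (rho `^ p * s i)) => S S0.
  have -> : (`|A| + 1) * ((N.+1%:R / d) ^+ N + 1) * (S * expR (d * rho `^ p)) =
    S * ((`|A| + 1) * ((N.+1%:R / d) ^+ N + 1) * expR (d * rho `^ p)) by ring.
  rewrite [_ * S]mulrC; apply: ler_wpM2l => //.
  apply: (@le_trans _ _ ((`|A| + 1) * rho ^+ N)).
    by apply: ler_wpM2r; rewrite ?exprn_ge0 // (le_trans (ler_norm _)) // lerDl.
  rewrite -mulrA; apply: ler_wpM2l; first exact: ltW.
  apply: (le_trans (pow_le_exp N d0 rr0)).
  apply: ler_pM; [|exact: expR_ge0| |].
  - by rewrite exprn_ge0 // divr_ge0 ?(ltW d0).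
  - by rewrite lerDl.
  by rewrite ler_expR ler_pM2l // le_powR // p_ge1.
have f10 : 0 <= \sum_ij (f ij).1 by apply: sumr_ge0 => ij _; have [/ltW] := fP ij.
have f20 : 0 <= \sum_ij (f ij).2.
  by apply: sumr_ge0 => ij _; have [_ h _] := fP ij; apply: le_trans h.
have le1 ij : (f ij).1 <= \sum_ij (f ij).1.
  by rewrite (bigD1 ij) //= lerDl; apply: sumr_ge0 => k _; have [/ltW] := fP k.
have le2 ij : (f ij).2 <= \sum_ij (f ij).2.
  rewrite (bigD1 ij) //= lerDl; apply: sumr_ge0 => k _; have [_ h _] := fP k.
  by apply: le_trans h.
exists (\sum_ij (f ij).1 + 1); first by rewrite ltr_wpDl.
exists (\sum_ij (f ij).2 + 1); first by rewrite lerDr.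
move=> i j rho hr; have [h1 h2 H] := fP (i, j); apply: (le_trans (H rho _)).
  by apply: le_trans hr; apply: (le_trans (le2 (i, j))); rewrite lerDl.
apply: ler_wpM2r; first exact: expR_ge0.
by apply: (le_trans (le1 (i, j))); rewrite lerDl.
Qed.

Section Small.
Variables (D : C -> Prop) (g : E -> C -> C) (rhoD : R).
Hypothesis cD : forall x y (s : R), 0 <= s <= 1 -> D x -> D y -> D (x + s%:C * (y - x)).
Hypothesis Dray : forall rho : R, rhoD <= rho -> D (polar rho t).
Hypothesis lg : lsol D g.
Variables (i0 : 'I_r) (A mu : R).
Hypothesis gb : forall j (rho : R), rhoD <= rho ->
  nrm (g (e j) (polar rho t)) <= A * expR (mu * rho `^ p).
Hypothesis mui0 : mu < s i0.

Let fam (i : 'I_r) := if i == i0 then g else so_sol (v i).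

Let fam_lsol i : lsol D (fam i).
Proof.
by rewrite /fam; case: eqP => _ //; apply: lsol_sub (so_lsol _).
Qed.

(** Up to the exponential of the trace, whose rate is the sum of the [s i], the Wronskian is
    constant. With [g] in place of [v i0] the growth bounds multiply to a smaller rate, so the
    constant tends to 0 along the ray. *)
Lemma det_small_fam x : D x -> wronskian e fam x = 0.
Proof.
move=> Dx; apply/eqP; apply: contraT => Wx; exfalso.
(* The errors [d] of at most [r] rows together spend half of the gap between [mu] and [s i0]. *)
pose d := (s i0 - mu) / (2 * r%:R).
have rR0 : 0 < r%:R :> R by rewrite ltr0n.
have d0 : 0 < d by rewrite divr_gt0 ?subr_gt0 // mulr_gt0.
have [B B0 [rho1 rho11 HB]] := adapted_bound d0.
pose sg := trace_sign R Th.
pose kap := nrm (wronskian e fam x) * expR (- complex.Re (sg * x ^+ b)).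
have kap0 : 0 < kap by rewrite mulr_gt0 ?expR_gt0 // nrm_gt0.
pose bd (i : 'I_r) := if i == i0 then mu else s i + d.
pose Bs := `|A| + B.
have Bs0 : 0 <= Bs by rewrite addr_ge0 // ltW.
pose K := \sum_(q : {perm 'I_r}) Bs ^+ r.
have Wb (rho : R) : Num.max rho1 rhoD <= rho -> nrm (wronskian e fam (polar rho t)) <=
    K * expR ((\sum_i bd i) * rho `^ p).
  rewrite ge_max => /andP[h1 h2]; rewrite /wronskian.
  apply: (le_trans (nrm_sum _ _ _)); rewrite /K mulr_suml; apply: ler_sum => q _.
  have -> : nrm ((-1) ^+ q * \prod_i (\matrix_(i, j) fam i (e j) (polar rho t)) i (q i)) =
      \prod_i nrm (fam i (e (q i)) (polar rho t)).
    rewrite nrmM nrmX nrmN nrm1 expr1n mul1r nrm_prod; apply: eq_bigr => i _; by rewrite mxE.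
  rewrite mulr_suml expR_sum -[r in Bs ^+ r]card_ord -prodr_const -big_split /=.
  apply: ler_prod => i _; rewrite nrm_ge0 /= /fam /bd; case: eqP => _.
    apply: (le_trans (gb _ h2)); apply: ler_wpM2r; first exact: expR_ge0.
    by apply: (le_trans (ler_norm _)); rewrite lerDl ltW.
  apply: (le_trans (HB _ _ _ h1)); apply: ler_wpM2r; first exact: expR_ge0.
  by rewrite lerDr.
have const (rho : R) : Num.max rho1 rhoD <= rho ->
    kap = nrm (wronskian e fam (polar rho t)) * expR (- (rho `^ p * \sum_(i < r) s i)).
  rewrite ge_max => /andP[h1 h2].
  have rr0 : 0 <= rho by apply: le_trans h1; apply: le_trans rho11.
  have := wronskian_exp cD trE fam_lsol Dx (Dray h2).
  move=> /(congr1 (@nrm R)); rewrite !nrmM !nrm_cexp !cReN => h.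
  by rewrite /kap h Re_trace_sign.
have bds : \sum_i bd i <= \sum_(i < r) s i - r%:R * d.
  rewrite (bigD1 i0) //= [X in _ <= X - _](bigD1 i0) //= {1}/bd eqxx.
  rewrite (eq_bigr (fun i : 'I_r => s i + d)); last by move=> i /negbTE h; rewrite /bd h.
  rewrite big_split /= sumr_const.
  have -> : #|(fun i : 'I_r => i != i0)| = r.-1 by rewrite cardC1 card_ord.
  have rd : r%:R * d = (s i0 - mu) / 2 by rewrite /d; field; rewrite gt_eqF.
  have : d *+ r.-1 <= r%:R * d.
    by rewrite -mulr_natl ler_wpM2r ?(ltW d0) // ler_nat leq_pred.
  rewrite rd; move: (\sum_(i < r | i != i0) s i) (d *+ _) (s i0) mui0 => S1 S2 si mlt; lra.
have rd0 : 0 < r%:R * d by rewrite mulr_gt0.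
have [rho2 rho2P] := exp_small K rd0 kap0.
pose rho := Num.max (Num.max rho1 rhoD) rho2.
have h1 : Num.max rho1 rhoD <= rho by rewrite le_max lexx.
have rho_1 : 1 <= rho by apply: le_trans h1; rewrite le_max rho11.
have h2 : rho2 <= rho `^ p.
  apply: (@le_trans _ _ rho); first by rewrite /rho le_max lexx orbT.
  by rewrite le_powR // p_ge1.
have := rho2P _ h2; rewrite ltNge => /negP; apply.
rewrite (const _ h1); apply: (@le_trans _ _ (K * expR ((\sum_i bd i) * rho `^ p) *
   expR (- (rho `^ p * \sum_(i < r) s i)))).
  by apply: ler_wpM2r; [exact: expR_ge0|exact: Wb].
rewrite -mulrA -expRD; apply: ler_wpM2l.
  by apply: sumr_ge0 => q _; rewrite exprn_ge0.
rewrite ler_expR [rho `^ p * _]mulrC -mulrBl -mulNr; apply: ler_wpM2r; first exact: powR_ge0.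
by move: bds; move: (\sum_i bd i) (\sum_(i < r) s i) (r%:R * d) => *; lra.
Qed.

(** By Cramer's rule this entry is the determinant times the coordinate of [g] on the solution
    [v i0]. *)
Lemma det_small x : D x -> ((\row_j g (e j) x) *m \adj (wmat x)) 0 i0 = 0.
Proof.
move=> Dx; rewrite -[RHS](det_small_fam Dx) /wronskian (expand_det_row _ i0) mxE.
apply: eq_bigr => j _; rewrite !mxE /fam eqxx; congr (_ * _).
rewrite /cofactor; congr (_ * \det _); apply/matrixP => k l; rewrite !mxE.
by rewrite eq_sym (negbTE (neq_lift _ _)).
Qed.

End Small.
End Det.

Section Conclusions.
Variables (R : realType) (Th : irr_class) (E : weyl_module R).
Local Notation C := R[i].
Local Notation r := (ic_rank Th).
Local Notation b := (ic_num Th).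
Local Notation p := (b%:R / r%:R : R).
Hypothesis (r0 : (0 < r)%N) (rb : (r < b)%N).
Variable V : stokes_of Th E.
Hypothesis irr : irregular_class Th E.
Variables (t : R).
Hypothesis tS : non_stokes Th t.

Let trace : exists (e : 'I_r -> E) (eP : wm_basis e),
    forall x, \sum_j (conn eP j j).[x] = trace_sign R Th * (b%:R * x ^+ b.-1).
Proof. by apply: trace_conn => //; exact: ltn_trans rb. Qed.

(** The index [i0] is the top one. Too slow a growth kills the coordinate of [w] on [v i0], and the
    remaining basis vectors lie in lower steps. *)
Lemma growth_filt_lt (w : V) (i0 : 'I_r) (mu rho1 : R) :
  (forall j, dir_le Th t j (i0 : nat)%:Z) ->
  mu < sval r (undir Th t) (i0 : nat)%:Z ->
  (forall m, exists A : R, forall rho : R, rho1 <= rho ->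
    nrm (so_sol w m (polar rho t)) <= A * expR (mu * rho `^ p)) ->
  w \in filt_lt Th (@ss_F _ _ V) t (i0 : nat)%:Z.
Proof.
move=> i0max mu0 wb; have [e [eP trE]] := trace.
have [v [vF vn]] := adapted_ex V tS.
have /choice[A AP] := fun j => wb (e j).
have wA : forall j (rho : R), rho1 <= rho ->
    nrm (so_sol w (e j) (polar rho t)) <= (\sum_j `|A j|) * expR (mu * rho `^ p).
  move=> j rho h; apply: (le_trans (AP j rho h)); apply: ler_wpM2r; first exact: expR_ge0.
  by rewrite (bigD1 j) //= (le_trans (ler_norm _)) // lerDl sumr_ge0.
have [c wE] : exists c : 'I_r -> C, w = \sum_i c i *: v i.
  pose X := [tuple v i | i < r].
  have fX : free X.
    apply/freeP => c c0 i; apply: (adapted_free r0 rb tS vF vn (c := c)).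
    by rewrite -[RHS]c0; apply: eq_bigr => k _; rewrite -tnth_nth tnth_mktuple.
  have bX : basis_of fullv X.
    by rewrite basisEfree fX subvf size_tuple ss_dim leqnn.
  exists (fun i => coord X i w); rewrite {1}(coord_basis bX (memvf w)).
  by apply: eq_bigr => k _; rewrite -tnth_nth tnth_mktuple.
have := @det_small R Th E r0 rb V e eP trE t tS v vF (fun=> True) (so_sol w) rho1
   (fun _ _ _ _ _ _ => I) (fun _ _ => I) (so_lsol w) i0 _ mu wA mu0 0 I.
have -> : \row_j so_sol w (e j) 0 = (\row_i c i) *m wmat e v 0.
  apply/rowP => j; rewrite !mxE wE so_solD; apply: eq_bigr => i _; by rewrite !mxE.
rewrite -mulmxA mul_mx_adj mul_mx_scalar !mxE => /eqP.
have := wmat_unit r0 rb eP tS vF vn 0; rewrite unitmxE unitfE mulf_eq0 => /negbTE -> /= /eqP ci0.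
rewrite wE; apply: memv_suml => i _; have [->|ii0] := eqVneq i i0.
  by rewrite ci0 scale0r mem0v.
apply: memvZ.
have jk : dir_lt Th t (i : nat)%:Z (i0 : nat)%:Z.
  have /orP[ij|//] := i0max (i : nat)%:Z.
  exfalso; move/eqP: ii0; apply; apply: val_inj.
  move: ij; rewrite /idx_eq !modz_small ?ltz_nat ?ltn_ord //.
  by move/eqP => [].
by apply: (subvP (sumv_sup i jk (subvv _))); exact: vF.
Qed.

(** Below every available rate all Cramer coordinates vanish. The function has to be a solution only
    on a convex set containing the end of the ray. *)
Lemma sector_zero (D : C -> Prop) (g : E -> C -> C) (mu rhoD : R) :
  (forall x y (s : R), 0 <= s <= 1 -> D x -> D y -> D (x + s%:C * (y - x))) ->
  (forall rho : R, rhoD <= rho -> D (polar rho t)) -> lsol D g ->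
  (forall i : int, mu < sval r (undir Th t) i) ->
  (forall m, exists A : R, forall rho : R, rhoD <= rho ->
    nrm (g m (polar rho t)) <= A * expR (mu * rho `^ p)) ->
  forall m x, D x -> g m x = 0.
Proof.
move=> cD Dray lg mu0 gb; have [e [eP trE]] := trace.
have [v [vF vn]] := adapted_ex V tS.
have /choice[A AP] := fun j => gb (e j).
have gA : forall j (rho : R), rhoD <= rho ->
    nrm (g (e j) (polar rho t)) <= (\sum_j `|A j|) * expR (mu * rho `^ p).
  move=> j rho h; apply: (le_trans (AP j rho h)); apply: ler_wpM2r; first exact: expR_ge0.
  by rewrite (bigD1 j) //= (le_trans (ler_norm _)) // lerDl sumr_ge0.
apply: (lsol_basis eP lg) => j x Dx.
have H : (\row_j g (e j) x) *m \adj (wmat e v x) = 0.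
  apply/rowP => i; rewrite [RHS]mxE.
  exact: (@det_small R Th E r0 rb V e eP trE t tS v vF D g rhoD cD Dray lg i _ mu gA).
have u := wmat_unit r0 rb eP tS vF vn x.
have /rowP/(_ j) : \row_j g (e j) x = 0.
  rewrite -[LHS]mulmx1 -(mulVmx u) /invmx u.
  by rewrite mulmxA -scalemxAr H scaler0 mul0mx.
by rewrite !mxE.
Qed.

End Conclusions.

(** * The Laplace transform of a relation between recessive solutions *)

Section Constants.
Variables (R : realType) (a m : nat).
Local Notation C := R[i].
Local Notation b := (m + a)%N.
Hypothesis (a0 : (0 < a)%N) (m0 : (0 < m)%N).
Local Notation p := (b%:R / a%:R : R).
Local Notation p' := (b%:R / m%:R : R).
Local Notation c := (fscale_val R a m).

Let aR : (0 : R) < a%:R. Proof. by rewrite ltr0n. Qed.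
Let mR : (0 : R) < m%:R. Proof. by rewrite ltr0n. Qed.
Let bR : (0 : R) < b%:R. Proof. by rewrite ltr0n addn_gt0 m0. Qed.
Let p0 : 0 < p. Proof. by rewrite divr_gt0. Qed.
Let p'0 : 0 < p'. Proof. by rewrite divr_gt0. Qed.
Let p1 : 1 <= p. Proof. by rewrite ler_pdivlMr // mul1r ler_nat leq_addl. Qed.
Let p'1 : 1 <= p'. Proof. by rewrite ler_pdivlMr // mul1r ler_nat leq_addr. Qed.
Let bE : b%:R = m%:R + a%:R :> R. Proof. by rewrite natrD. Qed.

Lemma fscaleE : c = p `^ p^-1 * p' `^ p'^-1.
Proof.
have e1 : p^-1 = 1 - p'^-1 by rewrite bE; field; rewrite -bE !gt_eqF.
have e2 : m%:R / b%:R = p'^-1 :> R by rewrite invf_div.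
have e3 : p' = p * (a%:R / m%:R) by field; rewrite !gt_eqF.
rewrite /fscale_val e2 e1 powRB ?powRr1 ?(ltW p0) //; last by rewrite (gt_eqF p0) implybT.
have e4 : p' `^ p'^-1 = p `^ p'^-1 * (a%:R / m%:R) `^ p'^-1.
  by rewrite {1}e3 powRM ?divr_ge0 ?ltW.
have u0 : p `^ p'^-1 != 0 by rewrite gt_eqF // powR_gt0.
rewrite e4; set v := (a%:R / m%:R) `^ p'^-1.
transitivity (p * v * (p `^ p'^-1 / p `^ p'^-1)); first by rewrite divff ?mulr1.
by ring.
Qed.

(* c is the constant which makes this instance of Young's inequality sharp. *)
Lemma young (x y : R) : 0 <= x -> 0 <= y -> c * x * y <= y `^ p + x `^ p'.
Proof.
move=> x0 y0; rewrite fscaleE.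
have pp : p^-1 + p'^-1 = 1 by rewrite bE; field; rewrite -bE !gt_eqF.
have := @conjugate_powR R (p `^ p^-1 * y) (p' `^ p'^-1 * x) p p'.
rewrite !mulr_ge0 ?powR_ge0 // => /(_ isT isT p0 p'0 pp).
have sc (q z : R) : 0 < q -> 0 <= z -> (q `^ q^-1 * z) `^ q / q = z `^ q.
  move=> q0 z0; rewrite powRM ?powR_ge0 // -powRrM mulVf ?gt_eqF // powRr1 ?(ltW q0) //.
  by rewrite mulrAC divff ?mul1r // gt_eqF.
rewrite (sc _ _ p0 y0) (sc _ _ p'0 x0).
by apply: le_trans; rewrite le_eqVlt; apply/orP; left; apply/eqP; ring.
Qed.

Variable s : R.
Hypothesis (s0 : 0 <= s) (s1 : s < 1).
(** Midway between the cosine bound [s] and 1, so that [s <= la ^+ 2]. *)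
Definition slope : R := (1 + s) / 2.
Local Notation la := slope.

Lemma slope_bound : 2^-1 <= la < 1.
Proof. by move: s0 s1; rewrite /slope => ? ?; apply/andP; split; lra. Qed.

(** Young's inequality for [s / la * x] and [la * y]: both factors are at most [la < 1], and raising
    them to exponents at least 1 does not increase them. *)
Lemma young_slope (x y : R) : 0 <= x -> 0 <= y -> c * s * x * y <= la * y `^ p + la * x `^ p'.
Proof.
move=> x0 y0; have /andP[l1 l2] := slope_bound.
have l0 : 0 < la by apply: lt_le_trans l1; rewrite invr_gt0.
have sl : s / la <= la.
  by rewrite ler_pdivrMr // /slope; have := sqr_ge0 (1 - s); nra.
have -> : c * s * x * y = c * (s / la * x) * (la * y) by field; rewrite gt_eqF.
have h0 : 0 <= s / la by rewrite divr_ge0 // ltW.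
apply: (le_trans (young (mulr_ge0 h0 x0) (mulr_ge0 (ltW l0) y0))).
rewrite (powRM _ (ltW l0) y0) (powRM _ h0 x0).
apply: lerD; apply: ler_wpM2r; rewrite ?powR_ge0 //.
  by rewrite -[leRHS]powRr1 ?(ltW l0) // //; apply: ger_powR => //; rewrite l0 ltW.
apply: (le_trans _ sl); have [->|h1] := eqVneq (s / la) 0; first by rewrite powR0 ?gt_eqF.
rewrite -[leRHS]powRr1 //; apply: ger_powR => //; rewrite lt_neqAle eq_sym h1 h0 /=.
by apply: (le_trans sl); exact: ltW.
Qed.

(* The point where Young's inequality with slope 1 is an equality. *)
Definition opt (x : R) : R := (m%:R / a%:R) `^ (m%:R / b%:R) * x `^ (m%:R / a%:R).

Lemma optE (x : R) : 0 < x -> - (c * x * opt x) + la * opt x `^ p' =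
  - ((b%:R - la * m%:R) / a%:R) * x `^ p.
Proof.
move=> x0; have ma : 0 < m%:R / a%:R :> R by rewrite divr_gt0.
have o1 : opt x `^ p' = m%:R / a%:R * x `^ p.
  rewrite /opt powRM ?powR_ge0 // -!powRrM.
  have -> : m%:R / b%:R * p' = 1 by rewrite -[m%:R / _]invf_div mulVf ?gt_eqF.
  have -> : m%:R / a%:R * p' = p by rewrite mulrC mulrA divfK ?gt_eqF.
  by rewrite powRr1 // ltW.
have o2 : c * x * opt x = p * x `^ p.
  have xe : x * x `^ (m%:R / a%:R) = x `^ p.
    rewrite -{1}[x]powRr1 ?(ltW x0) // -powRD; last by rewrite (gt_eqF x0) implybT.
    by congr (_ `^ _); rewrite bE; field; rewrite gt_eqF.
  have ce : (a%:R / m%:R) `^ (m%:R / b%:R) * (m%:R / a%:R) `^ (m%:R / b%:R) = 1 :> R.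
    rewrite -powRM ?divr_ge0 ?ltW // (_ : _ * _ = 1) ?powR1 //.
    by field; rewrite !gt_eqF.
  rewrite /fscale_val /opt -xe.
  transitivity (p * ((a%:R / m%:R) `^ (m%:R / b%:R) * (m%:R / a%:R) `^ (m%:R / b%:R)) *
     (x * x `^ (m%:R / a%:R))); first by ring.
  by rewrite ce mulr1.
by rewrite o1 o2; field; rewrite gt_eqF.
Qed.

Lemma opt_ge0 x : 0 <= opt x.
Proof. by rewrite mulr_ge0 ?powR_ge0. Qed.

(** Rate 1 is the fastest possible decay of a nonzero solution; [la < 1] pushes the Cauchy integral
    strictly beyond it. *)
Lemma opt_rate : (b%:R - la * m%:R) / a%:R > 1 :> R.
Proof.
rewrite ltr_pdivlMr // mul1r bE; have /andP[_ l2] := slope_bound.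
by move: mR l2; move: la (m%:R : R) (a%:R : R) => l M A *; nra.
Qed.

Variable c0 : R.
Hypothesis lac : la < c0.

(** Young's inequality bounds [k * t] by [d] times the power of [t], plus a constant. *)
Lemma exp_absorb (k d : R) : 0 < d -> exists2 B : R, 0 < B & forall t : R, 0 <= t ->
  expR (- (d * t `^ p)) <= B * expR (- (k * t)).
Proof.
move=> d0; pose mu := Num.min 1 d.
have mu0 : 0 < mu by rewrite lt_min ltr01.
have mu1 : mu <= 1 by rewrite ge_min lexx.
have c0' : 0 < c by exact: fscale_gt0.
pose x := `|k| / (c * mu); have x0 : 0 <= x := divr_ge0 (normr_ge0 _) (mulr_ge0 (ltW c0') (ltW mu0)).
exists (expR (x `^ p')); first exact: expR_gt0.
move=> t t0; rewrite -expRD ler_expR.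
have := young x0 (mulr_ge0 (ltW mu0) t0).
have -> : c * x * (mu * t) = `|k| * t by rewrite /x; field; rewrite !gt_eqF.
rewrite powRM ?(ltW mu0) //.
have h1 : mu `^ p <= d.
  apply: (@le_trans _ _ mu); last by rewrite ge_min lexx orbT.
  by rewrite -[leRHS]powRr1 ?(ltW mu0) //; apply: ger_powR => //; rewrite mu0.
have h2 : mu `^ p * t `^ p <= d * t `^ p by rewrite ler_wpM2r ?powR_ge0.
have h3 : k * t <= `|k| * t by rewrite ler_wpM2r // ler_norm.
by move: h2 h3; move: (mu `^ p * _) (d * _) (k * t) (`|k| * t) (x `^ p') => *; lra.
Qed.

Section OneRay.
Variables (e : C).
Hypothesis e1 : nrm e = 1.

Definition rexp (F : C -> C) := rhol e F /\
  exists2 B : R, 0 <= B & forall t : R, 0 <= t -> nrm (F (t%:C * e)) <= B * expR (- (c0 * t `^ p)).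

Let c00 : 0 < c0. Proof. by apply: lt_trans lac; have /andP[] := slope_bound; lra. Qed.

Lemma rexp_nice F : rexp F -> rnice e F.
Proof.
move=> [hF [B B0 FB]]; split=> // k; have [B1 B10 H] := exp_absorb k c00.
exists (B * B1) => t t0; apply: (le_trans (FB t t0)).
by rewrite -mulrA ler_wpM2l // H.
Qed.

(** Of the decay rate [c0], the part [la] pays for the growth of [G] through [young_slope], and the
    rest [c0 - la] makes the integral converge. *)
Lemma rexp_bound F : rexp F -> exists2 K : R, 0 <= K & forall (G : C -> C) (M om : R),
  0 <= M -> 0 <= om -> rnice e (fun z => G z * F z) ->
  (forall t : R, 0 <= t -> nrm (G (t%:C * e)) <= M * expR (c * s * om * t)) ->
  nrm (rint e (fun z => G z * F z)) <= K * M * expR (la * om `^ p').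
Proof.
move=> [hF [B B0 FB]]; have d0 : 0 < c0 - la by rewrite subr_gt0.
have [B1 B10 H] := exp_absorb 1 d0.
exists (2 * B * B1); first by rewrite !mulr_ge0 // ltW.
move=> G M om M0 om0 nGF GM.
have -> : 2 * B * B1 * M * expR (la * om `^ p') = 2 * (B * B1 * M * expR (la * om `^ p')) by ring.
apply: rint_bound => // t t0; rewrite nrmM.
apply: (@le_trans _ _ (M * expR (c * s * om * t) * (B * expR (- (c0 * t `^ p))))).
  by apply: ler_pM; rewrite ?nrm_ge0 ?GM ?FB.
have -> : M * expR (c * s * om * t) * (B * expR (- (c0 * t `^ p))) =
   B * M * expR (c * s * om * t + - (c0 * t `^ p)) by rewrite expRD; ring.
have -> : B * B1 * M * expR (la * om `^ p') * expR (- t) =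
   B * M * (B1 * expR (- (1 * t)) * expR (la * om `^ p')) by rewrite mul1r; ring.
apply: ler_wpM2l; first by rewrite mulr_ge0.
apply: (@le_trans _ _ (expR (- ((c0 - la) * t `^ p)) * expR (la * om `^ p'))).
  rewrite -expRD ler_expR; have := young_slope om0 t0.
  by move: (c * s * om * t) (t `^ p) (la * om `^ p') => u v w; lra.
by apply: ler_wpM2r; [exact: expR_ge0|exact: H].
Qed.

(** Growth conditions concern large [t]; compactness covers the rest of the ray, and passing from
    [c1] to [c0] absorbs the power of [t]. *)
Lemma rexp_entire F (A c1 rho0 : R) (N : nat) : c0 < c1 ->
  (forall z, exists d, cder F z d) ->
  (forall t : R, rho0 <= t -> nrm (F (t%:C * e)) <= A * t ^+ N * expR (- (c1 * t `^ p))) ->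
  rexp F.
Proof.
move=> c01 hF FA; split; first by move=> t _; exact: hF.
have cF : exists2 B1 : R, 0 <= B1 & forall t : R, 0 <= t <= Num.max rho0 1 -> nrm (F (t%:C * e)) <= B1.
  pose T := Num.max rho0 1; have T0 : 0 <= T by rewrite le_max ler01 orbT.
  have ct t : {for t, continuous (fun s : R => complex.Re (F (s%:C * e)))} /\
     {for t, continuous (fun s : R => complex.Im (F (s%:C * e)))}.
    have [d Fd] := hF (t%:C * e); have := @rcder_ray _ F 0 e t d; rewrite add0r => /(_ Fd).
    rewrite (_ : (fun s : R => F (0 + s%:C * e)) = (fun s : R => F (s%:C * e))); last first.
      by apply/funext => u; rewrite add0r.
    by case/rcder_cont.
  have b1 (f : R -> R) : (forall t, {for t, continuous f}) ->
      exists B, forall t, 0 <= t <= T -> `|f t| <= B.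
    move=> cf; have [||u _ uP] := @EVT_max R (fun t => `|f t|) 0 T => //.
      apply: continuous_subspaceT => t; apply: (@continuous_comp _ _ _ f (fun x => `|x|)) => //.
      exact: norm_continuous.
    by exists (`|f u|) => t tT; apply: uP; rewrite in_itv.
  have [B1 H1] := b1 _ (fun t => (ct t).1); have [B2 H2] := b1 _ (fun t => (ct t).2).
  exists (`|B1| + `|B2|) => [|t tT]; first exact: addr_ge0.
  have h1 := le_trans (H1 t tT) (ler_norm _); have h2 := le_trans (H2 t tT) (ler_norm _).
  rewrite (_ : F (t%:C * e) = (complex.Re (F (t%:C * e)))%:C + (complex.Im (F (t%:C * e)))%:C * 'i%C); last first.
    by apply: complexP; rewrite ?cReD ?cImD ?cReM ?cImM /=; ring.
  apply: (le_trans (nrmD _ _)); rewrite nrmM !nrmR [nrm 'i%C]nrmE /= expr0n add0r expr1n sqrtr1 mulr1.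
  exact: lerD.
have [B1 B10 H1] := cF; set T := Num.max rho0 1 in H1.
have T1 : 1 <= T by rewrite le_max lexx orbT.
have d0 : 0 < c1 - c0 by rewrite subr_gt0.
pose K := (N.+1%:R / (c1 - c0)) ^+ N.
have K0 : 0 <= K by rewrite exprn_ge0 // divr_ge0 // ltW.
exists (B1 * expR (c0 * T `^ p) + `|A| * K).
  by rewrite addr_ge0 ?mulr_ge0 ?expR_ge0.
move=> t t0; have [tT|Tt] := leP t T.
  apply: (@le_trans _ _ (B1 * expR (c0 * T `^ p) * expR (- (c0 * t `^ p)))).
    apply: (le_trans (H1 t _)); rewrite ?t0 //.
    rewrite -mulrA -expRD ler_peMr // -expR0 ler_expR subr_ge0 ler_pM2l // ge0_ler_powR ?nnegrE ?(ltW p0) //.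
    exact: le_trans T1.
  by rewrite ler_wpM2r ?expR_ge0 // lerDl mulr_ge0.
have t1 : 1 <= t by apply: le_trans T1 (ltW Tt).
apply: (le_trans (FA t _)); first by apply: le_trans (ltW Tt); rewrite le_max lexx.
apply: (@le_trans _ _ (`|A| * (K * expR ((c1 - c0) * t `^ p)) * expR (- (c1 * t `^ p)))).
  apply: ler_wpM2r; first exact: expR_ge0.
  apply: (@le_trans _ _ (`|A| * t ^+ N)).
    by rewrite ler_wpM2r ?exprn_ge0 // ler_norm.
  apply: ler_wpM2l => //; apply: (le_trans (pow_le_exp N d0 t0)).
  by rewrite ler_wpM2l // ler_expR ler_pM2l // le_powR.
have -> : `|A| * (K * expR ((c1 - c0) * t `^ p)) * expR (- (c1 * t `^ p)) =
   `|A| * K * expR ((c1 - c0) * t `^ p + - (c1 * t `^ p)) by rewrite expRD; ring.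
have -> : (c1 - c0) * t `^ p + - (c1 * t `^ p) = - (c0 * t `^ p) by ring.
by rewrite ler_wpM2r ?expR_ge0 // lerDr mulr_ge0 ?expR_ge0.
Qed.
End OneRay.
End Constants.

Lemma le_cos (R : realType) (x y : R) : 0 <= y -> y <= x -> x <= pi -> cos x <= cos y.
Proof.
move=> y0 yx xpi; have [->//|ne] := eqVneq x y.
by rewrite ltW // ltr_cos ?in_itv /= ?y0 ?xpi ?(le_trans y0) ?(le_trans yx) // lt_neqAle eq_sym ne.
Qed.

Section Angles.
Variables (R : realType) (b : nat).
Hypothesis b1 : (1 < b)%N.
Local Notation C := R[i].
Let bR : (0 : R) < b%:R. Proof. by rewrite ltr0n ltnW. Qed.

(** The largest cosine of a multiple of [pi / b] that is not a multiple of [2 pi]. *)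
Definition angle_slope : R := cos (pi / b%:R).

Lemma pib : (0 : R) < (pi : R) / b%:R <= (pi : R) / 2.
Proof.
have p0 := pi_gt0 R; rewrite divr_gt0 //= ler_wpM2l ?(ltW p0) // lef_pV2 ?posrE // ler_nat //.
Qed.

Lemma angle_slope_bound : 0 <= angle_slope < 1.
Proof.
have p0 := pi_gt0 R; have /andP[h1 h2] := pib; apply/andP; split.
  by apply: cos_ge0_pihalf; rewrite h2 andbT; lra.
rewrite /angle_slope -[X in _ < X]cos0 ltr_cos ?in_itv //= ?lexx ?(ltW h1) ?(ltW p0) //=; lra.
Qed.

Lemma cos_angle (n : int) : ~~ ((2 * b)%N%:Z %| n)%Z -> cos (pi / b%:R * n%:~R) <= angle_slope.
Proof.
move=> nd; have p0 := pi_gt0 R; have /andP[h1 h2] := pib.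
pose k := (n %% (2 * b)%N%:Z)%Z.
have b20 : (2 * b)%N%:Z != 0 by lia.
have k0 : 0 <= k by rewrite modz_ge0.
have kb : k < (2 * b)%N%:Z by rewrite ltz_pmod //; lia.
have nE : n = (n %/ (2 * b)%N%:Z)%Z * (2 * b)%N%:Z + k by exact: divz_eq.
have kn0 : k != 0 by apply: contra nd => /eqP kz; apply/dvdz_mod0P.
have -> : cos (pi / b%:R * n%:~R) = cos (pi / b%:R * k%:~R) :> R.
  rewrite -[RHS](cosD2piz _ (n %/ (2 * b)%N%:Z)%Z); congr cos; rewrite {1}nE intrD intrM.
  have -> : ((2 * b)%N%:Z)%:~R = 2 * b%:R :> R by rewrite -natrM.
  by move: (pi : R) => q; field; rewrite gt_eqF.
have k1 : 1 <= k%:~R :> R by rewrite -[1]/(1%:~R) ler_int; lia.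
have k2 : k%:~R <= 2 * b%:R - 1 :> R.
  by rewrite -natrM -[1]/(1%:~R) -[_%:R]/((2 * b)%N%:Z%:~R) -intrB ler_int; lia.
have pb : pi = pi / b%:R * b%:R :> R by rewrite divfK // gt_eqF.
rewrite /angle_slope; move: h1 h2 pb; move: (pi / b%:R : R) => t t0 t1 pb.
have [kb'|bk] := leP (t * k%:~R) pi.
  by apply: le_cos => //; [exact: ltW|nra].
have -> : cos (t * k%:~R) = cos (2 * pi - t * k%:~R) :> R.
  by rewrite -[RHS]cosN -[in RHS](cosD2piz _ 1); congr cos; ring.
by apply: le_cos; nra.
Qed.

(** The rotation must keep the rates above [la] both for rank [a], along the rays, and for rank [m],
    in the directions of the transform; hence the uniformity in [n]. The bound 1/4 serves to avoid
    Stokes directions. *)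
Lemma eps_exists (la : R) : 2^-1 <= la < 1 -> exists2 eps : R, 0 < eps < 4^-1 &
  forall n : nat, (0 < n)%N -> (1 + la) / 2 <= cos (2 * pi * eps / n%:R).
Proof.
move=> /andP[l1 l2]; have p0 := pi_gt0 R.
have u1 : -1 <= (1 + la) / 2 < 1 by apply/andP; split; lra.
have u2 : -1 <= (1 + la) / 2 <= 1 by apply/andP; split; lra.
have a0 := acos_gt0 u1; have ap := acos_lepi u2; have aK : cos (acos ((1 + la) / 2)) = (1 + la) / 2.
  by rewrite acosK // in_itv.
pose th := acos ((1 + la) / 2); rewrite -/th in a0 ap aK.
have th2 : th < pi / 2.
  rewrite ltNge; apply/negP => h; have : cos th <= cos (pi / 2 : R).
    by apply: le_cos => //; rewrite divr_ge0 // ltW.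
  by rewrite cos_pihalf aK; lra.
exists (th / (2 * pi)).
  rewrite divr_gt0 ?mulr_gt0 //= ltr_pdivrMr ?mulr_gt0 //; lra.
move=> n n0; have -> : 2 * pi * (th / (2 * pi)) / n%:R = th / n%:R :> R.
  by move: (gt_eqF p0); move: (pi : R) => q q0; field; rewrite q0 pnatr_eq0 -lt0n n0.
have n1 : 1 <= n%:R :> R by rewrite ler1n.
have n0' : 0 < n%:R :> R by apply: lt_le_trans n1.
have h : th / n%:R <= th by rewrite ler_pdivrMr // ler_peMr // ltW.
rewrite -[leLHS]aK; by apply: le_cos => //; rewrite divr_ge0 // ltW.
Qed.

End Angles.

Lemma ord_ieq (m : nat) (l : int) : (0 < m)%N -> exists i : 'I_m, ieq m (i : nat)%:Z l.
Proof.
move=> m0; have k0 : 0 <= (l %% m%:Z)%Z by apply: modz_ge0; lia.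
have km : (l %% m%:Z)%Z < m%:Z by apply: ltz_pmod; lia.
have il : (absz (l %% m%:Z)%Z < m)%N by lia.
by exists (Ordinal il); rewrite /ieq /= gez0_abs // modz_mod.
Qed.

Lemma ord_dvd (b : nat) (i j : 'I_b) :
  ((2 * b)%N%:Z %| 2 * ((i : nat)%:Z - (j : nat)%:Z))%Z -> i = j.
Proof.
move=> /dvdzP[q qE]; apply: val_inj => /=; have := ltn_ord i; have := ltn_ord j.
move: qE; rewrite PoszM; move: (i : nat) (j : nat) => {i}i {j}j qE jb ib.
have {}qE : i%:Z - j%:Z = q * b%:Z by lia.
have [q0|q0|q0] := ltrgtP q 0; [nia|nia|].
by move: qE; rewrite q0 mul0r => /eqP; rewrite subr_eq0 => /eqP [].
Qed.

Section Transform.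
Variables (R : realType) (a m : nat).
Local Notation C := R[i].
Local Notation b := (m + a)%N.
Hypothesis (a0 : (0 < a)%N) (m0 : (0 < m)%N).
Local Notation p := (b%:R / a%:R : R).
Local Notation p' := (b%:R / m%:R : R).
Local Notation c := (fscale R a0 m0).
Local Notation cv := (fscale_val R a m).
Local Notation s := (angle_slope R b).
Local Notation la := (slope s).
Local Notation c0 := ((1 + 3 * la) / 4).
Local Notation c1 := ((1 + la) / 2).

Let ab : (a < b)%N. Proof. by rewrite -[X in (X < _)%N]add0n ltn_add2r. Qed.
Let mb : (m < b)%N. Proof. by rewrite -[X in (X < _)%N]addn0 ltn_add2l. Qed.
Let b0 : (0 < b)%N. Proof. exact: ltn_trans ab. Qed.
Let b1 : (1 < b)%N. Proof. exact: leq_ltn_trans a0 ab. Qed.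
Let mR : (0 : R) < m%:R. Proof. by rewrite ltr0n. Qed.
Let bR : (0 : R) < b%:R. Proof. by rewrite ltr0n. Qed.
Let bE : b%:R = m%:R + a%:R :> R. Proof. by rewrite natrD. Qed.

Let s0 : 0 <= s. Proof. by have /andP[] := angle_slope_bound R b1. Qed.
Let s1 : s < 1. Proof. by have /andP[] := angle_slope_bound R b1. Qed.
Let lab : 2^-1 <= la < 1. Proof. exact: slope_bound s0 s1. Qed.
Let lac : la < c0. Proof. by move/andP: lab => [? ?]; lra. Qed.
Let c01 : c0 < c1. Proof. by move/andP: lab => [? ?]; lra. Qed.

(* The rays of integration are slightly rotated, away from Stokes directions. *)
Definition eps : R := s2val (cid2 (eps_exists lab)).
Lemma eps_bound : 0 < eps < 4^-1.
Proof. exact: (s2valP (cid2 (eps_exists lab))). Qed.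
Lemma eps_cos (n : nat) : (0 < n)%N -> c1 <= cos (2 * pi * eps / n%:R).
Proof. exact: (s2valP' (cid2 (eps_exists lab))). Qed.

(** The label [y = j + 1], near which [Lg j] is recessive, moved by [eps]. *)
Definition rang (j : int) : R := dir (Theta a b) (j%:~R + 1 - eps).
Definition iray (j : int) : C := polar 1 (rang j).

Lemma rangE j : rang j = (a%:R / 2 - j%:~R - 1 + eps) * (2 * pi / b%:R).
Proof. by rewrite /rang /dir /shift /=; congr (_ * _); ring. Qed.

Lemma nrm_ray1 j : nrm (iray j) = 1.
Proof. by rewrite nrm_polar normr1. Qed.

(** Twice [y] differs from an integer by [2 * eps], which lies strictly between 0 and 1. *)
Lemma sns_eps n (k l : int) (y : R) : (0 < n)%N -> 2 * y = k%:~R + l%:~R * (2 * eps) -> l = 1 \/ l = -1 -> sns n y.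
Proof.
move=> n0 yE l1; apply: sns_dense => // q; apply/eqP => qE; have /andP[e0 e4] := eps_bound.
have h : (q - k)%:~R = l%:~R * (2 * eps) :> R by rewrite intrB -qE yE; ring.
have lR : l%:~R = 1 :> R \/ l%:~R = -1 :> R by case: l1 => ->; [left|right; rewrite intrN].
have h1 : -1 < (q - k)%:~R :> R by rewrite h; case: lR => ->; lra.
have h3 : (q - k)%:~R < 1 :> R by rewrite h; case: lR => ->; lra.
have h2 : (q - k)%:~R != 0 :> R.
  have e2 : 2 * eps != 0 by rewrite gt_eqF // mulr_gt0.
  by rewrite h mulf_neq0 //; case: lR => ->; rewrite ?oppr_eq0 oner_eq0.
move: h1 h2 h3; rewrite intr_eq0 -[1]/(1%:~R) -[-1]/((-1)%:~R) !ltr_int => ? /eqP ? ?; lia.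
Qed.

Section Sol.
Variables (E : weyl_module R) (V : stokes_of (Theta a b) E).
Variable (V' : stokes_of (Theta_hat m b) (rescale c (fourier E))).
Hypothesis irr : irregular_class (Theta a b) E.
Local Notation F := (rescale c (fourier E)).
Local Notation a0' := (a0 : (0 < ic_rank (Theta a b))%N).
Local Notation b0' := (b0 : (0 < ic_num (Theta a b))%N).

Definition Lg (j : int) : {vspace V} := @line R (Theta a b) V a0 (j + 1).
(** The shift by 1 comes from 0-based ordinals, the sign from the labels [-1], ..., [-b] of the
    directions of the transform. *)
Definition lg (j : int) : {vspace V'} := @line R (Theta_hat m b) V' m0 (- (j + 1)).

Lemma plines_line (Th : irr_class) (r0 : (0 < ic_rank Th)%N) (n0 : (0 < ic_num Th)%N)
  (S : stokes_system R Th) : plines (ic_num Th) (ic_rank Th) (line S r0).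
Proof.
split; [exact: line_period|exact: dim_line_window|exact: ss_dim].
Qed.

Lemma Lg_plines : plines b a Lg.
Proof.
have H := plines_line a0' b0' V.
split; last exact: ss_dim.
  by move=> l; rewrite /Lg addrAC; exact: (pl_period H).
move=> j k ka; rewrite -[RHS](pl_dim H (j + 1) ka); congr (\dim _).
by rewrite /window; apply: eq_bigr => i _; rewrite /Lg addrAC.
Qed.

Lemma lg_plines : plines b m lg.
Proof.
have H := rev_plines b0 m0 (plines_line (Th := Theta_hat m b) m0 b0 V') (-1).
split; [|move=> j k km|exact: ss_dim].
  by move=> l; have := pl_period H l; rewrite /lg !opprD ![_ - 1]addrC.
rewrite -[RHS](pl_dim H j km); congr (\dim _).
by rewrite /window; apply: eq_bigr => i _; rewrite /lg opprD addrC.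
Qed.

Lemma hyper_lg i : hyper m lg i = window (@line R (Theta_hat m b) V' m0) (- (i + m%:Z)) m.-1.
Proof.
rewrite /hyper /window (reindex_inj rev_ord_inj) /=; apply: eq_bigr => k _.
rewrite /lg; congr line; have := ltn_ord k; lia.
Qed.

Lemma sol_der (v : V) n x : cder (so_sol v n) x (so_sol v (wm_d n) x).
Proof. by have [_ _ H] := so_lsol v; exact: H. Qed.

Lemma line_rexp (v : V) (j : int) : v \in Lg j -> forall n, rexp a m c0 (iray j) (so_sol v n).
Proof.
move=> vL n; have /andP[e0 e4] := eps_bound.
pose y : R := j%:~R + 1 - eps.
have sy : sns a y by apply: (@sns_eps a (2 * j + 2) (-1)); [by []|rewrite /y intrD intrM; ring|right].
have vF : v \in ss_F V (rang j) (j + 1).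
  have := @yF_line R (Theta a b) V a0 b0 y (j + 1) (j + 1) sy; rewrite /yF => -> //.
    by rewrite /y intrD ltr_norml; apply/andP; split; lra.
  exact: ieq_refl.
have /(@non_stokesE R (Theta a b) a0 b0) ns := sy.
have /(so_growth _ _ ns) H := vF; have [N [A [rho0 [ep [r0 ep0 {}H]]]]] := H n.
apply: (@rexp_entire R a m a0 s s0 s1 c0 lac (iray j) _ A c1 rho0 N c01).
  by move=> z; exists (so_sol v (wm_d n) z); exact: sol_der.
move=> t tr; have t0 : 0 <= t by apply: le_trans tr; exact: ltW.
rewrite -polar1E; have := H t (rang j) tr; rewrite subrr normr0 => /(_ ep0).
rewrite normrE lecR (@Re_expfac R (Theta a b) a0 b0) /= => h; apply: (le_trans h).
rewrite (dirK a0' b0') /sval.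
have -> : 2 * pi * ((j + 1)%:~R - y) / a%:R = 2 * pi * eps / a%:R :> R.
  by rewrite /y intrD; congr (_ / _); ring.
have hA : 0 <= A * t ^+ N.
  have := le_trans (nrm_ge0 _) h; rewrite pmulr_lge0 ?expR_gt0 //.
apply: ler_wpM2l => //; rewrite ler_expR mulrN lerN2 mulrC.
by apply: ler_wpM2l; [exact: powR_ge0|exact: eps_cos].
Qed.

Lemma line_rnice (v : V) (j : int) n : v \in Lg j -> rnice (iray j) (so_sol v n).
Proof. by move=> vL; exact: (rexp_nice a0 m0 s0 s1 lac (line_rexp vL n)). Qed.

Section Relation.
Variable v : 'I_b -> V.
Hypothesis vR : relation Lg v.

Lemma rel_sum0 n x : \sum_j so_sol (v j) n x = 0.
Proof.
have s00 : so_sol (0 : V) n x = 0.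
  by have := so_linear (-1) (0 : V) 0 n x; rewrite scaler0 addr0 mulN1r addNr.
have [_ vs] := vR; rewrite -[RHS]s00 -[X in so_sol X]vs.
elim/big_rec2 : _ => [|i y1 y2 _ IH]; first by rewrite s00.
by rewrite -[v i]scale1r so_linear mul1r scale1r -IH.
Qed.

End Relation.

Definition lapf (v : 'I_b -> V) (n : E) (w : C) : C :=
  \sum_(j < b) rint (iray (j : nat)%:Z) (fun z => cexp (- ((cv)%:C * w * z)) * so_sol (v j) n z).

Lemma rnice_lap (j : int) (x : C) f : rnice (iray j) f ->
  rnice (iray j) (fun z => cexp (- (x * z)) * f z).
Proof.
move=> nf; have := rnice_cexp (nrm_ray1 j) (- x) nf.
by under eq_fun do rewrite mulNr.
Qed.

Lemma lapf_solution v : relation Lg v -> @solution R F (lapf v).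
Proof.
move=> vR; have nice (j : 'I_b) n : rnice (iray (j : nat)%:Z) (so_sol (v j) n).
  by apply: line_rnice; have [H _] := vR; exact: H.
have cc : (cv)%:C * (cv^-1)%:C = 1 :> C.
  by rewrite -rmorphM /= divff // gt_eqF // fscale_gt0.
have cz : (cv^-1)%:C * (cv)%:C = 1 :> C by rewrite mulrC.
apply: (@lsol_solution R F); split=> [k n n' w _|n w _|n w _]; rewrite /lapf.
- rewrite mulr_sumr -big_split /=; apply: eq_bigr => j _.
  have [l1 _ _] := so_lsol (v j).
  rewrite -rint_linear; [|exact: rnice_lap|exact: rnice_lap].
  by congr rint; apply/funext => z; rewrite l1 //; ring.
- have step (j : 'I_b) : rint (iray (j : nat)%:Z) (fun z => cexp (- (cv%:C * w * z)) * so_sol (v j) (wm_z (n : F)) z) =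
      w * rint (iray (j : nat)%:Z) (fun z => cexp (- (cv%:C * w * z)) * so_sol (v j) n z)
      - (cv^-1)%:C * so_sol (v j) n 0.
    set x := cv%:C * w.
    pose u := so_sol (v j) n; pose u' := so_sol (v j) (@wm_d R E n).
    have n1 := rnice_lap x (nice j n); have n2 := rnice_lap x (nice j (@wm_d R E n)).
    have n3 := rnice_linear (- x) n1 n2.
    have := rint_FTC n3 n1 _; rewrite rint_linear // mulr0 oppr0 cexp0 mul1r => ftc.
    have {}ftc := ftc _; rewrite /= in ftc.
    have E1 : rint (iray (j : nat)%:Z) (fun z => cexp (- (x * z)) * u' z) =
       x * rint (iray (j : nat)%:Z) (fun z => cexp (- (x * z)) * u z) - u 0.
      apply/eqP; rewrite -subr_eq0 -[X in _ == X]subr0; apply/eqP.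
      rewrite -[0 in RHS](subrr (- u 0)) -{1}ftc; first by rewrite /u /u'; ring.
      move=> t _; have d1 := sol_der (v j) n (t%:C * iray (j : nat)%:Z).
      have d2 := cder_cexpZ (- x) (t%:C * iray (j : nat)%:Z).
      have fE : (fun z => cexp (- (x * z)) * so_sol (v j) n z) = (fun z => cexp (- x * z) * so_sol (v j) n z).
        by apply/funext => z; rewrite mulNr.
      have h := cderM d2 d1; rewrite fE; move: h; congr (cder _ _ _).
      have -> : - (x * (t%:C * iray (j : nat)%:Z)) = - x * (t%:C * iray (j : nat)%:Z) by rewrite mulNr.
      by rewrite /u'; ring.
    rewrite (_ : (fun z => _) = (fun z => (cv^-1)%:C * (cexp (- (x * z)) * u' z) + 0)); last first.
      apply/funext => z; rewrite /= (lsolZ _ _ (so_lsol (v j))) // addr0 /u'; ring.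
    rewrite rint_linear //; last exact: rnice0.
    have r00 : rint (iray (j : nat)%:Z) (fun=> 0) = 0 :> C.
      apply/eqP; rewrite -nrm_eq0 eq_le nrm_ge0 andbT -[leRHS](mulr0 2).
      by apply: (rint_bound (nrm_ray1 _) (rnice0 _)) => t _; rewrite nrm0 mul0r.
    rewrite r00 addr0 E1 mulrBr mulrA; congr (_ * _ - _).
    by rewrite /x mulrA cz mul1r.
  rewrite (eq_bigr _ (fun j _ => step j)) sumrB -!mulr_sumr rel_sum0 // mulr0 subr0 //.
- apply: cder_sum => j.
  have d := laplace_der (nrm_ray1 (j : nat)%:Z) (cv%:C * w) (nice j n).
  have := @cder_scale R _ cv%:C w _ d; congr (cder _ _ _).
  set G := fun z => _ * (_ * _).
  have nG : rnice (iray (j : nat)%:Z) G.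
    have h := rnice_lap (cv%:C * w) (rnice_z (nrm_ray1 _) (nice j n)).
    have := rnice_linear (-1) h (rnice0 _); congr rnice; apply/funext => z; rewrite /G /=; ring.
  have := rint_linear cv%:C nG (rnice0 _).
  have r00 : rint (iray (j : nat)%:Z) (fun=> 0) = 0 :> C.
    apply/eqP; rewrite -nrm_eq0 eq_le nrm_ge0 andbT -[leRHS](mulr0 2).
    by apply: (rint_bound (nrm_ray1 _) (rnice0 _)) => t _; rewrite nrm0 mul0r.
  rewrite r00 addr0 => <-; congr rint; apply/funext => z; rewrite addr0 /G.
  have [_ l2 _] := so_lsol (v j).
  rewrite /= (lsolZ _ _ (so_lsol (v j))) // -scaleN1r (lsolZ _ _ (so_lsol (v j))) // l2 //; ring.
Qed.

(** For a family that is not a relation the integrals need not add up to a solution, hence a choice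
    operator with default 0. *)
Definition lap (v : 'I_b -> V) : V' := xget 0 [set x : V' | so_sol x = lapf v].

Lemma lapE v : relation Lg v -> so_sol (lap v) = lapf v.
Proof.
move=> vR; have [x xE] := (so_solution V' (lapf v)).1 (lapf_solution vR).
by rewrite /lap; case: xgetP => [y -> //|/(_ x)].
Qed.

Lemma lap_linear k v v' : relation Lg v -> relation Lg v' ->
  lap (fun i => k *: v i + v' i) = k *: lap v + lap v'.
Proof.
move=> vR vR'; have vvR : relation Lg (fun i => k *: v i + v' i).
  have [h1 h2] := vR; have [h1' h2'] := vR'; split=> [i|]; first by rewrite memvD ?memvZ.
  by rewrite big_split /= -scaler_sumr h2 h2' scaler0 addr0.
apply: so_inj; rewrite lapE //; apply/funext => n; apply/funext => w.
rewrite so_linear !lapE // /lapf mulr_sumr -big_split /=; apply: eq_bigr => j _.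
have nice := line_rnice; rewrite -rint_linear; first last.
- by apply: rnice_lap; apply: line_rnice; have [H _] := vR'; exact: H.
- by apply: rnice_lap; apply: line_rnice; have [H _] := vR; exact: H.
by congr rint; apply/funext => z; rewrite so_linear; ring.
Qed.

Lemma lap_hyper v (i : 'I_b) : relation Lg v -> v i = 0 -> lap v \in hyper m lg (i : nat)%:Z.
Proof.
move=> vR vi0; have /andP[e0 e4] := eps_bound; have p0 := pi_gt0 R.
have irr' : irregular_class (Theta_hat m b) F by exact: irregular_class_fourier.
pose l : int := - ((i : nat)%:Z + m%:Z) - 1.
(* Rotated by the same [eps] as the rays, so that [eps] drops out of the arguments of [w z], which
   become [pi + 2 pi (i - j) / b]. *)
pose y : R := - ((i : nat)%:R + 1) - m%:R / 2 + eps.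
have iE : (i : nat)%:Z%:~R = (i : nat)%:R :> R by [].
have mE : m%:Z%:~R = m%:R :> R by [].
have sy : sns m y.
  apply: (@sns_eps m (- (2 * ((i : nat)%:Z + 1) + m%:Z)) 1); [by []| |by left].
  by rewrite /y intrN intrD intrM intrD iE mE; field.
have ns := (@non_stokesE R (Theta_hat m b) m0 b0 y).2 sy.
have lE : l%:~R = - ((i : nat)%:R + m%:R) - 1 :> R by rewrite /l intrB intrN intrD iE mE.
have sl : sval m y l = cos (2 * pi * eps / m%:R).
  rewrite /sval lE -cosDpi -[RHS]cosN; congr cos; rewrite /y.
  by move: (pi : R) => q; field; rewrite gt_eqF.
have yl : `|y - (l%:~R + m%:R / 2)| < 2^-1.
  by rewrite lE /y ltr_norml; apply/andP; split; lra.
have lmax := top_exists m0 (ss_dim V') sy yl.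
have [i0 il] := ord_ieq l m0.
have imax (j : int) : slt m y j (i0 : nat)%:Z || ieq m j (i0 : nat)%:Z.
  rewrite (slt_ieq m0 y (ieq_refl m j) il); case/orP: (lmax j) => [->//|jl].
  by rewrite (ieq_trans jl) ?orbT // ieq_sym.
rewrite hyper_lg.
have := @lower_line R (Theta_hat m b) V' m0 b0 y l (i0 : nat)%:Z sy yl imax.
have -> : l + 1 = - ((i : nat)%:Z + m%:Z) by rewrite /l subrK.
move=> <-; rewrite -filt_ltE //.
(* The dominant rate in this direction is [cos (2 * pi * eps / m)], which exceeds the rate [la] of
   the summands by [eps_cos]. *)
apply: (@growth_filt_lt R (Theta_hat m b) F m0 mb V' irr' _ ns (lap v) i0 la 1).
- by move=> j; rewrite /dir_le dir_ltE // orbC; exact: imax.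
- rewrite dirK // (sval_ieq m0 y il) sl.
  apply: (lt_le_trans _ (eps_cos m0)); have /andP[? ?] := lab; lra.
move=> n; rewrite lapE //.
have /choice[Kj KP] : forall j : 'I_b, exists K : R, forall rho : R, 1 <= rho ->
    nrm (rint (iray (j : nat)%:Z) (fun z => cexp (- (cv%:C * polar rho (dir (Theta_hat m b) y) * z)) * so_sol (v j) n z))
    <= K * expR (la * rho `^ p').
  move=> j; have vL : v j \in Lg (j : nat)%:Z by have [H _] := vR; exact: H.
  have [ji|ji] := eqVneq j i.
    exists 0 => rho _; rewrite mul0r ji vi0.
    rewrite (_ : (fun z => _) = (fun=> 0)).
      apply: le_trans (_ : 2 * 0 <= _); last by rewrite mulr0.
      by apply: (rint_bound (nrm_ray1 _) (rnice0 _)) => t _; rewrite nrm0 mul0r.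
    apply/funext => z; rewrite (_ : so_sol (0 : V) n z = 0) ?mulr0 //.
    by have := so_linear (-1) (0 : V) 0 n z; rewrite scaler0 addr0 mulN1r addNr.
  have [K K0 KP] := rexp_bound a0 m0 s0 s1 lac (nrm_ray1 (j : nat)%:Z) (line_rexp vL n).
  exists K => rho r1; have r0 : 0 <= rho by apply: le_trans r1.
  rewrite -(mulr1 K); apply: (KP (fun z => cexp (- (cv%:C * polar rho (dir (Theta_hat m b) y) * z))) 1 rho) => //.
    by apply: rnice_lap; exact: line_rnice.
  move=> t t0; rewrite mul1r nrm_cexp ler_expR.
  have -> : cv%:C * polar rho (dir (Theta_hat m b) y) * (t%:C * iray (j : nat)%:Z) =
     polar (cv * rho * t) (pi + pi / b%:R * (2 * ((i : nat)%:Z - (j : nat)%:Z))%:~R).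
    rewrite /iray; rewrite [polar rho _]polar1E -[LHS]/(_ * _ * _).
    transitivity ((cv%:C * rho%:C * t%:C) * (polar 1 (dir (Theta_hat m b) y) * polar 1 (rang (j : nat)%:Z))); first by ring.
    rewrite polarM mulr1 [in RHS]polar1E -!rmorphM /=; congr (_ * polar _ _).
    rewrite rangE /dir /shift /= /y intrM intrB iE -[(j : nat)%:Z%:~R]/((j : nat)%:R) bE.
    have mb0 : m%:R + a%:R != 0 :> R by rewrite -bE gt_eqF.
    by move: (pi : R) => q; field.
  rewrite cReN /polar /= -mulrN addrC cosDpi opprK.
  have hc : cos (pi / b%:R * (2 * ((i : nat)%:Z - (j : nat)%:Z))%:~R) <= s.
    by apply: cos_angle => //; apply: contra ji => /ord_dvd ->.
  have cv0 : 0 <= cv by rewrite ltW // fscale_gt0.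
  have -> : cv * s * rho * t = cv * rho * t * s by ring.
  by rewrite ler_wpM2l // !mulr_ge0.
exists (\sum_j Kj j) => rho r1; rewrite /lapf mulr_suml.
apply: (le_trans (nrm_sum _ _ _)); apply: ler_sum => j _; exact: KP.
Qed.

End Sol.
End Transform.

(** * Injectivity of the Laplace transform *)

Section Geometry.
Variable R : realType.
Local Notation C := R[i].

Lemma rint_eq (e : C) (F G : C -> C) : (forall t : R, 0 <= t -> F (t%:C * e) = G (t%:C * e)) ->
  rint e F = rint e G.
Proof. by move=> FG; rewrite /rint; congr (_ * _); apply: cint_eq. Qed.

Lemma rint0 (e : C) : nrm e = 1 -> rint e (fun=> 0) = 0.
Proof.
move=> e1; apply/eqP; rewrite -nrm_eq0 eq_le nrm_ge0 andbT -[leRHS](mulr0 2).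
by apply: (rint_bound e1 (rnice0 e)) => t _; rewrite nrm0 mul0r.
Qed.

Lemma dist_ray (e zeta : C) : nrm e = 1 -> (forall t : R, 0 <= t -> t%:C * e != zeta) ->
  exists2 d : R, 0 < d & forall t : R, 0 <= t -> d <= nrm (t%:C * e - zeta).
Proof.
move=> e1 ne; have e0 : e != 0 by rewrite -nrm_gt0 e1.
pose w := zeta / e; have we : zeta = w * e by rewrite /w divfK.
have E (t : R) : nrm (t%:C * e - zeta) = nrm (t%:C - w) by rewrite we -mulrBl nrmM e1 mulr1.
have [im0|im0] := eqVneq (complex.Im w) 0.
  have re0 : complex.Re w < 0.
    rewrite ltNge; apply/negP => re0; have /eqP := ne _ re0; apply.
    rewrite we; congr (_ * _); by apply: complexP; rewrite /= ?im0.
  exists (- complex.Re w) => [|t t0]; first by rewrite oppr_gt0.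
  rewrite E; apply: le_trans (nrm_Re _); rewrite cReD cReN /=.
  by apply: le_trans (ler_norm _); rewrite lerDr.
exists `|complex.Im w| => [|t t0]; first by rewrite normr_gt0.
by rewrite E; apply: le_trans (nrm_Im _); rewrite cImD cImN /= sub0r normrN.
Qed.

Lemma cder_inv_subr (zeta z : C) : z != zeta ->
  cder (fun z => (z - zeta)^-1) z (- ((z - zeta)^-1 * (z - zeta)^-1)).
Proof.
move=> zz; have := cderZ (-1) (@cder_inv_sub R zeta z (_ : zeta != z)).
rewrite eq_sym => /(_ zz) h.
apply: cder_ext (_ : cder _ _ _); last first.
  move: h; rewrite (_ : -1 * (zeta - z)^-1 ^+ 2 = - ((z - zeta)^-1 * (z - zeta)^-1)); first exact.
  by rewrite -[zeta - z]opprB invrN expr2; ring.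
by move=> x; rewrite /= -[zeta - x]opprB invrN mulrN mulN1r opprK.
Qed.

Variable b : nat.
Hypothesis b1 : (1 < b)%N.
Let bR : (0 : R) < b%:R. Proof. by rewrite ltr0n ltnW. Qed.

Lemma sinD2piz (x : R) (q : int) : sin (x + 2 * pi * q%:~R) = sin x.
Proof.
have H (y : R) : sin y = - cos (y + pi / 2) by rewrite cosDpihalf opprK.
by rewrite H addrAC cosD2piz -H.
Qed.

(** Where the sine is positive, [n] is at least 1 modulo [b], and one step less still gives an angle
    between 0 and [pi]. *)
Lemma sin_angle (n : int) : 0 < sin (2 * pi / b%:R * n%:~R : R) ->
  0 <= sin (2 * pi / b%:R * (n - 1)%:~R : R).
Proof.
have p0 := pi_gt0 R; pose n0 := (n %% b%:Z)%Z; pose q := (n %/ b%:Z)%Z.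
have bz : b%:Z != 0 by lia.
have n00 : 0 <= n0 by rewrite modz_ge0.
have n0b : n0 < b%:Z by rewrite ltz_pmod //; lia.
have nE : n = q * b%:Z + n0 by exact: divz_eq.
have red (k : int) : sin (2 * pi / b%:R * (q * b%:Z + k)%:~R) = sin (2 * pi / b%:R * k%:~R) :> R.
  rewrite -[RHS](sinD2piz _ q); congr sin; rewrite intrD intrM -[b%:Z%:~R]/(b%:R).
  by move: (pi : R) => p; field; rewrite gt_eqF.
rewrite nE red -addrA red; set t : R := 2 * pi / b%:R.
have t0 : 0 < t by rewrite divr_gt0 // mulr_gt0.
have tb : t * b%:R = 2 * pi by rewrite /t divfK // gt_eqF.
have nb : n0%:~R <= b%:R - 1 :> R.
  by rewrite -[1]/(1%:~R) -[b%:R]/(b%:Z%:~R) -intrB ler_int; lia.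
have [n1|n1] := leP 1 n0; last by rewrite (_ : n0 = 0) ?mulr0 ?sin0 ?ltxx //; lia.
have n1R : 1 <= n0%:~R :> R by rewrite -[1]/(1%:~R) ler_int.
have [tp _|tp] := leP (t * n0%:~R) pi.
  by apply: sin_ge0_pi; rewrite intrB; apply/andP; split; nra.
move=> h; exfalso; have : 0 <= sin (t * n0%:~R - pi) by apply: sin_ge0_pi; apply/andP; split; nra.
by have := sinDpi (t * n0%:~R - pi); rewrite subrK => h2; lra.
Qed.

(** The open sector of half-angle [pi / b] around [tau], cut out by two half-planes so that
    convexity is immediate; the half-angle does not exceed [pi / 2]. *)
Definition sector (tau : R) (zeta : C) : Prop :=
  0 < complex.Im (zeta * polar 1 (- (tau - pi / b%:R))) /\
  complex.Im (zeta * polar 1 (- (tau + pi / b%:R))) < 0.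

Lemma sector_convex tau x y (s : R) : 0 <= s <= 1 -> sector tau x -> sector tau y ->
  sector tau (x + s%:C * (y - x)).
Proof.
move=> /andP[s0 s1] [x1 x2] [y1 y2].
have E (q : C) : complex.Im ((x + s%:C * (y - x)) * q) =
    (1 - s) * complex.Im (x * q) + s * complex.Im (y * q).
  by rewrite !cImM cReD cImD cReZ cImZ cReD cImD cReN cImN; ring.
by split; rewrite E; nra.
Qed.

Lemma sector_mid (tau rho : R) : 0 < rho -> sector tau (polar rho tau).
Proof.
move=> r0; have p0 := pi_gt0 R; have /andP[h1 h2] := pib R b1.
have sp : 0 < sin (pi / b%:R : R) by apply: sin_gt0_pi; apply/andP; split; lra.
split; rewrite polarM mulr1 /polar /=.
  have -> : tau + - (tau - pi / b%:R) = pi / b%:R by ring.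
  by rewrite mulr_gt0.
have -> : tau + - (tau + pi / b%:R) = - (pi / b%:R) by ring.
by rewrite sinN mulrN oppr_lt0 mulr_gt0.
Qed.

(** Points close to one boundary ray of a sector are on the right side of the other boundary ray. *)
Lemma near_sector (t0 : R) : 0 < t0 -> exists2 r : R, 0 < r & forall e : R, 0 < e < r ->
  e * cos (2 * pi / b%:R) < t0 * sin (2 * pi / b%:R).
Proof.
move=> t00; have p0 := pi_gt0 R; have /andP[h1 h2] := pib R b1.
have [b2|b2] := eqVneq b 2%N.
  exists 1 => // e /andP[e0 _].
  by rewrite b2 (mulrC 2) mulfK ?pnatr_eq0 // cospi sinpi mulr0 mulrN1 oppr_lt0.
have b3 : 3 <= b%:R :> R by rewrite ler_nat; lia.
have s0 : 0 < sin (2 * pi / b%:R : R).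
  apply: sin_gt0_pi; rewrite divr_gt0 ?mulr_gt0 //= ltr_pdivrMr //; nra.
exists (t0 * sin (2 * pi / b%:R)); first exact: mulr_gt0.
move=> e /andP[e0 er]; apply: le_lt_trans er.
by rewrite -[leRHS]mulr1 ler_wpM2l ?(ltW e0) // cos_le1.
Qed.

End Geometry.

Section Injectivity.
Variables (R : realType) (a m : nat).
Local Notation C := R[i].
Local Notation b := (m + a)%N.
Hypothesis (a0 : (0 < a)%N) (m0 : (0 < m)%N).
Local Notation p := (b%:R / a%:R : R).
Local Notation p' := (b%:R / m%:R : R).
Local Notation cv := (fscale_val R a m).
Local Notation s := (angle_slope R b).
Local Notation la := (slope s).
Local Notation c0 := ((1 + 3 * la) / 4).
Local Notation ray := (@iray R a m a0 m0).
Local Notation rang := (@rang R a m a0 m0).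
Local Notation eps := (@eps R a m a0 m0).

Let ab : (a < b)%N. Proof. by rewrite -[X in (X < _)%N]add0n ltn_add2r. Qed.
Let b0 : (0 < b)%N. Proof. exact: ltn_trans ab. Qed.
Let b1 : (1 < b)%N. Proof. exact: leq_ltn_trans a0 ab. Qed.
Let aR : (0 : R) < a%:R. Proof. by rewrite ltr0n. Qed.
Let bR : (0 : R) < b%:R. Proof. by rewrite ltr0n. Qed.
Let s0 : 0 <= s. Proof. by have /andP[] := angle_slope_bound R b1. Qed.
Let s1 : s < 1. Proof. by have /andP[] := angle_slope_bound R b1. Qed.
Let lab : 2^-1 <= la < 1. Proof. exact: slope_bound s0 s1. Qed.
Let lac : la < c0. Proof. by move/andP: lab => [? ?]; lra. Qed.

Variables (E : weyl_module R) (V : stokes_of (Theta a b) E).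
Hypothesis irr : irregular_class (Theta a b) E.
Variable v : 'I_b -> V.
Hypothesis vR : relation (Lg a0 V) v.
Hypothesis lap0 : forall n w, lapf a0 m0 v n w = 0.

Let vL j : v j \in Lg a0 V (j : nat)%:Z. Proof. by case: vR. Qed.
Let nice (j : 'I_b) n : rnice (ray (j : nat)%:Z) (so_sol (v j) n).
Proof. exact: line_rnice. Qed.
Let e1 j : nrm (ray j) = 1. Proof. exact: nrm_ray1. Qed.

(** The bisector of the rays [j] and [j + 1]; arguments decrease as labels increase. *)
Definition mid (j : int) : R := rang j - pi / b%:R.

Lemma rang_diff j k : rang k - rang j = 2 * pi / b%:R * (j - k)%:~R.
Proof. by rewrite !rangE intrB; ring. Qed.

Lemma ray_sector (j k : int) (t : R) : 0 <= t -> ~ sector b (mid j) (t%:C * ray k).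
Proof.
move=> t0; rewrite /sector /iray -polar1E !polarM mulr1 /polar /=.
have -> : rang k + - (mid j - pi / b%:R) = 2 * pi / b%:R * (j - k + 1)%:~R.
  have h := rang_diff j k.
  have e3 : (j - k + 1)%:~R = (j - k)%:~R + 1 :> R by rewrite [LHS]intrD.
  rewrite /mid e3.
  have -> : rang k = 2 * pi / b%:R * (j - k)%:~R + rang j by rewrite -h subrK.
  by move: (pi : R) (b%:R^-1 : R) => q ib; ring.
have -> : rang k + - (mid j + pi / b%:R) = 2 * pi / b%:R * (j - k + 1 - 1)%:~R.
  by rewrite /mid subrK addrK -rang_diff.
move=> [h1 h2]; have tp : 0 < t by rewrite lt_neqAle t0 andbT; apply: contraTneq h1 => <-; rewrite mul0r ltxx.
have : 0 < sin (2 * pi / b%:R * (j - k + 1)%:~R : R) by rewrite -(pmulr_rgt0 _ tp).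
move=> /(sin_angle b1) h3; move: h2; rewrite ltNge => /negP; apply.
by rewrite mulr_ge0.
Qed.

Lemma sector_dist j zeta : sector b (mid j) zeta -> forall k : int,
  exists2 d : R, 0 < d & forall t : R, 0 <= t -> d <= nrm (t%:C * ray k - zeta).
Proof.
move=> sz k; apply: dist_ray => // t t0; apply/eqP => tz.
by apply: (@ray_sector j k t t0); rewrite tz.
Qed.

Definition cauchy (n : E) (zeta : C) : C :=
  \sum_(j < b) rint (ray (j : nat)%:Z) (fun z => (z - zeta)^-1 * so_sol (v j) n z).

(** As [z / (z - x) = 1 + x / (z - x)], the action of [z] leaves the Laplace transform at 0, which
    vanishes by [lap0]. For the derivative, integration by parts leaves boundary terms proportional
    to the values at 0, whose sum vanishes by the relation. *)
Lemma cauchy_lsol j0 : lsol (sector b (mid j0)) cauchy.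
Proof.
split=> [k n n' x Dx|n x Dx|n x Dx]; rewrite /cauchy.
- rewrite mulr_sumr -big_split /=; apply: eq_bigr => j _.
  have [d d0 dP] := sector_dist Dx (j : nat)%:Z.
  have n1 := rnice_cauchy d0 dP (nice j n); have n2 := rnice_cauchy d0 dP (nice j n').
  rewrite -rint_linear //; congr rint; apply/funext => z.
  by have [l1 _ _] := so_lsol (v j); rewrite l1 //; ring.
- have l0 := lap0 n 0; rewrite /lapf in l0.
  rewrite -[RHS]addr0 -[X in _ = _ + X]l0 mulr_sumr -big_split /=; apply: eq_bigr => j _.
  have [d d0 dP] := sector_dist Dx (j : nat)%:Z.
  have n1 := rnice_cauchy d0 dP (nice j n).
  rewrite (_ : (fun z => cexp (- (cv%:C * 0 * z)) * so_sol (v j) n z) = so_sol (v j) n); last first.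
    by apply/funext => z; rewrite mulr0 mul0r oppr0 cexp0 mul1r.
  rewrite -rint_linear //; apply: rint_eq => t t0.
  have [_ l2 _] := so_lsol (v j); rewrite l2 //.
  have nz : t%:C * ray (j : nat)%:Z - x != 0 by rewrite -nrm_gt0; apply: lt_le_trans (dP t t0).
  by move: (t%:C * _) (so_sol _ _ _) nz => z u nz; field.
- have /choice[dd ddP] : forall j : 'I_b, exists d : R, 0 < d /\
      forall t : R, 0 <= t -> d <= nrm (t%:C * ray (j : nat)%:Z - x).
    by move=> j; have [d d0 dP] := sector_dist Dx (j : nat)%:Z; exists d.
  have cd : cder (fun x => \sum_(j < b) rint (ray (j : nat)%:Z) (fun z => (z - x)^-1 * so_sol (v j) n z)) x
     (\sum_(j < b) rint (ray (j : nat)%:Z) (fun z => (z - x)^-1 * ((z - x)^-1 * so_sol (v j) n z))).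
    by apply: cder_sum => j; have [d0 dP] := ddP j; apply: (cauchy_der (e1 _) d0).
  move: cd; congr (cder _ _ _); apply/eqP; rewrite -subr_eq0 -sumrB; apply/eqP.
  rewrite -[RHS](mulr0 (- x^-1)) -[X in _ = _ * X](rel_sum0 vR n 0) mulr_sumr; apply: eq_bigr => j _.
  have [d0 dP] := ddP j; have n1 := rnice_cauchy d0 dP (nice j n).
  have n2 := rnice_cauchy d0 dP n1; have n3 := rnice_cauchy d0 dP (nice j (wm_d n)).
  have n4 := rnice_linear (-1) n2 n3.
  have := rint_FTC n4 n1; rewrite rint_linear // => ftc.
  set A := rint _ _; set B := rint _ (fun z => _ * so_sol (v j) (wm_d n) z).
  have -> : A - B = - (-1 * A + B) by ring.
  rewrite ftc; first by rewrite /= sub0r invrN; ring.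
  move=> t t0; have nz : t%:C * ray (j : nat)%:Z != x.
    by rewrite -subr_eq0 -nrm_gt0; apply: lt_le_trans (dP t t0).
  have := cderM (cder_inv_subr nz) (sol_der (v j) n (t%:C * ray (j : nat)%:Z)).
  by congr (cder _ _ _); ring.
Qed.

(* Shifting the exponential: as the Laplace transform vanishes, exp(w (zeta - z))
   can be inserted in the Cauchy integral for free. *)
Lemma cauchy_shift j0 n zeta w : sector b (mid j0) zeta ->
  cauchy n zeta = cexp (w * zeta) *
    \sum_(j < b) rint (ray (j : nat)%:Z) (fun z => cexp (- (w * z)) * ((z - zeta)^-1 * so_sol (v j) n z)).
Proof.
move=> Dz; have dist := sector_dist Dz.
have n1 (j : 'I_b) : rnice (ray (j : nat)%:Z) (fun z => (z - zeta)^-1 * so_sol (v j) n z).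
  by have [d d0 dP] := dist (j : nat)%:Z; exact: (rnice_cauchy d0 dP (nice j n)).
pose S w := \sum_(j < b) rint (ray (j : nat)%:Z) (fun z => cexp (- (w * z)) * ((z - zeta)^-1 * so_sol (v j) n z)).
have -> : cauchy n zeta = cexp (0 * zeta) * S 0.
  rewrite mul0r cexp0 mul1r; apply: eq_bigr => j _; congr rint; apply/funext => z.
  by rewrite mul0r oppr0 cexp0 mul1r.
apply: (@cder0_cst R (fun w => cexp (w * zeta) * S w)) => t _; rewrite subr0 add0r.
set x := t%:C * w.
have dS : cder S x (\sum_(j < b) rint (ray (j : nat)%:Z) (fun z => cexp (- (x * z)) * (- z * ((z - zeta)^-1 * so_sol (v j) n z)))).
  by apply: cder_sum => j; exact: laplace_der.
have dE : cder (fun w => cexp (w * zeta)) x (zeta * cexp (zeta * x)).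
  by apply: cder_ext (cder_cexpZ zeta x) => y; rewrite mulrC.
have := cderM dE dS; congr (cder _ _ _).
have -> : zeta * cexp (zeta * x) * S x = cexp (x * zeta) * (zeta * S x) by rewrite [zeta * x]mulrC; ring.
rewrite -mulrDr; apply/eqP; rewrite mulf_eq0; apply/orP; right; apply/eqP.
have cv0 : cv%:C != 0 :> C by rewrite -nrm_gt0 nrmR gtr0_norm ?fscale_gt0.
rewrite -[RHS](mulr0 (-1)) -[X in _ = _ * X](lap0 n (cv%:C^-1 * x)) /S /lapf !mulr_sumr -big_split /=.
apply: eq_bigr => j _.
have -> : cv%:C * (cv%:C^-1 * x) = x by rewrite mulrA mulfV // mul1r.
have na := rnice_lap x (n1 j).
have nb : rnice (ray (j : nat)%:Z) (fun z => cexp (- (x * z)) * (- z * ((z - zeta)^-1 * so_sol (v j) n z))).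
  have h := rnice_lap x (rnice_z (e1 _) (n1 j)).
  have := rnice_linear (-1) h (rnice0 _); congr rnice; apply/funext => z /=; ring.
have nc := rnice_lap x (nice j n).
rewrite -rint_linear // -[RHS]addr0 -[X in _ = _ + X](rint0 (e1 (j : nat)%:Z)) -rint_linear //; last exact: rnice0.
apply: rint_eq => t' t0; have [d d0 dP] := dist (j : nat)%:Z.
have nz : t'%:C * ray (j : nat)%:Z - zeta != 0 by rewrite -nrm_gt0; apply: lt_le_trans (dP t' t0).
rewrite /=; move: (cexp (- (x * (t'%:C * ray (j : nat)%:Z)))) (so_sol (v j) n (t'%:C * ray (j : nat)%:Z)) => ex u.
by move: (t'%:C * ray (j : nat)%:Z) nz => z nz; field.
Qed.

Lemma cauchy_zero j0 n zeta : sector b (mid j0) zeta -> cauchy n zeta = 0.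
Proof.
pose y : R := j0%:~R + 1 + 2^-1 - eps.
have yE : dir (Theta a b) y = mid j0.
  rewrite /mid rangE /dir /shift /y /=; have b00 := gt_eqF bR.
  by move: (pi : R) => q; field; rewrite -?natrD ?b00.
have sy : sns a y.
  apply: (@sns_eps R a m a0 m0 a (2 * j0 + 3) (-1)); [by []| |by right].
  by rewrite /y intrD intrM; field.
have ns : non_stokes (Theta a b) (mid j0) by rewrite -yE; apply/(@non_stokesE R (Theta a b) a0 b0).
move: n zeta.
apply: (@sector_zero R (Theta a b) E a0 ab V irr (mid j0) ns (sector b (mid j0)) cauchy
  (- ((b%:R - la * m%:R) / a%:R)) 1 (@sector_convex R b _) _ (cauchy_lsol j0)).
- by move=> rho r1; apply: sector_mid => //; apply: lt_le_trans r1.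
- move=> i; rewrite /sval ltrN2; apply: le_lt_trans (cos_le1 _) _.
  exact: (opt_rate a0 m0 s0 s1).
move=> n.
(* The shift [w] has the modulus prescribed by [opt] and the argument that makes [w * zeta] negative
   on the bisector. On the rays the arguments of [w z] are [pi] plus odd multiples of [pi / b], so
   [s] controls the exponential. *)
have /choice[K KP] : forall j : 'I_b, exists K : R, forall x : R, 1 <= x ->
    nrm (rint (ray (j : nat)%:Z) (fun z => cexp (- (cv%:C * (opt a m x)%:C * polar 1 (pi - mid j0) * z)) *
       ((z - polar x (mid j0))^-1 * so_sol (v j) n z))) <= K * expR (la * opt a m x `^ p').
  move=> j; have [K K0 KP] := rexp_bound a0 m0 s0 s1 lac (e1 (j : nat)%:Z) (line_rexp m0 (vL j) n).
  have [d d0 dP] := sector_dist (sector_mid b1 (mid j0) ltr01) (j : nat)%:Z.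
  exists (K * d^-1) => x x1; have x0 : 0 < x by apply: lt_le_trans x1.
  (* By homogeneity the distance to the ray is [x] times the one at modulus 1, so the same [d] works
     for all [x >= 1]. *)
  have dx (t : R) : 0 <= t -> d <= nrm (t%:C * ray (j : nat)%:Z - polar x (mid j0)).
    move=> t0; have := dP (t / x) (divr_ge0 t0 (ltW x0)) => h.
    have -> : t%:C * ray (j : nat)%:Z - polar x (mid j0) =
       x%:C * ((t / x)%:C * ray (j : nat)%:Z - polar 1 (mid j0)).
      rewrite mulrBr [polar x _]polar1E mulrA -rmorphM /=; congr (_%:C * _ - _).
      by rewrite mulrC divfK // gt_eqF.
    rewrite nrmM nrmR gtr0_norm //; apply: (le_trans h).
    by rewrite ler_peMl ?nrm_ge0.
  set w := cv%:C * _ * _.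
  have nj := rnice_lap w (rnice_cauchy d0 dx (nice j n)).
  have fE : (fun z => cexp (- (w * z)) * ((z - polar x (mid j0))^-1 * so_sol (v j) n z)) =
     (fun z => (cexp (- (w * z)) * (z - polar x (mid j0))^-1) * so_sol (v j) n z).
    by apply/funext => z; rewrite mulrA.
  rewrite fE in nj *; apply: KP nj _; [by rewrite invr_ge0 ltW|exact: opt_ge0|].
  move=> t t0; rewrite nrmM nrmV mulrC; apply: ler_pM; rewrite ?invr_ge0 ?nrm_ge0 //.
    by rewrite lef_pV2 ?posrE ?dx // (lt_le_trans d0) ?dx.
  rewrite nrm_cexp ler_expR cReN.
  have -> : w * (t%:C * ray (j : nat)%:Z) = polar (cv * opt a m x * t) (pi / b%:R * (2 * (j0 - (j : nat)%:Z) + 1)%:~R + pi).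
    rewrite /w /iray.
    transitivity ((cv%:C * (opt a m x)%:C * t%:C) * (polar 1 (pi - mid j0) * polar 1 (rang (j : nat)%:Z))); first by ring.
    rewrite polarM mulr1 [in RHS]polar1E -!rmorphM /=; congr (_ * polar _ _).
    have h := rang_diff j0 (j : nat)%:Z.
    have e3 : (2 * (j0 - (j : nat)%:Z) + 1)%:~R = 2 * (j0 - (j : nat)%:Z)%:~R + 1 :> R by rewrite [LHS]intrD intrM.
    rewrite /mid e3; move/eqP: h; rewrite subr_eq => /eqP ->.
    by move: (pi : R) (b%:R^-1 : R) => q ib; ring.
  rewrite /polar /= cosDpi mulrN opprK.
  have hc : cos (pi / b%:R * (2 * (j0 - (j : nat)%:Z) + 1)%:~R) <= s.
    apply: cos_angle => //; apply/negP => /dvdzP[q]; rewrite PoszM; clear; lia.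
  have cv0 : 0 <= cv by rewrite ltW // fscale_gt0.
  have -> : cv * s * opt a m x * t = cv * opt a m x * t * s by ring.
  by rewrite ler_wpM2l // !mulr_ge0 // ?powR_ge0.
exists (\sum_j K j) => x x1; have x0 : 0 < x by apply: lt_le_trans x1.
pose w := cv%:C * (opt a m x)%:C * polar 1 (pi - mid j0).
rewrite (cauchy_shift n w (sector_mid b1 (mid j0) x0)) nrmM nrm_cexp.
have -> : w * polar x (mid j0) = polar (cv * opt a m x * x) pi.
  rewrite /w [polar x _]polar1E.
  transitivity ((cv%:C * (opt a m x)%:C * x%:C) * (polar 1 (pi - mid j0) * polar 1 (mid j0))); first by ring.
  by rewrite polarM mulr1 subrK [in RHS]polar1E -!rmorphM.
rewrite {1}/polar /= cospi mulrN1.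
apply: (@le_trans _ _ (expR (- (cv * opt a m x * x)) * (\sum_j K j * expR (la * opt a m x `^ p')))).
  apply: ler_wpM2l; first exact: expR_ge0.
  by apply: (le_trans (nrm_sum _ _ _)); apply: ler_sum => j _; exact: KP.
rewrite -mulr_suml mulrCA -expRD.
have -> : - (cv * opt a m x * x) = - (cv * x * opt a m x) by ring.
by rewrite optE.
Qed.

(** The Cauchy integral is zero on both sides of the ray [k0], and the other rays contribute a
    difference of order [ep]; hence so does [k0], as [cauchy_jump] requires. *)
Lemma sol_vanish (k0 : 'I_b) (t0 : R) n : 0 < t0 -> so_sol (v k0) n (t0%:C * ray (k0 : nat)%:Z) = 0.
Proof.
move=> t00.
have /choice[d dP] : forall k : 'I_b, exists d : R, 0 < d /\ (k != k0 -> forall t : R, 0 <= t ->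
    d <= nrm (t%:C * ray (k : nat)%:Z - t0%:C * ray (k0 : nat)%:Z)).
  move=> k; have [kk|kk] := eqVneq k k0; first by exists 1.
  have [|d d0 dP] := @dist_ray R (ray (k : nat)%:Z) (t0%:C * ray (k0 : nat)%:Z) (e1 _); last by exists d.
  move=> t tt; apply/eqP => tE.
  have tt0 : t = t0.
    have := congr1 (@nrm R) tE; rewrite !nrmM !e1 !mulr1 !nrmR !ger0_norm //; exact: ltW.
  have : t0%:C != 0 :> C by rewrite -nrm_gt0 nrmR gtr0_norm.
  move: tE; rewrite tt0 => /mulfI h /h; rewrite /iray => {}h.
  have : polar 1 (rang (k : nat)%:Z - rang (k0 : nat)%:Z) = 1 :> C.
    have -> : polar 1 (rang (k : nat)%:Z - rang (k0 : nat)%:Z) =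
        polar 1 (rang (k : nat)%:Z) * polar 1 (- rang (k0 : nat)%:Z) :> C by rewrite polarM mulr1.
    by rewrite h polarM mulr1 subrr polar0.
  rewrite rang_diff => /(congr1 (@complex.Re R)); rewrite /= mul1r => c1.
  have := @cos_angle R b b1 (2 * ((k0 : nat)%:Z - (k : nat)%:Z)).
  rewrite intrM (_ : pi / b%:R * (2%:~R * _) = 2 * pi / b%:R * ((k0 : nat)%:Z - (k : nat)%:Z)%:~R); last by ring.
  rewrite c1 => H.
  have nd : 2 * ((k0 : nat)%:Z - (k : nat)%:Z) \notin dvdz (2 * b)%N%:Z.
    by apply: contra kk => /ord_dvd ->.
  by have := le_lt_trans (H nd) s1; rewrite ltxx.
have /choice[B BP] : forall k : 'I_b, exists B : R, 0 <= B /\ forall t : R, 0 <= t ->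
    nrm (so_sol (v k) n (t%:C * ray (k : nat)%:Z)) <= B * expR (- (1 * t)).
  by move=> k; have [B B0 BP] := rdecay_ge0 (nice k n).2 1; exists B.
have [r1 r10 r1P] := near_sector b1 t00.
pose r2 := \big[Num.min/1]_k (d k / 2).
have r20 : 0 < r2.
  by rewrite /r2; elim/big_ind : _ => // [x y x0 y0|k _]; [rewrite lt_min x0|rewrite divr_gt0 // (dP k).1].
have r2P k : r2 <= d k / 2 by rewrite /r2 (bigD1 k) //= ge_min lexx.
(* The difference of two Cauchy kernels is [zp - zm], of modulus at most [2 * ep], times their
   product, each factor being at most [(d k / 2)^-1]; the other factor 2 is that of [rint_bound]. *)
pose K := \sum_(k | k != k0) 2 * (2 * (B k * (d k / 2)^-1 * (d k / 2)^-1)).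
apply: (@cauchy_jump R (ray (k0 : nat)%:Z) (e1 _) _ t0 K (Num.min r1 r2)) => //.
  by rewrite lt_min r10.
move=> ep /andP[ep0]; rewrite lt_min => /andP[epr1 epr2].
set zp := (t0 +i* ep) * _; set zm := (t0 -i* ep) * _.
have hb := r1P ep; rewrite ep0 epr1 in hb; have {}hb := hb isT.
have rr (q t : R) (z : C) : z * polar 1 t * polar 1 (- q) = z * polar 1 (t - q).
  by rewrite -mulrA polarM mulr1.
have zpD : sector b (mid ((k0 : nat)%:Z - 1)) zp.
  have rE : rang ((k0 : nat)%:Z - 1) = rang (k0 : nat)%:Z + 2 * pi / b%:R.
    have := rang_diff (k0 : nat)%:Z ((k0 : nat)%:Z - 1).
    have -> : (k0 : nat)%:Z - ((k0 : nat)%:Z - 1) = 1 by rewrite opprB addrC subrK.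
    by rewrite mulr1 => h; rewrite -h addrCA subrr addr0.
  split; rewrite /zp /iray rr /mid rE.
    have -> : rang (k0 : nat)%:Z - (rang (k0 : nat)%:Z + 2 * pi / b%:R - pi / b%:R - pi / b%:R) = 0 by move: (pi : R) => q; ring.
    by rewrite polar0 mulr1.
  have -> : rang (k0 : nat)%:Z - (rang (k0 : nat)%:Z + 2 * pi / b%:R - pi / b%:R + pi / b%:R) = - (2 * pi / b%:R) by move: (pi : R) => q; ring.
  by rewrite cImM /polar /= !mul1r cosN sinN mulrN addrC subr_lt0.
have zmD : sector b (mid (k0 : nat)%:Z) zm.
  split; rewrite /zm /iray rr /mid.
    have -> : rang (k0 : nat)%:Z - (rang (k0 : nat)%:Z - pi / b%:R - pi / b%:R) = 2 * pi / b%:R by move: (pi : R) => q; ring.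
    by rewrite cImM /polar /= !mul1r mulNr subr_gt0.
  have -> : rang (k0 : nat)%:Z - (rang (k0 : nat)%:Z - pi / b%:R + pi / b%:R) = 0 by move: (pi : R) => q; ring.
  by rewrite polar0 mulr1 /= oppr_lt0.
have gp := cauchy_zero n zpD; have gm := cauchy_zero n zmD.
have : cauchy n zp - cauchy n zm = 0 by rewrite gp gm subrr.
rewrite /cauchy -sumrB (bigD1 k0) //= => /eqP; rewrite addr_eq0 => /eqP ED.
set S := \sum_(k < b | k != k0) _ in ED.
apply: (@le_trans _ _ (nrm (- S))); first by rewrite -ED; exact: lexx.
rewrite nrmN; apply: (le_trans (nrm_sum _ _ _)); rewrite /K mulr_suml; apply: ler_sum => k kk.
have [dk0 dkP] := dP k; have {}dkP := dkP kk; have [Bk0 BkP] := BP k.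
have d20 : 0 < d k / 2 by rewrite divr_gt0.
have near (z : C) : nrm (z - t0%:C * ray (k0 : nat)%:Z) <= ep -> forall t : R, 0 <= t ->
    d k / 2 <= nrm (t%:C * ray (k : nat)%:Z - z).
  move=> zt t tt; have := dkP t tt; have := r2P k; have := epr2.
  have := nrmD (t%:C * ray (k : nat)%:Z - z) (z - t0%:C * ray (k0 : nat)%:Z).
  by rewrite addrA subrK; move: zt; lra.
have np : nrm (zp - t0%:C * ray (k0 : nat)%:Z) <= ep.
  rewrite /zp -mulrBl nrmM e1 mulr1 nrmE /= subrr subr0 expr0n add0r sqrtr_sqr gtr0_norm //.
have nm : nrm (zm - t0%:C * ray (k0 : nat)%:Z) <= ep.
  rewrite /zm -mulrBl nrmM e1 mulr1 nrmE /= subrr subr0 expr0n add0r sqrtr_sqr normrN gtr0_norm //.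
have dp := near _ np; have dm := near _ nm.
have n1 := rnice_cauchy d20 dp (nice k n); have n2 := rnice_cauchy d20 dm (nice k n).
have n3 := rnice_cauchy d20 dp n2.
have -> : rint (ray (k : nat)%:Z) (fun z => (z - zp)^-1 * so_sol (v k) n z) -
    rint (ray (k : nat)%:Z) (fun z => (z - zm)^-1 * so_sol (v k) n z) =
    (zp - zm) * rint (ray (k : nat)%:Z) (fun z => (z - zp)^-1 * ((z - zm)^-1 * so_sol (v k) n z)).
  rewrite addrC -mulN1r -rint_linear // -[RHS]addr0 -[X in _ = _ + X](rint0 (e1 (k : nat)%:Z)) -rint_linear //; last exact: rnice0.
  apply: rint_eq => t tt.
  have z1 : t%:C * ray (k : nat)%:Z - zp != 0 by rewrite -nrm_gt0; apply: lt_le_trans (dp t tt).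
  have z2 : t%:C * ray (k : nat)%:Z - zm != 0 by rewrite -nrm_gt0; apply: lt_le_trans (dm t tt).
  rewrite /=; move: (so_sol (v k) n (t%:C * ray (k : nat)%:Z)) => u.
  by move: (t%:C * ray (k : nat)%:Z) z1 z2 => z z1 z2; field; rewrite z1 z2.
rewrite nrmM; apply: (@le_trans _ _ (2 * ep * (2 * (B k * (d k / 2)^-1 * (d k / 2)^-1)))).
  apply: ler_pM; rewrite ?nrm_ge0 //.
    have -> : zp - zm = (zp - t0%:C * ray (k0 : nat)%:Z) - (zm - t0%:C * ray (k0 : nat)%:Z) by ring.
    by apply: (le_trans (nrmD _ _)); rewrite nrmN; lra.
  apply: rint_bound n3 _ => // t tt; rewrite !nrmM !nrmV.
  have h1 : (nrm (t%:C * ray (k : nat)%:Z - zp))^-1 <= (d k / 2)^-1.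
    by rewrite lef_pV2 ?posrE ?dp // (lt_le_trans d20) ?dp.
  have h2 : (nrm (t%:C * ray (k : nat)%:Z - zm))^-1 <= (d k / 2)^-1.
    by rewrite lef_pV2 ?posrE ?dm // (lt_le_trans d20) ?dm.
  have h3 := BkP t tt; rewrite mul1r in h3.
  have -> : B k * (d k / 2)^-1 * (d k / 2)^-1 * expR (- t) = (d k / 2)^-1 * ((d k / 2)^-1 * (B k * expR (- t))) by ring.
  apply: ler_pM => //; rewrite ?invr_ge0 ?mulr_ge0 ?invr_ge0 ?nrm_ge0 //.
  by apply: ler_pM => //; rewrite ?invr_ge0 ?nrm_ge0.
by rewrite le_eqVlt; apply/orP; left; apply/eqP; ring.
Qed.

Lemma lapf_inj k : v k = 0.
Proof.
apply: so_inj; have [e [eP _]] := irr.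
apply/funext => n; apply/funext => z.
rewrite (lsol_uniq eP (x0 := 1%:C * ray (k : nat)%:Z) (so_lsol _)); last first.
  by move=> j; exact: sol_vanish.
by have := so_linear (-1) (0 : V) 0 n z; rewrite scaler0 addr0 mulN1r addNr.
Qed.

End Injectivity.

(** * Naturality *)

Section LinearIso.
Variables (K : fieldType) (U U' : vectType K) (f : 'Hom(U, U')).
Hypothesis (fker : lker f = 0%VS) (fim : limg f = fullv).

Let fK x : f^-1%VF (f x) = x.
Proof. by apply: lker0_lfunK; rewrite fker eqxx. Qed.

Lemma contragredientE (g : dualv U) y :
  (contragredient f g : 'Hom(U', K^o)) y = (g : 'Hom(U, K^o)) (f^-1%VF y).
Proof. by rewrite /contragredient precompE comp_lfunE. Qed.

Lemma contragredient_iso : lker (contragredient f) = 0%VS /\ limg (contragredient f) = fullv.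
Proof.
have ker : lker (contragredient f) = 0%VS.
  apply/vspaceP => g; rewrite memv_ker memv0; apply/eqP/eqP => [g0|->]; last exact: linear0.
  apply/lfunP => x; have := contragredientE g (f x); rewrite g0 fK => <-.
  by rewrite !lfunE.
split=> //; apply/eqP; rewrite eqEdim subvf /=.
have := limg_ker_dim (contragredient f) fullv; rewrite ker capv0 dimv0 add0n => ->.
have := limg_ker_dim f fullv; rewrite fker capv0 dimv0 add0n fim => e.
by rewrite !dim_dualv e.
Qed.

Lemma contragredient_annv (A : {vspace U}) : (contragredient f @: annv A)%VS = annv (f @: A)%VS.
Proof.
apply/eqP; rewrite eqEdim; apply/andP; split.
  apply/subvP => _ /memv_imgP[g + ->]; rewrite !mem_annv => /subvP gA.
  apply/subvP => _ /memv_imgP[x xA ->]; rewrite memv_ker contragredientE fK -memv_ker.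
  exact: gA.
have := limg_ker_dim (contragredient f) (annv A).
rewrite (proj1 contragredient_iso) capv0 dimv0 add0n => ->.
have := limg_ker_dim f A; rewrite fker capv0 dimv0 add0n => eA.
have := limg_ker_dim f fullv; rewrite fker capv0 dimv0 add0n fim => e.
have := dim_annv A; have := dim_annv (f @: A)%VS; rewrite eA -e; lia.
Qed.

Lemma contragredient_contragredient x :
  contragredient (contragredient f) (evalv x) = evalv (f x).
Proof.
have [k1 k2] := contragredient_iso; apply/lfunP => g.
rewrite /contragredient precompE comp_lfunE -/(contragredient f) !evalvE.
set g' := (contragredient f)^-1%VF g.
have gE : contragredient f g' = g by apply: limg_lfunVK; rewrite k2 memvf.
by rewrite -[X in _ = (X : 'Hom(_, _)) _]gE contragredientE fK.
Qed.

End LinearIso.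

Section Induced.
Variables (R : realType) (Th : irr_class) (E E' : weyl_module R) (phi : E -> E').
Hypothesis (r0 : (0 < ic_rank Th)%N) (b0 : (0 < ic_num Th)%N).
Hypothesis phi_bij : bijective phi.
Variables (S : stokes_of Th E) (S' : stokes_of Th E') (f : 'Hom(S, S')).
Hypothesis fE : induced_map phi f.

Lemma so_sol0 (S0 : stokes_of Th E) m x : so_sol (0 : S0) m x = 0.
Proof. by have := so_linear (-1) (0 : S0) 0 m x; rewrite scaler0 addr0 mulN1r addNr. Qed.

Lemma induced_ker : lker f = 0%VS.
Proof.
apply/vspaceP => v; rewrite memv_ker memv0; apply/eqP/eqP => [fv|->]; last exact: linear0.
apply: so_inj; apply/funext => m; apply/funext => x; rewrite -fE fv so_sol0.
by have := so_linear (-1) (0 : S') 0 (phi m) x; rewrite scaler0 addr0 mulN1r addNr.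
Qed.

Lemma induced_img : limg f = fullv.
Proof.
apply/eqP; rewrite eqEdim subvf /=; have := limg_ker_dim f fullv.
by rewrite induced_ker capv0 dimv0 add0n !ss_dim => ->.
Qed.

(** The filtration is determined by the growth of the functions, and an induced map leaves these
    unchanged. *)
Lemma induced_F t i : non_stokes Th t -> (f @: ss_F S t i)%VS = ss_F S' t i.
Proof.
move=> ns; have [psi phiK psiK] := phi_bij.
apply/vspaceP => w; have /memv_imgP[v _ ->] : w \in limg f by rewrite induced_img memvf.
have -> : (f v \in (f @: ss_F S t i)%VS) = (v \in ss_F S t i).
  apply/idP/idP => [/memv_imgP[v' v'F /eqP]|]; last exact: memv_img.
  rewrite -subr_eq0 -linearB -memv_ker induced_ker memv0 subr_eq0 => /eqP -> //.
have fE' m : so_sol (f v) (phi m) = so_sol v m by apply/funext => x; exact: fE.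
apply/idP/idP => /(so_growth _ _ ns) H; apply/(so_growth _ _ ns) => m.
  by rewrite -(psiK m) fE'.
by rewrite -fE'.
Qed.

Lemma induced_line l : (f @: line S r0 l)%VS = line S' r0 l.
Proof.
have [y /andP[y1 y2] sy] := @sns_near R _ r0 l%:~R 2^-1 (half_gt0 R).
have yl : `|y - l%:~R| < 2^-1 by rewrite ltr_norml; apply/andP; split; lra.
rewrite -(yF_line S r0 b0 sy yl (ieq_refl _ l)) -(yF_line S' r0 b0 sy yl (ieq_refl _ l)).
by apply: induced_F; apply/non_stokesE.
Qed.
End Induced.

Section Assembly.
Variables (R : realType) (a m : nat).
Local Notation C := R[i].
Local Notation b := (m + a)%N.
Hypothesis (a0 : (0 < a)%N) (m0 : (0 < m)%N).
Local Notation c := (fscale R a0 m0).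

Let ab : (a < b)%N. Proof. by rewrite -[X in (X < _)%N]add0n ltn_add2r. Qed.
Let b0 : (0 < b)%N. Proof. exact: ltn_trans ab. Qed.

Section Objects.
Variables (E : weyl_module R) (V : stokes_of (Theta a b) E).
Variable (V' : stokes_of (Theta_hat m b) (rescale c (fourier E))).
Local Notation L := (Lg a0 V).
Local Notation l := (@lg R a m a0 m0 E V').

Lemma hyper_Lg i : hyper a L i = window (@line R (Theta a b) V a0) (i + 1 + 1) a.-1.
Proof. by rewrite /hyper /window; apply: eq_bigr => k _; rewrite /Lg addrAC. Qed.

Lemma recE (k : 'I_b) : cline (Phi_rec V) k = L (k : nat)%:Z.
Proof.
rewrite /= /Lg -(@recessiveE R (Theta a b) V a0 b0); congr recessive.
rewrite /theta /dir /shift /= mulrC intrD; congr (_ * _).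
by rewrite -[(k.+1)%:Z%:~R]/(k.+1%:R) -[(k : nat)%:Z%:~R]/((k : nat)%:R) -[k.+1%:R]natr1 mul1r; ring.
Qed.

Lemma subE (k : 'I_b) : cline (Phi_sub V) k = annv (hyper a L (k : nat)%:Z).
Proof.
rewrite /= hyper_Lg; have := @subdominantE R (Theta a b) V a0 b0 ((k : nat)%:Z + 1).
move=> /= <-; congr (annv (subdominant _ _)).
rewrite /theta /dir /shift /= mulrC intrD; congr (_ * _).
by rewrite -[(k.+1)%:Z%:~R]/(k.+1%:R) -[(k : nat)%:Z%:~R]/((k : nat)%:R) -[k.+1%:R]natr1 mul0r; ring.
Qed.

Lemma rec_hatE (k : 'I_b) : cline (Phi_rec_hat V') k = l (k : nat)%:Z.
Proof.
rewrite /= /lg -(@recessiveE R (Theta_hat m b) V' m0 b0); congr recessive.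
rewrite /theta /dir /shift /= mulrC; congr (_ * _).
by rewrite !intrN intrD -[(k.+1)%:Z%:~R]/(k.+1%:R) -[(k : nat)%:Z%:~R]/((k : nat)%:R) -[k.+1%:R]natr1 mul0r; ring.
Qed.

Lemma sub_hatE (k : 'I_b) : subdominant V' (theta R m b (- (k.+1)%:Z) 1) = hyper m l (k : nat)%:Z.
Proof.
rewrite hyper_lg; have := @subdominantE R (Theta_hat m b) V' m0 b0 (- ((k : nat)%:Z + m%:Z) - 1).
rewrite subrK /= => <-; congr (subdominant _ _).
rewrite /theta /dir /shift /= mulrC; congr (_ * _).
rewrite intrB !intrN intrD -[(k.+1)%:Z%:~R]/(k.+1%:R) -[(k : nat)%:Z%:~R]/((k : nat)%:R) -[k.+1%:R]natr1 mul1r.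
by rewrite -[m%:Z%:~R]/(m%:R); field.
Qed.

Lemma in_P_objects : [/\ in_P a (Phi_rec V), in_P a (Phi_sub V),
  in_P m (Phi_rec_hat V') & in_P m (Phi_sub_hat V')].
Proof.
have PL := Lg_plines a0 m0 V; have Pl := lg_plines V'.
split.
- exact: (in_P_plines a0 PL recE).
- exact: (in_P_plines a0 (annv_plines b0 a0 PL) subE).
- exact: (in_P_plines m0 Pl rec_hatE).
- apply: (in_P_plines m0 (annv_plines b0 m0 Pl)) => k /=.
  by rewrite sub_hatE.
Qed.

Hypothesis irr : irregular_class (Theta a b) E.

Lemma lap_inj (v : 'I_b -> V) : relation L v -> lap V' v = 0 -> forall i, v i = 0.
Proof.
move=> vR v0; apply: (lapf_inj irr vR) => n w.
rewrite -(lapE V' vR) v0.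
by have := so_linear (-1) (0 : V') 0 n w; rewrite scaler0 addr0 mulN1r addNr.
Qed.

Let Pl' : plines b (b - a) l. Proof. by rewrite addnK; exact: lg_plines. Qed.
Let lapH v (i : 'I_b) : relation L v -> v i = 0 -> lap V' v \in hyper (b - a) l (i : nat)%:Z.
Proof. by rewrite addnK; exact: lap_hyper. Qed.

Lemma lap_onto x : exists2 v, relation L v & lap V' v = x.
Proof. exact: (lap_surj b0 a0 ab (Lg_plines a0 m0 V) Pl' (@lap_linear R a m a0 m0 E V V') lap_inj). Qed.

Lemma eta_rec_ex : exists eta : 'Hom(cspace (Phi_rec_hat V'), cspace (gale (Phi_sub V))),
  (forall v, relation L v -> eta (lap V' v) = rec_class b0 (cline (Phi_sub V)) v) /\ P_iso eta.
Proof.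
have [eta [H1 H2]] := rec_eta b0 a0 ab (Lg_plines a0 m0 V) Pl' (@lap_linear R a m a0 m0 E V V') lap_inj lapH subE.
by exists eta; split=> //; exact: H2 rec_hatE.
Qed.

Lemma eta_sub_ex : exists eta : 'Hom(cspace (Phi_sub_hat V'), cspace (gale (Phi_rec V))),
  (forall xi y, sub_rel L (lap V') (P := cline (Phi_rec V)) xi y -> eta xi = y) /\ P_iso eta.
Proof.
have [eta [H1 H2]] := sub_eta b0 a0 ab (Lg_plines a0 m0 V) Pl' (@lap_linear R a m a0 m0 E V V') lap_inj lapH recE.
exists eta; split=> //; apply: H2 => k; rewrite addnK; exact: sub_hatE.
Qed.

Lemma sub_rel_ex xi : exists y, sub_rel L (lap V') (P := cline (Phi_rec V)) xi y.
Proof.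
exact: (sub_rel_total a0 (Lg_plines a0 m0 V) (@lap_linear R a m a0 m0 E V V')).
Qed.

End Objects.

Definition eta_rec (E : weyl_module R) (V : stokes_of (Theta a b) E)
  (V' : stokes_of (Theta_hat m b) (rescale c (fourier E))) : 'Hom(cspace (Phi_rec_hat V'), cspace (gale (Phi_sub V))) :=
  if pselect (irregular_class (Theta a b) E) is left irr
  then projT1 (cid (@eta_rec_ex E V V' irr)) else 0.

Definition eta_sub (E : weyl_module R) (V : stokes_of (Theta a b) E)
  (V' : stokes_of (Theta_hat m b) (rescale c (fourier E))) : 'Hom(cspace (Phi_sub_hat V'), cspace (gale (Phi_rec V))) :=
  if pselect (irregular_class (Theta a b) E) is left irr
  then projT1 (cid (@eta_sub_ex E V V' irr)) else 0.

Lemma eta_recP (E : weyl_module R) (V : stokes_of (Theta a b) E)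
  (V' : stokes_of (Theta_hat m b) (rescale c (fourier E))) : irregular_class (Theta a b) E ->
  (forall v, relation (Lg a0 V) v -> @eta_rec E V V' (lap V' v) = rec_class b0 (cline (Phi_sub V)) v) /\
  P_iso (@eta_rec E V V').
Proof. by move=> irr; rewrite /eta_rec; case: pselect => // irr'; case: cid. Qed.

Lemma eta_subP (E : weyl_module R) (V : stokes_of (Theta a b) E)
  (V' : stokes_of (Theta_hat m b) (rescale c (fourier E))) : irregular_class (Theta a b) E ->
  (forall xi y, sub_rel (Lg a0 V) (lap V') (P := cline (Phi_rec V)) xi y -> @eta_sub E V V' xi = y) /\
  P_iso (@eta_sub E V V').
Proof. by move=> irr; rewrite /eta_sub; case: pselect => // irr'; case: cid. Qed.

Section Naturality.
Variables (E1 E2 : weyl_module R) (phi : E1 -> E2).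
Variables (V1 : stokes_of (Theta a b) E1) (V2 : stokes_of (Theta a b) E2).
Variables (V1' : stokes_of (Theta_hat m b) (rescale c (fourier E1))).
Variables (V2' : stokes_of (Theta_hat m b) (rescale c (fourier E2))).
Variables (f : 'Hom(V1, V2)) (f' : 'Hom(V1', V2')).
Hypothesis (irr1 : irregular_class (Theta a b) E1) (irr2 : irregular_class (Theta a b) E2).
Hypothesis phi_bij : bijective phi.
Hypothesis (fE : induced_map phi f).
Hypothesis (fE' : induced_map (E := rescale c (fourier E1)) (E' := rescale c (fourier E2)) phi f').

Let fker : lker f = 0%VS. Proof. exact: induced_ker fE. Qed.
Let fim : limg f = fullv. Proof. exact: induced_img fE. Qed.
Let fker' : lker f' = 0%VS. Proof. exact: induced_ker fE'. Qed.

Lemma map_Lg j : (f @: Lg a0 V1 j)%VS = Lg a0 V2 j.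
Proof. exact: (@induced_line R (Theta a b) E1 E2 phi a0 b0 phi_bij V1 V2 f fE). Qed.

Lemma map_hyper j : (f @: hyper a (Lg a0 V1) j)%VS = hyper a (Lg a0 V2) j.
Proof.
rewrite /hyper /window limg_sum; apply: eq_bigr => s _; exact: map_Lg.
Qed.

Lemma map_relation (v : 'I_b -> V1) : relation (Lg a0 V1) v -> relation (Lg a0 V2) (fun i => f (v i)).
Proof.
move=> [v1 v2]; split=> [i|]; first by rewrite -map_Lg memv_img.
by rewrite -linear_sum v2 linear0.
Qed.

Lemma lap_natural (v : 'I_b -> V1) : relation (Lg a0 V1) v -> lap V2' (fun i => f (v i)) = f' (lap V1' v).
Proof.
move=> vR; have [psi phiK psiK] := phi_bij; apply: so_inj.
rewrite (lapE V2' (map_relation vR)); apply/funext => n; apply/funext => w.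
rewrite -(psiK n) fE' (lapE V1' vR) /lapf; apply: eq_bigr => j _.
by congr rint; apply/funext => z; rewrite fE.
Qed.

Lemma rec_iso : P_iso (P := Phi_rec V1) (Q := Phi_rec V2) f.
Proof. by split=> // k; rewrite !recE; exact: map_Lg. Qed.

Lemma sub_iso : P_iso (P := Phi_sub V1) (Q := Phi_sub V2) (contragredient f).
Proof.
have [k1 k2] := contragredient_iso fker fim; split=> // k.
rewrite !subE -map_hyper; exact: contragredient_annv.
Qed.

(** Both sides are compared on transforms of relations, which exhaust the source; there a double
    contragredient is [f] itself under biduality. *)
Lemma eta_rec_natural :
  (gale_map (P := Phi_sub V1) (Q := Phi_sub V2) (contragredient f) \o eta_rec V1 V1')%VF
  = (eta_rec V2 V2' \o f')%VF.
Proof.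
have [H1 _] := eta_recP V1 V1' irr1; have [H2 _] := eta_recP V2 V2' irr2.
apply/lfunP => x; rewrite [LHS]comp_lfunE [RHS]comp_lfunE; have [v vR <-] := @lap_onto E1 V1 V1' irr1 x.
rewrite -(lap_natural vR) (H1 v vR) (H2 _ (map_relation vR)).
rewrite [LHS](gale_map_class _ sub_iso); congr gclass; apply/funext => i.
rewrite contragredient_contragredient //; congr evalv.
by rewrite /rec_fam /psum linear_sum.
Qed.

Lemma eta_sub_natural :
  (gale_map (P := Phi_rec V1) (Q := Phi_rec V2) f \o eta_sub V1 V1')%VF
  = (eta_sub V2 V2' \o contragredient f')%VF.
Proof.
have [H1 _] := eta_subP V1 V1' irr1; have [H2 _] := eta_subP V2 V2' irr2.
apply/lfunP => xi; rewrite [LHS]comp_lfunE [RHS]comp_lfunE; have [y [g gE yE]] := @sub_rel_ex E1 V1 V1' xi.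
have -> : eta_sub V1 V1' xi = y by apply: H1; exists g.
symmetry; apply: H2; exists (fun i => contragredient f (g i)); last first.
  by rewrite yE (gale_map_class _ rec_iso).
move=> w wR.
(* Every relation on the second side is the image of one on the first, because [f] maps lines onto
   lines; so the defining property can be tested on images. *)
have [v vR wE] : exists2 v : 'I_b -> V1, relation (Lg a0 V1) v & w = (fun i => f (v i)).
  exists (fun i => f^-1%VF (w i)); last first.
    by apply/funext => i; rewrite limg_lfunVK // fim memvf.
  have [w1 w2] := wR; split=> [i|].
    have /memv_imgP[v vL ->] : w i \in (f @: Lg a0 V1 (i : nat)%:Z)%VS by rewrite map_Lg.
    by rewrite lker0_lfunK // fker eqxx.
  by rewrite -linear_sum w2 linear0.
rewrite wE (lap_natural vR) contragredientE // lker0_lfunK ?fker' ?eqxx //.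
rewrite gE //; apply: eq_bigr => i _; rewrite contragredientE //.
by rewrite lker0_lfunK // fker eqxx.
Qed.

End Naturality.
End Assembly.

Theorem theorem1p1 (R : realType) (a b : nat) (a_gt0 : (0 < a)%N) (ltab : (a < b)%N) :
  exists c : {posnum R},
    (forall E : weyl_module R, irregular_class (Theta a b) E ->
       irregular_class (Theta_hat (b - a) b) (rescale c (fourier E)))
    /\
    exists (eta_rec : forall (E : weyl_module R) (V : stokes_of (Theta a b) E)
              (V' : stokes_of (Theta_hat (b - a) b) (rescale c (fourier E))),
              'Hom(cspace (Phi_rec_hat V'), cspace (gale (Phi_sub V))))
           (eta_sub : forall (E : weyl_module R) (V : stokes_of (Theta a b) E)
              (V' : stokes_of (Theta_hat (b - a) b) (rescale c (fourier E))),
              'Hom(cspace (Phi_sub_hat V'), cspace (gale (Phi_rec V)))),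
      (forall (E : weyl_module R) (V : stokes_of (Theta a b) E)
         (V' : stokes_of (Theta_hat (b - a) b) (rescale c (fourier E))),
         irregular_class (Theta a b) E ->
         [/\ in_P a (Phi_rec V) /\ in_P a (Phi_sub V),
             in_P (b - a) (Phi_rec_hat V') /\ in_P (b - a) (Phi_sub_hat V'),
             P_iso (eta_rec E V V') & P_iso (eta_sub E V V')])
      /\
      (forall (E1 E2 : weyl_module R) (phi : E1 -> E2)
         (V1 : stokes_of (Theta a b) E1) (V2 : stokes_of (Theta a b) E2)
         (V1' : stokes_of (Theta_hat (b - a) b) (rescale c (fourier E1)))
         (V2' : stokes_of (Theta_hat (b - a) b) (rescale c (fourier E2)))
         (f : 'Hom(V1, V2)) (f' : 'Hom(V1', V2')),
         irregular_class (Theta a b) E1 -> irregular_class (Theta a b) E2 ->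
         wm_iso phi -> induced_map phi f ->
         induced_map (E := rescale c (fourier E1)) (E' := rescale c (fourier E2)) phi f' ->
         (gale_map (P := Phi_sub V1) (Q := Phi_sub V2) (contragredient f)
            \o eta_rec E1 V1 V1'
          = eta_rec E2 V2 V2' \o f')%VF
         /\
         (gale_map (P := Phi_rec V1) (Q := Phi_rec V2) f \o eta_sub E1 V1 V1'
          = eta_sub E2 V2 V2' \o contragredient f')%VF).
Proof.
have m0 : (0 < b - a)%N by rewrite subn_gt0.
have bE : b = (b - a + a)%N by rewrite subnK // ltnW.
(* Writing [b] as [m + a] removes the subtraction and matches the form used above. *)
move: {ltab}(b - a)%N m0 bE => m m0 bE; subst b.
exists (fscale R a_gt0 m0); split=> [E|]; first exact: irregular_class_fourier.
exists (@eta_rec R a m a_gt0 m0), (@eta_sub R a m a_gt0 m0); split.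
  move=> E V V' irr; have [p1 p2 p3 p4] := @in_P_objects R a m a_gt0 m0 E V V'.
  have [_ i1] := @eta_recP R a m a_gt0 m0 E V V' irr; have [_ i2] := @eta_subP R a m a_gt0 m0 E V V' irr.
  by split.
move=> E1 E2 phi V1 V2 V1' V2' f f' irr1 irr2 [_ phi_bij _ _] fE fE'; split.
  exact: (@eta_rec_natural R a m a_gt0 m0 E1 E2 phi V1 V2 V1' V2' f f' irr1 irr2 phi_bij fE fE').
exact: (@eta_sub_natural R a m a_gt0 m0 E1 E2 phi V1 V2 V1' V2' f f' irr1 irr2 phi_bij fE fE').
Qed.
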